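(* Let $Q>0$, let $u_0:\mathbb{T}\to\mathbb{R}_+$ be bounded and measurable with $\inf_{x\in\mathbb{T}}u_0(x)>0$ (non-random, or random and independent of the noise), and let $u$ be the solution of $\partial_tu=\partial_x^2u+Qu\,\dot W$ on $(0,\infty)\times\mathbb{T}$ with $u(0)=u_0$. Let $\lambda$ and $\eta$ be the constant and the centered, non-degenerate normal random variable such that $(\log u(t,0)+\lambda t)/\sqrt t$ converges in distribution to $\eta$ as $t\to\infty$ (see the context). Then, as $t\to\infty$, $$\frac{\log u(t)+\lambda t\,\mathbb{1}}{\sqrt t}\Rightarrow\eta\,\mathbb{1},$$ where $\mathbb{1}(x)=1$ for all $x\in\mathbb{T}$ and $\Rightarrow$ denotes weak convergence (convergence in law) in the space $C(\mathbb{T})$ of continuous functions with the uniform norm.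
   Context: $\mathbb{T}=\mathbb{R}/(2\mathbb{Z})$ is the one-dimensional torus, identified with $[-1,1]$ (periodic boundary conditions). $\dot W$ is a space-time white noise on $\mathbb{R}_+\times\mathbb{T}$. The heat kernel on $\mathbb{T}$ is $p_t(x,y)=\frac{1}{\sqrt{4\pi t}}\sum_{n\in\mathbb{Z}}\exp\left(-\frac{(x-y+2n)^2}{4t}\right)$, and $(P_tf)(x)=\int_{\mathbb{T}}p_t(x,y)f(y)\,dy$. The solution $u$ is the unique predictable random field, continuous on $(0,\infty)\times\mathbb{T}$, satisfying $$u(t,x)=(P_tu_0)(x)+Q\int_{(0,t)\times\mathbb{T}}p_{t-s}(x,y)\,u(s,y)\,W(ds\,dy).$$ It is known (Mueller) that a.s. $u(t,x)>0$ for all $t>0$, $x\in\mathbb{T}$; $u(t)$ denotes the random function $x\mapsto u(t,x)$. The number $\lambda=\lambda(Q)>0$ is the non-random constant, independent of $u_0$, for which $\sup_{x\in\mathbb{T}}|t^{-1}\log u(t,x)+\lambda|\to0$ a.s. as $t\to\infty$. It is a known theorem of Gu and Komorowski, which may be used, that in this setting $(\log u(t,0)+\lambda t)/\sqrt t$ converges in distribution as $t\to\infty$ to a random variable $\eta$ with a centered, non-degenerate normal distribution. *)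

(* Defs.v *)
From HB Require Import structures.
From mathcomp Require Import all_boot all_order all_algebra.
From mathcomp Require Import all_classical all_reals all_analysis.

Set Implicit Arguments.
Unset Strict Implicit.
Unset Printing Implicit Defensive.
Import Order.TTheory GRing.Theory Num.Theory.
Import numFieldNormedType.Exports.

Local Open Scope classical_set_scope.
Local Open Scope ring_scope.

(* The torus T = R/2Z is not a separate type: a function on T is a 2-periodic
   function on R, and T, as a measure space, is its fundamental domain
   [-1, 1[ with Lebesgue measure. *)
Section torus.
Variable R : realType.

Definition periodic2 (f : R -> R) : Prop := forall x, f (x + 2) = f x.

Definition torus : set R := `[-1, 1[.

Definition spacetime : set (R * R) := `[0, +oo[ `*` torus.

Definition spacetime_measure : set (R * R) -> \bar R :=
  (lebesgue_measure \x lebesgue_measure)%E.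

(* The set of continuous functions on T, inside the space of all functions
   R -> R with the uniform topology. Used as a type, it is C(T) with the
   topology of the uniform norm. *)
Definition CT : set {uniform R -> R} :=
  [set f | continuous (f : R -> R) /\ periodic2 f].

Lemma CT_zero : (fun=> 0 : R) \in CT.
Proof. by apply/mem_set; split=> // x; exact: cvg_cst. Qed.

(* f as an element of C(T), and 0 if f is not continuous and 2-periodic *)
Definition toCT (f : R -> R) : CT :=
  insubd (exist _ (fun=> 0) CT_zero : CT) (f : {uniform R -> R}).

Definition heat_kernel (t x y : R) : R :=
  (Num.sqrt (4 * pi * t))^-1 *
  fine (\esum_(n in [set: int])
          (expR (- (x - y + 2 * n%:~R) ^+ 2 / (4 * t)))%:E).

Definition heat_semigroup (t : R) (f : R -> R) (x : R) : R :=
  \int[lebesgue_measure]_(y in torus) (heat_kernel t x y * f y).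

End torus.

Section probability.
Context {R : realType} {d : measure_display} {T : measurableType d}
  (P : probability T R).

(* sigma(X i, i in D) *)
Definition sigma_gen (I : Type) (D : set I) (X : I -> T -> R) : set (set T) :=
  <<s [set E | exists2 i, D i &
               exists2 B : set R, measurable B & E = X i @^-1` B] >>.

Definition indep_families (G H : set (set T)) : Prop :=
  forall A B, G A -> H B -> P (A `&` B) = (P A * P B)%E.

(* convergence to 0 in probability of nonnegative extended-real variables *)
Definition cvg0_in_probability (X : nat -> T -> \bar R) : Prop :=
  forall e : R, 0 < e ->
    P [set w | (e%:E < X n w)%E] @[n --> \oo] --> (0 : \bar R).

(* X t => Y in law as t -> +oo, for random elements of the space S *)
Definition cvg_in_law {d' : measure_display} {T' : measurableType d'}
    (P' : probability T' R) (S : topologicalType)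
    (X : R -> T -> S) (Y : T' -> S) : Prop :=
  forall F : S -> R, continuous F -> (exists M : R, forall s, `|F s| <= M) ->
    ('E_P[F \o X t])%E @[t --> +oo] --> ('E_P'[F \o Y])%E.

(* The centred normal law N(0, v) is the law of sqrt v * Z with Z ~ N(0, 1);
   this includes v = 0, for which normal_prob is not the Dirac mass. *)
Definition has_centered_normal_law (X : T -> R) (v : R) : Prop :=
  forall B : set R, measurable B ->
    P (X @^-1` B) = normal_prob 0 1 ((fun z => Num.sqrt v * z) @^-1` B).

Definition noise_set (A : set (R * R)) : Prop :=
  [/\ measurable A, A `<=` @spacetime R & (spacetime_measure A < +oo)%E].

(* Space-time white noise on R_+ x T: a centred Gaussian family indexed by the
   Borel sets of finite area, with Cov (W A, W B) = |A `&` B|. *)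
Definition white_noise (W : set (R * R) -> {RV P >-> R}) : Prop :=
  forall (n : nat) (A : 'I_n -> set (R * R)) (c : 'I_n -> R),
    (forall i, noise_set (A i)) ->
    has_centered_normal_law
      (fun w => \sum_i c i * W (A i) w)
      (\sum_i \sum_j c i * c j * fine (spacetime_measure (A i `&` A j))).

Definition initial_datum (W : set (R * R) -> {RV P >-> R})
    (u0 : T -> R -> R) : Prop :=
  [/\ measurable_fun [set: T * R] (fun z : T * R => u0 z.1 z.2),
      forall w, [/\ periodic2 (u0 w),
                    exists M : R, forall x, `|u0 w x| <= M &
                    0 < inf (range (u0 w))]
    & indep_families (sigma_gen [set: R] (fun x w => u0 w x))
                     (sigma_gen noise_set W)].

(* the filtration of u0 and the noise, augmented with the null events *)
Definition filtration (W : set (R * R) -> {RV P >-> R}) (u0 : T -> R -> R)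
    (t : R) : set (set T) :=
  <<s sigma_gen [set: R] (fun x w => u0 w x) `|`
      sigma_gen [set A | noise_set A /\ A `<=` `[0, t] `*` @torus R] W `|`
      [set N | measurable N /\ P N = 0%E] >>.

Section stochastic_integral.
Variables (W : set (R * R) -> {RV P >-> R}) (F : R -> set (set T)).

(* z = ((t, x), w) *)
Definition predictable_domain : set (R * R * T) :=
  [set z | 0 < z.1.1 /\ torus z.1.2].

Definition predictable_rectangle (E : set (R * R * T)) : Prop :=
  exists (a b : R) (A : set R) (G : set T),
    [/\ 0 <= a, measurable A, A `<=` @torus R, F a G &
        E = [set z | [/\ a < z.1.1 <= b, A z.1.2 & G z.2]]].

Definition predictable (u : R -> R -> T -> R) : Prop :=
  forall B : set R, measurable B ->
    <<s predictable_domain, predictable_rectangle >>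
      (predictable_domain `&` [set z | B (u z.1.1 z.1.2 z.2)]).

(* the process X(w) 1_{]a, b]}(s) 1_A(y) *)
Record elementary := Elementary {
  coef : T -> R;
  tmin : R;
  tmax : R;
  cell : set R;
  coef_bounded : exists M : R, forall w, `|coef w| <= M;
  coef_measurable : forall B : set R, measurable B -> F tmin (coef @^-1` B);
  tmin_ge0 : 0 <= tmin;
  cell_measurable : measurable cell;
  cell_torus : cell `<=` @torus R }.

Definition box (e : elementary) : set (R * R) :=
  `]tmin e, tmax e] `*` cell e.

Definition simple_process (es : seq elementary) (z : R * R) (w : T) : R :=
  \sum_(e <- es) coef e w * \1_(box e) z.

Definition simple_integral (es : seq elementary) (w : T) : R :=
  \sum_(e <- es) coef e w * W (box e) w.

(* I is the Walsh integral of Phi over R_+ x T against W: the limit in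
   probability of the integrals of simple processes converging to Phi in
   L^2(R_+ x T), in probability. This is the usual extension of the
   L^2(Omega)-isometric integral to the integrands Phi whose square is almost
   surely integrable; a random u0 need not have finite moments. *)
Definition stochastic_integral (Phi : R * R -> T -> R) (I : T -> R) : Prop :=
  exists es : nat -> seq elementary,
    cvg0_in_probability (fun n w =>
      \int[(lebesgue_measure \x lebesgue_measure)%E]_(z in @spacetime R)
        ((Phi z w - simple_process (es n) z w) ^+ 2)%:E)%E /\
    cvg0_in_probability (fun n w => `|simple_integral (es n) w - I w|%:E).

End stochastic_integral.

Definition mild_solution (Q : R) (W : set (R * R) -> {RV P >-> R})
    (u0 : T -> R -> R) (u : R -> R -> T -> R) : Prop :=
  [/\ forall (t : R) w, 0 < t -> periodic2 (fun x => u t x w),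
      forall w, {within [set z : R * R | 0 < z.1],
                  continuous (fun z : R * R => u z.1 z.2 w)},
      predictable (filtration W u0) u
    & forall t x : R, 0 < t -> exists I : {RV P >-> R},
        stochastic_integral W (filtration W u0)
          (fun z w => if 0 < z.1 < t
                      then heat_kernel (t - z.1) x z.2 * u z.1 z.2 w else 0)
          I /\
        {ae P, forall w, u t x w = heat_semigroup t (u0 w) x + Q * I w}].

(* sup_x |t^-1 log u(t, x) + lambda| -> 0 almost surely *)
Definition decay_rate (u : R -> R -> T -> R) (lambda : R) : Prop :=
  {ae P, forall w,
    ereal_sup [set `|t^-1 * ln (u t x w) + lambda|%:E | x in [set: R]]
      @[t --> +oo] --> (0 : \bar R)}.

(* The C(T)-valued random variable (log u(t) + lambda t 1) / sqrt t, set to 0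
   on the null event where u(t) is not everywhere positive. *)
Definition rescaled_log (u : R -> R -> T -> R) (lambda t : R) (w : T) : @CT R :=
  if `[< forall x, 0 < u t x w >]
  then toCT (fun x => (ln (u t x w) + lambda * t) / Num.sqrt t)
  else toCT (fun=> 0).

End probability.

(* Main.v *)
Require Import Defs.
From HB Require Import structures.
From mathcomp Require Import all_boot all_order all_algebra.
From mathcomp Require Import all_classical all_reals all_analysis.
From mathcomp Require Import measurable_realfun.
From mathcomp Require Import ring lra.

Set Implicit Arguments.
Unset Strict Implicit.
Unset Printing Implicit Defensive.
Import Order.TTheory GRing.Theory Num.Theory.
Import numFieldNormedType.Exports.

Local Open Scope classical_set_scope.
Local Open Scope ring_scope.

(* The oscillation [sup log u(t) - inf log u(t)] is bounded in probability uniformly in [t], so after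
   division by [sqrt t] the field [log u(t) + lambda t] has the same limit as its value at [x = 0].

   To bound the oscillation, restart the equation at [t0] and compare [u(t0 + s)] with
   [g(s) = P_s u(t0)], whose oscillation is at most [log C + 1/s] by the Gaussian bounds on the kernel.
   The noise part of [Z = u/g - 1] has the integrand [q(r,y) u(t0+r,y)/g(r,y)], where
   [q(r,y) = p_(s-r)(x,y) g(r,y)/g(s,x)] is a probability density in [y] bounded by
   [C ((s-r)^(-1/2) + r^(-1/2))], uniformly in [u(t0)]. As long as [|u| <= 2g], the increments of [Z]
   thus have quadratic variation at most a power of their length, uniformly in [t0] and [u(t0)].
   The exponential supermartingale of simple integrals gives Gaussian tails for them, with no moments
   of [u0] needed, and dyadic chaining from the level [2^(-N)] yields [|Z| <= 1/2] on [(0, 2^(-N))] with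
   probability at least [1 - eps]; the condition [|u| <= 2g] propagates by continuity in [s].
   The only positivity needed is that of [u(t0)], which the decay rate provides with probability
   tending to 1. *)

(** Two obstacles shape the proof. White noise is given only by the laws of its finite linear
    combinations and by its independence from [u0], so that even the independence of the future
    noise from the filtration has to be derived: characteristic functions show that cosines of past
    and future forms are uncorrelated, and a class of multipliers closed under products and bounded
    limits leads from cosines to events of the past. Restarting the equation at [t0] calls for
    exchanging a stochastic integral with the integral of the semigroup; Riemann sums in space do
    this with finitely many instances of the mild equation. Walsh integrals are only limits in
    probability, so estimates are stated off an exceptional event of small probability, and a bound
    on the quadratic variation is a condition on the sample point, not on an expectation. The
    regularity estimates of the kernel are relative, of the form [(1 - eps) K <= K'], because in
    this form they pass to [P_s f] for every nonnegative [f]; this is the source of the uniformity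
    in [u(t0)]. *)

Ltac pos := repeat first [ done | exact: pi_gt0 | exact: pi_ge0 | exact: ltW | exact: expR_ge0 | exact: expR_gt0
  | exact: sqr_ge0 | exact: sqrtr_ge0 | exact: normr_ge0
  | apply: mulr_gt0 | apply: mulr_ge0
  | apply: addr_gt0 | apply: addr_ge0 | rewrite invr_gt0 | rewrite invr_ge0
  | apply: exprn_gt0 | apply: exprn_ge0 | rewrite sqrtr_gt0 ].

(** * The heat kernel *)

Section kernel.
Variable R : realType.
Implicit Types (t s r a x y z : R).

Lemma esum_int (f : int -> \bar R) : (forall n, 0 <= f n)%E ->
  \esum_(n in [set: int]) f n =
  (\sum_(n <oo) f n%:Z + \sum_(n <oo) f (Negz n))%E.
Proof.
move=> f0; rewrite (esumID (range Posz))// !setTI.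
have -> : ~` range Posz = range Negz.
  apply/seteqP; split => [[n|n]|_ [n _ <-]]/=; last by case.
    by case; exists n.
  by move=> _; exists n.
rewrite !esum_image; [|by move=> ? ? _ _ []|by move=> ? ? _ _ []].
by rewrite !nneseries_esumT.
Qed.

Lemma esum_intZl (c : R) (f : int -> \bar R) : 0 <= c -> (forall n, 0 <= f n)%E ->
  (\esum_(n in [set: int]) (c%:E * f n) = c%:E * \esum_(n in [set: int]) f n)%E.
Proof.
move=> c0 f0; rewrite !esum_int// => [|n]; last by rewrite mule_ge0.
rewrite !nneseriesZl// ge0_muleDr//; exact: nneseries_ge0.
Qed.

Lemma esum_int_geometric : \esum_(n in [set: int]) ((2^-1 ^+ `|n|%N)%:E : \bar R) = 3%:E.
Proof.
rewrite esum_int => [|n]; last by rewrite lee_fin exprn_ge0.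
have h (r : R) : (\sum_(n <oo) (r * 2^-1 ^+ n.+1)%:E = r%:E)%E.
  apply/cvg_lim => //; have := @cvg_geometric_eseries_half R r 0.
  rewrite expr0 divr1; apply: cvg_trans; apply: near_eq_cvg.
  near=> n; rewrite /eseries/=; apply: eq_bigr => i _.
  by rewrite addn1 exprVn natrX.
rewrite -[X in _ = X%:E](_ : 2 + 1 = 3 :> R); last by lra.
rewrite EFinD; congr (_ + _)%E.
  rewrite -[RHS]h; apply: eq_eseriesr => n _; congr EFin.
  by rewrite exprS mulrA divff// mul1r.
by rewrite -[RHS]h; apply: eq_eseriesr => n _; rewrite mul1r.
Unshelve. all: end_near. Qed.

Definition gterm t a (n : int) : R := expR (- (a + 2 * n%:~R) ^+ 2 / (4 * t)).

(** The image sum of the heat kernel without its normalising factor, valued in [\bar R] so that sums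
    over images can be rearranged and exchanged freely; [th] is its real value. *)
Definition theta t a : \bar R := \esum_(n in [set: int]) (gterm t a n)%:E.

(** The weight is the price of a change of [t] and [a] in the exponent of the [n]-th image, see
    [gterm_lip]. *)
Definition theta_weighted t a : \bar R :=
  \esum_(n in [set: int]) ((1 + n%:~R ^+ 2) * gterm t a n)%:E.

(** With [m = |n|], [(a + 2 n)^2 >= a^2 + 4 m (m - 1)] since [|a| <= 1], and the decay
    [expR (- m (m - 1) / tau)] absorbs both [1 + n^2 <= 2 e^m] and [2^m <= e^m]. The exponent in the
    constant is the maximum over real [m] of [2 m - m (m - 1) / tau]. *)
Lemma gterm_le (tau t a : R) (n : int) : 0 < t -> t <= tau -> `|a| <= 1 ->
  (1 + n%:~R ^+ 2) * gterm t a n <=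
  2 * expR ((2 + tau^-1) ^+ 2 * tau / 4) * expR (- a ^+ 2 / (4 * t)) *
  2^-1 ^+ `|n|%N.
Proof.
move=> t0 ttau a1; have tau0 : 0 < tau by exact: lt_le_trans ttau.
set m := `|n|%N; pose M : R := m%:R.
have nM' : `|(n%:~R : R)| = M by rewrite -intr_norm.
have nM : (n%:~R : R) ^+ 2 = M ^+ 2 by rewrite -[LHS]real_normK ?num_real// nM'.
have M0 : 0 <= M by rewrite ler0n.
have M2M : 0 <= M * (M - 1).
  rewrite /M; case: (m) => [|k]; first by rewrite mul0r.
  by rewrite mulr_ge0// -natr1 addrK ler0n.
have e1 : 1 + (n%:~R : R) ^+ 2 <= 2 * expR M.
  rewrite nM; have := expR_ge1Dxn 1 M0; rewrite (_ : 2`!%N%:R = 2 :> R)// => h.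
  by apply: le_trans (_ : 2 * (1 + M ^+ 2 / 2) <= _); [lra|rewrite ler_pM2l].
have e2 : 1 <= expR M * 2^-1 ^+ m.
  rewrite -[M]mulr1 expRM_natl -exprMn exprn_ege1//.
  by have := expR_ge1Dx (1 : R); lra.
have e3 : gterm t a n <= expR (- a ^+ 2 / (4 * t)) * expR (- (M * (M - 1)) / tau).
  rewrite /gterm -expRD ler_expR.
  have k : a ^+ 2 + 4 * (M * (M - 1)) <= (a + 2 * n%:~R) ^+ 2.
    have : - M <= a * n%:~R.
      have : `|a * n%:~R| <= M by rewrite normrM nM' ler_piMl.
      by rewrite ler_norml => /andP[].
    by move: nM; nra.
  have k2 : M * (M - 1) / tau <= M * (M - 1) / t by rewrite ler_wpM2l// lef_pV2.
  apply: le_trans (_ : - (a ^+ 2 + 4 * (M * (M - 1))) / (4 * t) <= _).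
    by rewrite ler_pM2r ?invr_gt0 ?mulr_gt0// lerN2.
  rewrite opprD mulrDl lerD2l -mulrN mulNr invfM mulrACA divff// mul1r.
  by rewrite !mulNr lerN2.
have e4 : expR M * expR M * expR (- (M * (M - 1)) / tau) <=
    expR ((2 + tau^-1) ^+ 2 * tau / 4).
  rewrite -!expRD ler_expR.
  rewrite -subr_ge0 [leRHS](_ : _ = (2 * M - (2 + tau^-1) * tau) ^+ 2 / (4 * tau)).
    by rewrite mulr_ge0 ?sqr_ge0// invr_ge0 mulr_ge0// ltW.
  by field; rewrite gt_eqF.
have g0 : 0 < gterm t a n by exact: expR_gt0.
set E1 := expR (- a ^+ 2 / (4 * t)) in e3 *.
set E2 := expR (- (M * (M - 1)) / tau) in e3 e4.
set E3 := expR ((2 + _) ^+ 2 * tau / 4) in e4 *.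
have p1 : 0 <= E1 by exact: expR_ge0.
have p2 : 0 <= E2 by exact: expR_ge0.
apply: le_trans (ler_pM _ _ e1 e3) _; rewrite ?addr_ge0 ?sqr_ge0 ?(ltW g0)//.
have q0 : 0 <= 2^-1 ^+ m :> R by rewrite exprn_ge0.
apply: le_trans (_ : 2 * (expR M * expR M * E2) * E1 * 2^-1 ^+ m <= _).
  rewrite [leRHS](_ : _ = 2 * expR M * E2 * E1 * (expR M * 2^-1 ^+ m)); last by ring.
  rewrite [leLHS](_ : _ = 2 * expR M * E2 * E1 * 1); last by ring.
  by rewrite ler_wpM2l// !mulr_ge0// expR_ge0.
by rewrite ler_wpM2r// ler_wpM2r// ler_wpM2l.
Qed.

Lemma theta_weighted_le (tau : R) : exists2 C : R, 0 < C &
  forall t a, 0 < t -> t <= tau -> `|a| <= 1 ->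
    (theta_weighted t a <= (C * expR (- a ^+ 2 / (4 * t)))%:E)%E.
Proof.
exists (2 * expR ((2 + tau^-1) ^+ 2 * tau / 4) * 3); first by rewrite !mulr_gt0 ?expR_gt0.
move=> t a t0 tt a1.
rewrite /theta_weighted; apply: (@le_trans _ _ (\esum_(n in [set: int])
  (2 * expR ((2 + tau^-1) ^+ 2 * tau / 4) * expR (- a ^+ 2 / (4 * t)))%:E *
    (2^-1 ^+ `|n|%N)%:E))%E.
  by apply: le_esum => n _; rewrite -EFinM lee_fin; exact: gterm_le.
rewrite esum_intZl ?esum_int_geometric -?EFinM ?lee_fin.
- by rewrite le_eqVlt; apply/orP; left; apply/eqP; ring.
- by rewrite !mulr_ge0// expR_ge0.
- by move=> n; rewrite lee_fin exprn_ge0.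
Qed.

Lemma gterm_gt0 t a n : 0 < gterm t a n. Proof. exact: expR_gt0. Qed.

Lemma gterm0 t a : gterm t a 0 = expR (- a ^+ 2 / (4 * t)).
Proof. by rewrite /gterm mulr0 addr0. Qed.

Lemma thetaD2 t a (k : int) : theta t (a + 2 * k%:~R) = theta t a.
Proof.
rewrite /theta [RHS](@reindex_esum _ _ _ setT setT (fun n : int => n + k)%R); last first.
  split => // [x y _ _ /addIr//|x _]; exists (x - k) => //=; by rewrite subrK.
by apply: eq_esum => n _; rewrite /gterm intrD; congr ((expR _)%:E); congr (- _ ^+ 2 / _); ring.
Qed.

Lemma thetaN t a : theta t (- a) = theta t a.
Proof.
rewrite /theta [RHS](@reindex_esum _ _ _ setT setT (fun n : int => - n)%R); last first.
  split => // [x y _ _ /oppr_inj//|x _]; exists (- x) => //=; by rewrite opprK.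
by apply: eq_esum => n _; rewrite /gterm intrN; congr ((expR _)%:E); congr (- _ / _); ring.
Qed.

Lemma torus_repr a : exists k : int, `|a + 2 * k%:~R| <= 1.
Proof.
exists (- Num.floor ((a + 1) / 2)).
have := Num.Theory.floor_itv ((a + 1) / 2).
move: (Num.floor _) => n /andP[h1 h2]; rewrite intrN ler_norml.
by move: h2; rewrite intrD => h2; apply/andP; split; lra.
Qed.

Lemma theta_gterm0 t a : (0 <= theta t a)%E.
Proof. by apply: esum_ge0 => n _; rewrite lee_fin ltW ?gterm_gt0. Qed.

Lemma theta_ge t a n : ((gterm t a n)%:E <= theta t a)%E.
Proof.
apply: esum_ge; exists [set n]; first by split; [exact: finite_set1|exact: subsetT].
by rewrite fsbig_set1.
Qed.

Lemma theta_le_weighted t a : (theta t a <= theta_weighted t a)%E.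
Proof.
apply: le_esum => n _; rewrite lee_fin ler_peMl ?(ltW (gterm_gt0 _ _ _))//.
by rewrite lerDl sqr_ge0.
Qed.

Lemma theta_fin_num t a : 0 < t -> theta t a \is a fin_num.
Proof.
move=> t0; have [k ak] := torus_repr a; rewrite -(thetaD2 t a k).
have [C _ /(_ t _ t0 (lexx _) ak) h] := theta_weighted_le t.
rewrite fin_num_abs gee0_abs ?theta_gterm0//.
by rewrite (le_lt_trans (theta_le_weighted _ _))// (le_lt_trans h)// ltry.
Qed.

Definition th t a : R := fine (theta t a).

Lemma thE t a : 0 < t -> (th t a)%:E = theta t a.
Proof. by move=> t0; rewrite fineK// theta_fin_num. Qed.

Lemma thD2 t a (k : int) : th t (a + 2 * k%:~R) = th t a.
Proof. by rewrite /th thetaD2. Qed.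

Lemma thN t a : th t (- a) = th t a.
Proof. by rewrite /th thetaN. Qed.

Lemma th_gt0 t a : 0 < t -> 0 < th t a.
Proof.
move=> t0; rewrite -lte_fin thE//; apply: lt_le_trans (theta_ge t a 0).
by rewrite lte_fin gterm_gt0.
Qed.

Lemma th_le (tau : R) : exists2 C : R, 0 < C &
  forall t a, 0 < t -> t <= tau -> th t a <= C.
Proof.
have [C C0 h] := theta_weighted_le tau; exists C => // t a t0 tt.
have [k ak] := torus_repr a; rewrite -(thD2 t a k) -lee_fin thE//.
apply: le_trans (theta_le_weighted _ _) _; apply: le_trans (h _ _ t0 tt ak) _.
rewrite lee_fin ler_piMr ?(ltW C0)// expR_le1// mulNr oppr_le0.
by rewrite mulr_ge0 ?sqr_ge0// invr_ge0 mulr_ge0// ltW.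
Qed.

(** The image lying in [[-1, 1]] already gives the bound. *)
Lemma th_ge t a : 0 < t -> expR (- (4 * t)^-1) <= th t a.
Proof.
move=> t0; have [k ak] := torus_repr a; rewrite -(thD2 t a k) -lee_fin thE//.
apply: le_trans (theta_ge _ _ 0); rewrite gterm0 lee_fin ler_expR mulNr lerN2.
rewrite ler_piMl ?invr_ge0 ?mulr_ge0 ?(ltW t0)//.
by rewrite -[leLHS]real_normK ?num_real// expr_le1.
Qed.

(** The exponents of the two terms differ by at most the factor [B] in front of the weighted term,
    and [1 - B <= expR (- B)]. *)
Lemma gterm_lip t t' a a' (m del : R) (n : int) : 0 < m -> m <= 1 -> m <= t -> m <= t' ->
  `|t - t'| <= del -> `|a - a'| <= del -> del <= 2 -> `|a| <= 1 ->
  gterm t a n <= gterm t' a' n + 4 * del / m ^+ 2 * ((1 + n%:~R ^+ 2) * gterm t a n).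
Proof.
move=> m0 m1 mt mt' ht ha d2 a1.
have t0 : 0 < t by exact: lt_le_trans mt.
have t'0 : 0 < t' by exact: lt_le_trans mt'.
have d0 : 0 <= del by exact: le_trans ht.
set N := (n%:~R : R); pose B := 4 * del / m ^+ 2 * (1 + N ^+ 2).
pose E := (a + 2 * N) ^+ 2 / (4 * t); pose E' := (a' + 2 * N) ^+ 2 / (4 * t').
suff EB : E' - E <= B.
  have gE : gterm t a n = expR (- E) by rewrite /gterm mulNr.
  have gE' : gterm t' a' n = expR (- E') by rewrite /gterm mulNr.
  rewrite mulrA -/B gE gE' -lerBlDr -[X in X - _]mul1r -mulrBl.
  have -> : - E' = - (E' - E) + - E by ring.
  rewrite expRD ler_wpM2r ?expR_ge0//.
  apply: le_trans (expR_ge1Dx _); lra.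
have N1 : `|N| <= (1 + N ^+ 2) / 2.
  rewrite ler_norml; have := sqr_ge0 (N - 1); have := sqr_ge0 (N + 1); move=> ? ?.
  by apply/andP; split; nra.
have h1 : `|(a' + 2 * N) ^+ 2 - (a + 2 * N) ^+ 2| <= 8 * del * (1 + N ^+ 2).
  rewrite [X in `|X|](_ : _ = (a' - a) * (a' + a + 4 * N)); last by ring.
  rewrite normrM distrC.
  have : `|a' + a + 4 * N| <= 4 + 4 * `|N|.
    have := ler_normD (a' + a) (4 * N); rewrite normrM (@ger0_norm _ 4)//.
    have := ler_normD (a' - a) (a + a); rewrite distrC.
    have := ler_normD a a; rewrite (_ : a' - a + (a + a) = a' + a); last by ring.
    lra.
  move=> h; apply: le_trans (ler_pM _ _ ha h) _ => //.
  have := sqr_ge0 N; nra.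
have h2 : (a + 2 * N) ^+ 2 <= 8 * (1 + N ^+ 2).
  have h := sqr_ge0 N; move: a1; rewrite ler_norml => /andP[a1 a2].
  have := sqr_ge0 (a - 2 * N); nra.
have i1 : (4 * t')^-1 <= (4 * m ^+ 2)^-1.
  rewrite lef_pV2 ?posrE ?mulr_gt0 ?exprn_gt0// ler_pM2l//.
  by apply: le_trans mt'; rewrite expr2 ler_piMl// ltW.
have i2 : `|(4 * t')^-1 - (4 * t)^-1| <= del / (4 * m ^+ 2).
  rewrite [X in `|X|](_ : _ = (t - t') * (4 * t * t')^-1); last first.
    by field; rewrite !gt_eqF.
  rewrite normrM ler_pM//; rewrite ger0_norm; last by pos.
  rewrite lef_pV2 ?posrE; [|by pos|by pos]; rewrite -mulrA ler_pM2l// expr2.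
  by rewrite ler_pM// ltW.
have -> : E' - E = ((a' + 2 * N) ^+ 2 - (a + 2 * N) ^+ 2) * (4 * t')^-1 +
   (a + 2 * N) ^+ 2 * ((4 * t')^-1 - (4 * t)^-1) by rewrite /E /E'; ring.
have p : 0 <= 1 + N ^+ 2 by pos.
apply: le_trans (ler_norm _) _; apply: le_trans (ler_normD _ _) _.
rewrite (normrM (_ - _)) (normrM (_ ^+ 2)) (@ger0_norm _ (_ ^+ 2)) ?sqr_ge0// (@ger0_norm _ (_^-1)); last by pos.
have -> : B = 8 * del * (1 + N ^+ 2) * (4 * m ^+ 2)^-1 + 8 * (1 + N ^+ 2) * (del / (4 * m ^+ 2)).
  by rewrite /B; field; rewrite gt_eqF.
by rewrite lerD// ler_pM//; pos.
Qed.

(** The error is relative to [th t a] itself because [theta_weighted] is at most a multiple of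
    [theta]. In this form the estimate can be integrated against any nonnegative function. *)
Lemma th_lip (tau : R) : exists2 C : R, 0 < C & forall (t t' a a' m del : R),
  0 < m -> m <= 1 -> m <= t -> t <= tau -> m <= t' ->
  `|t - t'| <= del -> `|a - a'| <= del -> del <= 2 ->
  (1 - C * del / m ^+ 2) * th t a <= th t' a'.
Proof.
have [C C0 h] := theta_weighted_le tau; exists (4 * C); first by rewrite mulr_gt0.
move=> t t' a a' m del m0 m1 mt ttau mt' ht ha d2.
have t0 : 0 < t by exact: lt_le_trans mt.
have t'0 : 0 < t' by exact: lt_le_trans mt'.
have d0 : 0 <= del by exact: le_trans ht.
have [k ak] := torus_repr a; rewrite -(thD2 t a k) -(thD2 t' a' k).
have {}ha : `|a + 2 * k%:~R - (a' + 2 * k%:~R)| <= del.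
  by rewrite [X in `|X|](_ : _ = a - a')//; ring.
move: (a + _) (a' + _) ha ak => {}a {}a' ha a1.
rewrite mulrBl mul1r lerBlDr -lee_fin EFinD EFinM !thE//.
apply: (@le_trans _ _ (theta t' a' + (4 * del / m ^+ 2)%:E * theta_weighted t a)%E).
  rewrite /theta_weighted -esum_intZl; last 2 first.
  - by pos.
  - by move=> n; rewrite lee_fin; pos.
  rewrite /theta -esumD; last 2 first.
  - by move=> n _; rewrite lee_fin ltW ?gterm_gt0.
  - by move=> n _; rewrite mule_ge0// lee_fin; pos.
  by apply: le_esum => n _; rewrite -EFinM -EFinD lee_fin (gterm_lip _ m0)//.
rewrite leeD2l//; have /= := h t a t0 ttau a1; rewrite -gterm0 => h1.
have h2 : (theta_weighted t a <= C%:E * theta t a)%E.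
  apply: le_trans h1 _; rewrite EFinM lee_pmul2l// ?theta_ge// lte_fin//.
apply: le_trans (_ : (4 * del / m ^+ 2)%:E * (C%:E * theta t a) <= _)%E.
  by rewrite lee_wpmul2l// lee_fin; pos.
by rewrite muleA -EFinM le_eqVlt; apply/orP; left; apply/eqP; congr (_%:E * _)%E; ring.
Qed.

Lemma esum_int_swap (f : int -> int -> \bar R) : (forall n k, 0 <= f n k)%E ->
  \esum_(n in [set: int]) \esum_(k in [set: int]) f n k =
  \esum_(k in [set: int]) \esum_(n in [set: int]) f n k.
Proof.
move=> f0; rewrite (esum_esum (J := fun=> setT))// [RHS](esum_esum (J := fun=> setT))//.
rewrite [RHS](@reindex_esum _ _ _ ([set: int] `*`` fun=> [set: int]) _ (fun p : int * int => (p.2, p.1)))//.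
split => // [[x1 x2] [y1 y2] _ _ /= [-> ->]//|[x y] _]; by exists (y, x).
Qed.

(** Grouping the pairs of images by their total displacement [k] and completing the square factors
    each product into a Gaussian of time [s + r] in [x - z] and a Gaussian of the bridge time
    [s r / (s + r)] in [y]; the remaining sum over images reassembles [theta] at the bridge time. *)
Lemma theta_mul s r x y z : 0 < s -> 0 < r ->
  (theta s (x - y) * theta r (y - z) = \esum_(k in [set: int])
    ((gterm (s + r) (x - z) k)%:E *
     theta (s * r / (s + r)) ((r * x + s * z - 2 * k%:~R * s) / (r + s) - y)))%E.
Proof.
move=> s0 r0; rewrite muleC -(thE (y - z))// {1}/theta -esum_intZl ?ltW ?th_gt0//; last first.
  by move=> n; rewrite lee_fin; pos.
under eq_esum => n _.
  rewrite thE// muleC /theta -esum_intZl; [|exact: ltW (gterm_gt0 _ _ _)|by move=> k; rewrite lee_fin; pos].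
  rewrite (@reindex_esum _ _ _ setT setT (fun k : int => k - n)%R); last first.
    split => // [u v _ _ /addIr//|u _]; exists (u + n) => //=; by rewrite addrK.
  over.
rewrite /= esum_int_swap; last by move=> n k; rewrite mule_ge0// lee_fin; pos.
apply: eq_esum => k _; rewrite -thetaN /theta -esum_intZl; [|by pos|by move=> n; rewrite lee_fin; pos].
rewrite [RHS](@reindex_esum _ _ _ setT setT (fun n : int => - n)%R); last first.
  split => // [u v _ _ /oppr_inj//|u _]; exists (- u) => //=; by rewrite opprK.
apply: eq_esum => n _; rewrite -!EFinM /gterm -!expRD; congr ((expR _)%:E).
rewrite !intrD !intrN; field.
by rewrite !gt_eqF ?addr_gt0.
Qed.

(** The bridge time [s r / (s + r)] is at most [s], so the bridge factors of [theta_mul] are bounded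
    uniformly in [r]. *)
Lemma theta_mul_le (tau : R) : exists2 C : R, 0 < C & forall s r x y z,
  0 < s -> s <= tau -> 0 < r ->
  (theta s (x - y) * theta r (y - z) <= C%:E * theta (s + r) (x - z))%E.
Proof.
have [C C0 h] := th_le tau; exists C => // s r x y z s0 st r0.
have rho0 : 0 < s * r / (s + r) by pos.
have rhot : s * r / (s + r) <= tau.
  apply: le_trans st; rewrite -mulrA ler_piMr ?(ltW s0)//.
  by rewrite ler_pdivrMr ?addr_gt0// mul1r lerDr ltW.
rewrite theta_mul// {2}/theta -esum_intZl; [|exact: ltW|by move=> n; rewrite lee_fin; pos].
apply: le_esum => k _; rewrite muleC; apply: lee_wpmul2r; first by rewrite lee_fin; pos.
by rewrite -thE// lee_fin h.
Qed.

Local Notation mu := (@lebesgue_measure R).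

Fact measurable_translation (c : R) :
  @measurable_fun _ _ (measurableTypeR R) (measurableTypeR R) setT (fun y => y + c).
Proof. exact: (@measurable_realfun.measurable_funD _ _ R setT (@id R) (cst c)). Qed.

Definition translation (c : R) : {mfun measurableTypeR R >-> measurableTypeR R} :=
  HB.pack (fun y : R => y + c)
    (@isMeasurableFun.Build _ _ (measurableTypeR R) (measurableTypeR R)
       (fun y : R => y + c) (measurable_translation c)).

Lemma lebesgue_measure_translate (c : R) (A : set R) : measurable A ->
  pushforward mu (translation c) A = mu A.
Proof.
move=> mA; apply/esym/lebesgue_measure_unique => //= _ [[a b]] _ <-.
rewrite /pushforward /=.
have -> : (fun y => y + c) @^-1` `]a, b] = `]a - c, b - c]%classic.
  by apply/seteqP; split => y /=; rewrite !in_itv/= ltrBlDr lerBrDr.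
by rewrite !lebesgue_measure_itv/= !lte_fin ltrD2r -!EFinD opprD addrACA subrr addr0.
Qed.

Lemma ge0_integral_translate (c : R) (D : set R) (f : R -> \bar R) :
  measurable D -> measurable_fun D f -> (forall y, D y -> 0 <= f y)%E ->
  (\int[mu]_(y in [set y | D (y + c)%R]) f (y + c)%R = \int[mu]_(y in D) f y)%E.
Proof.
move=> mD mf f0.
rewrite -[RHS](@eq_measure_integral _ (measurableTypeR R) R D _ (pushforward mu (translation c))); last first.
  by move=> A mA _; exact: lebesgue_measure_translate.
rewrite ge0_integral_pushforward//.
by move=> y; rewrite inE; exact: f0.
Qed.

Lemma integral_gauss (c t : R) : 0 < t ->
  (\int[mu]_y (expR (- (c - y) ^+ 2 / (4 * t)))%:E = (Num.sqrt (4 * pi * t))%:E)%E.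
Proof.
move=> t0; have st0 : Num.sqrt (2 * t) != 0 by rewrite gt_eqF// sqrtr_gt0; pos.
have tE : Num.sqrt (2 * t) ^+ 2 *+ 2 = 4 * t.
  by rewrite sqr_sqrtr ?mulr_ge0 ?ltW// -mulr_natr; ring.
have pE : normal_peak (Num.sqrt (2 * t)) = (Num.sqrt (4 * pi * t))^-1.
  rewrite /normal_peak sqr_sqrtr ?mulr_ge0 ?ltW//; congr (Num.sqrt _)^-1.
  by rewrite -mulr_natr; ring.
have p0 : 0 < Num.sqrt (4 * pi * t) by rewrite sqrtr_gt0; pos.
have := integral_normal_pdf c (Num.sqrt (2 * t)).
under eq_integral do rewrite normal_pdfE// pE /normal_fun tE EFinM.
rewrite ge0_integralZl_EFin//; last first.
  apply/measurable_EFinP; apply: measurableT_comp => //.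
  apply: measurable_funM => //; apply: measurableT_comp => //.
  by apply: measurable_funX; apply: measurable_funB.
move=> h; under eq_integral do rewrite -(opprB _ c) sqrrN.
by rewrite -[LHS]mul1e -[X in X%:E](@divff _ (Num.sqrt (4 * pi * t))) ?gt_eqF// EFinM -muleA h mule1.
Qed.

Lemma measurable_fun_esum_int d (T : measurableType d) (D : set T)
    (f : int -> T -> \bar R) :
  (forall n w, 0 <= f n w)%E -> (forall n, measurable_fun D (f n)) ->
  measurable_fun D (fun w => \esum_(n in [set: int]) f n w).
Proof.
move=> f0 mf; rewrite (_ : (fun w => _) = fun w =>
    (\sum_(n <oo) f n%:Z w + \sum_(n <oo) f (Negz n) w)%E); last first.
  by apply/funext => w; rewrite esum_int.
by apply: emeasurable_funD; apply: (@ge0_emeasurable_sum _ _ _ _ _ xpredT).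
Qed.

Let strip (n : int) : set R := [set y | torus (y - 2 * n%:~R)].

Let stripE n : strip n = `[2 * n%:~R - 1, 2 * n%:~R + 1[%classic.
Proof.
by apply/seteqP; split => y; rewrite /strip/torus/= !in_itv/= lerBrDr ltrBlDr (addrC (-1)) (addrC 1).
Qed.

Let measurable_strip n : measurable (strip n).
Proof. by rewrite stripE; exact: measurable_itv. Qed.

Let strip_cover y : exists n, strip n y.
Proof.
exists (Num.floor ((y + 1) / 2)).
have := Num.Theory.floor_itv ((y + 1) / 2).
move: (Num.floor _) => n /andP[h1]; rewrite intrD => h2.
by rewrite stripE/= in_itv/=; apply/andP; split; lra.
Qed.

Let strip_inj m n y : strip m y -> strip n y -> m = n.
Proof.
rewrite !stripE/= !in_itv/= => /andP[h1 h2] /andP[h3 h4].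
apply/eqP; rewrite eq_le -!(ltzD1 _ (_ : int)) -!(ltr_int R) !intrD.
by apply/andP; split; lra.
Qed.

(** The sets [strip n] are the translates of the fundamental domain, and they tile the line. *)
Lemma integral_unfold (h : R -> \bar R) : (forall y, 0 <= h y)%E ->
  measurable_fun [set: R] h ->
  (\int[mu]_(y in @torus R) (\esum_(n in [set: int]) h (y + 2 * n%:~R)%R) =
   \int[mu]_y h y)%E.
Proof.
move=> h0 mh.
have mT : measurable (@torus R) by exact: measurable_itv.
have msh (c : R) : measurable_fun (@torus R) (fun y => h (y + c)).
  apply: measurable_funTS; apply: measurableT_comp => //.
  exact: (@measurable_translation c).
have step n : (\int[mu]_(y in @torus R) h (y + 2 * n%:~R)%R = \int[mu]_(y in strip n) h y)%E.
  rewrite -[RHS](@ge0_integral_translate (2 * n%:~R))//; [|exact: measurable_funTS].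
  congr (integral _ _ _); apply/seteqP; split => y; rewrite /strip/= addrK//.
under eq_integral do rewrite esum_int//.
rewrite ge0_integralD//; last 4 first.
- by move=> y _; exact: nneseries_ge0.
- by apply: (@ge0_emeasurable_sum _ _ _ _ (fun n y => h (y + 2 * n%:~R)) xpredT).
- by move=> y _; exact: nneseries_ge0.
- by apply: (@ge0_emeasurable_sum _ _ _ _ (fun n y => h (y + 2 * (Negz n)%:~R)) xpredT).
rewrite !integral_nneseries//; [|by move=> n; exact: msh|by move=> n; exact: msh].
under eq_eseriesr do rewrite step.
under [X in (_ + X)%E]eq_eseriesr do rewrite step.
have bigcupE (e : nat -> int) : injective e ->
    (\int[mu]_(y in \bigcup_n strip (e n)) h y =
     \sum_(n <oo) \int[mu]_(y in strip (e n)) h y)%E.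
  move=> einj; apply: ge0_integral_bigcup => //.
  - by move=> n; exact: measurable_strip.
  - exact: measurable_funTS.
  - by move=> m n _ _ [y [/strip_inj h1 /h1 /einj]].
rewrite -(bigcupE Posz); last by move=> ? ? [].
rewrite -(bigcupE Negz); last by move=> ? ? [].
rewrite -ge0_integral_setU//.
- congr (integral _ _ _); apply/seteqP; split => // y _.
  by have [[n|n] cy] := strip_cover y; [left|right]; exists n.
- by apply: bigcup_measurable => n _; exact: measurable_strip.
- by apply: bigcup_measurable => n _; exact: measurable_strip.
- exact: measurable_funTS.
- apply/disj_setPS => y [[m _ cm] [n _ cn]].
  by have := strip_inj cm cn.
Qed.

Lemma measurable_gterm t (n : int) c : measurable_fun [set: R] (fun y => gterm t (c - y) n).
Proof.
apply: measurableT_comp => //; apply: measurable_funM => //; apply: measurableT_comp => //.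
by apply: measurable_funX; apply: measurable_realfun.measurable_funD => //; exact: measurable_funB.
Qed.

Lemma measurable_theta t c : measurable_fun [set: R] (fun y => theta t (c - y)).
Proof.
apply: measurable_fun_esum_int => n; first by move=> x; rewrite lee_fin; pos.
by apply/measurable_EFinP; exact: measurable_gterm.
Qed.

Lemma measurable_torus : measurable (@torus R).
Proof. exact: measurable_itv. Qed.
Hint Resolve measurable_torus : core.

Lemma ge0_integral_esum_int d (T : measurableType d) (m : {measure set T -> \bar R})
    (D : set T) (f : int -> T -> \bar R) : measurable D ->
  (forall n w, 0 <= f n w)%E -> (forall n, measurable_fun D (f n)) ->
  (\int[m]_(w in D) (\esum_(n in [set: int]) f n w) =
   \esum_(n in [set: int]) \int[m]_(w in D) f n w)%E.
Proof.
move=> mD f0 mf; rewrite esum_int; last by move=> n; exact: integral_ge0.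
under eq_integral do rewrite esum_int//.
rewrite ge0_integralD//; last 4 first.
- by move=> w _; exact: nneseries_ge0.
- by apply: (@ge0_emeasurable_sum _ _ _ _ (fun n w => f n%:Z w) xpredT).
- by move=> w _; exact: nneseries_ge0.
- by apply: (@ge0_emeasurable_sum _ _ _ _ (fun n w => f (Negz n) w) xpredT).
by rewrite !integral_nneseries.
Qed.

Lemma integral_theta t c : 0 < t ->
  (\int[mu]_(y in @torus R) theta t (c - y) = (Num.sqrt (4 * pi * t))%:E)%E.
Proof.
move=> t0; rewrite -(integral_gauss c t0) -integral_unfold.
- apply: eq_integral => y _; rewrite /theta.
  rewrite (@reindex_esum _ _ _ setT setT (fun n : int => - n)%R); last first.
    by split => // [u v _ _ /oppr_inj//|u _]; exists (- u) => //=; rewrite opprK.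
  apply: eq_esum => n _; rewrite /gterm intrN.
  by have -> : c - y + 2 * - n%:~R = c - (y + 2 * n%:~R) by ring.
- by move=> y; rewrite lee_fin; pos.
- by apply/measurable_EFinP; have := measurable_gterm t 0 c; rewrite /gterm mulr0;
    under eq_fun do rewrite addr0.
Qed.

(* Locked copies: unification would otherwise unfold the kernel at every failure. *)
Definition hk : R -> R -> R -> R := locked (@heat_kernel R).

Definition hS : R -> (R -> R) -> R -> R := locked (@heat_semigroup R).

Lemma hk_heat_kernel t x y : hk t x y = heat_kernel t x y.
Proof. by rewrite /hk -lock. Qed.

Lemma hS_heat_semigroup t (f : R -> R) x :
  hS t f x = \int[mu]_(y in @torus R) (hk t x y * f y).
Proof. by rewrite /hS /hk -!lock. Qed.

Lemma hkE t x y : hk t x y = (Num.sqrt (4 * pi * t))^-1 * th t (x - y).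
Proof. by rewrite hk_heat_kernel. Qed.

Lemma hk_gt0 t x y : 0 < t -> 0 < hk t x y.
Proof. by move=> t0; rewrite hkE; pos; exact: th_gt0. Qed.

Lemma hkC t x y : hk t x y = hk t y x.
Proof. by rewrite !hkE -thN opprB. Qed.

Lemma hkD2 t x y : hk t (x + 2) y = hk t x y.
Proof. by rewrite !hkE addrAC -(thD2 t (x - y) 1) mulr1. Qed.

Lemma integral_hk t x : 0 < t ->
  (\int[mu]_(y in @torus R) (hk t x y)%:E = 1)%E.
Proof.
move=> t0; have p0 : 0 < Num.sqrt (4 * pi * t) by pos.
under eq_integral do rewrite hkE EFinM thE//.
rewrite ge0_integralZl_EFin//.
- by rewrite integral_theta// -EFinM mulVf// gt_eqF.
- by move=> y _; exact: theta_gterm0.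
- by apply: measurable_funTS; exact: measurable_theta.
Qed.

(** Integrating [theta_mul] in [y], each bridge factor contributes the same total mass whatever its
    centre, and the sum over [k] is the image sum at time [s + r]. *)
Lemma hk_semigroup s r x z : 0 < s -> 0 < r ->
  (\int[mu]_(y in @torus R) (hk s x y * hk r y z)%:E =
   (hk (s + r) x z)%:E)%E.
Proof.
move=> s0 r0; have sr0 : 0 < s + r by pos.
pose c : R := (Num.sqrt (4 * pi * s))^-1 * (Num.sqrt (4 * pi * r))^-1.
transitivity (\int[mu]_(y in @torus R) (c%:E * (theta s (x - y) * theta r (y - z))))%E.
  apply: eq_integral => y _; rewrite !hkE -!thE// -!EFinM /c; congr EFin; ring.
under eq_integral do rewrite theta_mul//.
have rho0 : 0 < s * r / (s + r) by pos.
have mg k : measurable_fun (@torus R) (fun y => (gterm (s + r) (x - z) k)%:E *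
     theta (s * r / (s + r)) ((r * x + s * z - 2 * k%:~R * s) / (r + s) - y))%E.
  by apply: measurable_funTS; apply: emeasurable_funM => //; exact: measurable_theta.
rewrite ge0_integralZl_EFin//; last 3 first.
- by move=> y _; apply: esum_ge0 => k _; rewrite mule_ge0 ?theta_gterm0// lee_fin; pos.
- by apply: measurable_fun_esum_int => // n w; rewrite mule_ge0 ?theta_gterm0// lee_fin; pos.
- by rewrite /c; pos.
have -> : (\int[mu]_(y in @torus R) (\esum_(k in [set: int]) ((gterm (s + r) (x - z) k)%:E *
     theta (s * r / (s + r)) ((r * x + s * z - 2 * k%:~R * s) / (r + s) - y))) =
     \esum_(k in [set: int]) ((Num.sqrt (4 * pi * (s * r / (s + r))))%:E * (gterm (s + r) (x - z) k)%:E))%E.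
  rewrite ge0_integral_esum_int//; last first.
    by move=> n w; rewrite mule_ge0 ?theta_gterm0// lee_fin; pos.
  apply: eq_esum => k _; rewrite ge0_integralZl_EFin//.
  - by rewrite integral_theta// muleC.
  - by move=> y _; exact: theta_gterm0.
  - by apply: measurable_funTS; exact: measurable_theta.
  - by pos.
rewrite esum_intZl; [|by pos|by move=> n; rewrite lee_fin; pos].
rewrite -/(theta _ _) -thE// -!EFinM hkE; congr EFin; rewrite mulrA; congr (_ * _).
rewrite /c !sqrtrM; try by pos.
rewrite sqrtrV; last by pos.
field.
by rewrite !gt_eqF ?sqrtr_gt0//; pos.
Qed.

Lemma measurable_funV d (T : measurableType d) (D : set T) (f : T -> R) :
  (forall w, D w -> 0 < f w) -> measurable_fun D f ->
  measurable_fun D (fun w => (f w)^-1).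
Proof.
move=> f0 mf; apply: (eq_measurable_fun (fun w => f w `^ (-1))).
  by move=> w; rewrite inE => Dw; rewrite powR_inv1// ltW// f0.
by apply: (measurableT_comp (measurable_powR _)).
Qed.

Lemma measurable_fun_hk d (T : measurableType d) (D : set T) (f g h : T -> R) :
  measurable D -> (forall w, D w -> 0 < f w) -> measurable_fun D f ->
  measurable_fun D g -> measurable_fun D h ->
  measurable_fun D (fun w => hk (f w) (g w) (h w)).
Proof.
move=> mD f0 mf mg mh.
rewrite (_ : (fun w => _) = fun w => (Num.sqrt (4 * pi * f w))^-1 * th (f w) (g w - h w)); last first.
  by apply/funext => w; rewrite hkE.
apply: measurable_funM.
  apply: measurable_funV => [w Dw|]; first by have := f0 _ Dw; pos.
  apply: (measurableT_comp (continuous_measurable_fun (@sqrt_continuous R))).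
  by apply: measurable_funM.
apply: (measurableT_comp (fine_measurable measurableT)).
apply: measurable_fun_esum_int => n; first by move=> w; rewrite lee_fin; pos.
apply/measurable_EFinP; apply: measurableT_comp => //; apply: measurable_funM.
  apply: measurableT_comp => //; apply: measurable_funX.
  by apply: measurable_realfun.measurable_funD => //; exact: measurable_funB.
apply: measurable_funV => [w Dw|]; first by have := f0 _ Dw; pos.
exact: measurable_funM.
Qed.

Lemma measurable_hk t x : 0 < t -> measurable_fun [set: R] (hk t x).
Proof. by move=> t0; apply: (@measurable_fun_hk _ _ _ (cst t) (cst x) id). Qed.

(** The images are handled by [theta_mul_le]; the normalising factors leave, up to a constant,
    [sqrt (s + r) / sqrt (s r)], which is at most [s^(-1/2) + r^(-1/2)]. Divided by
    [hk (s + r) x z], this bounds a bridge density. *)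
Lemma hk_mul_le : exists2 C : R, 0 < C & forall s r x y z,
  0 < s -> s <= 1 -> 0 < r ->
  hk s x y * hk r y z <=
  C * ((Num.sqrt s)^-1 + (Num.sqrt r)^-1) * hk (s + r) x z.
Proof.
have [C C0 h] := theta_mul_le 1; exists C => // s r x y z s0 s1 r0.
have sr0 : 0 < s + r by pos.
have {}h : th s (x - y) * th r (y - z) <= C * th (s + r) (x - z).
  by have := h s r x y z s0 s1 r0; rewrite -!thE// -!EFinM lee_fin.
rewrite !hkE.
have -> : forall a b c d : R, a * b * (c * d) = a * c * (b * d) by move=> *; ring.
apply: le_trans (ler_wpM2l _ h) _; first by pos.
rewrite mulrA [leRHS]mulrA; apply: ler_wpM2r; first exact/ltW/th_gt0.
have a0 : 0 < Num.sqrt (4 * pi * s) by pos.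
have b0 : 0 < Num.sqrt (4 * pi * r) by pos.
have c0 : 0 < Num.sqrt (4 * pi * (s + r)) by pos.
rewrite [leLHS]mulrC -!(mulrA C); apply: ler_wpM2l; first exact: ltW.
rewrite -(ler_pM2r (_ : 0 < Num.sqrt (4 * pi * s) * Num.sqrt (4 * pi * r) * Num.sqrt (4 * pi * (s + r)))); last by pos.
rewrite [leLHS](_ : _ = Num.sqrt (4 * pi * (s + r))); last first.
  by field; rewrite !gt_eqF.
rewrite [leRHS](_ : _ = ((Num.sqrt s)^-1 + (Num.sqrt r)^-1) *
    (Num.sqrt (4 * pi * s) * Num.sqrt (4 * pi * r))); last first.
  by field; rewrite !gt_eqF//; pos.
clear a0 b0 c0; have s4 : 1 <= Num.sqrt (4 * pi) :> R.
  by rewrite -[leLHS]sqrtr1 ler_sqrt; [have := @pi_ge2 R; lra|pos].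
rewrite (sqrtrM _ (_ : 0 <= 4 * pi)); last by pos.
rewrite (sqrtrM s (_ : 0 <= 4 * pi)); last by pos.
rewrite (sqrtrM r (_ : 0 <= 4 * pi)); last by pos.
set p := Num.sqrt (4 * pi) in s4 *; have S0 : 0 < Num.sqrt s by pos.
have R0 : 0 < Num.sqrt r by pos.
rewrite [leRHS](_ : _ = p * (p * (Num.sqrt s + Num.sqrt r))); last first.
  by field; rewrite !gt_eqF.
have p0 : 0 <= p by pos.
apply: ler_wpM2l => //; apply: le_trans (_ : Num.sqrt s + Num.sqrt r <= _).
  rewrite -(@ler_pXn2r _ 2%N)// ?nnegrE; try by pos.
  rewrite sqr_sqrtr ?(ltW sr0)// sqrrD (sqr_sqrtr (ltW s0)) (sqr_sqrtr (ltW r0)).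
  have : 0 <= Num.sqrt s * Num.sqrt r by pos.
  by rewrite mulr2n; lra.
by rewrite ler_peMl//; pos.
Qed.

Lemma hk_le (tau : R) : exists2 C : R, 0 < C & forall t x y,
  0 < t -> t <= tau -> hk t x y <= C / Num.sqrt t.
Proof.
have [C C0 h] := th_le tau; exists C => // t x y t0 tt.
rewrite hkE mulrC; apply: ler_pM; [exact/ltW/th_gt0|by pos|exact: h|].
rewrite lef_pV2 ?posrE; [|by pos|by pos].
by rewrite ler_sqrt; [have := @pi_ge2 R; nra|pos].
Qed.

(** The normalising factors agree, and the image sum lies between [expR (- (4 t)^-1)] and a
    constant, whatever the points. *)
Lemma hk_osc : exists2 C : R, 0 < C & forall t x x' y,
  0 < t -> t <= 1 -> hk t x y <= C * expR (t^-1) * hk t x' y.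
Proof.
have [C C0 h] := th_le 1; exists C => // t x x' y t0 t1.
rewrite !hkE mulrCA; apply: ler_wpM2l; first by pos.
apply: le_trans (h _ _ t0 t1) _; rewrite -mulrA ler_peMr ?(ltW C0)//.
apply: le_trans (_ : expR (t^-1) * expR (- (4 * t)^-1) <= _).
  rewrite -expRD -[leLHS](@expR0 R) ler_expR subr_ge0 lef_pV2 ?posrE; [|by pos|by pos].
  lra.
by apply: ler_wpM2l; [pos|exact: th_ge].
Qed.

(** The image sum is covered by [th_lip]. The normalising factor loses a relative error of at most
    [del / m^2], because [sqrt (t / t') >= t / t' >= 1 - del / m^2] when [t < t']; the two relative
    errors add up. *)
Lemma hk_lip (tau : R) : exists2 C : R, 0 < C & forall t t' x x' y (m del : R),
  0 < m -> m <= 1 -> m <= t -> t <= tau -> m <= t' ->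
  `|t - t'| <= del -> `|x - x'| <= del -> del <= 2 ->
  (1 - C * del / m ^+ 2) * hk t x y <= hk t' x' y.
Proof.
have [C C0 h] := th_lip tau; exists (C + 1); first by rewrite addr_gt0.
move=> t t' x x' y m del m0 m1 mt tt mt' ht hx d2.
have t0 : 0 < t by exact: lt_le_trans mt.
have t'0 : 0 < t' by exact: lt_le_trans mt'.
have d0 : 0 <= del by exact: le_trans ht.
rewrite !hkE.
have {}h := h t t' (x - y) (x' - y) m del m0 m1 mt tt mt' ht _ d2.
have {}h : (1 - C * del / m ^+ 2) * th t (x - y) <= th t' (x' - y).
  by apply: h; rewrite [X in `|X|](_ : _ = x - x')//; ring.
have q : (1 - del / m ^+ 2) * (Num.sqrt (4 * pi * t))^-1 <= (Num.sqrt (4 * pi * t'))^-1.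
  have [t't|tt'] := leP t' t.
    apply: le_trans (_ : (Num.sqrt (4 * pi * t))^-1 <= _).
      by apply: ler_piMl; [pos|rewrite gerBl; pos].
    rewrite lef_pV2 ?posrE; [|by pos|by pos].
    by rewrite ler_sqrt; [rewrite ler_pM2l//; pos|pos].
  have e1 : 1 - del / m ^+ 2 <= t / t'.
    have -> : t / t' = 1 - (t' - t) / t' by field; rewrite gt_eqF.
    rewrite lerD2l lerN2; apply: ler_pM; [|by pos| |].
    - by rewrite subr_ge0 ltW.
    - by move: ht; rewrite ler_norml => /andP[]; lra.
    - rewrite lef_pV2 ?posrE; [|by pos|by pos].
      by apply: le_trans mt'; rewrite expr2 ler_piMl// ltW.
  have tt0 : 0 < t / t' by pos.
  have e2 : t / t' <= Num.sqrt (t / t').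
    rewrite -[leLHS](@sqr_sqrtr _ (t / t')) ?(ltW tt0)// expr2; apply: ler_piMl; first by pos.
    by rewrite -[leRHS]sqrtr1 ler_sqrt// ler_pdivrMr// mul1r ltW.
  have -> : (Num.sqrt (4 * pi * t'))^-1 = Num.sqrt (t / t') * (Num.sqrt (4 * pi * t))^-1.
    have -> : 4 * pi * t = t / t' * (4 * pi * t') by field; rewrite gt_eqF.
    rewrite (sqrtrM _ (ltW tt0)); field; rewrite !gt_eqF//; pos.
  by apply: ler_wpM2r; [pos|exact: le_trans e1 e2].
have P1 : 0 < th t (x - y) by exact: th_gt0.
have P2 : 0 < th t' (x' - y) by exact: th_gt0.
have [neg|pos0] := leP (1 - (C + 1) * del / m ^+ 2) 0.
  apply: le_trans (_ : 0 <= _); last by pos.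
  by rewrite mulr_le0_ge0//; pos.
have Cp : 0 <= C * del / m ^+ 2 by pos.
have dp : 0 <= del / m ^+ 2 by pos.
have E : (C + 1) * del / m ^+ 2 = C * del / m ^+ 2 + del / m ^+ 2 by ring.
apply: le_trans (_ : ((1 - del / m ^+ 2) * (Num.sqrt (4 * pi * t))^-1) *
   ((1 - C * del / m ^+ 2) * th t (x - y)) <= _); last first.
  apply: ler_pM => //; apply: mulr_ge0; try by pos.
  - by move: pos0; rewrite E; lra.
  - by move: pos0; rewrite E; lra.
have -> : forall a b c d : R, a * b * (c * d) = (a * c) * (b * d) by move=> *; ring.
apply: ler_wpM2r; first by pos.
by rewrite E; nra.
Qed.

End kernel.

(** * The heat semigroup *)

Section heat_semigroup.
Variable R : realType.
Implicit Types (t s r x y z : R).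
Local Notation mu := (@lebesgue_measure R).
Let mtorus : measurable (@torus R) := @measurable_torus R.
Hint Resolve mtorus : core.

Lemma ge0_fubini_tonelli d1 d2 (T1 : measurableType d1) (T2 : measurableType d2)
    (m1 : {sigma_finite_measure set T1 -> \bar R})
    (m2 : {sigma_finite_measure set T2 -> \bar R})
    (D1 : set T1) (D2 : set T2) (f : T1 * T2 -> \bar R) :
  measurable D1 -> measurable D2 -> measurable_fun (D1 `*` D2) f ->
  (forall p, (D1 `*` D2) p -> 0 <= f p)%E ->
  (\int[m1]_(p in D1) \int[m2]_(q in D2) f (p, q) =
   \int[m2]_(q in D2) \int[m1]_(p in D1) f (p, q))%E.
Proof.
move=> mD1 mD2 mf f0; pose g := f \_ (D1 `*` D2).
have mD12 : measurable (D1 `*` D2) by exact: measurableX.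
have g0 p : (0 <= g p)%E.
  by rewrite /g patchE; case: ifPn => // /[!inE] /f0.
have mg : measurable_fun setT g by apply/(measurable_restrictT _ mD12).
have := @fubini_tonelli _ _ _ _ _ m1 m2 g mg g0.
have e1 : (\int[m1]_p \int[m2]_q g (p, q) = \int[m1]_(p in D1) \int[m2]_(q in D2) f (p, q))%E.
  rewrite [RHS]integral_mkcond; apply: eq_integral => p _; rewrite patchE.
  case: ifPn => [|] Dp; rewrite ?(integral_mkcond D2).
    by apply: eq_integral => q _; rewrite /g !patchE in_setX /= Dp.
  by apply: integral0_eq => q _; rewrite /g patchE in_setX /= (negbTE Dp).
have e2 : (\int[m2]_q \int[m1]_p g (p, q) = \int[m2]_(q in D2) \int[m1]_(p in D1) f (p, q))%E.
  rewrite [RHS]integral_mkcond; apply: eq_integral => q _; rewrite patchE.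
  case: ifPn => [|] Dq; rewrite ?(integral_mkcond D1).
    by apply: eq_integral => p _; rewrite /g !patchE in_setX /= Dq andbT.
  by apply: integral0_eq => p _; rewrite /g patchE in_setX /= (negbTE Dq) andbF.
by rewrite e1 e2.
Qed.

Let K0 t x y : 0 < t -> 0 <= hk t x y.
Proof. by move=> t0; exact/ltW/hk_gt0. Qed.

(** The real-valued integral behind [hS] returns a default value when the integrand diverges; for
    this class it is the genuine integral, by [hSE]. *)
Definition nnbounded (f : R -> R) : Prop :=
  measurable_fun (@torus R) f /\
  exists M : R, forall y, torus y -> 0 <= f y <= M.

Lemma measurable_hk_mul s x (f : R -> R) : 0 < s ->
  measurable_fun (@torus R) f ->
  measurable_fun (@torus R) (fun y => (hk s x y * f y)%:E).
Proof.
move=> s0 mf; apply/measurable_EFinP; apply: measurable_funM => //.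
by apply: measurable_funTS; exact: measurable_hk.
Qed.

Lemma hSE s (f : R -> R) x : 0 < s -> nnbounded f ->
  (hS s f x)%:E =
  (\int[mu]_(y in @torus R) (hk s x y * f y)%:E)%E.
Proof.
move=> s0 [mf [M fM]]; rewrite hS_heat_semigroup fineK// ge0_fin_numE; last first.
  apply: integral_ge0 => y /fM/andP[? _]; rewrite lee_fin mulr_ge0//.
  exact: K0.
apply: (@le_lt_trans _ _ (\int[mu]_(y in @torus R) (M%:E * (hk s x y)%:E))%E).
  apply: ge0_le_integral => //.
  - by move=> y /fM/andP[? _]; rewrite lee_fin mulr_ge0//; exact: K0.
  - exact: measurable_hk_mul.
  - apply: emeasurable_funM => //; apply/measurable_EFinP/measurable_funTS.
    exact: measurable_hk.
  - move=> y /fM/andP[_ ?]; rewrite -EFinM lee_fin mulrC ler_wpM2r//.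
    exact: K0.
have M0 : 0 <= M.
  have : torus (0 : R) by rewrite /torus/= in_itv/=; apply/andP; split; lra.
  by move=> /fM/andP[]; exact: le_trans.
rewrite ge0_integralZl_EFin//.
- by rewrite integral_hk// mule1 ltry.
- by move=> y _; rewrite lee_fin; exact: K0.
- apply/measurable_EFinP/measurable_funTS; exact: measurable_hk.
Qed.

(** The step by which every relative inequality between kernels becomes one between semigroups,
    uniformly in the profile. *)
Lemma hS_le s x x' s' (c : R) (f : R -> R) : 0 < s -> 0 < s' -> 0 <= c ->
  nnbounded f ->
  (forall y, torus y -> c * hk s x y * f y <= hk s' x' y * f y) ->
  c * hS s f x <= hS s' f x'.
Proof.
move=> s0 s'0 c0 bf h; rewrite -lee_fin (EFinM c) [leRHS](hSE x' s'0 bf) [X in (_ * X <= _)%E](hSE x s0 bf).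
have [mf [M fM]] := bf.
have f0 y : torus y -> 0 <= f y by move=> /fM/andP[].
rewrite -ge0_integralZl_EFin//.
- apply: ge0_le_integral => //.
  + move=> y /f0 fy; rewrite -EFinM lee_fin; rewrite !mulr_ge0// ?K0//.
  + by apply: emeasurable_funM => //; exact: measurable_hk_mul.
  + exact: measurable_hk_mul.
  + by move=> y /h; rewrite -EFinM lee_fin mulrA.
- move=> y /f0 fy; rewrite lee_fin; rewrite !mulr_ge0// ?K0//.
- exact: measurable_hk_mul.
Qed.

Lemma hS_ge0 s x (f : R -> R) : 0 < s -> nnbounded f ->
  0 <= hS s f x.
Proof.
move=> s0 bf; rewrite -lee_fin hSE//; apply: integral_ge0 => y Ty.
have [_ [M /(_ _ Ty)/andP[? _]]] := bf.
by rewrite lee_fin mulr_ge0//; exact: K0.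
Qed.

Lemma hS_lb s x (f : R -> R) (c : R) : 0 < s -> nnbounded f ->
  0 <= c -> (forall y, torus y -> c <= f y) -> c <= hS s f x.
Proof.
move=> s0 bf c0 cf; rewrite -lee_fin hSE//; have [mf _] := bf.
apply: (@le_trans _ _ (\int[mu]_(y in @torus R) (c%:E * (hk s x y)%:E))%E).
  rewrite ge0_integralZl_EFin//.
  - by rewrite integral_hk// mule1.
  - by move=> y _; rewrite lee_fin; exact: K0.
  - by apply/measurable_EFinP/measurable_funTS; exact: measurable_hk.
apply: ge0_le_integral => //.
- by move=> y _; rewrite -EFinM lee_fin mulr_ge0//; exact: K0.
- apply: emeasurable_funM => //; apply/measurable_EFinP/measurable_funTS.
  exact: measurable_hk.
- exact: measurable_hk_mul.
- move=> y /cf cy; rewrite -EFinM lee_fin mulrC ler_wpM2l//; exact: K0.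
Qed.

Lemma hS_ub s x (f : R -> R) (c : R) : 0 < s -> nnbounded f ->
  (forall y, torus y -> f y <= c) -> hS s f x <= c.
Proof.
move=> s0 bf cf; rewrite -lee_fin hSE//; have [mf [M fM]] := bf.
have c0 : 0 <= c.
  have T0 : torus (0 : R) by rewrite /torus/= in_itv/=; apply/andP; split; lra.
  by have /andP[h _] := fM _ T0; exact: le_trans (cf _ T0).
apply: (@le_trans _ _ (\int[mu]_(y in @torus R) (c%:E * (hk s x y)%:E))%E).
  apply: ge0_le_integral => //.
  - move=> y /fM/andP[? _]; rewrite lee_fin mulr_ge0//; exact: K0.
  - exact: measurable_hk_mul.
  - apply: emeasurable_funM => //; apply/measurable_EFinP/measurable_funTS.
    exact: measurable_hk.
  - move=> y /cf cy; rewrite -EFinM lee_fin mulrC ler_wpM2r//; exact: K0.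
rewrite ge0_integralZl_EFin//.
- by rewrite integral_hk// mule1.
- by move=> y _; rewrite lee_fin; exact: K0.
- by apply/measurable_EFinP/measurable_funTS; exact: measurable_hk.
Qed.

Lemma hSD2 s (f : R -> R) : periodic2 (hS s f).
Proof.
by move=> x; rewrite !hS_heat_semigroup/Rintegral; congr fine; apply: eq_integral => y _; rewrite hkD2.
Qed.

Lemma measurable_hS s (f : R -> R) : 0 < s -> nnbounded f ->
  measurable_fun [set: R] (hS s f).
Proof.
move=> s0 bf; apply/measurable_EFinP.
have [mf [M fM]] := bf.
pose D : set (R * R) := [set: R] `*` @torus R.
have mD : measurable D by exact: measurableX.
pose F := (fun p : R * R => (hk s p.1 p.2 * f p.2)%:E) \_ D.
have mF : measurable_fun setT F.
  apply/(measurable_restrictT _ mD).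
  apply/measurable_EFinP; apply: measurable_funM.
    by apply: measurable_fun_hk => //; apply: measurable_funTS; [exact: measurable_fst|exact: measurable_snd].
  apply: (measurable_comp (F := @torus R)) => //; last first.
    by apply: measurable_funTS; exact: measurable_snd.
  by move=> y [[a b] [_ /= tb] <-].
have F0 p : (0 <= F p)%E.
  rewrite /F patchE; case: ifPn => // /[!inE] -[_ /fM/andP[? _]].
  by rewrite lee_fin mulr_ge0//; exact: K0.
have := @measurable_fun_fubini_tonelli_F _ _ (measurableTypeR R) (measurableTypeR R) R mu F mF F0.
apply: eq_measurable_fun => x _; rewrite /fubini_F /= hSE//.
rewrite [RHS]integral_mkcond; apply: eq_integral => y _.
by rewrite /F !patchE /D in_setX/= in_setT.
Qed.

Lemma nnbounded_hS s (f : R -> R) : 0 < s -> nnbounded f ->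
  nnbounded (hS s f).
Proof.
move=> s0 bf; split.
  by apply: measurable_funTS; exact: measurable_hS.
have [_ [M fM]] := bf; exists M => y _; rewrite hS_ge0//=.
by apply: hS_ub => // z /fM/andP[].
Qed.

Lemma hS_comp s r (f : R -> R) x : 0 < s -> 0 < r -> nnbounded f ->
  hS s (hS r f) x = hS (s + r) f x.
Proof.
move=> s0 r0 bf; have [mf [M fM]] := bf; apply: EFin_inj.
have sr0 : 0 < s + r by pos.
rewrite [RHS]hSE// [LHS]hSE//; last exact: nnbounded_hS.
transitivity (\int[mu]_(y in @torus R) \int[mu]_(z in @torus R)
    (hk s x y * hk r y z * f z)%:E)%E.
  apply: eq_integral => y _; rewrite EFinM hSE// -ge0_integralZl_EFin//.
  - by apply: eq_integral => z _; rewrite -EFinM mulrA.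
  - by move=> z /fM/andP[? _]; rewrite lee_fin mulr_ge0// K0.
  - exact: measurable_hk_mul.
  - exact: K0.
rewrite (@ge0_fubini_tonelli _ _ (measurableTypeR R) (measurableTypeR R) mu mu _ _ (fun p => (hk s x p.1 * hk r p.1 p.2 * f p.2)%:E))//=; last first.
- by move=> [y z] [_ /= /fM/andP[? _]]; rewrite lee_fin !mulr_ge0// K0.
- have mTT : measurable (@torus R `*` @torus R) by exact: measurableX.
  apply/measurable_EFinP; apply: measurable_funM; first apply: measurable_funM.
  + by apply: measurable_fun_hk => //; apply: measurable_funTS; exact: measurable_fst.
  + by apply: measurable_fun_hk => //; apply: measurable_funTS; [exact: measurable_fst|exact: measurable_snd].
  + apply: (measurable_comp (F := @torus R)) => //; last first.
      by apply: measurable_funTS; exact: measurable_snd.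
    by move=> y [[a b] [_ /= tb] <-].
apply: eq_integral => z /[!inE] /fM/andP[fz _].
rewrite EFinM -hk_semigroup// muleC -ge0_integralZl_EFin//.
- by apply: eq_integral => y _; rewrite -EFinM mulrC.
- by move=> y _; rewrite lee_fin mulr_ge0// K0.
- apply/measurable_EFinP; apply: measurable_funM; first by apply: measurable_funTS; exact: measurable_hk.
  apply: measurable_funTS; have := measurable_hk z r0.
  by under eq_fun do rewrite hkC.
Qed.

Lemma integral_sqrtV_le (a b : R) : 0 <= a -> a <= b ->
  (\int[mu]_(y in `]a, b[) ((Num.sqrt y)^-1)%:E <= (2 * Num.sqrt (b - a))%:E)%E.
Proof.
rewrite [a <= b]le_eqVlt => a0 /predU1P[<-|ab].
  by rewrite set_itv_ge ?bnd_simp ?ltxx// integral_set0 lee_fin; pos.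
(* The integrand may blow up at [a = 0], so the primitive is used on [[e i, b]] with [e i]
   decreasing to [a]; the shift [i.+2] keeps [e i < b]. *)
pose e (i : nat) : R := a + (b - a) / i.+2%:R.
have ba0 : 0 < b - a by rewrite subr_gt0.
have ea i : a < e i by rewrite /e ltrDl divr_gt0.
have eb i : e i < b.
  rewrite /e -ltrBrDl ltr_pdivrMr// ltr_pMr//.
  by rewrite ltr1n.
have half i : (\int[mu]_(y in `[e i, b]) ((Num.sqrt y)^-1)%:E <= (2 * Num.sqrt (b - a))%:E)%E.
  have ei0 : 0 < e i by exact: le_lt_trans (ea i).
  have sq0 y : y \in `[e i, b] -> 0 < y by rewrite in_itv/= => /andP[h _]; exact: lt_le_trans h.
  have cf : {within `[e i, b], continuous (fun y : R => (Num.sqrt y)^-1)}.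
    apply: continuous_in_subspaceT => y; rewrite inE/= => yab.
    apply: cvgV; first by rewrite gt_eqF// sqrtr_gt0 sq0.
    exact: sqrt_continuous.
  rewrite (@continuous_FTC2 R (fun y => (Num.sqrt y)^-1) (fun y => 2 * Num.sqrt y))//.
  - rewrite -EFinB lee_fin -mulrBr ler_pM2l//.
    rewrite -(@ler_pXn2r _ 2%N)// ?nnegrE; last 2 first.
    + by rewrite subr_ge0 ler_sqrt ?ltW//; exact: lt_trans (eb i).
    + by pos.
    rewrite sqr_sqrtr ?ltW//; have h1 := sqr_sqrtr (ltW ei0).
    have h2 := sqr_sqrtr (ltW (lt_trans ei0 (eb i))).
    have h3 : 0 <= Num.sqrt (e i) by pos.
    have h4 : Num.sqrt (e i) <= Num.sqrt b by rewrite ler_sqrt ?ltW//; exact: lt_trans (eb i).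
    have h5 := ea i; rewrite sqrrB h1 h2 mulr2n; nra.
  - split.
    + move=> y /subset_itv_oo_cc/sq0 y0.
      by apply: derivableM => //; apply: ex_derive; exact: is_derive1_sqrt.
    + apply: cvg_at_right_filter; apply: cvgMr; exact: sqrt_continuous.
    + apply: cvg_at_left_filter; apply: cvgMr; exact: sqrt_continuous.
  - move=> y /subset_itv_oo_cc/sq0 y0; rewrite derive1E deriveM//; last first.
      by apply: ex_derive; exact: is_derive1_sqrt.
    rewrite derive_sqrt// derive_cst scaler0 addr0 /GRing.scale/= invfM mulrA divff// mul1r//.
have mf (i : nat) : measurable_fun `[e i, b] (fun y : R => ((Num.sqrt y)^-1)%:E).
  apply/measurable_EFinP; apply: measurable_funV.
    move=> y /=; rewrite in_itv/= => /andP[h _]; rewrite sqrtr_gt0.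
    by apply: lt_le_trans h; exact: le_lt_trans (ea i).
  by apply: measurable_funTS; exact: (continuous_measurable_fun (@sqrt_continuous R)).
have nd : {homo (fun i => `[e i, b]%classic) : n m / (n <= m)%N >-> (n <= m)%O}.
  move=> n m nm; apply/subsetPset => y /=; rewrite !in_itv/= => /andP[h ->]; rewrite andbT.
  apply: le_trans h; rewrite lerD2l ler_pM2l// lef_pV2 ?posrE// ler_nat//.
have := @ge0_nondecreasing_set_cvg_integral _ (measurableTypeR R) R (fun i => `[e i, b]%classic)
  (fun y : R => ((Num.sqrt y)^-1)%:E) mu nd (fun=> measurable_itv _) mf.
have -> : \bigcup_i `[e i, b]%classic = `]a, b]%classic.
  apply/seteqP; split => y /=.
    by move=> [i _ /=]; rewrite !in_itv/= => /andP[h ->]; rewrite (lt_le_trans (ea i)).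
  rewrite in_itv/= => /andP[ay yb].
  have [N hN] : exists N : nat, (b - a) / (y - a) <= N%:R.
    exists (Num.trunc ((b - a) / (y - a))).+1; apply: ltW; exact: truncnS_gt.
  exists N => //=; rewrite in_itv/= yb andbT /e -lerBrDl ler_pdivrMr//.
  rewrite mulrC -ler_pdivrMr ?subr_gt0//; apply: le_trans hN _.
  by rewrite ler_nat; exact: leq_trans (leqnSn _) (leqnSn _).
move=> /(_ _) cv; apply: (@le_trans _ _ (\int[mu]_(y in `]a, b]) ((Num.sqrt y)^-1)%:E)%E).
  apply: ge0_subset_integral => //.
  - apply/measurable_EFinP; apply: measurable_funV.
      move=> y /=; rewrite in_itv/= => /andP[h _]; rewrite sqrtr_gt0.
      exact: le_lt_trans h.
    by apply: measurable_funTS; exact: (continuous_measurable_fun (@sqrt_continuous R)).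
  - by move=> y /=; rewrite !in_itv/= => /andP[-> /ltW].
have {}cv : (\int[mu]_(x in `[e i, b]) ((Num.sqrt x)^-1)%:E)%E @[i --> \oo] -->
    (\int[mu]_(x in `]a, b]) ((Num.sqrt x)^-1)%:E)%E.
  by apply: cv => i y _; rewrite lee_fin; pos.
rewrite -(cvg_lim _ cv)//; apply: lime_le; first by apply/cvg_ex; eexists; exact: cv.
by apply: nearW => i; exact: half.
Qed.

Fact measurable_reflection (c : R) :
  @measurable_fun _ _ (measurableTypeR R) (measurableTypeR R) setT (fun y => c - y).
Proof. exact: (@measurable_realfun.measurable_funB _ _ R setT (cst c) id). Qed.

Definition reflection (c : R) : {mfun measurableTypeR R >-> measurableTypeR R} :=
  HB.pack (fun y : R => c - y)
    (@isMeasurableFun.Build _ _ (measurableTypeR R) (measurableTypeR R)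
       (fun y : R => c - y) (measurable_reflection c)).

Lemma lebesgue_measure_reflection (c : R) (A : set R) : measurable A ->
  pushforward mu (reflection c) A = mu A.
Proof.
move=> mA; apply/esym/lebesgue_measure_unique => //= _ [[a b]] _ <-.
rewrite /pushforward /=.
have -> : (fun y => c - y) @^-1` `]a, b] = `[c - b, c - a[%classic.
  by apply/seteqP; split => y /=; rewrite !in_itv/= => /andP[h1 h2]; apply/andP; split; lra.
rewrite !lebesgue_measure_itv/= !lte_fin ltrD2l ltrN2 -!EFinD.
by case: ifP => // _; congr EFin; ring.
Qed.

Lemma ge0_integral_reflection (c : R) (D : set R) (f : R -> \bar R) :
  measurable D -> measurable_fun D f -> (forall y, D y -> 0 <= f y)%E ->
  (\int[mu]_(y in [set y | D (c - y)%R]) f (c - y)%R = \int[mu]_(y in D) f y)%E.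
Proof.
move=> mD mf f0.
rewrite -[RHS](@eq_measure_integral _ (measurableTypeR R) R D _ (pushforward mu (reflection c))); last first.
  by move=> A mA _; exact: lebesgue_measure_reflection.
rewrite ge0_integral_pushforward//.
by move=> y; rewrite inE; exact: f0.
Qed.

(** Up to a constant, the bound on the density [qk] at time [r]. Its singularities at both ends of
    []0, s[] are integrable, so the square integral of a density over a time interval of length [h]
    is of order [sqrt h]. *)
Definition kprof (s r : R) : R := (Num.sqrt (s - r))^-1 + (Num.sqrt r)^-1.

Let msqrt := continuous_measurable_fun (@sqrt_continuous R).

Lemma kprof_ge0 s r : 0 <= kprof s r. Proof. by rewrite /kprof; pos. Qed.

Lemma measurable_kprof (a b s : R) : 0 <= a -> b <= s ->
  measurable_fun `]a, b[ (kprof s).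
Proof.
move=> a0 bs; apply: measurable_realfun.measurable_funD.
  apply: measurable_funV => [r|].
    by rewrite /= in_itv/= sqrtr_gt0 subr_gt0 => /andP[_ /lt_le_trans]; apply.
  by apply: (measurableT_comp msqrt); apply: measurable_funB => //; exact: measurable_id.
apply: measurable_funV => [r|].
  by rewrite /= in_itv/= sqrtr_gt0 => /andP[/(le_lt_trans a0)].
by apply: measurable_funTS.
Qed.

Lemma integral_kprof_le (a b s : R) : 0 <= a -> a <= b -> b <= s ->
  (\int[mu]_(r in `]a, b[) (kprof s r)%:E <= (4 * Num.sqrt (b - a))%:E)%E.
Proof.
move=> a0 ab bs; rewrite /kprof.
have m1 : measurable_fun `]a, b[ (fun r : R => ((Num.sqrt r)^-1)%:E).
  apply/measurable_EFinP; apply: measurable_funV => [r|].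
    by rewrite /= in_itv/= sqrtr_gt0 => /andP[/(le_lt_trans a0)].
  by apply: measurable_funTS.
have m2 : measurable_fun `]s - b, s - a[ (fun r : R => ((Num.sqrt r)^-1)%:E).
  apply/measurable_EFinP; apply: measurable_funV => [r|].
    rewrite /= in_itv/= sqrtr_gt0 => /andP[h _]; apply: le_lt_trans h.
    by rewrite subr_ge0.
  by apply: measurable_funTS.
have e1 : (\int[mu]_(r in `]a, b[) ((Num.sqrt (s - r))^-1)%:E <= (2 * Num.sqrt (b - a))%:E)%E.
  have := @integral_sqrtV_le (s - b) (s - a); rewrite subr_ge0 lerD2l lerN2.
  move=> /(_ bs ab); rewrite (_ : s - a - (s - b) = b - a); last by ring.
  apply: le_trans; rewrite -(ge0_integral_reflection s _ m2)//.
  rewrite le_eqVlt; apply/orP; left; apply/eqP; congr (integral _ _ _).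
  apply/seteqP; split => r /=; rewrite !in_itv/= => /andP[h1 h2]; apply/andP; split; lra.
rewrite (_ : 4 * Num.sqrt (b - a) = 2 * Num.sqrt (b - a) + 2 * Num.sqrt (b - a)); last by ring.
under eq_integral do rewrite EFinD.
rewrite ge0_integralD//.
- by rewrite EFinD; apply: leeD => //; exact: integral_sqrtV_le.
- apply/measurable_EFinP; apply: measurable_funV => [r|].
    by rewrite /= in_itv/= sqrtr_gt0 subr_gt0 => /andP[_ /lt_le_trans]; apply.
  by apply: (measurableT_comp msqrt); apply: measurable_funB => //; exact: measurable_id.
Qed.

(** The integral of a nonnegative function is a supremum over the simple functions below it, so
    monotonicity extends to non-measurable functions. *)
Lemma ge0_integral_mono d (T : measurableType d) (m : {measure set T -> \bar R})
    (D : set T) (f g : T -> \bar R) :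
  (forall w, D w -> 0 <= f w)%E -> (forall w, D w -> f w <= g w)%E ->
  (\int[m]_(w in D) f w <= \int[m]_(w in D) g w)%E.
Proof.
move=> f0 fg; rewrite !ge0_integralE//; last first.
  by move=> w Dw; apply: le_trans (f0 w Dw) (fg w Dw).
apply: le_ereal_sup => _ [h hf <-]; exists h => // w; apply: le_trans (hf w) _.
by rewrite !patchE; case: ifPn => // /[!inE] /fg.
Qed.

(** This is [hk_mul_le] integrated against [f]; divided by [hS s f x] it bounds [qk] with a constant
    that does not see [f]. *)
Lemma hS_mul_le : exists2 C : R, 0 < C & forall s r x y (f : R -> R), nnbounded f ->
  0 < r -> r < s -> s <= 1 ->
  hk (s - r) x y * hS r f y <= C * kprof s r * hS s f x.
Proof.
have [C C0 h] := hk_mul_le R; exists C => // s r x y f bf r0 rs s1.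
have sr0 : 0 < s - r by rewrite subr_gt0.
have s0 : 0 < s by exact: lt_trans rs.
have k0 : 0 < kprof s r by rewrite /kprof; pos.
have B0 : 0 < C * kprof s r by rewrite mulr_gt0.
have kk : 0 <= hk (s - r) x y by exact: K0.
rewrite mulrC -ler_pdivrMl// mulrA mulrC mulrA.
apply: hS_le => //; first by pos.
move=> z Tz; have [mf [M fM]] := bf; have /andP[fz _] := fM z Tz.
apply: ler_wpM2r => //; rewrite mulrAC ler_pdivrMr// [leRHS]mulrC.
have := h (s - r) r x y z sr0 _ r0; rewrite subrK; apply.
by apply: le_trans s1; rewrite gerBl ltW.
Qed.

Lemma hS_gt0 s x (f : R -> R) (c : R) : 0 < s -> nnbounded f -> 0 < c ->
  (forall y, torus y -> c <= f y) -> 0 < hS s f x.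
Proof. by move=> s0 bf c0 cf; have := ltW c0 => c0'; apply: (lt_le_trans c0); exact: hS_lb. Qed.

Lemma hS_osc : exists2 C : R, 0 < C & forall t x x' (f : R -> R), nnbounded f ->
  0 < t -> t <= 1 -> hS t f x <= C * expR (t^-1) * hS t f x'.
Proof.
have [C C0 h] := hk_osc R; exists C => // t x x' f bf t0 t1.
have B0 : 0 < C * expR (t^-1) by pos.
rewrite -ler_pdivrMl//; apply: hS_le => //; first by pos.
move=> z Tz; have [mf [M fM]] := bf; have /andP[fz _] := fM z Tz.
by apply: ler_wpM2r => //; rewrite ler_pdivrMl// h.
Qed.

Lemma hS_lip (tau : R) : exists2 C : R, 0 < C & forall t t' x x' (f : R -> R) (m del : R),
  nnbounded f -> 0 < m -> m <= 1 -> m <= t -> t <= tau -> m <= t' ->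
  `|t - t'| <= del -> `|x - x'| <= del -> del <= 2 ->
  (1 - C * del / m ^+ 2) * hS t f x <= hS t' f x'.
Proof.
have [C C0 h] := hk_lip tau; exists C => // t t' x x' f m del bf m0 m1 mt tt mt' ht hx d2.
have t0 : 0 < t by exact: lt_le_trans mt.
have t'0 : 0 < t' by exact: lt_le_trans mt'.
have [neg|/ltW pos0] := leP (1 - C * del / m ^+ 2) 0.
  apply: le_trans (_ : 0 <= _); last exact: hS_ge0.
  by rewrite mulr_le0_ge0// hS_ge0.
apply: hS_le => // z Tz; have [mf [M fM]] := bf; have /andP[fz _] := fM z Tz.
by apply: ler_wpM2r => //; exact: h.
Qed.

Lemma periodic2_int (f : R -> R) y (k : int) : periodic2 f -> f (y + 2 * k%:~R) = f y.
Proof.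
move=> pf; have pn (n : nat) z : f (z + 2 * n%:R) = f z.
  elim: n z => [|n ih] z; first by rewrite mulr0 addr0.
  by rewrite -(natr1 n) mulrDr mulr1 addrA pf ih.
case: k => n; first exact: pn.
by rewrite NegzE intrN -[LHS](pn n.+1); congr f; rewrite -pmulrn; ring.
Qed.

(** Where [f] may fall below [c], all images of the point are at distance at least [eta] from [x],
    and there the kernel at time [s] is at most [sqrt 2 * expR (- eta^2 / (8 s))] times the kernel
    at time [2 s], whose mass is 1. This controls [hS] as time tends to 0. *)
Lemma hS_near (s x eta c : R) (f : R -> R) : 0 < s -> 0 < eta -> nnbounded f ->
  periodic2 f -> 0 <= c -> (forall y, `|y - x| < eta -> c <= f y) ->
  c * (1 - Num.sqrt 2 * expR (- eta ^+ 2 / (8 * s))) <= hS s f x.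
Proof.
move=> s0 eta0 bf pf c0 cf; have [mf [M fM]] := bf.
have s20 : 0 < 2 * s by pos.
set E := expR _.
have pfk y (k : int) : f (y + 2 * k%:~R) = f y by exact: periodic2_int.
have key y : torus y -> c * hk s x y <= hk s x y * f y + c * (Num.sqrt 2 * E) * hk (2 * s) x y.
  move=> Ty; have /andP[fy _] := fM y Ty.
  have [[n xn]|no] := pselect (exists n : int, `|x - y + 2 * n%:~R| < eta).
    have cy : c <= f y.
      rewrite -(pfk y (- n)); apply: cf; rewrite distrC; move: xn.
      by rewrite intrN; congr (`|_| < _); ring.
    rewrite mulrC; apply: ler_wpDr; first by rewrite !mulr_ge0// ?K0//; pos.
    by apply: ler_wpM2l => //; exact: K0.
  apply: ler_wpDl; first by rewrite mulr_ge0// K0.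
  rewrite -mulrA; apply: ler_wpM2l => //; rewrite !hkE.
  have thE2 : th s (x - y) <= E * th (2 * s) (x - y).
    rewrite -lee_fin EFinM !thE// /theta -esum_intZl; last 2 first.
    - by pos.
    - by move=> n; rewrite lee_fin; pos.
    apply: le_esum => n _; rewrite -EFinM lee_fin /gterm /E -expRD ler_expR.
    have bn : eta ^+ 2 <= (x - y + 2 * n%:~R) ^+ 2.
      rewrite -[leRHS]real_normK ?num_real// ler_pXn2r ?nnegrE ?(ltW eta0)//.
      by rewrite leNgt; apply/negP => lt; apply: no; exists n.
    set b := (x - y + 2 * n%:~R) ^+ 2 in bn *.
    rewrite -subr_ge0 [leRHS](_ : _ = (b - eta ^+ 2) / (8 * s)); last by field; rewrite gt_eqF.
    by apply: divr_ge0; [rewrite subr_ge0|pos].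
  have -> : Num.sqrt (4 * pi * (2 * s)) = Num.sqrt 2 * Num.sqrt (4 * pi * s).
    by rewrite -sqrtrM//; congr Num.sqrt; ring.
  have q0 : 0 < Num.sqrt (4 * pi * s) by pos.
  rewrite [leRHS](_ : _ = (Num.sqrt (4 * pi * s))^-1 * (E * th (2 * s) (x - y))); last first.
    by field; rewrite !gt_eqF.
  by apply: ler_wpM2l => //; pos.
rewrite mulrBr mulr1 lerBlDr -lee_fin.
have mK t : 0 < t -> measurable_fun (@torus R) (fun y => (hk t x y)%:E).
  by move=> t0; apply/measurable_EFinP/measurable_funTS; exact: measurable_hk.
have iK (a t : R) : 0 <= a -> 0 < t ->
    (\int[mu]_(y in @torus R) (a%:E * (hk t x y)%:E) = a%:E)%E.
  move=> a0 t0; rewrite ge0_integralZl_EFin//; [|by move=> y _; rewrite lee_fin K0|exact: mK].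
  by rewrite integral_hk// mule1.
rewrite -(iK _ _ c0 s0) EFinD hSE// -[X in (_ + X)%E](iK _ (2 * s))//; last first.
  by rewrite mulr_ge0//; pos.
rewrite -ge0_integralD//; last 4 first.
- by move=> y /fM/andP[? _]; rewrite lee_fin mulr_ge0// K0.
- exact: measurable_hk_mul.
- by move=> y _; rewrite -EFinM lee_fin !mulr_ge0// ?K0//; pos.
- by apply: emeasurable_funM => //; exact: mK.
apply: ge0_integral_mono => y Ty; first by rewrite -EFinM lee_fin mulr_ge0// K0.
by rewrite -!EFinM -EFinD lee_fin; exact: key.
Qed.

(** A Doob transform of the heat kernel, run backwards from [x] at time [s], with the positive
    solution [hS r f] as weight. The semigroup property normalises it. *)
Definition qk (f : R -> R) s x r y : R := hk (s - r) x y * hS r f y / hS s f x.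

Section increments.
Variables (f : R -> R) (c : R).
Hypotheses (bf : nnbounded f) (c0 : 0 < c) (cf : forall y, torus y -> c <= f y).

Let S0 s x : 0 < s -> 0 < hS s f x. Proof. by move=> s0; exact: hS_gt0 cf. Qed.

Lemma qk_ge0 s x r y : 0 < r -> r < s -> 0 <= qk f s x r y.
Proof.
move=> r0 rs; rewrite /qk !mulr_ge0 ?K0 ?subr_gt0 ?hS_ge0 ?invr_ge0//.
by rewrite hS_ge0// (lt_trans r0).
Qed.

Lemma integral_qk s x r : 0 < r -> r < s ->
  (\int[mu]_(y in @torus R) (qk f s x r y)%:E = 1)%E.
Proof.
move=> r0 rs; have sr0 : 0 < s - r by rewrite subr_gt0.
have s0 : 0 < s by exact: lt_trans rs.
under eq_integral do rewrite /qk mulrC EFinM.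
rewrite ge0_integralZl_EFin//.
- rewrite -hSE//; last exact: nnbounded_hS.
  by rewrite hS_comp// subrK -EFinM mulVf// gt_eqF// S0.
- by move=> y _; rewrite lee_fin mulr_ge0 ?K0 ?hS_ge0.
- apply: measurable_hk_mul => //; by have [] := nnbounded_hS r0 bf.
- by rewrite invr_ge0 hS_ge0.
Qed.

Lemma measurable_qk s x r : 0 < r -> r < s ->
  measurable_fun (@torus R) (fun y => (qk f s x r y)%:E).
Proof.
move=> r0 rs; apply/measurable_EFinP; apply: measurable_funM => //.
by apply/measurable_EFinP; apply: measurable_hk_mul; [rewrite subr_gt0|have [] := nnbounded_hS r0 bf].
Qed.

End increments.

Section increment.
Variables (f : R -> R) (c : R).
Hypotheses (bf : nnbounded f) (c0 : 0 < c) (cf : forall y, torus y -> c <= f y).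

Let S0 s x : 0 < s -> 0 < hS s f x. Proof. by move=> s0; exact: hS_gt0 cf. Qed.

(** With [q] and [q'] the two densities, [(q - q')^2 <= B |q - q'| <= B m (q + q')], and both have
    mass 1. *)
Lemma integral_qk_sq_le (B m s s' x x' r : R) : 0 < r -> r < s' -> s' <= s ->
  (forall y, qk f s x r y <= B) -> (forall y, qk f s' x' r y <= B) ->
  0 <= B -> 0 <= m ->
  (forall y, `|qk f s x r y - qk f s' x' r y| <= m * (qk f s x r y + qk f s' x' r y)) ->
  (\int[mu]_(y in @torus R) ((qk f s x r y - qk f s' x' r y) ^+ 2)%:E <=
   (2 * B * m)%:E)%E.
Proof.
move=> r0 rs' s's qB q'B B0 m0 h.
have rs : r < s by exact: lt_le_trans s's.
have p1 y : 0 <= qk f s x r y by exact: (qk_ge0 bf).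
have p2 y : 0 <= qk f s' x' r y by exact: (qk_ge0 bf).
apply: (@le_trans _ _ (\int[mu]_(y in @torus R) ((B * m)%:E * ((qk f s x r y)%:E + (qk f s' x' r y)%:E)))%E).
  apply: ge0_integral_mono => y _; first by rewrite lee_fin sqr_ge0.
  rewrite -EFinD -EFinM lee_fin -mulrA -real_normK ?num_real// expr2.
  apply: ler_pM => //; rewrite ler_norml.
  by have := qB y; have := q'B y; have := p1 y; have := p2 y; move=> *; apply/andP; split; lra.
rewrite ge0_integralZl_EFin//; last 3 first.
- by move=> y _; rewrite -EFinD lee_fin addr_ge0.
- by apply: emeasurable_funD; exact: measurable_qk.
- by rewrite mulr_ge0.
rewrite ge0_integralD//; last 4 first.
- by move=> y _; rewrite lee_fin.
- exact: measurable_qk.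
- by move=> y _; rewrite lee_fin.
- exact: measurable_qk.
rewrite !(integral_qk bf c0 cf)// -EFinD -EFinM lee_fin.
by rewrite le_eqVlt; apply/orP; left; apply/eqP; ring.
Qed.

End increment.

(** The kernel in the numerator and the semigroup in the denominator each lose a relative error, and
    these add up. The gap [eta] keeps the kernel times [t - r] and [t' - r], hence also [t] and
    [t'], away from 0. *)
Lemma qk_lip : exists2 D : R, 0 < D & forall (f : R -> R) (c t t' z z' r y del eta : R),
  nnbounded f -> 0 < c -> (forall y, torus y -> c <= f y) ->
  0 < r -> del <= 2 -> 0 < eta -> eta <= 1 ->
  eta <= t - r -> t <= 1 -> t' <= 1 -> eta <= t' - r ->
  `|t - t'| <= del -> `|z - z'| <= del ->
  (1 - D * del / eta ^+ 2) * qk f t z r y <= qk f t' z' r y.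
Proof.
have [C2 C20 h2] := hk_lip (1 : R); have [C3 C30 h3] := hS_lip 1.
exists (C2 + C3); first by rewrite addr_gt0.
move=> f c t t' z z' r y del eta bf c0 cf r0 d2 eta0 eta1 et t1 t'1 et' tt zz.
have S0 u v : 0 < u -> 0 < hS u f v by move=> u0; exact: hS_gt0 cf.
have d0 : 0 <= del by exact: le_trans zz.
have rt : r < t by lra.
have rt' : r < t' by lra.
have t0 : 0 < t by lra.
have t'0 : 0 < t' by lra.
have q'0 := qk_ge0 bf z' y r0 rt'.
set a := C2 * del / eta ^+ 2; set b := C3 * del / eta ^+ 2.
have a0 : 0 <= a by rewrite /a; pos.
have b0 : 0 <= b by rewrite /b; pos.
have -> : (C2 + C3) * del / eta ^+ 2 = a + b by rewrite /a /b; ring.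
have [neg|pos0] := leP (1 - (a + b)) 0.
  by apply: le_trans q'0; apply: mulr_le0_ge0 => //; exact: qk_ge0.
have g1 : (1 - a) * hk (t - r) z y <= hk (t' - r) z' y.
  apply: h2 => //; first by lra.
  by rewrite (_ : t - r - (t' - r) = t - t')//; ring.
have g2 : (1 - b) * hS t' f z' <= hS t f z.
  by apply: h3 => //; [lra|lra|rewrite distrC|rewrite distrC].
have hy : 0 <= hS r f y by exact: hS_ge0.
have tr0 : 0 < t - r by lra.
rewrite /qk mulrA ler_pdivrMr ?S0// mulrAC ler_pdivlMr ?S0//.
have k1 : 0 <= hk (t - r) z y by exact: K0.
have s1 : 0 <= hS t' f z' by exact: hS_ge0.
apply: (@le_trans _ _ ((1 - a) * hk (t - r) z y * hS r f y * ((1 - b) * hS t' f z'))).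
  rewrite [leLHS](_ : _ = (1 - (a + b)) * (hk (t - r) z y * hS r f y * hS t' f z')); last by ring.
  rewrite [leRHS](_ : _ = ((1 - a) * (1 - b)) *
      (hk (t - r) z y * hS r f y * hS t' f z')); last by ring.
  apply: ler_wpM2r; first by rewrite !mulr_ge0.
  have := mulr_ge0 a0 b0; lra.
apply: ler_pM => //.
- by rewrite !mulr_ge0//; lra.
- by rewrite mulr_ge0//; lra.
- exact: ler_wpM2r.
Qed.

(** The time interval is cut at [s' - eta] and at [s']. Before [s' - eta] the densities are compared
    by [qk_lip], giving [del / eta^2]; between the cuts they are merely bounded, and the short
    interval gives [sqrt eta]; after [s'] a single density is left, on an interval of length at most
    [del], giving [sqrt del]. The parameter [eta] stays free, to be chosen at each dyadic level. *)
Lemma qk_increment : exists2 C : R, 0 < C & forall (f : R -> R) (c s s' x x' del eta : R),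
  nnbounded f -> 0 < c -> (forall y, torus y -> c <= f y) ->
  0 <= s' -> s' <= s -> s <= 1 -> s - s' <= del -> `|x - x'| <= del -> del <= 2 ->
  0 < eta -> eta <= 1 ->
  (\int[mu]_(r in `]0%R, s[) \int[mu]_(y in @torus R)
     ((qk f s x r y - if r < s' then qk f s' x' r y else 0) ^+ 2)%:E <=
   (C * (Num.sqrt eta + del / eta ^+ 2 + Num.sqrt del))%:E)%E.
Proof.
have [C1 C10 h1] := hS_mul_le; have [D D0 comp] := qk_lip.
exists (8 * C1 + 8 * C1 * D + 4 * C1); first by rewrite !addr_gt0// !mulr_gt0.
move=> f c s s' x x' del eta bf c0 cf s'0 s's s1 sdel xdel d2 eta0 eta1.
have S0 t z : 0 < t -> 0 < hS t f z by move=> t0; exact: hS_gt0 cf.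
have d0 : 0 <= del by exact: le_trans xdel.
have qB t z r y : 0 < r -> r < t -> t <= 1 -> qk f t z r y <= C1 * kprof t r.
  move=> r0 rt t1; rewrite /qk ler_pdivrMr; last by apply: S0; exact: lt_trans rt.
  exact: h1.
have kmono r : 0 < r -> r < s' -> kprof s r <= kprof s' r.
  move=> r0 rs'; rewrite /kprof lerD2r lef_pV2 ?posrE ?sqrtr_gt0 ?subr_gt0//.
    by rewrite ler_sqrt ?lerD2r// subr_ge0 ltW// (lt_le_trans rs').
  exact: lt_le_trans s's.
pose a := Num.max 0 (s' - eta).
have a0 : 0 <= a by rewrite le_max lexx.
have as' : a <= s' by rewrite ge_max s'0 gerBl ltW.
have bnd1 r : 0 < r -> r < s' ->
  (\int[mu]_(y in @torus R) ((qk f s x r y - qk f s' x' r y) ^+ 2)%:E <=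
     (2 * C1 * kprof s' r)%:E)%E.
  move=> r0 rs'; have rs : r < s by exact: lt_le_trans s's.
  rewrite -(mulrA 2) -(mulr1 (2 * _)); apply: (integral_qk_sq_le bf c0 cf) => //.
  - move=> y; apply: le_trans (qB _ _ _ _ r0 rs s1) _.
    by rewrite ler_pM2l// kmono.
  - by move=> y; apply: qB => //; exact: le_trans s1.
  - by rewrite mulr_ge0 ?kprof_ge0// ltW.
  - move=> y; rewrite mul1r; have p1 := qk_ge0 bf x y r0 rs.
    have p2 := qk_ge0 bf x' y r0 rs'.
    by rewrite ler_norml; apply/andP; split; lra.
have bnd2 r : 0 < r -> r <= s' - eta ->
  (\int[mu]_(y in @torus R) ((qk f s x r y - qk f s' x' r y) ^+ 2)%:E <=
     (2 * C1 * D * del / eta ^+ 2 * kprof s' r)%:E)%E.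
  move=> r0 rs'e; have rs' : r < s' by apply: le_lt_trans rs'e _; rewrite ltrBlDr ltrDl.
  have rs : r < s by exact: lt_le_trans s's.
  have -> : 2 * C1 * D * del / eta ^+ 2 * kprof s' r =
    2 * (C1 * kprof s' r) * (D * del / eta ^+ 2) by ring.
  apply: (integral_qk_sq_le bf c0 cf) => //.
  - move=> y; apply: le_trans (qB _ _ _ _ r0 rs s1) _.
    by rewrite ler_pM2l// kmono.
  - by move=> y; apply: qB => //; exact: le_trans s1.
  - by rewrite mulr_ge0 ?kprof_ge0// ltW.
  - by pos.
  - move=> y; have p1 := qk_ge0 bf x y r0 rs.
    have p2 := qk_ge0 bf x' y r0 rs'.
    set E := D * del / eta ^+ 2.
    have ns : `|s - s'| <= del by rewrite ger0_norm// subr_ge0.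
    have s'1 := le_trans s's s1.
    have c1 := comp f c s s' x x' r y del eta bf c0 cf r0 d2 eta0 eta1 _ s1 s'1 _ ns xdel.
    have c2 := comp f c s' s x' x r y del eta bf c0 cf r0 d2 eta0 eta1 _ s'1 s1 _ _ _.
    have {}c1 : (1 - E) * qk f s x r y <= qk f s' x' r y by apply: c1; lra.
    have {}c2 : (1 - E) * qk f s' x' r y <= qk f s x r y.
      by apply: c2; rewrite 1?distrC//; lra.
    have E0 : 0 <= E by rewrite /E; pos.
    by rewrite ler_norml; apply/andP; split; nra.
have bnd3 r : 0 < r -> s' <= r -> r < s ->
  (\int[mu]_(y in @torus R) ((qk f s x r y - 0) ^+ 2)%:E <= (C1 * kprof s r)%:E)%E.
  move=> r0 s'r rs; have p1 y := qk_ge0 bf x y r0 rs.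
  apply: (@le_trans _ _ (\int[mu]_(y in @torus R) ((C1 * kprof s r)%:E * (qk f s x r y)%:E))%E).
    apply: ge0_integral_mono => y _; first by rewrite lee_fin sqr_ge0.
    by rewrite subr0 -EFinM lee_fin expr2; apply: ler_wpM2r => //; exact: qB.
  rewrite ge0_integralZl_EFin//.
  - by rewrite (integral_qk bf c0 cf)// mule1.
  - by move=> y _; rewrite lee_fin.
  - exact: measurable_qk.
  - by rewrite mulr_ge0 ?kprof_ge0// ltW.
pose K t u v : R -> \bar R := (fun r : R => (kprof t r)%:E) \_ `]u, v[.
have K_ge0 t u v r : (0 <= K t u v r)%E.
  by rewrite /K patchE; case: ifPn => // _; rewrite lee_fin kprof_ge0.
have mK t u v : 0 <= u -> v <= t -> measurable_fun [set: R] (K t u v).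
  move=> u0 vt; apply/(measurable_restrictT _ (measurable_itv `]u, v[)).
  by apply/measurable_EFinP; exact: measurable_kprof.
have intK (e t u v : R) : 0 <= e -> 0 <= u -> u <= v -> v <= t ->
    (\int[mu]_r (e%:E * K t u v r) <= (e * (4 * Num.sqrt (v - u)))%:E)%E.
  move=> e0 u0 uv vt; rewrite ge0_integralZl_EFin//; last exact: mK.
  rewrite EFinM; apply: lee_wpmul2l; first by rewrite lee_fin.
  rewrite /K -integral_mkcond; exact: integral_kprof_le.
(* The open intervals of [K] leave out the point [s']; the value [+oo] there covers it at no cost,
   the point being null. *)
pose Z : R -> \bar R := (cst +oo%E) \_ [set s'].
have Z0 r : (0 <= Z r)%E by rewrite /Z patchE; case: ifPn => _ /=; rewrite ?leey.
have mZ : measurable_fun [set: R] Z.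
  by apply/(measurable_restrictT _ (measurable_set1 s')); exact: measurable_cst.
pose A1 := 2 * C1; pose A2 := 2 * C1 * D * del / eta ^+ 2.
have A10 : 0 <= A1 by rewrite /A1; pos.
have A20 : 0 <= A2 by rewrite /A2; pos.
have C1p : 0 <= C1 by exact: ltW.
have EK e t u v r : 0 <= e -> (0 <= e%:E * K t u v r)%E.
  by move=> e0; rewrite mule_ge0 ?lee_fin.
have mEK e t u v : 0 <= u -> v <= t -> measurable_fun [set: R] (fun r => e%:E * K t u v r)%E.
  by move=> u0 vt; apply: emeasurable_funM => //; exact: mK.
pose H (r : R) : \bar R := (A1%:E * K s' a s' r + A2%:E * K s' 0%R s' r
   + C1%:E * K s s' s r + Z r)%E.
apply: (@le_trans _ _ (\int[mu]_r H r)%E).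
  rewrite integral_mkcond; apply: ge0_integral_mono => r _.
    by rewrite patchE; case: ifPn => // _; apply: integral_ge0 => y _; rewrite lee_fin sqr_ge0.
  rewrite patchE /H; case: ifPn => [|_]; last by rewrite !adde_ge0// EK.
  rewrite inE/= in_itv/= => /andP[r0 rs].
  have [rs'|] := ltP r s'.
    have [re|re] := leP r (s' - eta).
      apply: le_trans (bnd2 r r0 re) _.
      rewrite (_ : _%:E = (A2%:E * K s' 0%R s' r)%E); last first.
        by rewrite /K patchE mem_set /= ?in_itv/= ?r0// -EFinM.
      by rewrite -addeA -addeA addeCA leeDl// !adde_ge0// EK.
    apply: le_trans (bnd1 r r0 rs') _.
    rewrite (_ : _%:E = (A1%:E * K s' a s' r)%E); last first.
      by rewrite /K patchE mem_set /= ?in_itv/= ?rs' ?andbT ?gt_max ?r0// -EFinM.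
    by rewrite -!addeA leeDl// !adde_ge0// EK.
  rewrite le_eqVlt => /predU1P[<-|s'r].
    rewrite [X in (_ <= _ + X)%E](_ : Z s' = +oo%E); last by rewrite /Z patchE mem_set.
    rewrite addey; first by rewrite leey.
    by rewrite gt_eqF// (@lt_le_trans _ _ 0%E)// !adde_ge0// EK.
  apply: le_trans (bnd3 r r0 (ltW s'r) rs) _.
  rewrite (_ : _%:E = (C1%:E * K s s' s r)%E); last first.
    by rewrite /K patchE mem_set /= ?in_itv/= ?s'r ?rs// -EFinM.
  by rewrite addeAC leeDr// !adde_ge0// EK.
have iZ : (\int[mu]_r Z r = 0)%E by rewrite /Z -integral_mkcond integral_set1.
rewrite /H ge0_integralD//; last 2 first.
- by move=> r _; rewrite !adde_ge0// EK.
- by apply: emeasurable_funD; [apply: emeasurable_funD|]; apply: mEK.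
rewrite iZ adde0 ge0_integralD//; last 4 first.
- by move=> r _; rewrite !adde_ge0// EK.
- by apply: emeasurable_funD; apply: mEK.
- by move=> r _; rewrite EK.
- by apply: mEK.
rewrite ge0_integralD//; last 4 first.
- by move=> r _; rewrite EK.
- by apply: mEK.
- by move=> r _; rewrite EK.
- by apply: mEK.
apply: le_trans (leeD (leeD (intK _ _ _ _ A10 a0 as' (lexx _)) (intK _ _ _ _ A20 (lexx _) s'0 (lexx _)))
  (intK _ _ _ _ C1p s'0 s's (lexx _))) _.
rewrite -!EFinD lee_fin subr0.
have q1 : Num.sqrt (s' - a) <= Num.sqrt eta.
  by rewrite ler_sqrt ?(ltW eta0)// lerBlDr -lerBlDl le_max lexx orbT.
have q2 : Num.sqrt s' <= 1 by rewrite -sqrtr1 ler_sqrt//; exact: le_trans s1.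
have q3 : Num.sqrt (s - s') <= Num.sqrt del by rewrite ler_sqrt.
have w1 := ler_wpM2l A10 q1; have w2 := ler_wpM2l A20 q2; have w3 := ler_wpM2l C1p q3.
rewrite mulr1 in w2; have B0 : 0 <= del / eta ^+ 2 by pos.
have eA1 : A1 = 2 * C1 by []; have eA2 : A2 = 2 * C1 * D * (del / eta ^+ 2) by rewrite /A2; ring.
have v1 : 0 <= Num.sqrt eta by pos. 
have v3 : 0 <= Num.sqrt del by pos. 
have u1 : 0 <= C1 * D by rewrite mulr_ge0 ?ltW//.
have P1 : 0 <= C1 * D * Num.sqrt eta by rewrite mulr_ge0.
have P2 : 0 <= C1 * D * Num.sqrt del by rewrite mulr_ge0.
have P3 : 0 <= C1 * (del / eta ^+ 2) by rewrite mulr_ge0.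
have P4 : 0 <= C1 * Num.sqrt eta by rewrite mulr_ge0.
have P5 : 0 <= C1 * Num.sqrt del by rewrite mulr_ge0.
rewrite eA1 in w1; rewrite eA2 in w2; rewrite eA1 eA2.
move: w1 w2 w3 P1 P2 P3 P4 P5 B0.
move: (Num.sqrt eta) (Num.sqrt del) (del / eta ^+ 2) (Num.sqrt (s' - a)) (Num.sqrt s') (Num.sqrt (s - s')).
clear => e1 e2 e3 e4 e5 e6 *; lra.
Qed.

End heat_semigroup.

(** * Gaussian linear forms of the noise *)

Section density.
Context d (T : measurableType d) (R : realType).
Variables (mu nu : {measure set T -> \bar R}) (p : T -> R).
Hypotheses (mp : measurable_fun setT p) (p0 : forall x, 0 <= p x)
  (nuE : forall A, measurable A -> nu A = (\int[mu]_(x in A) (p x)%:E)%E).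

Let nu_indic (A : set T) : measurable A ->
  (\int[nu]_x (\1_A x)%:E = \int[mu]_x ((\1_A x)%:E * (p x)%:E))%E.
Proof.
move=> mA; rewrite integral_indic// setIT nuE// integral_mkcond.
by apply: eq_integral => x _; rewrite patchE indicE; case: (x \in A); rewrite ?mul1e ?mul0e.
Qed.

Import HBNNSimple.

Let nu_nnsfun (h : {nnsfun T >-> R}) :
  (\int[nu]_x (h x)%:E = \int[mu]_x ((h x)%:E * (p x)%:E))%E.
Proof.
under [LHS]eq_integral do rewrite fimfunE -fsumEFin//.
rewrite [LHS]ge0_integral_fsum//; last 2 first.
- by move=> r; exact/measurable_EFinP/measurableT_comp.
- by move=> n x _; rewrite EFinM nnfun_muleindic_ge0.
under [RHS]eq_integral.
  move=> x xD; rewrite fimfunE -fsumEFin// muleC ge0_mule_fsumr; last first.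
    by move=> r; rewrite EFinM nnfun_muleindic_ge0.
  over.
rewrite [RHS]ge0_integral_fsum//; last 2 first.
- move=> r; apply: emeasurable_funM; first exact/measurable_EFinP.
  by apply/measurable_EFinP; do 2 apply/measurableT_comp => //.
- move=> n x _; apply: mule_ge0; first by rewrite lee_fin.
  by rewrite EFinM nnfun_muleindic_ge0.
apply: eq_fsbigr => r _; rewrite integralZl_indic_nnsfun// nu_indic//.
have [r0|r0] := leP 0 r.
  rewrite -ge0_integralZl_EFin//.
  - by apply: eq_integral => x _; rewrite -!EFinM; congr EFin; ring.
  - by move=> x _; rewrite mule_ge0// lee_fin.
  - apply: emeasurable_funM; last exact/measurable_EFinP.
    exact/measurable_EFinP/measurable_indic.
have -> : h @^-1` [set r] = set0.
  apply/seteqP; split => // x /= hx; have : 0 <= h x by [].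
  by rewrite hx leNgt r0.
rewrite indic0 (_ : (fun _ => _) = cst 0%E); last by apply/funext => x /=; rewrite mul0e.
rewrite integral0 mule0; apply/esym/integral0_eq => x _.
by rewrite mulr0 mule0.
Qed.

Lemma integral_density (f : T -> \bar R) : measurable_fun setT f ->
  (forall x, 0 <= f x)%E -> (\int[nu]_x f x = \int[mu]_x (f x * (p x)%:E))%E.
Proof.
move=> mf f0; pose f_ := nnsfun_approx measurableT mf.
have cvf x : (EFin \o f_ ^~ x) @ \oo --> f x by exact: cvg_nnsfun_approx.
transitivity (lim (\int[nu]_x (f_ n x)%:E @[n --> \oo])%E).
  rewrite -monotone_convergence//=.
  - by apply: eq_integral => x _; apply/esym/cvg_lim => //; exact: cvf.
  - by move=> n; exact/measurable_EFinP/measurable_funTS.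
  - by move=> n x _; rewrite lee_fin.
  - by move=> x _ m n mn; rewrite lee_fin; exact/lefP/nd_nnsfun_approx.
rewrite [RHS](_ : _ = lim (\int[mu]_x ((f_ n x)%:E * (p x)%:E) @[n --> \oo])%E).
  by apply: congr_lim; apply/funext => n /=; exact: nu_nnsfun.
rewrite -monotone_convergence//=.
- apply: eq_integral => x _; apply/esym/cvg_lim => //.
  by apply: cvgeZr => //; exact: cvf.
- move=> n; apply: emeasurable_funM; last exact/measurable_EFinP.
  exact/measurable_EFinP/measurable_funTS.
- by move=> n x _; rewrite mule_ge0// lee_fin.
- move=> x _ m n mn; apply: lee_wpmul2r; first by rewrite lee_fin.
  by rewrite lee_fin; exact/lefP/nd_nnsfun_approx.
Qed.

End density.

Section gaussian.
Variable R : realType.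
Local Notation mu := (@lebesgue_measure R).

(** The heat kernel of the line, that is, the centred normal density of variance [2 t]: variance [v]
    corresponds to time [v / 2]. *)
Definition gd (t x : R) : R := (Num.sqrt (4 * pi * t))^-1 * expR (- x ^+ 2 / (4 * t)).

Lemma gd_gt0 t x : 0 < t -> 0 < gd t x. Proof. by move=> t0; rewrite /gd; pos. Qed.

Lemma continuous_gd t : continuous (gd t).
Proof.
move=> x; apply: cvgMr; apply: continuous_comp; last exact: continuous_expR.
apply: cvgMl; apply: cvgN; exact: exprn_continuous.
Qed.

Lemma measurable_gd t c : measurable_fun [set: R] (fun x => (gd t (x - c))%:E).
Proof.
apply/measurable_EFinP; apply: (measurableT_comp (continuous_measurable_fun (@continuous_gd t))).
exact: measurable_funB.
Qed.

Lemma integral_gd t c : 0 < t -> (\int[mu]_x (gd t (x - c))%:E = 1)%E.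
Proof.
move=> t0; have p0 : 0 < Num.sqrt (4 * pi * t) by pos.
under eq_integral do rewrite /gd EFinM -(opprB c) sqrrN.
rewrite ge0_integralZl_EFin//.
- by rewrite integral_gauss// -EFinM mulVf// gt_eqF.
- apply/measurable_EFinP; have := measurable_gterm t 0 c; rewrite /gterm mulr0.
  by under eq_fun do rewrite addr0.
Qed.

Lemma gd_convolution s r x : 0 < s -> 0 < r ->
  (\int[mu]_y (gd s (x - y) * gd r y)%:E = (gd (s + r) x)%:E)%E.
Proof.
move=> s0 r0; have sr0 : 0 < s + r by pos.
have rho0 : 0 < s * r / (s + r) by pos.
transitivity (\int[mu]_y ((gd (s + r) x)%:E * (gd (s * r / (s + r)) (y - r * x / (s + r)))%:E))%E.
  apply: eq_integral => y _; rewrite -EFinM; congr EFin.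
  rewrite /gd mulrACA [RHS]mulrACA -!expRD; congr (_ * expR _); last first.
    by field; rewrite !gt_eqF.
  rewrite -!invfM -!sqrtrM; try by pos.
  by congr (Num.sqrt _)^-1; field; rewrite gt_eqF.
rewrite ge0_integralZl_EFin//.
- by rewrite integral_gd// mule1.
- by move=> y _; rewrite lee_fin ltW// gd_gt0.
- exact: measurable_gd.
- by rewrite ltW// gd_gt0.
Qed.

Lemma integral_normal_scale (v : R) (h : R -> R) : 0 < v -> continuous h ->
  (forall x, 0 <= h x) ->
  (\int[normal_prob 0 1]_z (h (Num.sqrt v * z))%:E =
   \int[mu]_x (h x * gd (v / 2) x)%:E)%E.
Proof.
move=> v0 ch h0.
have sv0 : 0 < Num.sqrt v by pos.
have mh : measurable_fun setT h by exact: continuous_measurable_fun.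
rewrite (@integral_density _ (measurableTypeR R) R mu _ (normal_pdf 0 1))//; last 4 first.
- exact: measurable_normal_pdf.
- by move=> x; exact: normal_pdf_ge0.
- apply/measurable_EFinP; apply: measurableT_comp => //; exact: measurable_funM.
- by move=> x; rewrite lee_fin.
have F'E : (fun z : R => Num.sqrt v * z)^`()%classic = cst (Num.sqrt v).
  by apply/funext => z; rewrite derive1E deriveM// derive_id derive_cst scaler0 addr0 /GRing.scale/= mulr1.
rewrite (@increasing_ge0_integration_by_substitutionT R (fun z => Num.sqrt v * z) (fun x => h x * gd (v / 2) x)).
- apply: eq_integral => z _; rewrite F'E/= -EFinM; congr EFin.
  have -> : normal_pdf 0 1 z = gd (v / 2) (Num.sqrt v * z) * Num.sqrt v.
    rewrite normal_pdfE ?oner_eq0//= /normal_peak /normal_fun subr0 expr1n mul1r /gd.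
    have -> : 4 * pi * (v / 2) = v * (pi *+ 2) by rewrite -mulr_natr; field.
    rewrite sqrtrM ?(ltW v0)// exprMn (sqr_sqrtr (ltW v0)).
    have -> : - (v * z ^+ 2) / (4 * (v / 2)) = - z ^+ 2 / 2 by field; rewrite gt_eqF.
    have q0 : 0 < Num.sqrt (pi *+ 2) :> R by rewrite sqrtr_gt0 pmulrn_lgt0// pi_gt0.
    by field; rewrite !gt_eqF.
  by rewrite mulrA.
- by move=> x y xy; rewrite ltr_pM2l.
- by rewrite F'E => z; exact: cvg_cst.
- by rewrite F'E; exact: is_cvg_cst.
- by rewrite F'E; exact: is_cvg_cst.
- by move=> x; apply: derivableM.
- by apply/gt0_cvgMrNy => //; exact: cvg_id.
- by apply/gt0_cvgMry => //; exact: cvg_id.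
- by move=> x; apply: cvgM; [exact: ch|exact: continuous_gd].
- by move=> x; rewrite mulr_ge0// ltW// gd_gt0// divr_gt0.
Qed.

Section gd_trig.
Variable s : R.
Hypothesis s0 : 0 < s.

Let i0 : (\int[mu]_x (gd s x)%:E = 1)%E.
Proof.
by rewrite -(integral_gd 0 s0); apply: eq_integral => x _; rewrite subr0.
Qed.

Let cgd := @continuous_gd s.

Lemma integrable_mul_gd (k : R -> R) (M : R) : continuous k -> (forall x, `|k x| <= M) ->
  mu.-integrable setT (fun x => (k x * gd s x)%:E).
Proof.
move=> ck kM; have M0 : 0 <= M by apply: le_trans (kM 0).
have ig : mu.-integrable setT (fun x => (M * gd s x)%:E).
  apply/integrableP; split.
    apply/measurable_EFinP; apply: measurable_funM => //; exact: continuous_measurable_fun.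
  under eq_integral do rewrite gee0_abs ?lee_fin ?mulr_ge0 ?(ltW (gd_gt0 _ s0))// EFinM.
  rewrite ge0_integralZl_EFin//.
  - by rewrite i0 mule1 ltry.
  - by move=> x _; rewrite lee_fin ltW// gd_gt0.
  - by apply/measurable_EFinP; exact: continuous_measurable_fun.
apply: le_integrable ig => //.
- by apply/measurable_EFinP; apply: measurable_funM; exact: continuous_measurable_fun.
- move=> x _; rewrite !abse_EFin lee_fin !normrM; apply: ler_wpM2r => //.
  by rewrite (ger0_norm M0).
Qed.

Let ib := integrable_mul_gd.

(** Reflection exchanges [1 + sin] and [1 - sin]; the constant 1 makes both nonnegative, as the
    reflection formula requires. The same device recurs below with [1 + cos]. *)
Lemma integral_sin_gd : \int[mu]_x (sin x * gd s x) = 0.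
Proof.
have c1 : continuous (fun x : R => 1 + sin x).
  by move=> x; apply: cvgD; [exact: cvg_cst|exact: continuous_sin].
have p1 (x : R) : 0 <= 1 + sin x by have := sin_geN1 x; lra.
have h : (\int[mu]_x ((1 + sin x) * gd s x)%:E = \int[mu]_x ((1 - sin x) * gd s x)%:E)%E.
  rewrite -(@ge0_integral_reflection R 0 setT (fun x => ((1 + sin x) * gd s x)%:E)); [|exact: measurableT| |].
  - congr (integral _ _ _); apply/funext => x.
    by rewrite sub0r sinN /gd sqrrN.
  - by apply/measurable_EFinP; apply: measurable_funM; exact: continuous_measurable_fun.
  - by move=> x _; rewrite lee_fin mulr_ge0// ltW// gd_gt0.
have e1 (e : R) : `|e| <= 1 -> \int[mu]_x ((1 + e * sin x) * gd s x) =
    1 + e * \int[mu]_x (sin x * gd s x).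
  move=> eb; have is1 := ib (@continuous_sin R) (@sin_max R).
  have ie : mu.-integrable setT (fun x => ((e * sin x) * gd s x)%:E).
    apply: (@ib (fun x => e * sin x) 1); first by move=> x; apply: cvgMr; exact: continuous_sin.
    by move=> x; rewrite normrM mulr_ile1// sin_max.
  have i1 : mu.-integrable setT (fun x => (1 * gd s x)%:E).
    by apply: (@ib (cst 1) 1) => [x|x]; [exact: cvg_cst|rewrite normr1].
  transitivity (\int[mu]_x (1 * gd s x + (e * sin x) * gd s x)).
    by apply: eq_Rintegral => x _; ring.
  rewrite RintegralD//; congr (_ + _).
    by under eq_Rintegral do rewrite mul1r; rewrite /Rintegral i0.
  by under eq_Rintegral do rewrite -mulrA; rewrite RintegralZl.
have := e1 1; have := e1 (-1); rewrite normrN normr1 => /(_ (lexx _)) h1 /(_ (lexx _)) h2.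
have : \int[mu]_x ((1 + 1 * sin x) * gd s x) = \int[mu]_x ((1 + -1 * sin x) * gd s x).
  rewrite /Rintegral; under [X in fine X = _]eq_integral do rewrite mul1r.
  by under [X in _ = fine X]eq_integral do rewrite mulN1r; rewrite h.
rewrite h1 h2; move: (Rintegral _ _ _) => S ?; lra.
Qed.

Lemma integral_cos_gd_shift (y : R) :
  \int[mu]_x ((1 + cos (x + y)) * gd s x) =
  1 + cos y * \int[mu]_x (cos x * gd s x).
Proof.
have ic := ib (@continuous_cos R) (@cos_max R).
have is1 := ib (@continuous_sin R) (@sin_max R).
have i1 : mu.-integrable setT (fun x => (1 * gd s x)%:E).
  by apply: (@ib (cst 1) 1) => [x|x]; [exact: cvg_cst|rewrite normr1].
have iZ (k : R -> R) (a : R) : mu.-integrable setT (fun x => (k x * gd s x)%:E) ->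
    mu.-integrable setT (fun x => (a * (k x * gd s x))%:E).
  by move=> ik; under eq_fun do rewrite EFinM; exact: integrableZl.
have iD (k l : R -> R) : mu.-integrable setT (fun x => (k x)%:E) ->
    mu.-integrable setT (fun x => (l x)%:E) ->
    mu.-integrable setT (fun x => (k x + l x)%:E).
  by move=> ik il; under eq_fun do rewrite EFinD; exact: integrableD.
transitivity (\int[mu]_x (1 * gd s x + cos y * (cos x * gd s x) + (- sin y) * (sin x * gd s x))).
  by apply: eq_Rintegral => x _; rewrite cosD; ring.
have j1 := iZ _ (cos y) ic; have j2 := iZ _ (- sin y) is1.
rewrite RintegralD//; last exact: iD.
have e1 : \int[mu]_x (cos y * (cos x * gd s x)) = cos y * \int[mu]_x (cos x * gd s x) by rewrite RintegralZl.
have e2 : \int[mu]_x (- sin y * (sin x * gd s x)) = 0 by rewrite RintegralZl// integral_sin_gd mulr0.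
rewrite RintegralD// e1 e2 addr0; congr (_ + _).
by under eq_Rintegral do rewrite mul1r; rewrite /Rintegral i0.
Qed.

Lemma integral_cos_gdE (e : R) : (\int[mu]_x ((1 + e * cos x) * gd s x)%:E =
  (1 + e * \int[mu]_x (cos x * gd s x))%:E)%E.
Proof.
have ic := ib (@continuous_cos R) (@cos_max R).
have ie : mu.-integrable setT (fun x => (e * (cos x * gd s x))%:E).
  by under eq_fun do rewrite EFinM; exact: integrableZl.
have i1 : mu.-integrable setT (fun x => (1 * gd s x)%:E).
  by apply: (@ib (cst 1) 1) => [x|x]; [exact: cvg_cst|rewrite normr1].
have is2 : mu.-integrable setT (fun x => (1 * gd s x + e * (cos x * gd s x))%:E).
  by under eq_fun do rewrite EFinD; exact: integrableD.
transitivity (\int[mu]_x (1 * gd s x + e * (cos x * gd s x))%:E)%E.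
  by apply: eq_integral => x _; congr EFin; ring.
have <- : \int[mu]_x (1 * gd s x + e * (cos x * gd s x)) =
    1 + e * \int[mu]_x (cos x * gd s x).
  have e1 : \int[mu]_x (e * (cos x * gd s x)) = e * \int[mu]_x (cos x * gd s x) by rewrite RintegralZl.
  rewrite RintegralD// e1; congr (_ + _).
  by under eq_Rintegral do rewrite mul1r; rewrite /Rintegral i0.
by rewrite /Rintegral fineK//; exact: integrable_fin_num.
Qed.

End gd_trig.

(** Convolution becomes multiplication: in [cos (x + y)] the sine part integrates to 0 against the
    even kernel, which leaves a product. *)
Lemma integral_cos_gdD (s r : R) : 0 < s -> 0 < r ->
  \int[mu]_x (cos x * gd (s + r) x) =
  (\int[mu]_x (cos x * gd s x)) * (\int[mu]_x (cos x * gd r x)).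
Proof.
move=> s0 r0; have sr0 : 0 < s + r by pos.
have c1 : continuous (fun x : R => 1 + cos x).
  by move=> x; apply: cvgD; [exact: cvg_cst|exact: continuous_cos].
have p1 (x : R) : 0 <= 1 + cos x by have := cos_geN1 x; lra.
have mgd t : measurable_fun [set: R] (gd t) by apply: continuous_measurable_fun; exact: continuous_gd.
have m1 : measurable_fun [set: R] (fun x : R => 1 + cos x) by exact: continuous_measurable_fun.
pose A := \int[mu]_x (cos x * gd s x); pose B := \int[mu]_x (cos x * gd r x).
suff : (1 + \int[mu]_x (cos x * gd (s + r) x))%:E = (1 + A * B)%:E.
  by move=> h; apply: (@addrI _ 1); exact: EFin_inj h.
have := integral_cos_gdE sr0 1; rewrite mul1r => <-.
under eq_integral do rewrite mul1r.
transitivity (\int[mu]_x \int[mu]_y ((1 + cos x) * (gd s (x - y) * gd r y))%:E)%E.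
  apply: eq_integral => x _; rewrite EFinM -gd_convolution// -ge0_integralZl_EFin//.
  - by move=> y _; rewrite lee_fin mulr_ge0// ltW// gd_gt0.
  - apply/measurable_EFinP; apply: measurable_funM; last exact: mgd.
    by apply: (measurableT_comp (mgd s)); exact: measurable_funB.
rewrite (@fubini_tonelli _ _ (measurableTypeR R) (measurableTypeR R) R mu mu
  (fun p => ((1 + cos p.1) * (gd s (p.1 - p.2) * gd r p.2))%:E)); last 2 first.
- apply/measurable_EFinP; apply: measurable_funM.
    by apply: (measurableT_comp m1); exact: measurable_fst.
  apply: measurable_funM; last by apply: (measurableT_comp (mgd r)); exact: measurable_snd.
  by apply: (measurableT_comp (mgd s)); apply: measurable_funB; [exact: measurable_fst|exact: measurable_snd].
- by move=> p; rewrite lee_fin !mulr_ge0// ltW// gd_gt0.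
have ri (y : R) : mu.-integrable setT (fun x => ((1 + cos (x + y)) * gd s x)%:E).
  apply: (@integrable_mul_gd s s0 (fun x => 1 + cos (x + y)) 2) => x.
    apply: cvgD; first exact: cvg_cst.
    apply: (@continuous_comp _ _ _ (fun x => x + y) cos); last exact: continuous_cos.
    by apply: cvgD; [exact: cvg_id|exact: cvg_cst].
  by rewrite ler_norml; have := cos_geN1 (x + y); have := cos_le1 (x + y); lra.
transitivity (\int[mu]_y ((1 + A * cos y) * gd r y)%:E)%E.
  apply: eq_integral => y _ /=.
  rewrite -(@ge0_integral_translate R y setT (fun x => ((1 + cos x) * (gd s (x - y) * gd r y))%:E))//.
  - transitivity (\int[mu]_x ((gd r y)%:E * ((1 + cos (x + y)) * gd s x)%:E))%E.
      by apply: eq_integral => x _; rewrite addrK -EFinM; congr EFin; ring.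
    rewrite ge0_integralZl_EFin//.
    + rewrite (mulrC A) /A -integral_cos_gd_shift// (EFinM _ (gd r y)) muleC; congr (_ * _)%E.
      rewrite /Rintegral fineK//.
      by apply: integrable_fin_num => //; exact: ri.
    + by move=> x _; rewrite lee_fin mulr_ge0// ltW// gd_gt0.
    + by have /integrableP[] := ri y.
    + exact/ltW/gd_gt0.
  - apply/measurable_EFinP; apply: measurable_funM => //; apply: measurable_funM => //.
    by apply: (measurableT_comp (mgd s)); exact: measurable_funB.
  - by move=> x _; rewrite lee_fin !mulr_ge0// ltW// gd_gt0.
exact: integral_cos_gdE.
Qed.

(** The characteristic function at 1 of the centred normal law of variance [v]. The degenerate law
    has no density and is set apart; multiplicativity, [psiD], is what yields independence. *)
Definition psi (v : R) : R := if v == 0 then 1 else \int[mu]_x (cos x * gd (v / 2) x).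

Lemma psiD (v w : R) : 0 <= v -> 0 <= w -> psi (v + w) = psi v * psi w.
Proof.
rewrite /psi !le_eqVlt => /predU1P[<-|v0]; first by rewrite add0r eqxx mul1r.
move=> /predU1P[<-|w0]; first by rewrite addr0 eqxx mulr1.
by rewrite !gt_eqF ?addr_gt0// mulrDl integral_cos_gdD// divr_gt0.
Qed.

End gaussian.

Section equal_laws.
Context {R : realType} {d d' : measure_display} {T : measurableType d} {T' : measurableType d'}.
Variables (P : {measure set T -> \bar R}) (P' : {measure set T' -> \bar R}) (X : T -> R) (X' : T' -> R).
Hypotheses (mX : measurable_fun setT X) (mX' : measurable_fun setT X')
  (law : forall B : set R, measurable B -> P (X @^-1` B) = P' (X' @^-1` B)).

Let Y : {mfun T >-> measurableTypeR R} :=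
  HB.pack X (@isMeasurableFun.Build _ _ T (measurableTypeR R) X mX).
Let Y' : {mfun T' >-> measurableTypeR R} :=
  HB.pack X' (@isMeasurableFun.Build _ _ T' (measurableTypeR R) X' mX').

Lemma ge0_integral_law (h : R -> R) : measurable_fun setT h -> (forall x, 0 <= h x) ->
  (\int[P]_w (h (X w))%:E = \int[P']_w (h (X' w))%:E)%E.
Proof.
move=> mh h0; have mh' : measurable_fun setT (EFin \o (h : measurableTypeR R -> R)) by exact/measurable_EFinP.
have h0' : {in [set: measurableTypeR R], forall y, (0 <= (EFin \o h) y)%E} by move=> y _; rewrite /= lee_fin.
transitivity (\int[pushforward P Y]_x (h x)%:E)%E.
  by symmetry; apply: (eq_trans (@ge0_integral_pushforward _ _ _ _ _ Y (@measurable_funPT _ _ _ _ Y) P setT (EFin \o h) _ mh' h0')).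
transitivity (\int[pushforward P' Y']_x (h x)%:E)%E.
  by apply: eq_measure_integral => A mA _; exact: law.
by apply: (eq_trans (@ge0_integral_pushforward _ _ _ _ _ Y' (@measurable_funPT _ _ _ _ Y') P' setT (EFin \o h) _ mh' h0')).
Qed.

End equal_laws.

Section normal_law.
Context {R : realType} {d : measure_display} {T : measurableType d} (P : probability T R).
Variables (X : T -> R) (v : R).
Hypotheses (mX : measurable_fun setT X) (v0 : 0 <= v)
  (lawX : has_centered_normal_law P X v).
Local Notation mu := (@lebesgue_measure R).

Let law_integral (h : R -> R) : continuous h -> (forall x, 0 <= h x) ->
  (\int[P]_w (h (X w))%:E = \int[normal_prob 0 1]_z (h (Num.sqrt v * z))%:E)%E.
Proof.
move=> ch h0; apply: (@ge0_integral_law R _ _ T (measurableTypeR R) P (normal_prob 0 1) X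
  (fun z => Num.sqrt v * z)) => //.
- exact: (@measurable_funM _ (measurableTypeR R) R).
- exact: continuous_measurable_fun.
Qed.

Let law_integral0 (h : R -> R) : continuous h -> (forall x, 0 <= h x) -> v = 0 ->
  (\int[P]_w (h (X w))%:E = (h 0)%:E)%E.
Proof.
move=> ch h0 ve; rewrite law_integral//.
transitivity (\int[normal_prob (0:R) 1]_z (cst (h 0)%:E) z)%E.
  by apply: eq_integral => z _; rewrite ve sqrtr0 mul0r.
apply: (eq_trans (@integral_cst _ (measurableTypeR R) R (normal_prob 0 1) setT measurableT (h 0)%:E)).
by have := lawX measurableT; rewrite !preimage_setT probability_setT => h1; apply: (eq_trans (congr1 (fun a => (h 0)%:E * a)%E (esym h1))); rewrite mule1.
Qed.

Lemma normal_law_expR : (\int[P]_w (expR (X w))%:E = (expR (v / 2))%:E)%E.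
Proof.
move: v0; rewrite le_eqVlt => /predU1P[/esym ve|vp].
  by rewrite law_integral0 ?ve ?mul0r ?expR0//; exact: continuous_expR.
rewrite law_integral//; last exact: continuous_expR.
rewrite integral_normal_scale//; last exact: continuous_expR.
have v20 : 0 < v / 2 by pos.
transitivity (\int[mu]_x ((expR (v / 2))%:E * (gd (v / 2) (x - v))%:E))%E.
  apply: eq_integral => x _; rewrite -EFinM /gd mulrCA [in RHS]mulrCA; congr (_ * _)%:E.
  by rewrite -!expRD; congr expR; field; rewrite gt_eqF.
rewrite ge0_integralZl_EFin//.
- by rewrite integral_gd// mule1.
- by move=> x _; rewrite lee_fin ltW// gd_gt0.
- exact: measurable_gd.
Qed.

Lemma normal_law_cos (e : R) : \int[P]_w cos (X w + e) = cos e * psi v.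
Proof.
have ch : continuous (fun x : R => 1 + cos (x + e)).
  move=> x; apply: cvgD; first exact: cvg_cst.
  apply: (@continuous_comp _ _ _ (fun x => x + e) cos); last exact: continuous_cos.
  by apply: cvgD; [exact: cvg_id|exact: cvg_cst].
have h0 (x : R) : 0 <= 1 + cos (x + e) by have := cos_geN1 (x + e); lra.
have mc : measurable_fun setT (fun w => cos (X w + e)).
  apply: (measurableT_comp (continuous_measurable_fun (@continuous_cos R))).
  exact: measurable_realfun.measurable_funD.
have ib : P.-integrable setT (fun w => (cos (X w + e))%:E).
  apply: (@measurable_bounded_integrable _ _ _ P (fun w => cos (X w + e))) => //.
    exact: (le_lt_trans (probability_le1 _ _) (ltry _)).
  exists 1; split => // M M1 w _; apply: le_trans (ltW M1); exact: cos_max.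
have i1 : P.-integrable setT (fun w : T => (1 : R)%:E).
  exact: finite_measure_integrable_cst.
have e1 : \int[P]_w (1 + cos (X w + e)) = 1 + \int[P]_w cos (X w + e).
  rewrite RintegralD//; congr (_ + _).
  apply: (eq_trans (Rintegral_cst P measurableT 1)); rewrite mul1r.
  by rewrite [X in fine X = _](_ : _ = 1%E)//; exact: probability_setT.
have e2 : \int[P]_w (1 + cos (X w + e)) = 1 + cos e * psi v.
  rewrite /psi; case: eqP => [ve|/eqP vn].
    by rewrite /Rintegral (law_integral0 ch h0 ve) /= add0r mulr1.
  have vp : 0 < v by rewrite lt_neqAle eq_sym vn.
  transitivity (fine (\int[P]_w ((fun x => 1 + cos (x + e)) (X w))%:E)%E) => //.
  rewrite (law_integral ch h0) (integral_normal_scale vp ch h0).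
  by have := integral_cos_gd_shift (divr_gt0 vp (ltr0n R 2)) e; rewrite /Rintegral.
by apply: (@addrI _ 1); rewrite -e1 -e2.
Qed.

End normal_law.

Section noise.
Context {R : realType} {d : measure_display} {T : measurableType d} (P : probability T R).
Variable (W : set (R * R) -> {RV P >-> R}).
Hypothesis hW : white_noise W.

(** A linear combination of noise values is a list of coefficients and sets, so that sums and
    multiples of forms are operations on lists; [lin_var] is its variance. *)
Definition lin (l : seq (R * set (R * R))) (w : T) : R := \sum_(p <- l) p.1 * W p.2 w.

Definition lin_var (l : seq (R * set (R * R))) : R :=
  \sum_(p <- l) \sum_(q <- l) p.1 * q.1 * fine (spacetime_measure (p.2 `&` q.2)).

Fixpoint lall (Q : set (set (R * R))) (l : seq (R * set (R * R))) : Prop :=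
  if l is p :: l' then Q p.2 /\ lall Q l' else True.

Lemma lall_cat Q l l' : lall Q (l ++ l') <-> lall Q l /\ lall Q l'.
Proof. by elim: l => [|p l ih] /=; [tauto|rewrite ih; tauto]. Qed.

Lemma lall_sub (Q Q' : set (set (R * R))) l : Q `<=` Q' -> lall Q l -> lall Q' l.
Proof. by move=> QQ'; elim: l => //= p l ih [/QQ' ? /ih]. Qed.

Lemma lall_nth Q l i : lall Q l -> (i < size l)%N -> Q (nth (0, set0) l i).2.
Proof. by elim: l i => [|p l ih] [|i] //= [? ?] //; apply: ih. Qed.

Lemma measurable_lin l : measurable_fun setT (lin l).
Proof. by apply: measurable_sum => p; apply: measurable_funM. Qed.

Lemma lin_law l : lall (@noise_set R) l -> has_centered_normal_law P (lin l) (lin_var l).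
Proof.
move=> nl; have := hW (A := fun i => (tnth (in_tuple l) i).2) (fun i => (tnth (in_tuple l) i).1) _.
have h (i : 'I_(size l)) : noise_set (tnth (in_tuple l) i).2.
  by rewrite (tnth_nth (0, set0)); exact: lall_nth.
move=> /(_ h); congr has_centered_normal_law.
  by apply: funext => w; rewrite /lin [in RHS]big_tnth.
by rewrite /lin_var [in RHS]big_tnth; apply: eq_bigr => i _; rewrite [in RHS]big_tnth.
Qed.

Lemma lin_cat l l' w : lin (l ++ l') w = lin l w + lin l' w.
Proof. by rewrite /lin big_cat. Qed.

Definition lscale (e : R) (l : seq (R * set (R * R))) := [seq (e * p.1, p.2) | p <- l].

Lemma lin_scale e l w : lin (lscale e l) w = e * lin l w.
Proof. by rewrite /lin big_map mulr_sumr; apply: eq_bigr => p _; rewrite mulrA. Qed.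

Lemma lall_scale Q e l : lall Q (lscale e l) <-> lall Q l.
Proof. by elim: l => //= p l ->. Qed.

Lemma lin_var_scale e l : lin_var (lscale e l) = e ^+ 2 * lin_var l.
Proof.
rewrite /lin_var big_map mulr_sumr; apply: eq_bigr => p _; rewrite big_map mulr_sumr.
by apply: eq_bigr => q _ /=; ring.
Qed.

(** The mixed covariances are areas of empty intersections. *)
Lemma lin_var_cat Q Q' l l' : (forall A B, Q A -> Q' B -> A `&` B = set0) ->
  lall Q l -> lall Q' l' -> lin_var (l ++ l') = lin_var l + lin_var l'.
Proof.
move=> dj ql ql'; have z (F : R * set (R * R) -> R * set (R * R) -> R) :
    (\sum_(p <- l) \sum_(q <- l') F p q * fine (spacetime_measure (p.2 `&` q.2)) = 0) *
    (\sum_(q <- l') \sum_(p <- l) F q p * fine (spacetime_measure (q.2 `&` p.2)) = 0).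
  have m0 : spacetime_measure (set0 : set (R * R)) = 0%E by rewrite /spacetime_measure measure0.
  split; rewrite (big_nth (0, set0)) big_mkord big1// => i _;
    rewrite (big_nth (0, set0)) big_mkord big1// => j _; rewrite 1?setIC.
    by rewrite setIC dj ?m0/= ?mulr0//; exact: lall_nth.
  by rewrite dj ?m0/= ?mulr0//; exact: lall_nth.
rewrite /lin_var big_cat/=; congr (_ + _).
  under eq_bigr do rewrite big_cat/=; rewrite big_split/=.
  by rewrite (z (fun p q => p.1 * q.1)).1 addr0.
under eq_bigr do rewrite big_cat/=; rewrite big_split/=.
by rewrite (z (fun p q => p.1 * q.1)).2 add0r.
Qed.

Local Notation stm := ((@lebesgue_measure R \x @lebesgue_measure R)%E).

(** The isometry for deterministic simple functions. It makes the variance depend only on the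
    function that the list represents, which gives positivity, additivity of the noise and the
    splitting of variances in time. *)
Lemma lin_var_int l : lall (@noise_set R) l ->
  (\int[stm]_(z in @spacetime R) ((\sum_(p <- l) p.1 * \1_(p.2) z) ^+ 2)%:E = (lin_var l)%:E)%E.
Proof.
move=> nl; pose c i := (tnth (in_tuple l) i).1; pose A i := (tnth (in_tuple l) i).2.
have nA i : noise_set (A i).
  by rewrite /A (tnth_nth (0, set0)); exact: lall_nth.
have fm i j : (stm (A i `&` A j) < +oo)%E.
  have [mi _ fi] := nA i; have [mj _ _] := nA j; apply: le_lt_trans fi.
  apply: (le_measure stm) => //; rewrite ?inE//; exact: measurableI.
transitivity (\int[stm]_(z in @spacetime R) \sum_(i < size l) \sum_(j < size l)
    ((c i * c j)%:E * (\1_(A i `&` A j) z)%:E))%E.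
  apply: eq_integral => z _; rewrite [in LHS]big_tnth expr2 mulr_suml -sumEFin; apply: eq_bigr => i _.
  rewrite mulr_sumr -sumEFin; apply: eq_bigr => j _; rewrite -EFinM; congr EFin.
  rewrite indicI/= -/(c i) -/(c j) -/(A i) -/(A j); ring.
have mS : measurable (@spacetime R).
  by apply: measurableX; [exact: measurable_itv|exact: measurable_itv].
have ii i j : stm.-integrable (@spacetime R) (fun z => (\1_(A i `&` A j) z)%:E).
  have [mi _ fi] := nA i; have [mj _ _] := nA j.
  apply/integrableP; split.
    by apply/measurable_EFinP; apply: measurable_funTS; apply: measurable_indic; exact: measurableI.
  under eq_integral do rewrite gee0_abs ?lee_fin//.
  rewrite integral_indic//; last exact: measurableI.
  apply: le_lt_trans (fm i j); apply: (le_measure stm) => //; rewrite ?inE.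
  - by apply: measurableI => //; exact: measurableI.
  - exact: measurableI.
rewrite integral_sum//; last by move=> i; apply: integrable_sum => // j _; exact: integrableZl.
rewrite /lin_var [in RHS]big_tnth -sumEFin; apply: eq_bigr => i _.
rewrite integral_sum//; last by move=> j; exact: integrableZl.
rewrite [in RHS]big_tnth -sumEFin; apply: eq_bigr => j _.
have [mi si fi] := nA i; have [mj _ _] := nA j.
rewrite integralZl// integral_indic//; last exact: measurableI.
rewrite (setIidl (B := @spacetime R)); last by move=> z [+ _]; exact: si.
rewrite [RHS]EFinM [X in (_ = _ * X)%E]fineK// ge0_fin_numE ?measure_ge0//; exact: fm.
Qed.

Lemma lin_var_ge0 l : lall (@noise_set R) l -> 0 <= lin_var l.
Proof.
by move=> nl; rewrite -lee_fin -lin_var_int//; apply: integral_ge0 => z _; rewrite lee_fin sqr_ge0.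
Qed.

Lemma lin_eq0 l : lall (@noise_set R) l -> lin_var l = 0 -> {ae P, forall w, lin l w = 0}.
Proof.
move=> nl v0; exists (lin l @^-1` ~` [set 0]); split.
- rewrite -[X in measurable X]setTI; apply: measurable_lin => //.
  exact: measurableC.
- rewrite lin_law//; last exact: measurableC.
  rewrite v0 sqrtr0 (_ : _ @^-1` _ = set0) ?measure0//.
  by apply/seteqP; split => z //=; rewrite mul0r.
- by move=> w /= h; apply: h.
Qed.

Lemma noise_setU (A B : set (R * R)) : noise_set A -> noise_set B -> noise_set (A `|` B).
Proof.
move=> [mA sA fA] [mB sB fB]; split; first exact: measurableU.
- by move=> z [/sA|/sB].
- apply: (@le_lt_trans _ _ (stm A + stm B)%E); last exact: lte_add_pinfty.
  exact: measureU2.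
Qed.

(** The noise of the union minus those of [A] and [B] is a form that represents the function 0,
    hence has variance 0 and vanishes almost surely. *)
Lemma noise_additive A B : noise_set A -> noise_set B -> A `&` B = set0 ->
  {ae P, forall w, W (A `|` B) w = W A w + W B w}.
Proof.
move=> nA nB AB; pose l : seq (R * set (R * R)) := [:: (1, A `|` B); (-1, A); (-1, B)].
have nl : lall (@noise_set R) l by split; [exact: noise_setU|].
have : {ae P, forall w, lin l w = 0}.
  apply: lin_eq0 => //; apply: EFin_inj; rewrite -lin_var_int//.
  transitivity (\int[stm]_(z in @spacetime R) cst 0%E z)%E; last exact: integral0.
  apply: eq_integral => z _; rewrite !big_cons big_nil/= !indicE.
  have : ~ (A z /\ B z) by move=> ab; have : (A `&` B) z by []; rewrite AB.
  have [/set_mem a|/negP na] := boolP (z \in A); have [/set_mem b|/negP nb] := boolP (z \in B) => ab.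
  - by case: ab.
  - by rewrite mem_set /=; [congr EFin; ring|left].
  - by rewrite mem_set /=; [congr EFin; ring|right].
  - rewrite memNset /=; first by congr EFin; ring.
    by move=> [/mem_set|/mem_set].
apply: filterS => w; rewrite /lin !big_cons big_nil /=; lra.
Qed.

Lemma lin_expR l : lall (@noise_set R) l ->
  (\int[P]_w (expR (lin l w))%:E = (expR (lin_var l / 2))%:E)%E.
Proof.
move=> nl; apply: normal_law_expR; [exact: measurable_lin|exact: lin_var_ge0|exact: lin_law].
Qed.

Lemma lin_cos l e : lall (@noise_set R) l -> \int[P]_w cos (lin l w + e) = cos e * psi (lin_var l).
Proof.
move=> nl; apply: normal_law_cos; [exact: measurable_lin|exact: lin_var_ge0|exact: lin_law].
Qed.

End noise.

Section density_measure.
Context d (T : measurableType d) (R : realType) (P : {measure set T -> \bar R}) (p : T -> R).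

(* [p] is replaced by its absolute value to obtain a measure unconditionally. *)
Definition dens (mp : measurable_fun setT p) (A : set T) : \bar R := (\int[P]_(x in A) `|p x|%:E)%E.

Variable mp : measurable_fun setT p.

Let mnp : measurable_fun setT (fun x => `|p x|%:E).
Proof. by apply/measurable_EFinP; exact: measurableT_comp. Qed.

Let dens0 : dens mp set0 = 0%E. Proof. exact: integral_set0. Qed.

Let dens_ge0 A : (0 <= dens mp A)%E.
Proof. by apply: integral_ge0 => x _; rewrite lee_fin. Qed.

Let dens_sigma_additive : semi_sigma_additive (dens mp).
Proof.
move=> A mA tA mUA; rewrite /dens ge0_integral_bigcup//=.
- apply: is_cvg_ereal_nneg_natsum_cond => n _ _.
  by apply: integral_ge0 => x _; rewrite lee_fin.
exact: measurable_funTS.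
Qed.

HB.instance Definition _ := isMeasure.Build _ _ _ (dens mp) dens0 dens_ge0 dens_sigma_additive.

Lemma integral_dens (f : T -> R) : measurable_fun setT f -> (forall x, 0 <= f x) -> (forall x, 0 <= p x) ->
  (\int[dens mp]_x (f x)%:E = \int[P]_x (f x * p x)%:E)%E.
Proof.
move=> mf f0 p0; under [RHS]eq_integral do rewrite EFinM; apply: integral_density => //.
- by move=> A mA; apply: eq_integral => x _; rewrite ger0_norm.
- exact/measurable_EFinP.
Qed.

End density_measure.

Section equal_weights.
Context d (T : measurableType d) (R : realType) (P : probability T R) (p q : T -> R).
Hypotheses (mp : measurable_fun setT p) (mq : measurable_fun setT q)
  (p0 : forall x, 0 <= p x) (q0 : forall x, 0 <= q x).

(** Under the measures of densities [p] and [q] the variable [X] has the same law. With a constant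
    [q], this is how the independence of [X] from [p] is exploited. *)
Lemma integral_law_weight (X : T -> R) (h : R -> R) : measurable_fun setT X ->
  (forall B, measurable B ->
    (\int[P]_(x in X @^-1` B) (p x)%:E = \int[P]_(x in X @^-1` B) (q x)%:E)%E) ->
  measurable_fun setT h -> (forall x, 0 <= h x) ->
  (\int[P]_x (h (X x) * p x)%:E = \int[P]_x (h (X x) * q x)%:E)%E.
Proof.
move=> mX e mh h0; have mhX : measurable_fun setT (fun x => h (X x)) by exact: measurableT_comp.
rewrite -(integral_dens P mp mhX)// -(integral_dens P mq mhX)//.
apply: ge0_integral_law => // B mB.
rewrite /= /dens; transitivity (\int[P]_(x in X @^-1` B) (p x)%:E)%E.
  by apply: eq_integral => x _; rewrite ger0_norm.
by rewrite e//; apply: eq_integral => x _; rewrite ger0_norm.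
Qed.

Lemma integral_weight_unique (G : set (set T)) : G `<=` measurable -> setI_closed G -> G setT ->
  (\int[P]_x (p x)%:E < +oo)%E ->
  (forall A, G A -> (\int[P]_(x in A) (p x)%:E = \int[P]_(x in A) (q x)%:E)%E) ->
  forall A, <<s G >> A -> (\int[P]_(x in A) (p x)%:E = \int[P]_(x in A) (q x)%:E)%E.
Proof.
move=> Gm GI GT foo e A sA.
have dp B : dens P mp B = (\int[P]_(x in B) (p x)%:E)%E.
  by apply: eq_integral => x _; rewrite ger0_norm.
have dq B : dens P mq B = (\int[P]_(x in B) (q x)%:E)%E.
  by apply: eq_integral => x _; rewrite ger0_norm.
rewrite -dp -dq; apply: (@g_sigma_algebra_measure_unique _ _ _ G Gm (fun=> setT)) => //.
- by rewrite bigcup_const//; exists 0%N.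
- by move=> B GB; rewrite /= dp dq e.
- by move=> _; rewrite /= dp.
Qed.

End equal_weights.

(** * Bounded functions of a random variable generated by its sines *)

Section trigonometric_closure.
Context {R : realType}.

Lemma sin_lip (y : R) : `|sin y - y| <= y ^+ 2 /\ `|sin y| <= `|y|.
Proof.
wlog y0 : y / 0 <= y => [h|].
  have [|yn] := leP 0 y; first exact: h.
  have [] := h (- y); first by lra.
  by rewrite sinN -opprD !normrN sqrrN.
have mvt (f df : R -> R) (z : R) : 0 <= z -> (forall x : R, is_derive x 1 f (df x)) ->
    exists2 c, 0 <= c <= z & f z - f 0 = df c * z.
  move=> z0 hd; have cf : {within `[0, z], continuous f}.
    apply: continuous_subspaceT => x; apply: differentiable_continuous.
    by apply/derivable1_diffP; apply: ex_derive; exact: hd.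
  have [c] := @MVT_segment R f df 0 z z0 (fun x _ => hd x) cf.
  by rewrite in_itv/= subr0 => ?; exists c.
have [c /andP[c0 cy]] := mvt sin cos y y0 (@is_derive_sin R).
rewrite sin0 subr0 => ->; split; last first.
  by rewrite normrM ler_piMl// cos_max.
have [b /andP[b0 bc]] := mvt cos (fun x => - sin x) c c0 (@is_derive_cos R).
rewrite cos0 => e; have -> : cos c * y - y = (cos c - 1) * y by ring.
rewrite e !normrM normrN (ger0_norm c0) (ger0_norm y0) expr2; apply: ler_wpM2r => //.
by apply: le_trans cy; rewrite ler_piMl// sin_max.
Qed.

Lemma cvg_scaled_sin (x : R) : n.+1%:R * sin (x / n.+1%:R) @[n --> \oo] --> x.
Proof.
apply/cvgrPdist_le => e e0.
have h : `|x| ^+ 2 * n.+1%:R^-1 @[n --> \oo] --> (0 : R).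
  by rewrite -(mulr0 (`|x| ^+ 2)); apply: cvgMr; exact: cvg_harmonic.
have /cvgrPdist_le/(_ _ e0) := h; apply: filterS => n; rewrite sub0r normrN ger0_norm ?mulr_ge0//.
apply: le_trans; have n0 : (0 : R) < n.+1%:R by [].
have -> : x - n.+1%:R * sin (x / n.+1%:R) = n.+1%:R * (x / n.+1%:R - sin (x / n.+1%:R)).
  by field; rewrite gt_eqF.
rewrite normrM (gtr0_norm n0) distrC.
have [/(ler_wpM2l (ltW n0)) + _] := sin_lip (x / n.+1%:R); move=> /le_trans; apply.
rewrite real_normK ?num_real//.
by rewrite le_eqVlt; apply/orP; left; apply/eqP; field; rewrite gt_eqF.
Qed.

(** With [m = n + 1], the inner exponent is close to [m - m^2 x]: it tends to minus infinity for
    [x > 0] and to infinity for [x <= 0], the term [m] settling the case [x = 0]. The double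
    exponential turns this into the indicator of [x > 0], built only from sines, linear combinations
    and exponentials. *)
Definition sin_step (n : nat) (x : R) : R :=
  expR (- expR (n.+1%:R - n.+1%:R ^+ 3 * sin (x / n.+1%:R))).

Lemma cvg_sin_step (x : R) : sin_step n x @[n --> \oo] --> (((0 < x)%R : nat)%:R : R).
Proof.
have ch : (n.+1%:R^-1 : R) @[n --> \oo] --> (0 : R) by exact: cvg_harmonic.
have small (z : R) n : n.+1%:R <= z -> expR (- z) <= n.+1%:R^-1.
  move=> nz; rewrite expRN lef_pV2 ?posrE ?expR_gt0//.
  by apply: le_trans nz _; have := expR_ge1Dx z; lra.
have [x0|x0] := ltP 0 x.
  apply: (@squeeze_cvgr _ _ _ _ (fun n => 1 - n.+1%:R^-1) (fun=> 1)); last exact: cvg_cst.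
    have /cvgr_ge/(_ (x / 2)) := @cvg_scaled_sin x; have -> : x / 2 < x by lra.
    move=> /(_ isT) h1.
    have h2 : \forall n \near \oo, 4 / x <= n.+1%:R.
      have [N _ hN] := nbhs_infty_ger (4 / x); exists N => // n Nn.
      by apply: le_trans (hN n Nn) _; rewrite ler_nat.
    near=> n; rewrite /sin_step; apply/andP; split; last by rewrite expR_le1 oppr_le0 expR_ge0.
    have a1 : x / 2 <= n.+1%:R * sin (x / n.+1%:R) by near: n.
    have a2 : 4 / x <= n.+1%:R :> R by near: n.
    set m := n.+1%:R in a1 a2 *; set s := sin _ in a1 *.
    have m0 : 0 < m by rewrite /m.
    have k1 : m * (x / 2) <= m * (m * s) by rewrite ler_pM2l.
    have k2 : 2 <= m * (x / 2) by move: a2; rewrite ler_pdivrMr// => a2; lra.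
    have k3 : m <= - (m - m ^+ 3 * s).
      have : m * 2 <= m * (m * (m * s)) by rewrite ler_pM2l//; exact: le_trans k1.
      by rewrite (_ : m ^+ 3 * s = m * (m * (m * s))); [lra|ring].
    have := small _ _ k3; rewrite opprK -/m => k4.
    by apply: le_trans (expR_ge1Dx _); rewrite lerD2l lerN2.
  by rewrite -[X in _ --> X](subr0 (1 : R)); apply: cvgB => //; exact: cvg_cst.
apply: (@squeeze_cvgr _ _ _ _ (fun=> 0) (fun n => n.+1%:R^-1)) => //; last exact: cvg_cst.
have hs : \forall n \near \oo, n.+1%:R * sin (x / n.+1%:R) <= 0.
  move: x0; rewrite le_eqVlt => /predU1P[->|x0].
    by apply: nearW => n; rewrite mul0r sin0 mulr0.
  have /cvgr_le/(_ (x / 2)) := @cvg_scaled_sin x; have -> : x < x / 2 by lra.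
  by move=> /(_ isT); apply: filterS => n h; lra.
near=> n; rewrite /sin_step expR_ge0/=; apply: small.
have a1 : n.+1%:R * sin (x / n.+1%:R) <= 0 by near: n.
set m := n.+1%:R in a1 *; set s := sin _ in a1 *.
have m0 : 0 <= m by rewrite /m.
have : m ^+ 2 * (m * s) <= 0 by rewrite mulr_ge0_le0 ?exprn_ge0.
have -> : m ^+ 2 * (m * s) = m ^+ 3 * s by ring.
by have := expR_ge1Dx (m - m ^+ 3 * s); lra.
Unshelve. all: by end_near. Qed.

End trigonometric_closure.

Section trigonometric_class.
Context {R : realType} {d : measure_display} {T : measurableType d} (P : probability T R).

Lemma integrable_bounded (f : T -> R) (B : R) : measurable_fun setT f -> (forall w, `|f w| <= B) ->
  P.-integrable setT (EFin \o f).
Proof.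
move=> mf fB; apply: (@measurable_bounded_integrable _ _ _ P f) => //.
  exact: (le_lt_trans (probability_le1 _ _) (ltry _)).
by exists B; split; [exact: num_real|move=> M /ltW BM w _; exact: le_trans (fB w) BM].
Qed.

Lemma cvg_Rintegral_dominated (f_ : nat -> T -> R) (f g : T -> R) :
  (forall n, measurable_fun setT (f_ n)) -> P.-integrable setT (EFin \o g) ->
  (forall n w, `|f_ n w| <= g w) -> (forall w, f_ n w @[n --> \oo] --> f w) ->
  measurable_fun setT f /\ \int[P]_w f_ n w @[n --> \oo] --> \int[P]_w f w.
Proof.
move=> mf ig fg ff; have m : measurable_fun setT f.
  by apply: (@measurable_fun_cvg _ _ _ setT f_ f mf) => w _; exact: ff.
split => //; have [||i _ h] := @dominated_convergence _ T R P setT measurableT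
  (fun n => EFin \o f_ n) (EFin \o f) (EFin \o g) (fun n => proj2 (measurable_EFinP _ _) (mf n)) (proj2 (measurable_EFinP _ _) m) _ ig.
- by apply: aeW => w _; apply: cvg_EFin; [exact: nearW|exact: ff].
- by apply: aeW => w n _; rewrite lee_fin.
apply: (@fine_cvg _ _ _ _ (fun n => (\int[P]_w (f_ n w)%:E)%E)).
by rewrite fineK//; exact: integrable_fin_num.
Qed.

Variables (b : T -> R) (Bb : R) (L : set (T -> R)) (X : T -> R).
Hypotheses (mb : measurable_fun setT b) (bB : forall w, `|b w| <= Bb)
  (mL : forall l, L l -> measurable_fun setT l) (mX : measurable_fun setT X)
  (LX : forall l c, L l -> L (fun w => l w + c * X w)).

(** The phases [e] bring in the sines. In the applications [V] or [b] contains a centred variable,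
    and taking the form 0 turns orthogonality into the factorisation of an expectation. *)
Definition orth (V : T -> R) : Prop := [/\ measurable_fun setT V, exists B : R, forall w, `|V w| <= B &
  forall l e, L l -> \int[P]_w (V w * cos (l w + e) * b w) = 0].

Let mcos l e : L l -> measurable_fun setT (fun w => cos (l w + e)).
Proof.
move=> Ll; apply: (measurableT_comp (continuous_measurable_fun (@continuous_cos R))).
by apply: measurable_realfun.measurable_funD => //; exact: mL.
Qed.

Let mVcb (V : T -> R) l e : measurable_fun setT V -> L l -> measurable_fun setT (fun w => V w * cos (l w + e) * b w).
Proof. by move=> mV Ll; apply: measurable_funM => //; apply: measurable_funM => //; exact: mcos. Qed.

Let Vcb_le (V : T -> R) B l e : (forall w, `|V w| <= B :> R) -> forall w, `|V w * cos (l w + e) * b w| <= B * Bb.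
Proof.
move=> VB w; rewrite !normrM; apply: ler_pM => //; apply: le_trans (VB w).
by rewrite ler_piMr// cos_max.
Qed.

Let iVcb (V : T -> R) l e : measurable_fun setT V -> (exists B : R, forall w, `|V w| <= B) -> L l ->
  P.-integrable setT (EFin \o (fun w => V w * cos (l w + e) * b w)).
Proof.
by move=> mV [B VB] Ll; apply: (@integrable_bounded _ (B * Bb)); [exact: mVcb|exact: Vcb_le].
Qed.

Lemma orth_lin a c V V' : orth V -> orth V' -> orth (fun w => a * V w + c * V' w).
Proof.
move=> [mV [B VB] oV] [mV' [B' VB'] oV']; split.
- by apply: measurable_realfun.measurable_funD; apply: measurable_funM.
- exists (`|a| * B + `|c| * B') => w; apply: le_trans (ler_normD _ _) _.
  by rewrite !normrM lerD// ler_wpM2l.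
- move=> l e Ll.
  have i1 := iVcb e mV (ex_intro _ B VB) Ll; have i2 := iVcb e mV' (ex_intro _ B' VB') Ll.
  transitivity (\int[P]_w (a * (V w * cos (l w + e) * b w) + c * (V' w * cos (l w + e) * b w))).
    by apply: eq_Rintegral => w _; ring.
  rewrite RintegralD//.
  + by rewrite !RintegralZl// oV// oV'// !mulr0 addr0.
  + exact: (integrableZl measurableT a i1).
  + exact: (integrableZl measurableT c i2).
Qed.

(** The product-to-sum formula rewrites [sin (c X + e0) cos (l + e)] through cosines of [l + c X]
    and [l - c X], which are again in [L]; the phase [pi / 2] turns sines into cosines. *)
Lemma orth_sin c e0 V : orth V -> orth (fun w => V w * sin (c * X w + e0)).
Proof.
move=> [mV [B VB] oV]; split.
- apply: measurable_funM => //.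
  apply: (measurableT_comp (continuous_measurable_fun (@continuous_sin R))).
  by apply: measurable_realfun.measurable_funD => //; exact: measurable_funM.
- by exists B => w; rewrite normrM; apply: le_trans (VB w); rewrite ler_piMr// sin_max.
- move=> l e Ll; have L1 := LX c Ll; have L2 := LX (- c) Ll.
  have e1 : forall w, V w * sin (c * X w + e0) * cos (l w + e) * b w =
     2^-1 * (V w * cos (l w + c * X w + (e + e0 - pi / 2)) * b w) +
     (- 2^-1) * (V w * cos (l w + (- c) * X w + (e - e0 - pi / 2)) * b w).
    move=> w; have -> : l w + c * X w + (e + e0 - pi / 2) = (l w + e + (c * X w + e0)) - pi / 2 by ring.
    have -> : l w + (- c) * X w + (e - e0 - pi / 2) = (l w + e - (c * X w + e0)) - pi / 2 by ring.
    by rewrite !cosBpihalf sinD sinB; field.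
  under eq_Rintegral do rewrite e1.
  have i1 := iVcb (e + e0 - pi / 2) mV (ex_intro _ B VB) L1.
  have i2 := iVcb (e - e0 - pi / 2) mV (ex_intro _ B VB) L2.
  rewrite RintegralD//.
  + by rewrite !RintegralZl// (oV _ _ L1) (oV _ _ L2) !mulr0 addr0.
  + exact: (integrableZl measurableT _ i1).
  + exact: (integrableZl measurableT _ i2).
Qed.

Lemma orth_lim (V_ : nat -> T -> R) V B : (forall n, orth (V_ n)) -> (forall n w, `|V_ n w| <= B) ->
  (forall w, V_ n w @[n --> \oo] --> V w) -> orth V.
Proof.
move=> oV VB VV; have mV_ n : measurable_fun setT (V_ n) by case: (oV n).
have iB (C : R) : P.-integrable setT (EFin \o (fun=> C)) by exact: finite_measure_integrable_cst.
have [mV _] := cvg_Rintegral_dominated mV_ (iB B) VB VV.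
have VB' w : `|V w| <= B.
  have h : `|V_ n w| @[n --> \oo] --> `|V w| by apply: cvg_norm; exact: VV.
  rewrite -(cvg_lim (@norm_hausdorff _ _) h); apply: limr_le; first by apply/cvg_ex; eexists; exact: h.
  exact: nearW.
split => //; first by exists B.
move=> l e Ll.
have hc w : V_ n w * cos (l w + e) * b w @[n --> \oo] --> V w * cos (l w + e) * b w.
  by apply: cvgMl; apply: cvgMl; exact: VV.
have [|_] := @cvg_Rintegral_dominated (fun n w => V_ n w * cos (l w + e) * b w)
  (fun w => V w * cos (l w + e) * b w) (fun=> B * Bb) (fun n => mVcb e (mV_ n) Ll) (iB _) _ hc.
  by move=> n w; exact: Vcb_le.
have -> : (fun n => \int[P]_w (V_ n w * cos (l w + e) * b w)) = fun=> 0.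
  by apply: funext => n; case: (oV n) => _ _; apply.
by move=> h; rewrite -(cvg_lim (@norm_hausdorff _ _) h) lim_cst.
Qed.

(** These functions form an algebra, closed under bounded pointwise limits, that contains the sines
    of multiples of [X]; exponentials and indicators of half-lines of [X] are reached from there.
    This takes the place of the uniqueness theorem for characteristic functions. *)
Definition multiplier (h : T -> R) : Prop := (exists B : R, forall w, `|h w| <= B) /\
  forall V, orth V -> orth (fun w => V w * h w).

Lemma multiplier_cst c : multiplier (fun=> c).
Proof.
split; first by exists `|c|.
move=> V oV; have := orth_lin c 0 oV oV; congr orth; apply: funext => w; ring.
Qed.

Lemma multiplier_sin c e : multiplier (fun w => sin (c * X w + e)).
Proof. by split; [exists 1 => w; exact: sin_max|move=> V; exact: orth_sin]. Qed.

Lemma multiplierM h h' : multiplier h -> multiplier h' -> multiplier (fun w => h w * h' w).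
Proof.
move=> [[B hB] oh] [[B' hB'] oh']; split.
  by exists (B * B') => w; rewrite normrM ler_pM.
by move=> V oV; have := oh' _ (oh _ oV); congr orth; apply: funext => w; ring.
Qed.

Lemma multiplier_lin a c h h' : multiplier h -> multiplier h' -> multiplier (fun w => a * h w + c * h' w).
Proof.
move=> [[B hB] oh] [[B' hB'] oh']; split.
  exists (`|a| * B + `|c| * B') => w; apply: le_trans (ler_normD _ _) _.
  by rewrite !normrM lerD// ler_wpM2l.
move=> V oV; have := orth_lin a c (oh _ oV) (oh' _ oV); congr orth; apply: funext => w; ring.
Qed.

Lemma multiplier_lim (h_ : nat -> T -> R) h B : (forall n, multiplier (h_ n)) ->
  (forall n w, `|h_ n w| <= B) -> (forall w, h_ n w @[n --> \oo] --> h w) -> multiplier h.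
Proof.
move=> mh hB hh; split.
  exists B => w; have k : `|h_ n w| @[n --> \oo] --> `|h w| by apply: cvg_norm; exact: hh.
  rewrite -(cvg_lim (@norm_hausdorff _ _) k); apply: limr_le; first by apply/cvg_ex; eexists; exact: k.
  exact: nearW.
move=> V oV; have [_ [C VC] _] := oV.
apply: (@orth_lim (fun n w => V w * h_ n w) _ (C * B)).
- by move=> n; have [_] := mh n; apply.
- by move=> n w; rewrite normrM ler_pM.
- by move=> w; apply: cvgMr; exact: hh.
Qed.

Lemma multiplier_expR h : multiplier h -> multiplier (fun w => expR (h w)).
Proof.
move=> mh; have [[B hB] _] := mh.
have mp k : multiplier (fun w => h w ^+ k).
  elim: k => [|k ih]; first exact: multiplier_cst.
  by have := multiplierM mh ih; congr multiplier; apply: funext => w; rewrite exprS.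
apply: (@multiplier_lim (fun n w => series (exp_coeff (h w)) n) _ (expR B)).
- elim=> [|n ih].
    by have := multiplier_cst 0; congr multiplier; apply: funext => w; rewrite /series/= big_geq.
  have := multiplier_lin 1 (n`!%:R^-1) ih (mp n); congr multiplier; apply: funext => w.
  have -> : series (exp_coeff (h w)) n.+1 = series (exp_coeff (h w)) n + exp_coeff (h w) n by rewrite /series/= big_nat_recr.
  by rewrite mul1r /exp_coeff/= [in RHS]mulrC.
- move=> n w; have B0 : 0 <= B by apply: le_trans (hB w).
  apply: (@le_trans _ _ (series (exp_coeff B) n)).
    rewrite /series /=; apply: le_trans (ler_norm_sum _ _ _) _; apply: ler_sum => i _.
    by rewrite /exp_coeff/= normrM normrX [X in _ * X]ger0_norm// ler_wpM2r// lerXn2r// nnegrE.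
  rewrite /expR; apply: (nondecreasing_cvgn_le _ (is_cvg_series_exp_coeff B)).
  by apply/nondecreasing_seqP => k; rewrite /series/= big_nat_recr//= lerDl exp_coeff_ge0.
- move=> w; exact: is_cvg_series_exp_coeff.
Qed.

Lemma multiplier_gt a : multiplier (fun w => ((a < X w)%R : nat)%:R).
Proof.
apply: (@multiplier_lim (fun n w => sin_step n (X w - a)) _ 1).
- move=> n; apply: multiplier_expR.
  have h2 := multiplier_sin (n.+1%:R^-1) (- a / n.+1%:R).
  have h3 := multiplier_expR (multiplier_lin n.+1%:R (- (n.+1%:R ^+ 3)) (multiplier_cst 1) h2).
  have := multiplier_lin 0 (-1) h3 h3; congr multiplier; apply: funext => w.
  rewrite mul0r add0r mulN1r; congr (- expR _); rewrite mulr1 mulNr; congr (_ - _ * sin _).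
  by rewrite mulrBl mulNr mulrC.
- by move=> n w; rewrite /sin_step ger0_norm ?expR_ge0// expR_le1 oppr_le0 expR_ge0.
- by move=> w; have := @cvg_sin_step R (X w - a); rewrite subr_gt0.
Qed.

(** Bounded functions of [X] that converge to [expR X] and are dominated by [expR |X|]. *)
Lemma multiplier_expR_sin n : multiplier (fun w => expR (n.+1%:R * sin (X w / n.+1%:R))).
Proof.
apply: multiplier_expR; have h := multiplier_sin (n.+1%:R^-1) 0.
have := multiplier_lin n.+1%:R 0 h h; congr multiplier; apply: funext => w.
have -> : n.+1%:R^-1 * X w + 0 = X w / n.+1%:R by rewrite addr0 mulrC.
by rewrite mul0r addr0.
Qed.

End trigonometric_class.

(** * Independence of the future noise from the filtration *)

Section independence.
Context {R : realType} {d : measure_display} {T : measurableType d} (P : probability T R).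
Variables (W : set (R * R) -> {RV P >-> R}) (u0 : T -> R -> R).
Hypotheses (hW : white_noise W) (hu0 : initial_datum W u0).

Definition past (t : R) : set (set (R * R)) := [set A | noise_set A /\ A `<=` `[0, t] `*` @torus R].
Definition future (t : R) : set (set (R * R)) := [set A | noise_set A /\ forall z, A z -> t < z.1].

Lemma past_future t A B : past t A -> future t B -> A `&` B = set0.
Proof.
move=> [_ sA] [_ fB]; rewrite -subset0 => z [/sA[/=]]; rewrite in_itv/= => /andP[_ zt] _ /fB.
by rewrite ltNge zt.
Qed.

Lemma sigma_gen_lin (Q : set (set (R * R))) l (B : set R) : lall Q l -> measurable B ->
  sigma_gen Q W (lin W l @^-1` B).
Proof.
move=> Ql mB; rewrite /sigma_gen; set G := (X in <<s X >>).
have mW A : Q A -> measurable_fun [set: g_sigma_algebraType G] (W A : g_sigma_algebraType G -> R).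
  by move=> QA _ C mC; rewrite setTI; apply: sub_gen_smallest; exists A => //; exists C.
have : measurable_fun [set: g_sigma_algebraType G] (lin W l : g_sigma_algebraType G -> R).
  elim: l Ql => [|p l ih] /= => [_|[Qp Ql]].
    by rewrite (_ : lin W [::] = cst 0)//; apply: funext => w; rewrite /lin big_nil.
  rewrite (_ : lin W (p :: l) = fun w => p.1 * W p.2 w + lin W l w); last first.
    by apply: funext => w; rewrite /lin big_cons.
  apply: measurable_realfun.measurable_funD; last exact: ih.
  by apply: measurable_funM => //; exact: mW.
by move=> /(_ measurableT B mB); rewrite setTI.
Qed.

Let mu0 x : measurable_fun setT (fun w => u0 w x).
Proof. by have [m _ _] := hu0; exact: (measurableT_comp m (pair2_measurable x)). Qed.

Lemma sigma_gen_measurable (I : Type) (D : set I) (X : I -> T -> R) :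
  (forall i, measurable_fun setT (X i)) -> sigma_gen D X `<=` measurable.
Proof.
move=> mX; apply: smallest_sub; first exact: sigma_algebra_measurable.
by move=> _ [i _ [B mB ->]]; rewrite -[X in measurable X]setTI; exact: mX.
Qed.

Lemma filtration_measurable t : filtration W u0 t `<=` measurable.
Proof.
apply: smallest_sub; first exact: sigma_algebra_measurable.
move=> E [[]|[]//]; apply: sigma_gen_measurable; [exact: mu0|by move=> A; exact: measurable_funPT].
Qed.

Let iRR (f : T -> R) B : measurable_fun setT f -> (forall w, `|f w| <= B) ->
  P.-integrable setT (EFin \o f).
Proof. exact: integrable_bounded. Qed.

Let mcos (f : T -> R) e : measurable_fun setT f -> measurable_fun setT (fun w => cos (f w + e)).
Proof.
move=> mf; apply: (measurableT_comp (continuous_measurable_fun (@continuous_cos R))).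
exact: measurable_realfun.measurable_funD.
Qed.

(** The independence of [u0] from the noise enters here: the form has the same law under the
    indicator of [U] and under the constant weight [P U]. *)
Let initial_cos U k e : sigma_gen setT (fun x w => u0 w x) U -> lall (@noise_set R) k ->
  \int[P]_w (\1_U w * cos (lin W k w + e)) = fine (P U) * \int[P]_w cos (lin W k w + e).
Proof.
move=> sU nk; have mU : measurable U by apply: sigma_gen_measurable sU => x; exact: mu0.
have mk := measurable_lin W k.
have ch : measurable_fun setT (fun x : R => 1 + cos (x + e)).
  apply: measurable_realfun.measurable_funD => //.
  apply: (measurableT_comp (continuous_measurable_fun (@continuous_cos R))).
  exact: measurable_realfun.measurable_funD.
have PU : (fine (P U))%:E = P U by rewrite fineK// fin_num_measure.
have law (B : set R) : measurable B ->
    (\int[P]_(x in lin W k @^-1` B) (\1_U x : R)%:E = \int[P]_(x in lin W k @^-1` B) (cst (fine (P U)) x)%:E)%E.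
  move=> mB; have mX : measurable (lin W k @^-1` B).
    by rewrite -[X in measurable X]setTI; exact: mk.
  rewrite integral_indic// (_ : (\int[P]_(x in _) (cst _ x)%:E = P U * P (lin W k @^-1` B))%E); last first.
    by exact: (eq_trans (integral_cst P mX (fine (P U))%:E) (congr1 (fun z => z * _)%E PU)).
  by have [_ _] := hu0; apply => //; exact: sigma_gen_lin.
have ch0 (x : R) : 0 <= 1 + cos (x + e) by have := cos_geN1 (x + e); lra.
have U0 w : 0 <= \1_U w :> R by rewrite indicE.
have PU0 (w : T) : 0 <= cst (fine (P U)) w by rewrite /= fine_ge0.
have mI : measurable_fun setT (\1_U : T -> R) by exact: measurable_indic.
have := @integral_law_weight _ T R P \1_U (cst (fine (P U))) mI
  (measurable_cst _) U0 PU0 (lin W k) (fun x => 1 + cos (x + e)) mk law ch ch0.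
have c1 w : `|cos (lin W k w + e)| <= 1 by exact: cos_max.
have i1 : P.-integrable setT (EFin \o (\1_U : T -> R)).
  by apply: (@iRR _ 1); [exact: measurable_indic|move=> w; rewrite indicE; case: (_ \in _); rewrite ?normr1 ?normr0].
have i2 : P.-integrable setT (EFin \o (fun w => \1_U w * cos (lin W k w + e))).
  apply: (@iRR _ 1); first by apply: measurable_funM; [exact: measurable_indic|exact: mcos].
  by move=> w; rewrite normrM mulr_ile1// indicE; case: (_ \in _); rewrite ?normr1 ?normr0.
have i3 : P.-integrable setT (EFin \o (fun w => cos (lin W k w + e))).
  by apply: (@iRR _ 1); [exact: mcos|].
have i4 (c : R) : P.-integrable setT (EFin \o (fun=> c)) by exact: finite_measure_integrable_cst.
have e1 : \int[P]_w ((1 + cos (lin W k w + e)) * \1_U w) =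
    fine (P U) + \int[P]_w (\1_U w * cos (lin W k w + e)).
  rewrite -(_ : \int[P]_w (\1_U w) = fine (P U)); last by rewrite /Rintegral integral_indic// setIT.
  by rewrite -RintegralD//; apply: eq_Rintegral => w _; ring.
have e2 : \int[P]_w ((1 + cos (lin W k w + e)) * fine (P U)) =
    fine (P U) + fine (P U) * \int[P]_w cos (lin W k w + e).
  rewrite -RintegralZl//.
  rewrite -[X in _ = X + _](_ : \int[P]_w (fine (P U)) = fine (P U)); last first.
    apply: (eq_trans (Rintegral_cst P measurableT (fine (P U)))).
    by rewrite (_ : fine (P setT) = 1) ?mulr1//; exact: (congr1 fine (probability_setT P)).
  rewrite -RintegralD//; last exact: (integrableZl measurableT _ i3).
  by apply: eq_Rintegral => w _; ring.
move=> h; apply: (@addrI _ (fine (P U))); rewrite -e1 -e2.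
exact: (congr1 fine h).
Qed.

Variables (t : R) (m : seq (R * set (R * R))).
Hypothesis fm : lall (future t) m.

Let nm : lall (@noise_set R) m. Proof. by apply: lall_sub fm => A []. Qed.

(** A pi-system that, together with the null events, generates the filtration at time [t]; its
    inductive form lets the indicators be multiplied in one at a time. *)
Inductive past_event : set T -> Prop :=
| past_initial U : sigma_gen setT (fun x w => u0 w x) U -> past_event U
| past_noise G A a : past_event G -> past t A -> past_event (G `&` [set w | a < W A w]).

Lemma past_event_measurable : past_event `<=` measurable.
Proof.
move=> G; elim=> [U|H A a _ mH _]; first by apply: sigma_gen_measurable => x; exact: mu0.
apply: measurableI => //; rewrite (_ : [set _ | _] = W A @^-1` `]a, +oo[%classic).
  by rewrite -[X in measurable X]setTI; apply: measurable_funPT.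
by apply/seteqP; split => w; rewrite /= in_itv/= andbT.
Qed.

Lemma past_eventI : setI_closed past_event.
Proof.
move=> G H pG; elim=> [U sU|K A a _ ih pA]; last by rewrite setIA; exact: past_noise.
elim: pG => [V sV|K A a _ ih pA]; last by rewrite setIAC; exact: past_noise.
by apply: past_initial; apply: (@measurableI _ (g_sigma_algebraType _)).
Qed.

(** By induction on the event. For an event of [u0], the product of the two cosines is a sum of
    cosines of joint forms, whose variances add up because past and future sets are disjoint, so
    that [psiD] factorises the expectations. Each further condition on [W A] is a multiplier, as
    past forms are stable under adding multiples of [W A]. *)
Let orth_past s e0 G : past_event G ->
  orth P (fun w => cos (s * lin W m w + e0) - \int[P]_w cos (s * lin W m w + e0))
    [set f | exists2 l, lall (past t) l & f = lin W l] (\1_G : T -> R).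
Proof.
set b := (X in orth P X); set L := (X in orth P _ X).
have nP l : lall (past t) l -> lall (@noise_set R) l by apply: lall_sub => A [].
have eb w : b w = cos (lin W (lscale s m) w + e0) - cos e0 * psi (s ^+ 2 * lin_var m).
  rewrite /b lin_scale; congr (_ - _); rewrite -lin_var_scale.
  rewrite -(lin_cos hW e0); last by rewrite lall_scale.
  by apply: eq_Rintegral => v _; rewrite lin_scale.
have mb : measurable_fun setT b.
  apply: measurable_realfun.measurable_funB => //; apply: mcos; apply: measurable_funM => //.
  exact: measurable_lin.
have bB w : `|b w| <= 1 + `|cos e0 * psi (s ^+ 2 * lin_var m)|.
  by rewrite eb; apply: le_trans (ler_normB _ _) _; rewrite lerD2r cos_max.
have mL l : L l -> measurable_fun setT l by move=> [k _ ->]; exact: measurable_lin.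
have oneU (U : set T) w : `|\1_U w : R| <= 1.
  by rewrite indicE; case: (_ \in _); rewrite ?normr1 ?normr0.
elim=> [U sU|H A a pH ih pA].
  have mU : measurable U by apply: sigma_gen_measurable sU => x; exact: mu0.
  split; [exact: measurable_indic|by exists 1|].
  move=> _ e [l pl ->].
  have nl := nP _ pl; have nl' k : lall (@noise_set R) (l ++ lscale k m).
    by rewrite lall_cat lall_scale.
  have vl k : lin_var (l ++ lscale k m) = lin_var l + k ^+ 2 * lin_var m.
    rewrite -lin_var_scale; apply: (@lin_var_cat _ (past t) (future t)) => //.
      by move=> A B; exact: past_future.
    by rewrite lall_scale.
  have ic k e1 : lall (@noise_set R) k -> P.-integrable setT (EFin \o (fun w => \1_U w * cos (lin W k w + e1))).
    move=> _; apply: (@iRR _ 1); first by apply: measurable_funM; [exact: measurable_indic|apply: mcos; exact: measurable_lin].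
    by move=> w; rewrite normrM mulr_ile1//; exact: cos_max.
  have e3 w : \1_U w * cos (lin W l w + e) * b w =
     2^-1 * (\1_U w * cos (lin W (l ++ lscale s m) w + (e + e0))) +
     (2^-1 * (\1_U w * cos (lin W (l ++ lscale (- s) m) w + (e - e0))) +
     (- (cos e0 * psi (s ^+ 2 * lin_var m))) * (\1_U w * cos (lin W l w + e))).
    rewrite eb !lin_cat !lin_scale.
    rewrite (_ : lin W l w + s * lin W m w + (e + e0) = (lin W l w + e) + (s * lin W m w + e0)); last by ring.
    rewrite (_ : lin W l w + - s * lin W m w + (e - e0) = (lin W l w + e) - (s * lin W m w + e0)); last by ring.
    by rewrite (cosD (lin W l w + e)) (cosB (lin W l w + e)); field.
  under eq_Rintegral do rewrite e3.
  have j1 := integrableZl measurableT 2^-1 (ic _ (e + e0) (nl' s)).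
  have j2 := integrableZl measurableT 2^-1 (ic _ (e - e0) (nl' (- s))).
  have j3 := integrableZl measurableT (- (cos e0 * psi (s ^+ 2 * lin_var m))) (ic _ e nl).
  rewrite RintegralD//; last exact: (integrableD measurableT j2 j3).
  rewrite RintegralD// !RintegralZl//; try exact: ic.
  rewrite !initial_cos// !(lin_cos hW)// !vl sqrrN psiD; last 2 first.
  - exact: lin_var_ge0.
  - by rewrite mulr_ge0 ?sqr_ge0//; exact: lin_var_ge0.
  by move: (psi _) (psi _) (fine _) => p1 p2 q; rewrite cosD cosB; field.
have LA l c : L l -> L (fun w => l w + c * W A w).
  move=> [k pl ->]; exists (k ++ [:: (c, A)]); first by rewrite lall_cat.
  by apply: funext => w; rewrite lin_cat /lin big_seq1.
have [_ h] := @multiplier_gt R d T P b _ L (W A) mb bB mL (measurable_funPT (W A)) LA a.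
have -> : (\1_(H `&` [set w | a < W A w]) : T -> R) = fun w => \1_H w * ((a < W A w)%R : nat)%:R.
  apply: funext => w; rewrite indicI/=; congr (_ * _); rewrite indicE.
  by case: (ltP a (W A w)) => aw; [rewrite mem_set|rewrite memNset//=; apply/negP; rewrite -leNgt].
by apply: h.
Qed.

Let expR_noise (k : seq (R * set (R * R))) : lall (@noise_set R) k ->
  P.-integrable setT (EFin \o (fun w => expR (lin W k w))).
Proof.
move=> nk; apply/integrableP; split.
  by apply/measurable_EFinP; apply: measurableT_comp => //; exact: measurable_lin.
under eq_integral do rewrite gee0_abs ?lee_fin ?expR_ge0//.
by rewrite lin_expR// ltry.
Qed.

(** The roles are now exchanged: the weight is the centred indicator of the event and the
    multipliers are functions of the future form [X]. The bounded approximations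
    [expR (n sin (X / n))] reach [expR X] by dominated convergence, with bound
    [expR X + expR (- X)]. *)
Let past_event_expR G : past_event G ->
  (\int[P]_(w in G) (expR (lin W m w))%:E = \int[P]_(w in G) (expR (lin_var m / 2))%:E)%E.
Proof.
move=> pG; have mG := past_event_measurable pG.
have mX := measurable_lin W m.
pose b w : R := \1_G w - fine (P G).
have PG : (fine (P G))%:E = P G by rewrite fineK// fin_num_measure.
have mb : measurable_fun setT b by apply: measurable_realfun.measurable_funB => //; exact: measurable_indic.
have bB w : `|b w| <= 1.
  have : 0 <= fine (P G) <= 1 by rewrite fine_ge0//= -lee_fin PG probability_le1.
  by rewrite /b indicE ler_norml => /andP[p0 p1]; case: (_ \in _) => /=; lra.
have i1 : P.-integrable setT (EFin \o (\1_G : T -> R)).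
  by apply: (@iRR _ 1); [exact: measurable_indic|move=> w; rewrite indicE; case: (_ \in _); rewrite ?normr1 ?normr0].
have ib : P.-integrable setT (EFin \o b) by exact: (@iRR _ 1).
pose L : set (T -> R) := [set f | exists s, f = fun w => s * lin W m w].
have mL l : L l -> measurable_fun setT l by move=> [s ->]; exact: measurable_funM.
have LX l c : L l -> L (fun w => l w + c * lin W m w).
  by move=> [s ->]; exists (s + c); apply: funext => w; rewrite mulrDl.
have o1 : orth P b L (cst 1).
  split => //; first by exists 1 => w; rewrite normr1.
  move=> _ e [s ->]; have [_ _ o] := orth_past s e pG.
  have ic : P.-integrable setT (EFin \o (fun w => cos (s * lin W m w + e))).
    by apply: (@iRR _ 1); [apply: mcos; exact: measurable_funM|move=> w; exact: cos_max].
  have i2 : P.-integrable setT (EFin \o (fun w => \1_G w * cos (s * lin W m w + e))).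
    apply: (@iRR _ 1); first by apply: measurable_funM; [exact: measurable_indic|apply: mcos; exact: measurable_funM].
    by move=> w; rewrite normrM mulr_ile1 ?cos_max// indicE; case: (_ \in _); rewrite ?normr1 ?normr0.
  have := o (lin W [::]) 0 (ex_intro2 _ _ [::] I erefl).
  pose k := \int[P]_w cos (s * lin W m w + e); rewrite -/k => h.
  have h' : \int[P]_w (\1_G w * cos (s * lin W m w + e) + (- k) * \1_G w) = 0.
    rewrite -[RHS]h; apply: eq_Rintegral => w _.
    by rewrite {2}/lin big_nil add0r cos0; ring.
  transitivity (\int[P]_w (\1_G w * cos (s * lin W m w + e) + (- fine (P G)) * cos (s * lin W m w + e))).
    by apply: eq_Rintegral => w _; rewrite /b/=; ring.
  rewrite -[RHS]h' !RintegralD//; last 2 first.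
  - exact: (integrableZl measurableT _ i1).
  - exact: (integrableZl measurableT _ ic).
  rewrite !RintegralZl// -/k; congr (_ + _).
  rewrite [X in _ = - k * X](_ : _ = fine (P G)); first by ring.
  by rewrite /Rintegral integral_indic// setIT.
have hn n : \int[P]_w (expR (n.+1%:R * sin (lin W m w / n.+1%:R)) * b w) = 0.
  have [_ h] := @multiplier_expR_sin R d T P b 1 L (lin W m) mb bB mL mX LX n.
  have [_ _ /(_ (fun w => 0 * lin W m w) 0)] := h _ o1.
  move=> /(_ (ex_intro _ 0 erefl)) h'; rewrite -[RHS]h'; apply: eq_Rintegral => w _ /=.
  by rewrite mul0r addr0 cos0 mulr1 mul1r.
have nm' : lall (@noise_set R) (lscale (-1) m) by rewrite lall_scale.
have [||||_] := @cvg_Rintegral_dominated R d T P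
  (fun n w => expR (n.+1%:R * sin (lin W m w / n.+1%:R)) * b w) (fun w => expR (lin W m w) * b w)
  (fun w => expR (lin W m w) + expR (lin W (lscale (-1) m) w)).
- move=> n; apply: measurable_funM => //; apply: measurableT_comp => //; apply: measurable_funM => //.
  apply: (measurableT_comp (continuous_measurable_fun (@continuous_sin R))).
  exact: measurable_funM.
- exact: (integrableD measurableT (expR_noise nm) (expR_noise nm')).
- move=> n w; rewrite normrM lin_scale mulN1r.
  apply: (@le_trans _ _ (expR `|lin W m w|)).
    rewrite -[leRHS]mulr1 (ger0_norm (expR_ge0 _)); apply: ler_pM => //.
    rewrite ler_expR; have [_ h] := sin_lip (lin W m w / n.+1%:R).
    apply: le_trans (ler_norm _) _; rewrite normrM ger0_norm//.
    apply: le_trans (ler_wpM2l _ h) _ => //; rewrite normrM normfV (ger0_norm (ler0n _ _)).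
    by rewrite mulrCA divff ?mulr1// pnatr_eq0.
  have [h|h] := leP 0 (lin W m w); first by rewrite ger0_norm// lerDl expR_ge0.
  by rewrite ltr0_norm// lerDr expR_ge0.
- move=> w; apply: cvgMl; apply: (@cvg_comp _ _ _ (fun n => n.+1%:R * sin (lin W m w / n.+1%:R)) expR _ _ _ (@cvg_scaled_sin R _)).
  exact: continuous_expR.
under eq_fun do rewrite hn.
move=> /(cvg_lim (@norm_hausdorff _ _)); rewrite lim_cst// => h0.
have iX := expR_noise nm.
have iXG : P.-integrable setT (EFin \o (fun w => expR (lin W m w) * \1_G w)).
  apply: (le_integrable measurableT _ _ iX).
  - apply/measurable_EFinP; apply: measurable_funM; last exact: measurable_indic.
    by apply: measurableT_comp.
  - move=> w _ /=; rewrite lee_fin normrM ler_piMr// indicE.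
    by case: (_ \in _); rewrite ?normr1 ?normr0.
have EX : \int[P]_w expR (lin W m w) = expR (lin_var m / 2) by rewrite /Rintegral lin_expR.
have e1 : \int[P]_w (expR (lin W m w) * \1_G w) = fine (P G) * expR (lin_var m / 2).
  have : \int[P]_w (expR (lin W m w) * \1_G w + (- fine (P G)) * expR (lin W m w)) = 0.
    by rewrite [RHS]h0; apply: eq_Rintegral => w _; rewrite /b; ring.
  rewrite RintegralD//; last exact: (integrableZl measurableT _ iX).
  rewrite RintegralZl// EX; lra.
rewrite [RHS](_ : _ = ((expR (lin_var m / 2))%:E * P G)%E); last exact: integral_cst.
rewrite -PG -EFinM mulrC -e1 /Rintegral fineK; last exact: integrable_fin_num.
rewrite [LHS]integral_mkcond; apply: eq_integral => w _; rewrite patchE indicE.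
by case: (_ \in _); rewrite ?mulr1 ?mulr0.
Qed.

(** Uniqueness of measures carries the identity from past and null events to the whole filtration;
    it then says that [V] has the same law under the weight [expR (lin W m)] and under the constant
    weight [expR (lin_var m / 2)]. *)
Lemma filtration_expR (V : T -> R) : (forall B, measurable B -> filtration W u0 t (V @^-1` B)) ->
  (forall w, 0 <= V w) ->
  (\int[P]_w (V w * expR (lin W m w - lin_var m / 2))%:E = \int[P]_w (V w)%:E)%E.
Proof.
move=> fV V0; pose G := past_event `|` [set N | measurable N /\ P N = 0%E].
have mX := measurable_lin W m.
have mV : measurable_fun setT V by move=> _ B mB; rewrite setTI; exact: (filtration_measurable (fV B mB)).
have Gm : G `<=` measurable by move=> A [/past_event_measurable|[]].
have GI : setI_closed G.
  have nI A B : measurable A -> measurable B -> P B = 0%E -> P (A `&` B) = 0%E.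
    by move=> mA mB B0; apply: (subset_measure0 _ mB) => //; exact: measurableI.
  move=> A B [pA|[mA A0]] [pB|[mB B0]]; [by left; exact: past_eventI|right..].
  - by have mA := past_event_measurable pA; split; [exact: measurableI|exact: nI].
  - have mB := past_event_measurable pB; split; first exact: measurableI.
    by rewrite setIC; exact: nI.
  - by split; [exact: measurableI|exact: nI].
have GF : filtration W u0 t `<=` <<s G >>.
  apply: smallest_sub; first exact: smallest_sigma_algebra.
  move=> E [[sE|sE]|nE].
  - by apply: sub_gen_smallest; left; exact: past_initial.
  - move: E sE; apply: smallest_sub; first exact: smallest_sigma_algebra.
    move=> _ [A pA [B mB ->]].
    suff : measurable_fun [set: g_sigma_algebraType G] (W A : g_sigma_algebraType G -> R).
      by move=> /(_ measurableT B mB); rewrite setTI.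
    apply: (measurability _ (RGenOInfty.measurableE R)) => _ [_ [a ->] <-]; rewrite setTI.
    apply: sub_gen_smallest; left; rewrite -[X in past_event X]setTI.
    rewrite (_ : _ @^-1` _ = [set w | a < W A w]); last by apply/seteqP; split => w; rewrite /= in_itv/= andbT.
    apply: past_noise => //; apply: past_initial.
    exact: (@measurableT _ (g_sigma_algebraType _)).
  - by apply: sub_gen_smallest; right.
have mp : measurable_fun setT (fun w => expR (lin W m w)) by exact: measurableT_comp.
have e1 := @integral_weight_unique _ T R P (fun w => expR (lin W m w)) (cst (expR (lin_var m / 2))) mp
  (measurable_cst _) (fun w => expR_ge0 _) (fun w => expR_ge0 _) G Gm GI.
have GT : G setT by left; apply: past_initial; exact: (@measurableT _ (g_sigma_algebraType _)).
have foo : (\int[P]_w (expR (lin W m w))%:E < +oo)%E by rewrite lin_expR// ltry.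
have {}e1 := e1 GT foo _.
have eG A : G A -> (\int[P]_(w in A) (expR (lin W m w))%:E = \int[P]_(w in A) (cst (expR (lin_var m / 2)) w)%:E)%E.
  move=> [/past_event_expR//|[mA A0]].
  by rewrite !null_set_integral//; apply/measurable_EFinP; exact: measurable_funTS.
have := @integral_law_weight _ T R P (fun w => expR (lin W m w)) (cst (expR (lin_var m / 2))) mp
  (measurable_cst _) (fun w => expR_ge0 _) (fun w => expR_ge0 _) V (fun x => `|x|) mV
  (fun B mB => e1 eG _ (GF _ (fV B mB))) (@normr_measurable _ setT) (@normr_ge0 _ _).
under eq_integral do rewrite ger0_norm//.
under [X in _ = X -> _]eq_integral do rewrite ger0_norm// mulrC EFinM.
rewrite ge0_integralZl_EFin ?expR_ge0//; last 2 first.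
- by move=> w _; rewrite lee_fin.
- exact/measurable_EFinP.
move=> h; transitivity (\int[P]_w ((expR (- (lin_var m / 2)))%:E * (V w * expR (lin W m w))%:E))%E.
  by apply: eq_integral => w _; rewrite expRD -EFinM; congr EFin; ring.
rewrite ge0_integralZl_EFin ?expR_ge0//.
- by rewrite h muleA -EFinM -expRD addNr expR0 mul1e.
- by move=> w _; rewrite lee_fin mulr_ge0// expR_ge0.
- by apply/measurable_EFinP; exact: measurable_funM.
Qed.

End independence.

(** * Walsh integrals *)

Section simple_processes.
Context {R : realType} {d : measure_display} {T : measurableType d} (P : probability T R).
Variables (W : set (R * R) -> {RV P >-> R}) (u0 : T -> R -> R).
Hypotheses (hW : white_noise W) (hu0 : initial_datum W u0).
Local Notation stm := ((@lebesgue_measure R \x @lebesgue_measure R)%E).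
Local Notation F := (filtration W u0).

Definition fgen (t : R) : set (set T) :=
  sigma_gen [set: R] (fun x w => u0 w x) `|`
  sigma_gen [set A | noise_set A /\ A `<=` `[0, t] `*` @torus R] W `|`
  [set N | measurable N /\ P N = 0%E].

(** Measurability for the measurable type generated by [fgen t], so that the closure properties of
    measurable functions apply to adapted variables as they are. *)
Definition adapted (t : R) (V : T -> R) : Prop :=
  measurable_fun [set: g_sigma_algebraType (fgen t)] (V : g_sigma_algebraType (fgen t) -> R).

Lemma adaptedP t V : adapted t V <-> forall B, measurable B -> F t (V @^-1` B).
Proof.
split=> [h B mB|h _ B mB]; last by rewrite setTI; exact: h.
by have := h measurableT B mB; rewrite setTI.
Qed.

Lemma filtration_mono s t : s <= t -> F s `<=` F t.
Proof.
move=> st; apply: sub_sigma_algebra2 => E [[h|h]|h]; [by left; left| |by right].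
left; right; move: h; rewrite /sigma_gen; apply: sub_sigma_algebra2 => E' [A [nA sA] h]; exists A => //; split => //.
by move=> z /sA[/= + ?]; rewrite !in_itv/= => /andP[? /le_trans->//]; rewrite andbT.
Qed.

Lemma adapted_mono s t V : s <= t -> adapted s V -> adapted t V.
Proof. by move=> st /adaptedP h; apply/adaptedP => B mB; apply: filtration_mono st _ (h B mB). Qed.

Lemma adapted_measurable t V : adapted t V -> measurable_fun setT V.
Proof.
by move=> /adaptedP h _ B mB; rewrite setTI; exact: (filtration_measurable hu0 (h B mB)).
Qed.

Lemma adapted_noise t A : past t A -> adapted t (W A).
Proof.
move=> pA; apply/adaptedP => B mB; apply: sub_gen_smallest; left; right.
by apply: sub_gen_smallest; exists A => //; exists B.
Qed.

Definition boundedf (c : T -> R) : Prop := exists M : R, forall w, `|c w| <= M.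

Definition wform := seq ((T -> R) * set (R * R)).

Definition at_point (l : wform) (w : T) : seq (R * set (R * R)) := [seq (p.1 w, p.2) | p <- l].

Fixpoint wall {T2 : Type} (Q : set (T2 -> R)) (Q' : set (set (R * R))) (l : seq ((T2 -> R) * set (R * R))) : Prop :=
  if l is p :: l' then [/\ Q p.1, Q' p.2 & wall Q Q' l'] else True.

(** Rounding down to a multiple of [1 / (n + 1)]; the shift by [M] makes the argument of [truncn]
    nonnegative when [|x| <= M]. *)
Definition grid (n M : nat) (x : R) : R := (Num.truncn ((x + M%:R) * n.+1%:R))%:R / n.+1%:R - M%:R.

Lemma cvg_grid M (x : R) : `|x| <= M%:R -> grid n M x @[n --> \oo] --> x.
Proof.
rewrite ler_norml => /andP[x1 x2]; apply/cvgrPdist_le => e e0.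
have /cvgrPdist_le/(_ _ e0) := @cvg_harmonic R; apply: filterS => n; rewrite sub0r normrN.
rewrite ger0_norm ?invr_ge0// => ne; have n0 : (0 : R) < n.+1%:R by [].
have /truncn_itv/andP[k1 k2] : 0 <= (x + M%:R) * n.+1%:R by rewrite mulr_ge0//; lra.
rewrite /grid; set k := Num.truncn _ in k1 k2 *.
have j1 : k%:R / n.+1%:R <= x + M%:R by rewrite ler_pdivrMr.
have j2 : x + M%:R <= k%:R / n.+1%:R + n.+1%:R^-1.
  have -> : k%:R / n.+1%:R + n.+1%:R^-1 = k.+1%:R / n.+1%:R :> R by rewrite -[k.+1%:R]natr1 mulrDl mul1r.
  by rewrite ler_pdivlMr// ltW.
rewrite /harmonic/= in ne; move: (k%:R / n.+1%:R : R) (n.+1%:R^-1 : R) j1 j2 ne => a b j1 j2 be.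
by rewrite ler_norml; lra.
Qed.

(** One coefficient at a time is frozen. On the event [G k] where its rounding takes its [k]-th
    value it is a constant and joins the deterministic form [l0], while the indicator of [G k],
    which is adapted, joins [V]. *)
Let expR_grid t n (l0 : seq (R * set (R * R))) (l : wform) V :
  lall (future t) l0 -> wall [set c | adapted t c /\ boundedf c] (future t) l ->
  adapted t V -> (forall w, 0 <= V w) -> forall (Ms : seq nat),
  (size Ms = size l) -> (forall i w, (i < size l)%N -> `|(nth (cst 0, set0) l i).1 w| <= (nth 0%N Ms i)%:R) ->
  let L w := l0 ++ [seq (grid n q.2 (q.1.1 w), q.1.2) | q <- zip l Ms] in
  measurable_fun setT (fun w => V w * expR (lin W (L w) w - lin_var (L w) / 2)) /\
  (\int[P]_w (V w * expR (lin W (L w) w - lin_var (L w) / 2))%:E = \int[P]_w (V w)%:E)%E.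
Proof.
elim: l l0 V => [|[c A] l ih] l0 V f0 fl aV V0 [|M Ms] //= => [_ _|[sz] hM].
  rewrite cats0; split; last exact: (filtration_expR hW hu0 f0 (proj1 (adaptedP t V) aV) V0).
  apply: measurable_funM; first exact: adapted_measurable aV.
  apply: measurableT_comp => //; apply: measurable_realfun.measurable_funB => //; exact: measurable_lin.
have [[ac bc] fA wl] := fl.
(* Since [|c| <= M], the index of the rounded value is at most [2 M (n + 1)]. *)
pose K := (M * 2 * n.+1).+1.
pose G (k : nat) : set T := [set w | Num.truncn ((c w + M%:R) * n.+1%:R) = k].
have hM0 w : `|c w| <= M%:R by have := hM 0%N w; apply.
have aG k : adapted t (\1_(G k)).
  apply: measurable_indic; rewrite /G.
  have -> : [set w | Num.truncn ((c w + M%:R) * n.+1%:R) = k] =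
      (fun w => (c w + M%:R) * n.+1%:R) @^-1` `[k%:R, k.+1%:R[%classic.
    apply/seteqP; split => w /=; rewrite in_itv/=.
      move=> <-; apply: truncn_itv; rewrite mulr_ge0//.
      by have := hM0 w; rewrite ler_norml; lra.
    by move=> /truncn_def.
  rewrite -[X in measurable X]setTI.
  suff : adapted t (fun w => (c w + M%:R) * n.+1%:R) by apply => //.
  by apply: measurable_funM => //; apply: measurable_realfun.measurable_funD.
have aVG k : adapted t (fun w => V w * \1_(G k) w) by apply: measurable_funM => //; exact: aG.
have VG0 k w : 0 <= V w * \1_(G k) w by rewrite mulr_ge0// indicE.
have sumG w : \sum_(k < K) \1_(G k) w = 1 :> R.
  have kK : (Num.truncn ((c w + M%:R) * n.+1%:R) < K)%N.
    rewrite /K ltnS truncn_le_nat; have /ler_normlP[_ cM] := hM0 w.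
    apply: (@le_lt_trans _ _ ((M * 2 * n.+1)%:R)); last by rewrite ltr_nat.
    by rewrite natrM ler_wpM2r// natrM; lra.
  rewrite (bigD1 (Ordinal kK))//= big1 ?addr0.
    by rewrite indicE mem_set.
  move=> i ik; rewrite indicE memNset// => h; move/eqP: ik; apply; apply: val_inj => /=; exact/esym.
pose L' k w := rcons l0 (k%:R / n.+1%:R - M%:R, A) ++ [seq (grid n q.2 (q.1.1 w), q.1.2) | q <- zip l Ms].
have fk k : lall (future t) (rcons l0 (k%:R / n.+1%:R - M%:R, A)).
  by rewrite -cats1 lall_cat.
have IH (k : nat) := ih _ _ (fk k) wl (aVG k) (VG0 k) Ms sz (fun i w => hM i.+1 w).
have mL k : measurable_fun setT (fun w => V w * \1_(G k) w * expR (lin W (L' k w) w - lin_var (L' k w) / 2)).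
  by have [] := IH k.
have e1 w : V w * expR (lin W ((l0 ++ (grid n M (c w), A) :: [seq (grid n q.2 (q.1.1 w), q.1.2) | q <- zip l Ms])) w -
    lin_var (l0 ++ (grid n M (c w), A) :: [seq (grid n q.2 (q.1.1 w), q.1.2) | q <- zip l Ms]) / 2) =
    \sum_(k < K) (V w * \1_(G k) w * expR (lin W (L' k w) w - lin_var (L' k w) / 2)).
  rewrite -[LHS]mulr1 -(sumG w) mulr_sumr; apply: eq_bigr => k _.
  rewrite indicE; case: (boolP (w \in G k)) => [/set_mem wk|_]; last by rewrite !mulr0 mul0r.
  by rewrite !mulr1 /L' cat_rcons /grid wk.
split; first by under eq_fun do rewrite e1; apply: measurable_sum => k; exact: mL.
under eq_integral do rewrite e1 -sumEFin.
rewrite ge0_integral_sum//; last 2 first.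
- by move=> k; exact/measurable_EFinP.
- by move=> k w _; rewrite lee_fin mulr_ge0// expR_ge0.
under eq_bigr => k _ do rewrite (IH k).2.
rewrite -ge0_integral_sum//; last 2 first.
- by move=> k; apply/measurable_EFinP; exact: adapted_measurable (aVG k).
- by move=> k w _; rewrite lee_fin.
apply: eq_integral => w _; rewrite sumEFin; congr EFin.
by rewrite -mulr_sumr sumG mulr1.
Qed.

Lemma measurable_weighted_sum d2 (T2 : measurableType d2) (X : set (R * R) -> T2 -> R)
    (l : seq ((T2 -> R) * set (R * R))) (Q : set (T2 -> R)) (Q' : set (set (R * R))) :
  (forall c, Q c -> measurable_fun setT c) -> (forall A, Q' A -> measurable_fun setT (X A)) ->
  wall Q Q' l ->
  measurable_fun setT (fun w => \sum_(p <- l) p.1 w * X p.2 w).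
Proof.
move=> mQ mX; elim: l => [_|p l ih [Qp Q'p wl]].
  by under eq_fun do rewrite big_nil; exact: measurable_cst.
under eq_fun do rewrite big_cons.
apply: measurable_realfun.measurable_funD; last exact: ih.
by apply: measurable_funM; [exact: mQ|exact: mX].
Qed.

Lemma measurable_weighted_var d2 (T2 : measurableType d2)
    (l : seq ((T2 -> R) * set (R * R))) (Q : set (T2 -> R)) (Q' : set (set (R * R))) :
  (forall c, Q c -> measurable_fun setT c) ->
  wall Q Q' l ->
  measurable_fun setT (fun w => lin_var [seq (p.1 w, p.2) | p <- l]).
Proof.
move=> mQ wl; rewrite /lin_var; under eq_fun do rewrite big_map.
have e w : \sum_(p <- l) \sum_(q <- [seq (p0.1 w, p0.2) | p0 <- l]) (p.1 w * q.1) * fine (spacetime_measure (p.2 `&` q.2)) =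
    \sum_(p <- l) p.1 w * \sum_(q <- l) q.1 w * fine (spacetime_measure (p.2 `&` q.2)).
  apply: eq_bigr => p _; rewrite big_map mulr_sumr; apply: eq_bigr => q _; by rewrite mulrA.
under eq_fun do rewrite e.
apply: (@measurable_weighted_sum _ T2 (fun A w => \sum_(q <- l) q.1 w * fine (spacetime_measure (A `&` q.2))) l Q Q') => // A _.
exact: (@measurable_weighted_sum _ T2 (fun B _ => fine (spacetime_measure (A `&` B))) l Q Q').
Qed.

Lemma wallW (Q : set (T -> R)) Q' (S : set (T -> R)) S' l : Q `<=` S -> Q' `<=` S' -> wall Q Q' l -> wall S S' l.
Proof. by move=> QS QS'; elim: l => //= p l ih [/QS ? /QS' ? /ih]. Qed.

(** The coefficients are rounded so as to take finitely many values, and the rounding is then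
    refined. Fatou's lemma leaves an inequality, which is what a supermartingale needs. *)
Lemma filtration_expR_le t l V : wall [set c | adapted t c /\ boundedf c] (future t) l ->
  adapted t V -> (forall w, 0 <= V w) ->
  (\int[P]_w (V w * expR (lin W (at_point l w) w - lin_var (at_point l w) / 2))%:E <= \int[P]_w (V w)%:E)%E.
Proof.
move=> wl aV V0; have [Ms [sz hM]] : exists Ms : seq nat, size Ms = size l /\
    forall i w, (i < size l)%N -> `|(nth (cst 0, set0) l i).1 w| <= (nth 0%N Ms i)%:R.
  elim: l wl => [_|p l ih [[_ [B pB]] _ wl]]; first by exists [::].
  have [Ms [sz hM]] := ih wl; exists (Num.bound `|B| :: Ms); split; first by rewrite /= sz.
  move=> [|i] w /=; last by rewrite ltnS; exact: hM.
  by move=> _; exact: (le_trans (pB w) (le_trans (ler_norm B) (ltW (archi_boundP (normr_ge0 B))))).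
have hn n := expR_grid n (l0 := [::]) I wl aV V0 sz hM.
pose L n w := [seq (grid n q.2 (q.1.1 w), q.1.2) | q <- zip l Ms].
pose f n w := (V w * expR (lin W (L n w) w - lin_var (L n w) / 2))%:E.
have zipl w : at_point l w = [seq (q.1.1 w, q.1.2) | q <- zip l Ms].
  by rewrite /at_point -[in LHS](@unzip1_zip _ _ l Ms) ?sz// /unzip1 -map_comp.
have hq q w : List.In q (zip l Ms) -> `|q.1.1 w| <= q.2%:R.
  elim: l Ms {wl hn L f zipl} sz hM => [|p l ih] [|M Ms]//= [sz] hM [<-|qin].
    exact: (hM 0%N w).
  by apply: ih sz _ qin => i v; exact: (hM i.+1).
have cL w : (f n w @[n --> \oo] --> (V w * expR (lin W (at_point l w) w - lin_var (at_point l w) / 2))%:E)%E.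
  apply: cvg_EFin; first exact: nearW.
  apply: cvgMr; apply: (@cvg_comp _ _ _ _ expR _ _ _ _ (@continuous_expR R _)).
  have cs (I : Type) (s : seq I) (g : nat -> I -> R) (h : I -> R) :
      (forall i, List.In i s -> g n i @[n --> \oo] --> h i) ->
      \sum_(i <- s) g n i @[n --> \oo] --> \sum_(i <- s) h i.
    elim: s => [_|i s ih hs]; first by under eq_cvg do rewrite big_nil; rewrite big_nil; exact: cvg_cst.
    rewrite big_cons; under eq_cvg do rewrite big_cons.
    by apply: cvgD; [apply: hs; left|apply: ih => j js; apply: hs; right].
  have cg q : List.In q (zip l Ms) -> grid n q.2 (q.1.1 w) @[n --> \oo] --> q.1.1 w.
    by move=> qin; apply: cvg_grid; exact: hq.
  have eL (g : (T -> R) * set (R * R) * nat -> R) : lin_var [seq (g q, q.1.2) | q <- zip l Ms] =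
      \sum_(q <- zip l Ms) \sum_(r <- zip l Ms) g q * g r * fine (spacetime_measure (q.1.2 `&` r.1.2)).
    by rewrite /lin_var big_map; apply: eq_bigr => q _; rewrite big_map.
  rewrite zipl; apply: cvgB.
    rewrite /lin big_map; under eq_cvg do rewrite /L big_map.
    by apply: (cs _ (zip l Ms) (fun n q => grid n q.2 (q.1.1 w) * W q.1.2 w) (fun q => q.1.1 w * W q.1.2 w)) => q qin; apply: cvgMl; exact: cg.
  apply: cvgMl; rewrite eL; under eq_cvg do rewrite /L eL.
  apply: (cs _ (zip l Ms) (fun n q => \sum_(r <- zip l Ms) grid n q.2 (q.1.1 w) * grid n r.2 (r.1.1 w) * fine (spacetime_measure (q.1.2 `&` r.1.2)))
    (fun q => \sum_(r <- zip l Ms) q.1.1 w * r.1.1 w * fine (spacetime_measure (q.1.2 `&` r.1.2)))) => q qin.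
  apply: (cs _ (zip l Ms) (fun n r => grid n q.2 (q.1.1 w) * grid n r.2 (r.1.1 w) * fine (spacetime_measure (q.1.2 `&` r.1.2)))
    (fun r => q.1.1 w * r.1.1 w * fine (spacetime_measure (q.1.2 `&` r.1.2)))) => r rin.
  by apply: cvgMl; apply: cvgM; exact: cg.
apply: (@le_trans _ _ (\int[P]_w limn_einf (f^~ w))%E).
  rewrite le_eqVlt; apply/orP; left; apply/eqP; apply: eq_integral => w _.
  rewrite is_cvg_limn_einfE; last by apply/cvg_ex; eexists; exact: cL.
  by apply/esym/cvg_lim => //; exact: cL.
apply: le_trans (fatou P measurableT _ _) _.
- by move=> n; apply/measurable_EFinP; exact: (hn n).1.
- by move=> n w _; rewrite lee_fin mulr_ge0// expR_ge0.
under [X in limn_einf X]eq_fun do rewrite (hn _).2.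
have c : (fun _ : nat => \int[P]_w (V w)%:E)%E n @[n --> \oo] --> (\int[P]_w (V w)%:E)%E by exact: cvg_cst.
by rewrite is_cvg_limn_einfE; [rewrite (cvg_lim _ c)|apply/cvg_ex; eexists; exact: c].
Qed.

Local Notation elem := (elementary F).

Definition eform (es : seq elem) : wform := [seq (coef e, box e) | e <- es].

Lemma simple_integralE es w : simple_integral W es w = lin W (at_point (eform es) w) w.
Proof. by rewrite /simple_integral /lin /at_point /eform !big_map. Qed.

Lemma box_noise (e : elem) : noise_set (box e).
Proof.
have mb : measurable (box e) by apply: measurableX; [exact: measurable_itv|exact: cell_measurable].
split => //.
  move=> z [/=]; rewrite in_itv/= => /andP[z1 _] z2; split; last exact: (@cell_torus _ _ _ _ e).
  by rewrite /= in_itv/= andbT; apply: le_trans (ltW z1); exact: tmin_ge0.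
rewrite /spacetime_measure product_measure1E//; last exact: cell_measurable.
apply: lte_mul_pinfty => //.
- have h : lebesgue_measure (`]tmin e, tmax e]%classic : set R) \is a fin_num.
    by rewrite lebesgue_measure_itv /=; case: ifP => // _; rewrite -EFinB fin_numE.
  exact: h.
- apply: (@le_lt_trans _ _ (lebesgue_measure (@torus R))).
    apply: le_measure; rewrite ?inE; [exact: cell_measurable|exact: measurable_itv|].
    exact: (@cell_torus _ _ _ _ e).
  have h : (lebesgue_measure (@torus R) < +oo)%E.
    by rewrite lebesgue_measure_itv /=; case: ifP => // _; rewrite -EFinB ltry.
  exact: h.
Qed.

Lemma box_noises es w : lall (@noise_set R) (at_point (eform es) w).
Proof. by elim: es => //= e es ih; split => //; exact: box_noise. Qed.

Lemma simple_process_int es w :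
  (\int[stm]_(z in @spacetime R) (simple_process es z w ^+ 2)%:E =
   (lin_var (at_point (eform es) w))%:E)%E.
Proof.
rewrite -lin_var_int; last exact: box_noises.
by apply: eq_integral => z _; rewrite /simple_process /at_point /eform !big_map.
Qed.

(** The coefficient is kept; an element that starts at [t] or later gets an empty box. *)
Definition cut_above (t : R) (e : elem) : elem :=
  Elementary (Num.min (tmax e) t) (coef_bounded e) (@coef_measurable _ _ _ _ e) (tmin_ge0 e)
    (cell_measurable e) (@cell_torus _ _ _ _ e).

Definition strip_above (t : R) (e : elem) : set (R * R) := box e `&` [set z | t < z.1].

Lemma strip_above_future t e : future t (strip_above t e).
Proof.
have [mb sb fb] := box_noise e.
have mh : measurable [set z : R * R | t < z.1].
  rewrite (_ : [set _ | _] = `]t, +oo[%classic `*` setT).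
    by apply: measurableX => //; exact: measurable_itv.
  by apply/seteqP; split => z /=; rewrite in_itv/= andbT; [move=> ?; split|case].
have ms : measurable (strip_above t e) by exact: measurableI.
split; last by move=> z [].
split => //; first by move=> z [/sb].
apply: le_lt_trans fb; apply: (le_measure stm); rewrite ?inE//.
by move=> z [].
Qed.

Lemma box_split t e : box e = box (cut_above t e) `|` strip_above t e /\
  box (cut_above t e) `&` strip_above t e = set0.
Proof.
split; apply/seteqP; split => z //=.
- move=> [/= + ze]; rewrite in_itv/= => /andP[z1 z2].
  have [zt|zt] := leP z.1 t; [left|right].
    by split => //=; rewrite in_itv/= z1 le_min z2 zt.
  by split => //; split => //=; rewrite in_itv/= z1.
- move=> [[/= + ze]|[]//]; rewrite in_itv/= => /andP[z1]; rewrite le_min => /andP[z2 _].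
  by split => //=; rewrite in_itv/= z1.
- move=> [[/=]]; rewrite in_itv/= le_min => /andP[_ /andP[_ zt]] _ [_ /=].
  by rewrite ltNge zt.
Qed.

Lemma box_split_noise t e :
  {ae P, forall w, W (box e) w = W (box (cut_above t e)) w + W (strip_above t e) w}.
Proof.
have [e1 e2] := box_split t e; have [ns _] := strip_above_future t e.
have := noise_additive hW (box_noise (cut_above t e)) ns e2.
by apply: filterS => w <-; rewrite -e1.
Qed.

Fixpoint eall (Q : elem -> Prop) (es : seq elem) : Prop :=
  if es is e :: es' then Q e /\ eall Q es' else True.

Lemma ae_list (I : Type) (s : seq I) (Q : I -> T -> Prop) : (forall i, {ae P, forall w, Q i w}) ->
  {ae P, forall w, (fix all s := if s is i :: s' then Q i w /\ all s' else True) s}.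
Proof.
move=> h; elim: s => [|i s ih]; first exact: aeW.
by apply: filterS2 (h i) ih => w; split.
Qed.

Definition strips (t : R) (es : seq elem) : wform := [seq (coef e, strip_above t e) | e <- es].

Lemma simple_integral_split t es : {ae P, forall w, simple_integral W es w =
  simple_integral W [seq cut_above t e | e <- es] w + lin W (at_point (strips t es) w) w}.
Proof.
apply: filterS (ae_list es (box_split_noise t)) => w.
elim: es => [_|e es ih /= [ew /ih]].
  by rewrite /simple_integral /lin !big_nil addr0.
rewrite /simple_integral /lin !big_cons /= => ->; rewrite ew; ring.
Qed.

Lemma indic_split t e z : \1_(box e) z = \1_(box (cut_above t e)) z + \1_(strip_above t e) z :> R.
Proof.
have [e1 e2] := box_split t e; rewrite {1}e1 !indicE in_setU.
have : ~ ((z \in box (cut_above t e)) /\ (z \in strip_above t e)).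
  by move=> [/set_mem a /set_mem b]; have : (box (cut_above t e) `&` strip_above t e) z by []; rewrite e2.
by case: (_ \in _); case: (_ \in _) => //= h; rewrite ?addr0 ?add0r//; case: h.
Qed.

(** The split list represents the same simple function as the original one, and its two parts live
    on disjoint time strips. *)
Lemma lin_var_split t es w : lin_var (at_point (eform es) w) =
  lin_var (at_point (eform [seq cut_above t e | e <- es]) w) + lin_var (at_point (strips t es) w).
Proof.
have sf : lall (future t) (at_point (strips t es) w).
  by elim: es => //= e es ih; split => //; exact: strip_above_future.
have pf : lall [set A | noise_set A /\ forall z, A z -> z.1 <= t] (at_point (eform [seq cut_above t e | e <- es]) w).
  elim: es {sf} => //= e es ih; split => //; split; first exact: box_noise.
  by move=> z [/=]; rewrite in_itv/= le_min => /andP[_ /andP[]].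
rewrite -(@lin_var_cat _ [set A | noise_set A /\ forall z, A z -> z.1 <= t] (future t))//; last first.
  move=> A B [_ h1] [_ h2]; rewrite -subset0 => z [/h1 + /h2]; by rewrite leNgt => /negP.
apply: EFin_inj; rewrite -!lin_var_int; first last.
- exact: box_noises.
- by rewrite lall_cat; split; [exact: box_noises|apply: lall_sub sf => A []].
apply: eq_integral => z _; congr ((_ ^+ 2)%:E).
rewrite big_cat/= /at_point /eform /strips !big_map -big_split/=.
by apply: eq_bigr => e _; rewrite (indic_split t) mulrDr.
Qed.

Lemma adapted_simple t es : eall (fun e => tmin e <= t) es ->
  adapted t (fun w => simple_integral W [seq cut_above t e | e <- es] w) /\
  adapted t (fun w => lin_var (at_point (eform [seq cut_above t e | e <- es]) w)).
Proof.
move=> hs; have wl : wall (adapted t) (past t) (eform [seq cut_above t e | e <- es]).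
  elim: es hs => //= e es ih [et /ih]; split => //.
    by apply: (adapted_mono et); apply/adaptedP; exact: (@coef_measurable _ _ _ _ e).
  split; first exact: box_noise.
  move=> z [/=]; rewrite in_itv/= le_min => /andP[z1 /andP[_ zt]] ze; split; last exact: (@cell_torus _ _ _ _ e).
  by rewrite /= in_itv/= zt andbT; apply: le_trans (ltW z1); exact: tmin_ge0.
split; last exact: (@measurable_weighted_var _ (g_sigma_algebraType (fgen t)) _ (adapted t) (past t) (fun c h => h) wl).
rewrite (_ : (fun w => simple_integral W _ w) = fun w => \sum_(p <- eform [seq cut_above t e | e <- es]) p.1 w * W p.2 w).
  apply: (@measurable_weighted_sum _ (g_sigma_algebraType (fgen t)) (fun A w => W A w) _ (adapted t) (past t) (fun c h => h) _ wl).
  exact: adapted_noise.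
by apply: funext => w; rewrite /simple_integral /eform [in RHS]big_map.
Qed.

Lemma measurable_at_point l : wall (measurable_fun setT) setT l ->
  measurable_fun setT (fun w => lin W (at_point l w) w) /\
  measurable_fun setT (fun w => lin_var (at_point l w)).
Proof.
move=> wl; split; last exact: (@measurable_weighted_var _ T _ _ _ (fun c h => h) wl).
rewrite (_ : (fun w => lin W _ w) = fun w => \sum_(p <- l) p.1 w * W p.2 w).
  by apply: (@measurable_weighted_sum _ T (fun A w => W A w) _ _ _ (fun c h => h) _ wl) => A _; exact: measurable_funPT.
by apply: funext => w; rewrite /lin /at_point big_map.
Qed.

Lemma coef_adapted (e : elem) : adapted (tmin e) (coef e).
Proof. by apply/adaptedP; exact: (@coef_measurable _ _ _ _ e). Qed.
Arguments coef_adapted : clear implicits.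

Lemma measurable_simple es : measurable_fun setT (simple_integral W es) /\
  measurable_fun setT (fun w => lin_var (at_point (eform es) w)).
Proof.
have mc (e : elem) : measurable_fun setT (coef e) by exact: adapted_measurable (coef_adapted e).
have wl : wall (measurable_fun setT) setT (eform es).
  by elim: es => //= e es ih; split.
have [] := measurable_at_point wl.
by under eq_fun do rewrite -simple_integralE.
Qed.

(** [W set0] vanishes almost surely, by additivity. Removing the elements emptied by a cut is what
    makes the induction on the number of terms descend. *)
Lemma drop_empty (p : pred elem) (f : elem -> elem) es : (forall e, ~~ p (f e) -> box (f e) = set0) ->
  {ae P, forall w, simple_integral W (map f es) w = simple_integral W [seq e <- map f es | p e] w} /\
  forall w, lin_var (at_point (eform (map f es)) w) = lin_var (at_point (eform [seq e <- map f es | p e]) w).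
Proof.
move=> pe; have n0 : noise_set (set0 : set (R * R)).
  by split => //; rewrite /spacetime_measure measure0.
split.
  have := noise_additive hW n0 n0 (setI0 _); rewrite setU0; apply: filterS => w w0.
  have {}w0 : W set0 w = 0 by lra.
  rewrite /simple_integral big_filter [in RHS]big_mkcond !big_map; apply: eq_bigr => e _.
  by case: ifPn => // /pe ->; rewrite w0 mulr0.
move=> w; apply: EFin_inj; rewrite -!simple_process_int; apply: eq_integral => z _.
congr ((_ ^+ 2)%:E); rewrite /simple_process big_filter [in RHS]big_mkcond !big_map; apply: eq_bigr => e _.
by case: ifPn => // /pe ->; rewrite indic0 mulr0.
Qed.

(* Conditioning on the last of the times [tmin e]: beyond it the integral is a linear form in the
   noise with frozen coefficients, and the rest is a simple integral with fewer terms. *)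
Lemma exponential_supermartingale es :
  (\int[P]_w (expR (simple_integral W es w - lin_var (at_point (eform es) w) / 2))%:E <= 1)%E.
Proof.
elim: (size es).+1 {-2}es (ltnSn (size es)) => // n ih {}es; rewrite ltnS => sz.
case: es sz => [_|e0 es0].
  under eq_integral do rewrite /simple_integral /lin_var !big_nil mul0r subr0 expR0.
  by rewrite integral_cst// mul1e; exact: probability_le1.
set es := e0 :: es0 => sz.
have [t [ht hs]] : exists t, eall (fun e => tmin e <= t) es /\ has (predC (fun e => tmin e < t)) es.
  rewrite /es; elim: es0 e0 {es sz} => [|e1 es ih1] e0.
    by exists (tmin e0); rewrite /= ltxx.
  have [t [ht hs]] := ih1 e1; have [te|te] := leP (tmin e0) t.
    by exists t; split; [split|rewrite /= in hs *; rewrite hs orbT].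
  exists (tmin e0); split; last by rewrite /= ltxx.
  split => //; move: ht; elim: (e1 :: es) => //= e s ihs [h1 /ihs h2]; split => //.
  exact: le_trans h1 (ltW te).
pose es1 := [seq cut_above t e | e <- es]; pose es2 := [seq e <- es1 | tmin e < t].
pose V w := expR (simple_integral W es1 w - lin_var (at_point (eform es1) w) / 2).
have [aI aQ] := adapted_simple ht.
have aV : adapted t V.
  apply: measurableT_comp => //; apply: measurable_realfun.measurable_funB => //.
  exact: measurable_funM.
have wl : wall [set c | adapted t c /\ boundedf c] (future t) (strips t es).
  move: ht; elim: es {sz hs es1 es2 V aI aQ aV} => //= e s ihs [h1 /ihs h2]; split => //.
  - by split; [apply: adapted_mono h1 _; exact: coef_adapted|exact: coef_bounded].
  - exact: strip_above_future.
have [mI mQ] := measurable_simple es; have [mI1 mQ1] := measurable_simple es1.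
have [mI2 mQ2] := measurable_simple es2.
have ms : [set c | adapted t c /\ boundedf c] `<=` measurable_fun setT by move=> c [+ _]; exact: adapted_measurable.
have [mL mLv] := measurable_at_point (wallW ms (@subsetT _ _) wl).
have mE (f g : T -> R) : measurable_fun setT f -> measurable_fun setT g ->
    measurable_fun setT (fun w => expR (f w - g w / 2)).
  move=> mf mg; apply: measurableT_comp => //; apply: measurable_realfun.measurable_funB => //.
  exact: measurable_funM.
have [|d1 d2] := @drop_empty (fun e => tmin e < t) (cut_above t) es.
  move=> e; rewrite -leNgt => te; rewrite -subset0 => z [/=]; rewrite in_itv/= le_min => /andP[z1 /andP[_ z2]] _.
  by have := lt_le_trans z1 (le_trans z2 te); rewrite ltxx.
rewrite (@ae_eq_integral _ _ _ P setT (fun w => (V w * expR (lin W (at_point (strips t es) w) w - lin_var (at_point (strips t es) w) / 2))%:E))//; last 3 first.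
- by apply/measurable_EFinP; exact: mE.
- apply/measurable_EFinP; apply: measurable_funM; last exact: mE.
  exact: adapted_measurable aV.
- apply: filterS (simple_integral_split t es) => w ew _.
  congr EFin; rewrite /V -expRD ew (lin_var_split t); congr expR; rewrite -/es1; ring.
apply: le_trans (filtration_expR_le wl aV (fun w => expR_ge0 _)) _.
rewrite (@ae_eq_integral _ _ _ P setT (fun w => (expR (simple_integral W es2 w - lin_var (at_point (eform es2) w) / 2))%:E))//; last 3 first.
- by apply/measurable_EFinP; exact: adapted_measurable aV.
- by apply/measurable_EFinP; exact: mE.
- by apply: filterS d1 => w ew _; rewrite /V ew d2.
(* The time [t] is attained by some [tmin e], so at least one element is dropped. *)
apply: ih; apply: leq_trans sz; rewrite /es2 size_filter count_map.
by rewrite -(count_predC (fun e => tmin e < t) es) -[X in (X < _)%N]addn0 ltn_add2l -has_count.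
Qed.

(** A factor known at time [t] enters the coefficients without breaking adaptedness, since all boxes
    lie after [t]. *)
Lemma eall_scale (t : R) (c : T -> R) (es : seq elem) : boundedf c -> adapted t c ->
  eall (fun e => t <= tmin e) es ->
  exists es', [/\ eall (fun e => t <= tmin e) es',
    forall w, simple_integral W es' w = c w * simple_integral W es w &
    forall w z, simple_process es' z w = c w * simple_process es z w].
Proof.
move=> [M cM] ac; elim: es => [_|e es ih /= [te /ih[es' [ht hI hp]]]].
  by exists [::]; split => // w; rewrite /simple_integral/simple_process ?big_nil ?mulr0 // => z; rewrite !big_nil mulr0.
have be : exists M' : R, forall w, `|c w * coef e w| <= M'.
  by have [B eB] := coef_bounded e; exists (M * B) => w; rewrite normrM ler_pM.
have ae : adapted (tmin e) (fun w => c w * coef e w).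
  by apply: measurable_funM; [exact: adapted_mono te ac|exact: coef_adapted].
exists (Elementary (tmax e) be (proj1 (adaptedP _ _) ae) (tmin_ge0 e) (cell_measurable e) (@cell_torus _ _ _ _ e) :: es').
split => //.
- by move=> w; rewrite /simple_integral !big_cons/= mulrDr mulrA; congr (_ + _); exact: hI.
- by move=> w z; rewrite /simple_process !big_cons/= mulrDr mulrA; congr (_ + _); exact: hp.
Qed.

Lemma adapted_cst t c : adapted t (fun=> c). Proof. exact: measurable_cst. Qed.
Arguments adapted_cst : clear implicits.

Lemma eall0 (es : seq elem) : eall (fun e => 0 <= tmin e) es.
Proof. by elim: es => //= e es ih; split => //; exact: tmin_ge0. Qed.

(** Markov's inequality for the exponential supermartingale of [th] times the integral, with the
    optimal [th = a / b] and its opposite, one for each side. The variance bound is a condition on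
    the sample point, which may itself fail with positive probability. *)
Lemma simple_tail es (a b : R) : 0 < a -> 0 < b -> exists N, [/\ measurable N,
  (P N <= (2 * expR (- (a ^+ 2 / (2 * b))))%:E)%E &
  forall w, ~ N w -> lin_var (at_point (eform es) w) <= b -> `|simple_integral W es w| <= a].
Proof.
move=> a0 b0; have half (th : R) : `|th| = a / b -> exists N, [/\ measurable N,
    (P N <= (expR (- (a ^+ 2 / (2 * b))))%:E)%E &
    forall w, ~ N w -> lin_var (at_point (eform es) w) <= b -> (th * simple_integral W es w) <= a ^+ 2 / b].
  move=> hth; have [es' [_ hI hp]] := @eall_scale 0 (fun=> th) es (ex_intro (fun M => forall w : T, `|th| <= M) `|th| (fun=> lexx _)) (adapted_cst _ _) (eall0 es).
  have hv w : lin_var (at_point (eform es') w) = th ^+ 2 * lin_var (at_point (eform es) w).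
    apply: EFin_inj; rewrite EFinM -!simple_process_int -ge0_integralZl_EFin ?sqr_ge0//.
    - by apply: eq_integral => z _; rewrite hp exprMn EFinM.
    - by apply: measurableX; exact: measurable_itv.
    - by move=> z _; rewrite lee_fin sqr_ge0.
    - apply/measurable_EFinP; apply: measurable_funX; apply: measurable_sum => e; apply: measurable_funM => //.
      by apply: measurable_funTS; apply: measurable_indic; have [] := box_noise e.
  have [mI mQ] := measurable_simple es'.
  pose X w := expR (simple_integral W es' w - lin_var (at_point (eform es') w) / 2).
  have mX : measurable_fun setT X.
    apply: measurableT_comp => //; apply: measurable_realfun.measurable_funB => //.
    exact: measurable_funM.
  pose c := expR (a ^+ 2 / (2 * b)).
  have mN : measurable [set w | c <= X w].
    rewrite (_ : [set _ | _] = X @^-1` `[c, +oo[%classic).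
      by rewrite -[Y in measurable Y]setTI; apply: mX => //; exact: measurable_itv.
    by apply/seteqP; split => w /=; rewrite in_itv/= andbT.
  exists [set w | c <= X w]; split => //.
    rewrite expRN -[leRHS]mule1 lee_pdivlMl ?expR_gt0// -/c.
    apply: le_trans (exponential_supermartingale es').
    apply: (@le_trans _ _ (\int[P]_(w in [set w | (c <= X w)%R]) cst c%:E w)%E).
      by rewrite (integral_cst P mN c%:E).
    apply: (@le_trans _ _ (\int[P]_(w in [set w | (c <= X w)%R]) (X w)%:E)%E).
      by apply: ge0_integral_mono => w; rewrite /= lee_fin ?expR_ge0.
    apply: ge0_subset_integral => //; first exact/measurable_EFinP.
    by move=> w _; rewrite lee_fin expR_ge0.
  move=> w /negP; rewrite -ltNge => Xc Qb.
  have : simple_integral W es' w - lin_var (at_point (eform es') w) / 2 < a ^+ 2 / (2 * b).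
    by rewrite -ltr_expR.
  rewrite hI hv => h.
  have : th ^+ 2 * lin_var (at_point (eform es) w) / 2 <= a ^+ 2 / (2 * b).
    rewrite -(real_normK (num_real th)) hth.
    have -> : a ^+ 2 / (2 * b) = (a / b) ^+ 2 * b / 2 by field; rewrite gt_eqF.
    by rewrite ler_wpM2r// ler_wpM2l// sqr_ge0.
  have -> : a ^+ 2 / b = a ^+ 2 / (2 * b) + a ^+ 2 / (2 * b) by field; rewrite gt_eqF.
  by move: h; generalize (a ^+ 2 / (2 * b)) => q; lra.
have ab0 : 0 < a / b by rewrite divr_gt0.
have [N1 [mN1 p1 h1]] := half (a / b) (gtr0_norm ab0).
have hN : `|- (a / b)| = a / b by rewrite normrN gtr0_norm.
have [N2 [mN2 p2 h2]] := half _ hN.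
exists (N1 `|` N2); split; first exact: measurableU.
  apply: le_trans (measureU2 P mN1 mN2) _.
  by rewrite mulrDl mul1r EFinD leeD.
move=> w /not_orP[n1 n2] Qb; have := h1 w n1 Qb; have := h2 w n2 Qb.
have -> : a ^+ 2 / b = (a / b) * a by field; rewrite gt_eqF.
rewrite mulNr -mulrN !ler_pM2l// => k1 k2.
by rewrite ler_norml; lra.
Qed.

(* [I] is the Walsh integral of [Phi] against the noise after time [t]; unlike in
   [stochastic_integral], the exceptional events are measurable by construction. *)
Definition walsh (t : R) (Phi : R * R -> T -> R) (I : T -> R) : Prop :=
  (forall w, measurable_fun [set: R * R] (Phi ^~ w)) /\
  forall e, 0 < e -> exists (es : seq elem) (N : set T),
    [/\ eall (fun e => t <= tmin e) es, measurable N, (P N <= e%:E)%E &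
      forall w, ~ N w ->
        (\int[stm]_(z in @spacetime R) ((Phi z w - simple_process es z w) ^+ 2)%:E <= e%:E)%E /\
        `|simple_integral W es w - I w| <= e].

Lemma measurable_simple_process (es : seq elem) w : measurable_fun [set: R * R] (simple_process es ^~ w).
Proof.
apply: measurable_sum => e; apply: measurable_funM => //.
by apply: measurable_indic; have [] := box_noise e.
Qed.

Lemma measurable_spacetime : measurable (@spacetime R).
Proof. by apply: measurableX; exact: measurable_itv. Qed.

Lemma integral_sqrD (f g : R * R -> R) (c k A B : R) :
  measurable_fun [set: R * R] f -> measurable_fun [set: R * R] g ->
  (\int[stm]_(z in @spacetime R) (f z ^+ 2)%:E <= A%:E)%E ->
  (\int[stm]_(z in @spacetime R) (g z ^+ 2)%:E <= B%:E)%E ->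
  (\int[stm]_(z in @spacetime R) ((c * f z + k * g z) ^+ 2)%:E <= (2 * c ^+ 2 * A + 2 * k ^+ 2 * B)%:E)%E.
Proof.
move=> mf mg hA hB; have mS := measurable_spacetime.
have mf2 : measurable_fun (@spacetime R) (fun z => (f z ^+ 2)%:E).
  by apply/measurable_EFinP; apply: measurable_funTS; exact: measurable_funX.
have mg2 : measurable_fun (@spacetime R) (fun z => (g z ^+ 2)%:E).
  by apply/measurable_EFinP; apply: measurable_funTS; exact: measurable_funX.
apply: (@le_trans _ _ (\int[stm]_(z in @spacetime R) ((2 * c ^+ 2)%:E * (f z ^+ 2)%:E + (2 * k ^+ 2)%:E * (g z ^+ 2)%:E))%E).
  apply: ge0_integral_mono => z _; first by rewrite lee_fin sqr_ge0.
  rewrite -!EFinM -EFinD lee_fin -subr_ge0.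
  rewrite (_ : _ - _ = (c * f z - k * g z) ^+ 2) ?sqr_ge0//; ring.
have c0 : 0 <= 2 * c ^+ 2 by rewrite mulr_ge0// sqr_ge0.
have k0 : 0 <= 2 * k ^+ 2 by rewrite mulr_ge0// sqr_ge0.
rewrite ge0_integralD//; last 4 first.
- by move=> z _; rewrite mule_ge0// lee_fin// sqr_ge0.
- exact: measurable_funeM.
- by move=> z _; rewrite mule_ge0// lee_fin// sqr_ge0.
- exact: measurable_funeM.
rewrite !ge0_integralZl_EFin//; try by move=> z _; rewrite lee_fin sqr_ge0.
by rewrite EFinD !(EFinM (_ * _)) leeD// lee_wpmul2l.
Qed.

(** The approximating simple integral is kept below [a / 2], and its variance is at most [2 b + 2 b]
    by the squared triangle inequality; [(a / 2)^2 / (2 (4 b))] is [a^2 / (32 b)]. *)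
Lemma walsh_tail t Phi I a b dlt : walsh t Phi I -> 0 < a -> 0 < b -> 0 < dlt -> exists N, [/\ measurable N,
  (P N <= (2 * expR (- (a ^+ 2 / (32 * b))) + dlt)%:E)%E &
  forall w, ~ N w -> (\int[stm]_(z in @spacetime R) (Phi z w ^+ 2)%:E <= b%:E)%E -> `|I w| <= a].
Proof.
move=> [mP hP] a0 b0 d0; pose e := Num.min dlt (Num.min b (a / 2)).
have e0 : 0 < e by rewrite !lt_min d0 b0/= divr_gt0.
have [es [N1 [_ mN1 p1 h1]]] := hP e e0.
have [||N2 [mN2 p2 h2]] := @simple_tail es (a / 2) (4 * b); [by rewrite divr_gt0|by rewrite mulr_gt0|].
exists (N1 `|` N2); split; first exact: measurableU.
  apply: le_trans (measureU2 P mN1 mN2) _; rewrite addeC EFinD; apply: leeD.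
    by apply: le_trans p2 _; rewrite lee_fin (_ : (a / 2) ^+ 2 / (2 * (4 * b)) = a ^+ 2 / (32 * b))//; field; rewrite gt_eqF.
  by apply: le_trans p1 _; rewrite lee_fin /e ge_min lexx.
move=> w /not_orP[n1 n2] Phib; have [k1 k2] := h1 w n1.
have eb : e <= b by rewrite /e !ge_min lexx orbT.
have ea : e <= a / 2 by rewrite /e !ge_min lexx !orbT.
have : lin_var (at_point (eform es) w) <= 4 * b.
  rewrite -lee_fin -simple_process_int.
  rewrite (_ : (\int[stm]_(z in _) _)%E = (\int[stm]_(z in @spacetime R)
      ((1 * Phi z w + (-1) * (Phi z w - simple_process es z w)) ^+ 2)%:E)%E); last first.
    by apply: eq_integral => z _; congr EFin; ring.
  apply: le_trans (@integral_sqrD (Phi ^~ w) (fun z => Phi z w - simple_process es z w) 1 (-1) b b (mP w) _ Phib _) _.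
  - by apply: measurable_realfun.measurable_funB => //; exact: measurable_simple_process.
  - by apply: le_trans k1 _; rewrite lee_fin.
  - by rewrite lee_fin sqrrN expr1n; lra.
move=> /(h2 w n2) h3; move: k2 h3; rewrite !ler_norml => /andP[? ?] /andP[? ?]; lra.
Qed.

(** The coefficients may be random: being known at time [t], they are absorbed by [eall_scale]. *)
Lemma walsh_lin t Phi Phi' I I' c c' : 0 <= t -> boundedf c -> boundedf c' -> adapted t c -> adapted t c' ->
  walsh t Phi I -> walsh t Phi' I' ->
  walsh t (fun z w => c w * Phi z w + c' w * Phi' z w) (fun w => c w * I w + c' w * I' w).
Proof.
move=> t0 bc bc' ac ac' [mP hP] [mP' hP']; split.
  by move=> w; apply: measurable_realfun.measurable_funD; exact: measurable_funM.
move=> e e0; have [M cM] := bc; have [M' cM'] := bc'.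
(* [K] covers the factors [2 c^2] of the squared triangle inequality, the factors [|c|] on the
   integrals and the two exceptional events. *)
pose K := 1 + 4 * `|M| ^+ 2 + 4 * `|M'| ^+ 2 + 2 * `|M| + 2 * `|M'|.
have n1 := normr_ge0 M; have n2 := normr_ge0 M'.
have q1 := sqr_ge0 `|M|; have q2 := sqr_ge0 `|M'|.
have K1 : 1 <= K by rewrite /K; lra.
pose dl := e / (2 * K); have K0 : 0 < K by lra.
have dl0 : 0 < dl by rewrite divr_gt0// mulr_gt0.
have dK : 2 * K * dl = e by rewrite /dl; field; rewrite gt_eqF.
have [es [N [ht mN pN h]]] := hP dl dl0; have [es' [N' [ht' mN' pN' h']]] := hP' dl dl0.
have [fs [hf hI hp]] := eall_scale bc ac ht; have [fs' [hf' hI' hp']] := eall_scale bc' ac' ht'.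
exists (fs ++ fs'), (N `|` N'); split.
- by elim: fs hf {hI hp} => //= f fs ih [? /ih].
- exact: measurableU.
- apply: le_trans (measureU2 P mN mN') _; apply: le_trans (leeD pN pN') _.
  by rewrite -EFinD lee_fin -dK; nra.
move=> w /not_orP[/h[k1 k2] /h'[k1' k2']]; split.
  have := @integral_sqrD (fun z => Phi z w - simple_process es z w) (fun z => Phi' z w - simple_process es' z w)
     (c w) (c' w) dl dl _ _ k1 k1'.
  have e1 z : c w * (Phi z w - simple_process es z w) + c' w * (Phi' z w - simple_process es' z w) =
     c w * Phi z w + c' w * Phi' z w - simple_process (fs ++ fs') z w.
    by rewrite {3}/simple_process big_cat/= -/(simple_process fs z w) -/(simple_process fs' z w) hp hp'; ring.
  under eq_integral do rewrite e1.
  move=> h3; apply: le_trans (h3 _ _) _.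
  - by apply: measurable_realfun.measurable_funB => //; exact: measurable_simple_process.
  - by apply: measurable_realfun.measurable_funB => //; exact: measurable_simple_process.
  - rewrite lee_fin -dK.
    have s1 : c w ^+ 2 <= `|M| ^+ 2.
      by rewrite -(real_normK (num_real (c w))) lerXn2r// ?nnegrE//; apply: le_trans (cM w) (ler_norm _).
    have s2 : c' w ^+ 2 <= `|M'| ^+ 2.
      by rewrite -(real_normK (num_real (c' w))) lerXn2r// ?nnegrE//; apply: le_trans (cM' w) (ler_norm _).
    by rewrite -mulrDl ler_pM2r// /K; lra.
have -> : simple_integral W (fs ++ fs') w - (c w * I w + c' w * I' w) =
   c w * (simple_integral W es w - I w) + c' w * (simple_integral W es' w - I' w).
  by rewrite {1}/simple_integral big_cat/= -/(simple_integral W fs w) -/(simple_integral W fs' w) hI hI'; ring.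
apply: le_trans (ler_normD _ _) _; rewrite !normrM.
have s1 : `|c w| <= `|M| by apply: le_trans (cM w) (ler_norm _).
have s2 : `|c' w| <= `|M'| by apply: le_trans (cM' w) (ler_norm _).
apply: (@le_trans _ _ (`|M| * dl + `|M'| * dl)); first by apply: lerD; exact: ler_pM.
by rewrite -mulrDl -dK ler_pM2r// /K; lra.
Qed.

Lemma walsh_lim t (Phi : R * R -> T -> R) (I : T -> R) : (forall w, measurable_fun [set: R * R] (Phi ^~ w)) ->
  (forall e, 0 < e -> exists (Phi' : R * R -> T -> R) (I' : T -> R) N, [/\ walsh t Phi' I', measurable N, (P N <= e%:E)%E &
    forall w, ~ N w -> (\int[stm]_(z in @spacetime R) ((Phi z w - Phi' z w) ^+ 2)%:E <= e%:E)%E /\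
        `|I' w - I w| <= e]) ->
  walsh t Phi I.
Proof.
move=> mP h; split => // e e0; have e40 : 0 < e / 4 by rewrite divr_gt0.
have [Phi' [I' [N [[mP' hP'] mN pN k]]]] := h _ e40.
have [es [N' [ht mN' pN' k']]] := hP' _ e40.
exists es, (N `|` N'); split => //; first exact: measurableU.
  apply: le_trans (measureU2 P mN mN') _; apply: le_trans (leeD pN pN') _.
  by rewrite -EFinD lee_fin; lra.
move=> w /not_orP[/k[k1 k2] /k'[k1' k2']]; split.
  have := @integral_sqrD (fun z => Phi z w - Phi' z w) (fun z => Phi' z w - simple_process es z w)
     1 1 _ _ _ _ k1 k1'.
  under eq_integral do rewrite !mul1r addrA subrK.
  move=> h3; apply: le_trans (h3 _ _) _.
  - exact: measurable_realfun.measurable_funB.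
  - by apply: measurable_realfun.measurable_funB => //; exact: measurable_simple_process.
  - by rewrite lee_fin; lra.
by move: k2 k2'; rewrite !ler_norml => /andP[? ?] /andP[? ?]; lra.
Qed.

Definition cut_below (t : R) (e : elem) : elem.
Proof.
refine (@Elementary _ _ _ F (coef e) (Num.max (tmin e) t) (tmax e) (cell e) (coef_bounded e) _ _
  (cell_measurable e) (@cell_torus _ _ _ _ e)); last by rewrite le_max tmin_ge0.
refine (proj1 (adaptedP _ _) (adapted_mono _ (coef_adapted e))); by rewrite le_max lexx.
Defined.

Lemma box_cut_below t e : box (cut_below t e) = strip_above t e.
Proof.
apply/seteqP; split => z; rewrite /strip_above /box /=.
  by move=> [/=]; rewrite in_itv/= gt_max => /andP[/andP[z1 z2] z3] ze; split => //; split => //=; rewrite in_itv/= z1.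
by move=> [[/=]]; rewrite in_itv/= => /andP[z1 z2] ze zt; split => //=; rewrite in_itv/= gt_max z1 zt.
Qed.

(** The approximating simple processes are cut at [t]. Their part before [t] is close to 0 in
    space-time square integral, as [Phi] vanishes there, and [simple_tail] makes its stochastic
    integral small; only the part after [t] is kept. *)
Lemma walsh_after t Phi I : (forall z w, z.1 <= t -> Phi z w = 0) -> walsh 0 Phi I -> walsh t Phi I.
Proof.
move=> P0 [mP hP]; split => // e e0.
pose a := e / 4; have a0 : 0 < a by rewrite divr_gt0.
(* The bound [expR (- y) <= 1 / y] with [y >= 8 / e] makes the tail at most [e / 4]. *)
have [b [b0 [be bexp]]] : exists b, [/\ 0 < b, b <= e / 4 & 2 * expR (- (a ^+ 2 / (2 * b))) <= e / 4].
  exists (Num.min (e / 4) (a ^+ 2 * e / 16)); split.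
  - by rewrite lt_min divr_gt0//= divr_gt0// mulr_gt0// exprn_gt0.
  - by rewrite ge_min lexx.
  - set b := Num.min _ _; have b0 : 0 < b by rewrite lt_min divr_gt0//= divr_gt0// mulr_gt0// exprn_gt0.
    have b1 : b <= a ^+ 2 * e / 16 by rewrite ge_min lexx orbT.
    have y0 : 0 < a ^+ 2 / (2 * b) by rewrite divr_gt0 ?exprn_gt0// mulr_gt0.
    have y1 : 8 / e <= a ^+ 2 / (2 * b).
      rewrite ler_pdivrMr// mulrAC ler_pdivlMr ?mulr_gt0//; lra.
    rewrite expRN; apply: (@le_trans _ _ (2 * (8 / e)^-1)); last first.
      by rewrite le_eqVlt; apply/orP; left; apply/eqP; field; rewrite gt_eqF.
    rewrite ler_pM2l// lef_pV2 ?posrE ?expR_gt0// ?divr_gt0//.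
    by apply: le_trans y1 _; have := expR_ge1Dx (a ^+ 2 / (2 * b)); lra.
have [es [N [_ mN pN k]]] := hP b b0.
have [N' [mN' pN' k']] := simple_tail [seq cut_above t e | e <- es] a0 b0.
have [N2 [mN2 pN2 k2]] := simple_integral_split t es.
exists [seq cut_below t e | e <- es], (N `|` N' `|` N2); split.
- by elim: es {k N' mN' pN' k' k2} => //= f es ih; split => //; rewrite le_max lexx orbT.
- by apply: measurableU => //; exact: measurableU.
- apply: le_trans (measureU2 P _ mN2) _; first exact: measurableU.
  rewrite [X in (_ + X)%E]pN2 adde0; apply: le_trans (measureU2 P mN mN') _; apply: le_trans (leeD pN pN') _.
  by rewrite -EFinD lee_fin; lra.
move=> w /not_orP[/not_orP[/k[k1 k3] n'] n2].
have eI : simple_integral W es w = simple_integral W [seq cut_above t e | e <- es] w +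
    simple_integral W [seq cut_below t e | e <- es] w.
  have : [set x | simple_integral W es x = simple_integral W [seq cut_above t e | e <- es] x +
      lin W (at_point (strips t es) x) x] w by apply: contrapT => h; apply: n2; exact: k2.
  move=> /= ->; congr (_ + _).
  by rewrite /lin /simple_integral /strips !big_map; apply: eq_bigr => f _; rewrite box_cut_below.
have before z : t < z.1 -> simple_process [seq cut_above t e | e <- es] z w = 0.
  move=> tz; rewrite /simple_process big_map big1// => f _; rewrite indicE memNset ?mulr0//.
  by move=> [/=]; rewrite in_itv/= le_min => /andP[_ /andP[_]]; rewrite leNgt tz.
have after z : z.1 <= t -> simple_process [seq cut_below t e | e <- es] z w = 0.
  move=> tz; rewrite /simple_process big_map big1// => f _; rewrite box_cut_below indicE memNset ?mulr0//.
  by move=> [_ /=]; rewrite ltNge tz.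
have both z : simple_process es z w = simple_process [seq cut_above t e | e <- es] z w +
    simple_process [seq cut_below t e | e <- es] z w.
  rewrite /simple_process !big_map -big_split/=; apply: eq_bigr => f _.
  by rewrite box_cut_below (indic_split t) mulrDr.
split.
  apply: (@le_trans _ _ b%:E); last by rewrite lee_fin; lra.
  apply: le_trans k1; apply: ge0_integral_mono => z _; first by rewrite lee_fin sqr_ge0.
  rewrite lee_fin both; have [zt|zt] := leP z.1 t.
    by rewrite P0// after// addr0 subr0 expr0n sqr_ge0.
  by rewrite before// add0r.
have h : `|simple_integral W [seq cut_above t e | e <- es] w| <= a.
  apply: k' n' _; rewrite -lee_fin -simple_process_int; apply: le_trans k1.
  apply: ge0_integral_mono => z _; first by rewrite lee_fin sqr_ge0.
  rewrite lee_fin both; have [zt|zt] := leP z.1 t.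
    by rewrite P0// after// addr0 add0r sqrrN.
  by rewrite before// expr0n sqr_ge0.
by move: h k3; rewrite eI /a !ler_norml => /andP[? ?] /andP[? ?]; lra.
Qed.

End simple_processes.

(** * Riemann sums on the torus *)

Section riemann.
Context {R : realType}.
Local Notation mu := (@lebesgue_measure R).

Lemma cvg_integral_dominated d (T : measurableType d) (m : {measure set T -> \bar R}) (D : set T)
    (f_ : nat -> T -> R) (f g : T -> R) :
  measurable D -> (forall n, measurable_fun D (f_ n)) -> m.-integrable D (EFin \o g) ->
  (forall n x, D x -> `|f_ n x| <= g x) -> (forall x, D x -> f_ n x @[n --> \oo] --> f x) ->
  m.-integrable D (EFin \o f) /\
  (\int[m]_(x in D) (f_ n x)%:E)%E @[n --> \oo] --> (\int[m]_(x in D) (f x)%:E)%E.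
Proof.
move=> mD mf ig fg ff; have mF : measurable_fun D f.
  by apply: (@measurable_fun_cvg _ _ _ D f_ f mf) => x Dx; exact: ff.
have [||i _ h] := @dominated_convergence _ T R m D mD
  (fun n => EFin \o f_ n) (EFin \o f) (EFin \o g) (fun n => proj2 (measurable_EFinP _ _) (mf n)) (proj2 (measurable_EFinP _ _) mF) _ ig.
- by apply: aeW => x Dx; apply: cvg_EFin; [exact: nearW|exact: ff].
- by apply: aeW => x n Dx; rewrite lee_fin; exact: fg.
by split.
Qed.

Definition mesh (n : nat) : R := 2 / n.+1%:R.
Definition node (n j : nat) : R := -1 + mesh n * j%:R.

Lemma mesh_gt0 n : 0 < mesh n. Proof. by rewrite /mesh divr_gt0. Qed.

Lemma cvg_mesh : mesh n @[n --> \oo] --> (0 : R).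
Proof. by rewrite -(mulr0 2); apply: cvgMr; exact: cvg_harmonic. Qed.

Lemma node_torus n j : (j < n.+1)%N -> torus (node n j).
Proof.
move=> jn; rewrite /torus/= in_itv/= /node lerDl mulr_ge0 ?(ltW (mesh_gt0 n))//=.
have : mesh n * j%:R < mesh n * n.+1%:R by rewrite ltr_pM2l ?mesh_gt0// ltr_nat.
by rewrite {2}/mesh divfK ?pnatr_eq0//; lra.
Qed.

Definition riemann_sum (phi : R -> R) (n : nat) : R := \sum_(j < n.+1) mesh n * phi (node n j).

Lemma torus_measure : mu (@torus R) = (2 : R)%:E.
Proof.
have h : (-1 : R) < 1 by lra.
by rewrite lebesgue_measure_itv /= lte_fin h -EFinD; congr EFin; ring.
Qed.

(** Gives space integrals as limits of finite sums, the form in which they can act on stochastic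
    integrals and on adapted variables. The sums are integrals of step functions, which converge
    boundedly. *)
Lemma cvg_riemann_sum (phi : R -> R) : continuous phi ->
  riemann_sum phi n @[n --> \oo] --> \int[mu]_(y in @torus R) phi y.
Proof.
move=> cphi; have mT : measurable (@torus R) by exact: measurable_torus.
pose I n j : set R := `[node n j, node n j.+1[%classic.
pose F n y : R := \sum_(j < n.+1) phi (node n j) * \1_(I n j) y.
have Fy n y : torus y -> exists2 z, torus z /\ `|y - z| <= mesh n & F n y = phi z.
  rewrite /torus/= in_itv/= => /andP[y1 y2]; have h0 := mesh_gt0 n.
  have y0 : 0 <= (y + 1) / mesh n by rewrite divr_ge0 ?(ltW h0)//; lra.
  pose j := Num.truncn ((y + 1) / mesh n).
  have /andP[j1 j2] : j%:R <= (y + 1) / mesh n < j.+1%:R by exact: truncn_itv.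
  move: j1 j2; rewrite ler_pdivlMr// ltr_pdivrMr// => j1 j2.
  have jn : (j < n.+1)%N.
    rewrite -(ltr_nat R) -(ltr_pM2r h0); apply: le_lt_trans j1 _.
    by rewrite mulrC /mesh divfK ?pnatr_eq0//; lra.
  have Iy : I n j y by rewrite /I /= in_itv/= /node; apply/andP; split; lra.
  exists (node n j).
    split; first exact: node_torus.
    rewrite /node ger0_norm; first by move: j2; rewrite -natr1; lra.
    by lra.
  rewrite /F (bigD1 (Ordinal jn))//= big1 ?addr0; first by rewrite indicE mem_set// mulr1.
  move=> i ij; rewrite indicE memNset ?mulr0// /I /= in_itv/= => /andP[i1 i2].
  move/eqP: ij; apply; apply: val_inj => /=; rewrite /node in i1 i2.
  have k1 : mesh n * i%:R < mesh n * j.+1%:R by lra.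
  have k2 : mesh n * j%:R < mesh n * i.+1%:R by lra.
  move: k1 k2; rewrite !ltr_pM2l// !ltr_nat !ltnS => k1 k2.
  by apply/eqP; rewrite eqn_leq k1 k2.
have [M hM] : exists M : R, forall y, torus y -> `|phi y| <= M.
  have c1 : {within `[(-1 : R), 1], continuous (fun y => `|phi y|)}.
    by apply: continuous_subspaceT => x; apply: continuous_comp; [exact: cphi|exact: norm_continuous].
  have [|c _ hc] := EVT_max _ c1; first by lra.
  by exists `|phi c| => y; rewrite /torus/= in_itv/= => /andP[y1 y2]; apply: hc; rewrite in_itv/= y1 ltW.
have mI n j : measurable (I n j) by exact: measurable_itv.
have mF n : measurable_fun (@torus R) (F n).
  by apply: measurable_sum => j; apply: measurable_funM => //; exact: measurable_indic.
have iM : mu.-integrable (@torus R) (EFin \o (fun=> M)).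
  apply/integrableP; split; first exact: measurable_cst.
  by rewrite integral_cst//= torus_measure ltry.
have FM n x : torus x -> `|F n x| <= M by move=> Tx; have [z [Tz _] ->] := Fy n x Tx; exact: hM.
have Fc x : torus x -> F n x @[n --> \oo] --> phi x.
  move=> Tx; apply/cvgrPdist_le => e e0.
  have /cvgrPdist_le/(_ _ e0)/nbhs_ballP[dl /= dl0 hd] := cphi x.
  have /cvgrPdist_lt/(_ _ dl0) := cvg_mesh; apply: filterS => n.
  rewrite sub0r normrN (gtr0_norm (mesh_gt0 n)) => hm; have [z [Tz xz] ->] := Fy n x Tx.
  by apply: hd; rewrite /ball/=; exact: le_lt_trans hm.
have [iphi h] := @cvg_integral_dominated _ (measurableTypeR R) mu (@torus R) F phi (fun=> M) mT mF iM FM Fc.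
have -> : riemann_sum phi = fun n => fine (\int[mu]_(x in @torus R) (F n x)%:E)%E.
  apply: funext => n; rewrite /F; under eq_integral do rewrite -sumEFin.
  have intI (j : 'I_n.+1) : (\int[mu]_(x in @torus R) (\1_(I n j) x)%:E)%E = (mesh n)%:E.
    apply: (eq_trans (@integral_indic _ (measurableTypeR R) R mu (@torus R) mT (I n j) (mI n j))).
    rewrite setIidl; last first.
      move=> y; rewrite /I /torus /= !in_itv/= => /andP[a1 a2].
      have := node_torus (ltn_ord j); rewrite /torus/= in_itv/= => /andP[b1 _].
      rewrite (le_trans b1 a1)/=; apply: lt_le_trans a2 _.
      have : mesh n * j.+1%:R <= mesh n * n.+1%:R by rewrite ler_pM2l ?mesh_gt0// ler_nat ltn_ord.
      by rewrite {2}/mesh divfK ?pnatr_eq0// /node; lra.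
    have l2 : node n j.+1 - node n j = mesh n by rewrite /node -natr1; ring.
    have l1 : mu (I n j) = (mesh n)%:E.
      rewrite /I lebesgue_measure_itv /= lte_fin ifT; first by rewrite -EFinB l2.
      by rewrite -subr_gt0 l2 mesh_gt0.
    exact: l1.
  have iI (j : 'I_n.+1) : mu.-integrable (@torus R) (EFin \o (\1_(I n j) : R -> R)).
    apply/integrableP; split.
      by apply/measurable_EFinP; exact: (@measurable_indic _ (measurableTypeR R) R (@torus R) (I n j) (mI n j)).
    rewrite [X in (X < _)%E](_ : _ = (mesh n)%:E) ?ltry// -(intI j).
    by apply: eq_integral => x _; rewrite /= ger0_norm.
  have iZ (j : 'I_n.+1) : mu.-integrable (@torus R) (fun x => (phi (node n j) * \1_(I n j) x)%:E).
    apply: (@eq_integrable _ (measurableTypeR R) R mu _ mT (fun x => (phi (node n j))%:E * (\1_(I n j) x)%:E)%E) => //.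
    exact: (@integrableZl _ (measurableTypeR R) R mu (@torus R) mT (phi (node n j)) _ (iI j)).
  rewrite integral_sum//.
  rewrite -[LHS]/(fine (riemann_sum phi n)%:E); congr fine.
  rewrite /riemann_sum -sumEFin; apply: eq_bigr => j _.
  under eq_integral do rewrite EFinM.
  transitivity ((phi (node n j))%:E * (mesh n)%:E)%E; first by rewrite -EFinM mulrC.
  rewrite -(intI j); apply/esym.
  exact: (@integralZl _ (measurableTypeR R) R mu (@torus R) mT _ (iI j) (phi (node n j))).
apply: (@fine_cvg _ _ _ _ (fun n => (\int[mu]_(x in @torus R) (F n x)%:E)%E)).
by rewrite fineK//; exact: integrable_fin_num.
Qed.

(** The relative one-sided estimate, used in both directions, becomes an absolute one through the
    bound [B]. *)
Lemma continuous_of_lip (f : R -> R) (C B : R) : 0 < C -> (forall x, 0 <= f x <= B) ->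
  (forall x x' del, `|x - x'| <= del -> del <= 2 -> (1 - C * del) * f x <= f x') -> continuous f.
Proof.
move=> C0 fB h x; apply/cvgrPdist_le => e e0.
have B0 : 0 <= B by have /andP[a b] := fB 0; lra.
pose d := Num.min 2 (e / (C * (B + 1))).
have CB : 0 < C * (B + 1) by rewrite mulr_gt0//; lra.
have d0 : 0 < d by rewrite lt_min ltr0n/= divr_gt0.
have d2 : d <= 2 by rewrite ge_min lexx.
have dE : C * (B + 1) * d <= e by rewrite mulrC -ler_pdivlMr// ge_min lexx orbT.
apply/nbhs_ballP; exists d => //= y; rewrite /ball/= => /ltW xy.
have k1 := h _ _ _ xy d2; have := xy; rewrite distrC => /h/(_ d2) k2.
have Cd (z : R) : 0 <= z <= B -> C * d * z <= e.
  move=> /andP[z0 zB]; apply: le_trans dE; rewrite -!mulrA ler_pM2l// mulrC ler_pM2r//; lra.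
have := Cd _ (fB x); have := Cd _ (fB y); rewrite ler_norml; move: k1 k2; rewrite !mulrBl !mul1r; lra.
Qed.

Lemma continuous_hk_l t y : 0 < t -> continuous (fun x => hk t x y : R).
Proof.
move=> t0; have [C C0 h] := hk_lip t; have [C' C'0 h'] := @hk_le R t.
pose m := Num.min 1 t; have m0 : 0 < m by rewrite lt_min ltr01 t0.
apply: (@continuous_of_lip _ (C / m ^+ 2) (C' / Num.sqrt t)).
- by rewrite divr_gt0// exprn_gt0.
- by move=> x; rewrite (ltW (hk_gt0 _ _ t0)) h'.
- move=> x x' del xd d2; have := h t t x x' y m del m0 _ _ _ _ _ xd d2.
  rewrite subrr normr0 (mulrAC C) => -> //; rewrite ?ge_min ?lexx ?orbT//.
  exact: le_trans xd.
Qed.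

Lemma continuous_hk_r t x : 0 < t -> continuous (fun y => hk t x y : R).
Proof.
by move=> t0; rewrite (_ : (fun y => hk t x y) = fun y => hk t y x); [exact: continuous_hk_l|apply: funext => y; exact: hkC].
Qed.

Lemma continuous_hS t (f : R -> R) : 0 < t -> nnbounded f -> continuous (hS t f).
Proof.
move=> t0 bf; have [C C0 h] := hS_lip t; have [mf [B fB]] := bf.
pose m := Num.min 1 t; have m0 : 0 < m by rewrite lt_min ltr01 t0.
apply: (@continuous_of_lip _ (C / m ^+ 2) B).
- by rewrite divr_gt0// exprn_gt0.
- by move=> x; rewrite hS_ge0//= hS_ub// => y /fB/andP[].
- move=> x x' del xd d2; have := h t t x x' f m del bf m0 _ _ _ _ _ xd d2.
  rewrite subrr normr0 (mulrAC C) => -> //; rewrite ?ge_min ?lexx ?orbT//.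
  exact: le_trans xd.
Qed.

End riemann.

(** * The mild solution and its restart *)

Section mild.
Context {R : realType} {d : measure_display} {T : measurableType d} (P : probability T R).
Variables (W : set (R * R) -> {RV P >-> R}) (Q : R) (u0 : T -> R -> R) (u : R -> R -> T -> R).
Hypotheses (hW : white_noise W) (hQ : 0 < Q) (hu0 : initial_datum W u0) (hu : mild_solution Q W u0 u).
Local Notation mu := (@lebesgue_measure R).
Local Notation stm := ((@lebesgue_measure R \x @lebesgue_measure R)%E).
Local Notation F := (filtration W u0).
Local Notation walsh := (walsh W u0).
Local Notation adapted := (adapted W u0).
Let mT : measurable (@torus R) := @measurable_torus R.

Lemma measurable_u : measurable_fun (@predictable_domain R d T) (fun z => u z.1.1 z.1.2 z.2).
Proof.
have mD : measurable (@predictable_domain R d T).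
  rewrite (_ : predictable_domain = (`]0, +oo[ `*` @torus R) `*` [set: T]).
    by apply: measurableX => //; apply: measurableX => //; exact: measurable_itv.
  by apply/seteqP; split => z /=; rewrite in_itv/= andbT; [move=> [? ?]|move=> [[? ?] _]].
have [_ _ hp _] := hu; move=> _ B mB; move: (hp B mB); rewrite -[X in measurable X]/(predictable_domain `&` _).
move: (predictable_domain `&` _); apply: smallest_sub.
  split; [exact: measurable0|by move=> A mA; exact: measurableD|by move=> A mA; exact: bigcupT_measurable].
move=> _ [a [b [A [G [a0 mA AT FG ->]]]]].
have mG : measurable G by exact: (filtration_measurable hu0 FG).
rewrite (_ : [set z | _] = (`]a, b] `*` A) `*` G); last first.
  by apply/seteqP; split => z /=; rewrite in_itv/=; [move=> [? ? ?]|move=> [[? ?] ?]].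
by apply: measurableX => //; apply: measurableX => //; exact: measurable_itv.
Qed.

Lemma periodic_torus x : exists2 x', torus x' & forall f : R -> R, periodic2 f -> f x = f x'.
Proof.
pose k := Num.floor ((x + 1) / 2); exists (x + 2 * (- k)%:~R); last by move=> f pf; rewrite periodic2_int.
rewrite /torus/= in_itv/= intrN; have := floor_itv ((x + 1) / 2); rewrite -/k => /andP[k1 k2].
move: k2; rewrite intrD => k2; apply/andP; split; lra.
Qed.

(** The section of a predictable set at a fixed space-time point belongs to the filtration: for a
    rectangle it is empty or an event of an earlier time [a < t]. Predictability concerns the cell
    of the torus, so [x] is moved there by periodicity. *)
Lemma adapted_u t x : 0 < t -> adapted t (u t x).
Proof.
move=> t0; have [hper _ hp _] := hu.
have [x' Tx hx] := periodic_torus x.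
rewrite (_ : u t x = u t x'); last by apply: funext => w; exact: (hx _ (hper t w t0)).
apply/adaptedP => B mB; have Dx w : predictable_domain ((t, x'), w) by [].
have := hp B mB.
suff h E : <<s predictable_domain, @predictable_rectangle _ _ _ F >> E -> F t [set w | E ((t, x'), w)].
  move=> /h; rewrite (_ : [set w | _] = u t x' @^-1` B)//.
  by apply/seteqP; split => w //= [].
move: E; apply: smallest_sub.
  split.
  - by rewrite /=; exact: (@measurable0 _ (g_sigma_algebraType (fgen W u0 t))).
  - move=> A FA /=; rewrite (_ : [set w | _] = ~` [set w | A ((t, x'), w)]).
      exact: (@measurableC _ (g_sigma_algebraType (fgen W u0 t))).
    by apply/seteqP; split => w /=; [case|].
  - move=> A FA /=; rewrite (_ : [set w | _] = \bigcup_k [set w | A k ((t, x'), w)]).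
      exact: (@bigcupT_measurable _ (g_sigma_algebraType (fgen W u0 t))).
    by apply/seteqP; split => w /= [k]; exists k.
move=> _ [a [b [A [G [a0 mA AT FG ->]]]]] /=.
case: (pselect ((a < t <= b) /\ A x')) => [[tab Ax]|n].
  rewrite (_ : [set w | _] = G); last by apply/seteqP; split => w //= [].
  by have /andP[at_ _] := tab; exact: (filtration_mono (ltW at_) FG).
rewrite (_ : [set w | _] = set0); first exact: (@measurable0 _ (g_sigma_algebraType (fgen W u0 t))).
by rewrite -subset0 => w [h1 h2 _]; apply: n.
Qed.

(** The integrand of the mild equation over times in []a, b[], extended by 0 so as to be measurable
    on the whole plane. With [a = t0] it is the integrand of the equation restarted at [t0]. *)
Definition uk (a b x : R) (z : R * R) (w : T) : R :=
  if (a < z.1 < b) && (-1 <= z.2 < 1) then hk (b - z.1) x z.2 * u z.1 z.2 w else 0.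

Lemma measurable_uk2 a b x : 0 <= a -> measurable_fun [set: R * R * T] (fun p => uk a b x p.1 p.2).
Proof.
move=> a0; pose D : set (R * R * T) := (`]a, b[ `*` @torus R) `*` setT.
have mD : measurable D by apply: measurableX => //; apply: measurableX => //; exact: measurable_itv.
have -> : (fun p : R * R * T => uk a b x p.1 p.2) = (fun p => hk (b - p.1.1) x p.1.2 * u p.1.1 p.1.2 p.2) \_ D.
  apply: funext => p; rewrite patchE /uk; case: ifPn => [/andP[h1 h2]|n].
    by rewrite mem_set//; split => //; split => //=; rewrite in_itv.
  rewrite memNset// => -[[/=]]; rewrite in_itv/= => h1 h2 _.
  by move: n; rewrite h1/=; move: h2; rewrite /torus/= in_itv/= => ->.
apply: (measurable_restrictT _ mD).1; apply: measurable_funM.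
  apply: measurable_fun_hk => //.
  - by move=> p [[/=]]; rewrite in_itv/= subr_gt0 => /andP[].
  - apply: measurable_funTS; apply: measurable_realfun.measurable_funB => //.
    by apply: (measurableT_comp measurable_fst); exact: measurable_fst.
  - by apply: measurable_funTS; apply: (measurableT_comp measurable_snd); exact: measurable_fst.
apply: measurable_funS measurable_u => //.
  rewrite (_ : predictable_domain = (`]0, +oo[ `*` @torus R) `*` [set: T]).
    by apply: measurableX => //; apply: measurableX => //; exact: measurable_itv.
  by apply/seteqP; split => z /=; rewrite in_itv/= andbT; [move=> [? ?]|move=> [[? ?] _]].
by move=> p [[/=]]; rewrite in_itv/= => /andP[h1 _] h2 _; split => //; exact: le_lt_trans h1.
Qed.

Lemma measurable_uk a b x w : 0 <= a -> measurable_fun [set: R * R] (uk a b x ^~ w).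
Proof. by move=> a0; exact: (measurableT_comp (measurable_uk2 b x a0) (pair2_measurable w)). Qed.

Lemma ge0_integral_plane (D1 D2 : set R) (f : R * R -> \bar R) : measurable D1 -> measurable D2 ->
  measurable_fun (D1 `*` D2) f -> (forall z, (D1 `*` D2) z -> 0 <= f z)%E ->
  (\int[stm]_(z in D1 `*` D2) f z = \int[mu]_(r in D1) \int[mu]_(y in D2) f (r, y))%E.
Proof.
move=> mD1 mD2 mf f0; have mD : measurable (D1 `*` D2) by exact: measurableX.
rewrite integral_mkcond.
have m' : measurable_fun [set: measurableTypeR R * measurableTypeR R] (f \_ (D1 `*` D2)).
  exact: (measurable_restrictT f mD).1.
have f' z : (0 <= (f \_ (D1 `*` D2)) z)%E by apply: erestrict_ge0.
rewrite (@fubini_tonelli1 _ _ (measurableTypeR R) (measurableTypeR R) R mu mu _ m' f').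
rewrite [RHS]integral_mkcond; apply: eq_integral => r _; rewrite /fubini_F patchE.
case: ifPn => [/set_mem r1|/negP r1].
  rewrite [RHS]integral_mkcond; apply: eq_integral => y _; rewrite !patchE.
  by congr (if _ then _ else _); apply/idP/idP => /set_mem h; apply/mem_set; [case: h|split].
transitivity (0%E : \bar R); last by [].
by apply: integral0_eq => y _; rewrite patchE memNset// => -[h _]; apply: r1; exact/mem_set.
Qed.

Lemma measurable_integral_sqr (Psi : R * R -> T -> R) : measurable_fun setT (fun p : R * R * T => Psi p.1 p.2) ->
  measurable_fun setT (fun w => \int[stm]_(z in @spacetime R) (Psi z w ^+ 2)%:E)%E.
Proof.
move=> mP; pose f (p : R * R * T) := ((EFin \o (fun p : R * R * T => Psi p.1 p.2 ^+ 2)) \_ (@spacetime R `*` setT)) p.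
have mf : measurable_fun setT f.
  have mS : measurable (@spacetime R `*` [set: T]) by apply: measurableX => //; exact: measurable_spacetime.
  apply: (measurable_restrictT _ mS).1; apply: measurable_funTS; apply/measurable_EFinP.
  exact: measurable_funX.
have f0 p : (0 <= f p)%E by rewrite /f patchE; case: ifP => // _; rewrite lee_fin sqr_ge0.
have m3 : measurable_fun setT (fun q : R * (R * T) => ((q.2.1, q.1), q.2.2)).
  apply: measurable_fun_pair; first apply: measurable_fun_pair.
  - by apply: (measurableT_comp measurable_fst); exact: measurable_snd.
  - exact: measurable_fst.
  - by apply: (measurableT_comp measurable_snd); exact: measurable_snd.
pose g (q : R * (R * T)) := f ((q.2.1, q.1), q.2.2).
have mg : measurable_fun setT g by exact: (measurableT_comp mf m3).
have m1 := @measurable_fun_fubini_tonelli_G _ _ (measurableTypeR R) (R * T)%type R mu g mg (fun q => f0 _).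
have g0 (q : R * T) : (0 <= fubini_G mu g q)%E by apply: integral_ge0 => y _; exact: f0.
have m2 := @measurable_fun_fubini_tonelli_G _ _ (measurableTypeR R) T R mu (fubini_G mu g) m1 g0.
rewrite (_ : (fun w => _) = fubini_G mu (fubini_G mu g))//; apply: funext => w.
transitivity (\int[stm]_(z in [set: R] `*` [set: R]) f (z, w))%E.
  rewrite setXTT [LHS]integral_mkcond; apply: eq_integral => z _; rewrite /f !patchE /=.
  by congr (if _ then _ else _); apply/idP/idP => /set_mem h; apply/mem_set; [split|case: h].
rewrite ge0_integral_plane//.
by rewrite setXTT; exact: (measurableT_comp mf (pair2_measurable w)).
Qed.

Lemma measurable_simple_process2 (es : seq (elementary F)) :
  measurable_fun setT (fun p : R * R * T => simple_process es p.1 p.2).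
Proof.
have mc (e : elementary F) : measurable_fun setT (coef e).
  exact: (adapted_measurable hu0 (@coef_adapted _ _ _ _ _ _ e)).
have mi (e : elementary F) : measurable_fun setT (\1_(box e) : R * R -> R).
  by apply: measurable_indic; have [] := box_noise e.
by apply: measurable_sum => e; apply: measurable_funM;
  [exact: (measurableT_comp (mc e) measurable_snd)|exact: (measurableT_comp (mi e) measurable_fst)].
Qed.

(** Convergence in probability provides, for each tolerance, one index at which both exceptional
    events are small; their measurability comes from that of [u]. *)
Lemma walsh_of_mild t x : 0 < t -> exists I : {RV P >-> R}, walsh 0 (uk 0 t x) I /\
  {ae P, forall w, u t x w = hS t (u0 w) x + Q * I w}.
Proof.
move=> t0; have [_ _ _ hm] := hu; have [I [[es [h1 h2]] h3]] := hm t x t0; exists I; split; last first.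
  by apply: filterS h3 => w ->; rewrite hS_heat_semigroup /heat_semigroup; under [in RHS]eq_Rintegral do rewrite hk_heat_kernel.
split; first by move=> w; exact: measurable_uk.
move=> e e0; have e20 : 0 < e / 2 by rewrite divr_gt0.
pose q n w := (\int[stm]_(z in @spacetime R) ((uk 0 t x z w - simple_process (es n) z w) ^+ 2)%:E)%E.
pose raw n w := (\int[stm]_(z in @spacetime R) (((if 0 < z.1 < t
     then heat_kernel (t - z.1) x z.2 * u z.1 z.2 w else 0) - simple_process (es n) z w) ^+ 2)%:E)%E.
have qE n : raw n = q n.
  apply: funext => w; apply: eq_integral => z /set_mem[/= z1 z2].
  by rewrite /uk; move: z2; rewrite /torus/= in_itv/= => ->; rewrite andbT hk_heat_kernel.
have mq n : measurable_fun setT (q n).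
  apply: measurable_integral_sqr; apply: measurable_realfun.measurable_funB.
    exact: measurable_uk2.
  exact: measurable_simple_process2.
pose A n := [set w | (e%:E < q n w)%E]; pose B n := [set w | (e%:E < `|simple_integral W (es n) w - I w|%:E)%E].
have mA n : measurable (A n).
  by rewrite /A -[X in measurable X]setTI; exact: emeasurable_fun_o_infty.
have mB n : measurable (B n).
  rewrite /B -[X in measurable X]setTI; apply: emeasurable_fun_o_infty => //.
  apply/measurable_EFinP; apply: measurableT_comp => //; apply: measurable_realfun.measurable_funB => //.
  by have [] := measurable_simple hu0 (es n).
have hA : P (A n) @[n --> \oo] --> (0 : \bar R).
  have -> : (fun n => P (A n)) = (fun n => P [set w | (e%:E < raw n w)%E]) by apply: funext => n; rewrite qE.
  exact: h1.
have hB : P (B n) @[n --> \oo] --> (0 : \bar R) := h2 e e0.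
have small (X : nat -> set T) : (forall n, measurable (X n)) -> P (X n) @[n --> \oo] --> (0 : \bar R) ->
    \forall n \near \oo, (P (X n) <= (e / 2)%:E)%E.
  move=> mX /fine_cvg/cvgrPdist_le/(_ _ e20); apply: filterS => n; rewrite sub0r normrN => h.
  rewrite -(fineK (fin_num_measure P _ (mX n))) lee_fin; apply: le_trans h; exact: ler_norm.
have [n [Pa Pb]] : exists n, (P (A n) <= (e / 2)%:E)%E /\ (P (B n) <= (e / 2)%:E)%E.
  have := filterI (small _ mA hA) (small _ mB hB) => -[N _ hN].
  by exists N; exact: (hN N (leqnn N)).
exists (es n), (A n `|` B n); split.
- exact: eall0.
- exact: measurableU.
- apply: le_trans (measureU2 P (mA n) (mB n)) _; apply: le_trans (leeD Pa Pb) _.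
  by rewrite -EFinD lee_fin; lra.
- move=> w /not_orP[/negP na /negP nb]; split; first by rewrite leNgt.
  by rewrite -lee_fin leNgt.
Qed.

Lemma walsh_sub_sum t n (c : nat -> R) (Phi : R * R -> T -> R) I (Ps : nat -> R * R -> T -> R) Is : 0 <= t ->
  walsh t Phi I -> (forall j, walsh t (Ps j) (Is j)) ->
  walsh t (fun z w => Phi z w - \sum_(j < n) c j * Ps j z w) (fun w => I w - \sum_(j < n) c j * Is j w).
Proof.
move=> t0 h hs; elim: n => [|n ih].
  move: h; congr walsh; apply: funext => z; last by rewrite big_ord0 subr0.
  by apply: funext => w; rewrite big_ord0 subr0.
have b1 : boundedf (fun _ : T => 1 : R) by exists 1 => w; rewrite normr1.
have bc : boundedf (fun _ : T => - c n) by exists `|- c n| => w.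
have := walsh_lin t0 b1 bc (@adapted_cst _ _ _ P W u0 t 1) (@adapted_cst _ _ _ P W u0 t (- c n)) ih (hs n).
congr walsh; apply: funext => z; last by rewrite big_ord_recr/=; ring.
by apply: funext => w; rewrite big_ord_recr/=; ring.
Qed.

Lemma u_bounded a b w : 0 < a -> exists M : R, forall r y, a <= r <= b -> torus y -> `|u r y w| <= M.
Proof.
move=> a0; have [_ hc _ _] := hu.
have ck : compact ((`[a, b] : set R) `*` (`[-1, 1] : set R)) by apply: compact_setX; exact: segment_compact.
have cu : {within (`[a, b] : set R) `*` (`[-1, 1] : set R), continuous (fun z : R * R => u z.1 z.2 w)}.
  by apply: continuous_subspaceW (hc w) => z [/=]; rewrite in_itv/= => /andP[h _] _; exact: lt_le_trans h.
have := compact_bounded (continuous_compact cu ck) => -[M [_ hM]]; exists (M + 1) => r y ry Ty.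
apply: (hM (M + 1)); first by lra.
exists (r, y) => //; split => /=; rewrite in_itv/=//.
by move: Ty; rewrite /torus/= in_itv/= => /andP[-> /ltW].
Qed.

Lemma continuous_u t w : 0 < t -> continuous (fun x => u t x w).
Proof.
move=> t0 x; have [_ hc _ _] := hu.
have oD : open [set z : R * R | 0 < z.1].
  by apply: (open_comp (f := fst) (D := [set x : R | 0 < x])); [move=> z _; exact: cvg_fst|exact: open_gt].
have := hc w; rewrite continuous_open_subspace// => /(_ (t, x)); rewrite inE => /(_ t0) h.
apply: (@continuous_comp _ _ _ (fun x => (t, x)) (fun z : R * R => u z.1 z.2 w)) => //.
exact: (@cvg_pair R R R (nbhs x) (nbhs t) (nbhs x) _ _ _ (fun=> t) id (cvg_cst t) (fun A h => h)).
Qed.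

(** Almost sure smallness becomes smallness in probability: dominated convergence for the indicators
    of the bad events. *)
Lemma near_small (X : nat -> T -> \bar R) (N0 : set T) (e : R) : 0 < e ->
  (forall n, measurable_fun setT (X n)) -> measurable N0 -> (P N0 <= e%:E)%E ->
  (forall w, ~ N0 w -> forall dl : R, 0 < dl -> \forall n \near \oo, (X n w <= dl%:E)%E) ->
  \forall n \near \oo, exists N, [/\ measurable N, (P N <= (2 * e)%:E)%E & forall w, ~ N w -> (X n w <= e%:E)%E].
Proof.
move=> e0 mX mN pN hX; pose A n := [set w | (e%:E < X n w)%E] `\` N0.
have mA n : measurable (A n).
  by apply: measurableD => //; rewrite -[Y in measurable Y]setTI; exact: emeasurable_fun_o_infty.
have i1 : P.-integrable setT (EFin \o (fun=> 1 : R)) by exact: finite_measure_integrable_cst.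
have oneA n w : `|\1_(A n) w : R| <= 1 by rewrite indicE; case: (_ \in _); rewrite ?normr1 ?normr0.
have cA w : \1_(A n) w @[n --> \oo] --> (0 : R).
  have [wN|wN] := pselect (N0 w).
    have -> : (fun n => \1_(A n) w : R) = fun=> 0 by apply: funext => n; rewrite indicE memNset// => -[_ /(_ wN)].
    exact: cvg_cst.
  apply: cvg_near_cst; apply: filterS (hX w wN e e0) => n h; rewrite indicE memNset//.
  by move=> [/=]; rewrite ltNge h.
have [_ ] := @cvg_Rintegral_dominated R d T P (fun n => \1_(A n)) (fun=> 0) (fun=> 1)
  (fun n => measurable_indic (mA n)) i1 oneA cA.
rewrite [X in _ --> X](_ : _ = 0); last by rewrite /Rintegral integral0.
move=> /cvgrPdist_le/(_ _ e0); apply: filterS => n; rewrite sub0r normrN => h.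
have PA : (P (A n) <= e%:E)%E.
  rewrite -(fineK (fin_num_measure P _ (mA n))) lee_fin; apply: le_trans h; apply: le_trans (ler_norm _).
  by rewrite /Rintegral integral_indic// setIT.
exists (A n `|` N0); split; first exact: measurableU.
  apply: le_trans (measureU2 P (mA n) mN) _; apply: le_trans (leeD PA pN) _.
  by rewrite -EFinD lee_fin; lra.
by move=> w /not_orP[nA nN]; rewrite leNgt; apply/negP => hlt; apply: nA; split.
Qed.

Lemma nnbounded_u0 w : nnbounded (u0 w).
Proof.
have [m h _] := hu0; have [_ [M hM] h0] := h w; split.
  by apply: measurable_funTS; exact: (measurableT_comp m (pair1_measurable w)).
exists M => y _; rewrite (le_trans (ler_norm _) (hM y)) andbT.
apply: le_trans (ltW h0) _; apply: ge_inf; last by exists y.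
by exists (- M) => _ [z _ <-]; have := hM z; rewrite ler_norml => /andP[].
Qed.

Lemma continuous_hk_mul s x (f : R -> R) : 0 < s -> continuous f -> continuous (fun y => hk s x y * f y).
Proof. by move=> s0 cf y; apply: cvgM; [exact: continuous_hk_r|exact: cf]. Qed.

Lemma cvg_riemann_hS s x (f : R -> R) : 0 < s -> continuous f ->
  riemann_sum (fun y => hk s x y * f y) n @[n --> \oo] --> hS s f x.
Proof. by move=> s0 cf; rewrite hS_heat_semigroup; apply: cvg_riemann_sum; exact: continuous_hk_mul. Qed.

(** A limit of Riemann sums, each a finite combination of the adapted variables [u t y]. *)
Lemma adapted_hS t s x : 0 < t -> 0 < s -> adapted t (fun w => hS s (u t ^~ w) x).
Proof.
move=> t0 s0; apply: (@measurable_fun_cvg _ (g_sigma_algebraType (fgen W u0 t)) R setT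
  (fun n w => riemann_sum (fun y => hk s x y * u t y w) n)) => [n|w _].
  apply: measurable_sum => j; apply: measurable_funM => //; apply: measurable_funM => //.
  exact: adapted_u.
by apply: cvg_riemann_hS => //; exact: continuous_u.
Qed.

Lemma hk_lower a b : 0 < a -> exists2 c : R, 0 < c & forall t x y, a <= t -> t <= b -> c <= hk t x y.
Proof.
move=> a0; have [ab|ba] := leP a b; last first.
  by exists 1 => // t x y at_ tb; have := le_trans at_ tb; rewrite leNgt ba.
have b0 : 0 < b by exact: lt_le_trans ab.
exists ((Num.sqrt (4 * pi * b))^-1 * expR (- (4 * a)^-1)); first by pos.
move=> t x y at_ tb; have t0 : 0 < t by exact: lt_le_trans at_.
rewrite hkE; apply: ler_pM; [by pos|by pos| |].
  by rewrite lef_pV2 ?posrE; [apply: ler_wsqrtr; rewrite ler_pM2l//; pos|by pos|by pos].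
apply: le_trans (th_ge _ t0); rewrite ler_expR lerN2 lef_pV2 ?posrE; [by rewrite ler_pM2l|by pos|by pos].
Qed.

(** * The mild equation restarted at a positive time *)

Section restart.
Variables (t0 s x : R).
Hypotheses (t00 : 0 < t0) (s0 : 0 < s).

Definition wt n j : R := mesh n * hk s x (node n j).

(** The error of the Riemann sum in the semigroup identity for the kernel of time [t0 + s - z.1], as
    long as [z.1 < t0]. *)
Definition restart_kernel n (z : R * R) : R := hk (t0 + s - z.1) x z.2 -
  \sum_(j < n.+1) wt n j * (if z.1 < t0 then hk (t0 - z.1) (node n j) z.2 else 0).

(** The integrand of the mild equation at [(t0 + s, x)] minus the Riemann sum of those at time [t0];
    [D] is what separates it from the integrand of the restarted equation. *)
Let Phi n z w := uk 0 (t0 + s) x z w - \sum_(j < n.+1) wt n j * uk 0 t0 (node n j) z w.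

Let D n z w := uk t0 (t0 + s) x z w - Phi n z w.

Let DE n (z : R * R) w : torus z.2 -> 0 < z.1 -> z.1 <= t0 -> D n z w = - (restart_kernel n z * u z.1 z.2 w).
Proof.
rewrite /torus/= in_itv/= => h z0 zt; have sp := s0.
rewrite /D /Phi /uk h !andbT ltNge zt/= z0/= ifT; last by lra.
rewrite /restart_kernel mulrBl mulr_suml sub0r opprB opprB; congr (_ - _).
by apply: eq_bigr => j _; case: ifP => _; ring.
Qed.

Let D0 n (z : R * R) w : z.1 <= 0 \/ t0 < z.1 -> D n z w = 0.
Proof.
move=> h; rewrite /D /Phi /uk; case: h => h.
  rewrite (ltNge 0) h/= !(ltNge t0) (le_trans h (ltW t00))/= big1 ?subr0// => j _; by rewrite mulr0.
have h' : 0 < z.1 by exact: lt_trans h.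
rewrite h h' /= big1 ?subr0 ?subrr// => j _; by rewrite ltNge (ltW h)/= mulr0.
Qed.

Let mD n w : measurable_fun [set: R * R] (fun z => D n z w).
Proof.
apply: measurable_realfun.measurable_funB; first by apply: measurable_uk; exact: ltW.
apply: measurable_realfun.measurable_funB; first exact: measurable_uk.
by apply: measurable_sum => j; apply: measurable_funM => //; exact: measurable_uk.
Qed.

Let mD2 n : measurable_fun [set: R * R * T] (fun p => D n p.1 p.2).
Proof.
apply: measurable_realfun.measurable_funB; first by apply: measurable_uk2; exact: ltW.
apply: measurable_realfun.measurable_funB; first exact: measurable_uk2.
by apply: measurable_sum => j; apply: measurable_funM => //; exact: measurable_uk2.
Qed.

Let wt_ge0 n j : 0 <= wt n j.
Proof. by rewrite mulr_ge0 ?(ltW (mesh_gt0 _))// ltW// hk_gt0. Qed.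

Let kernel_cvg (z : R * R) : 0 < z.1 -> z.1 < t0 -> restart_kernel n z @[n --> \oo] --> (0 : R).
Proof.
move=> z0 zt; have zt' : 0 < t0 - z.1 by rewrite subr_gt0.
have e : hk (t0 + s - z.1) x z.2 = hS s (fun y => hk (t0 - z.1) y z.2) x.
  apply: EFin_inj; rewrite hSE//; last first.
    split; first by apply: measurable_funTS; apply: continuous_measurable_fun; exact: continuous_hk_l.
    have [C C0 h] := @hk_le R (t0 - z.1); exists (C / Num.sqrt (t0 - z.1)) => y _.
    by rewrite (ltW (hk_gt0 _ _ zt')) h.
  by rewrite hk_semigroup//; congr (hk _ _ _)%:E; ring.
rewrite -(subrr (hk (t0 + s - z.1) x z.2)); apply: cvgB; first exact: cvg_cst.
rewrite e; have := @cvg_riemann_hS s x (fun y => hk (t0 - z.1) y z.2) s0 (continuous_hk_l zt').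
apply: cvg_trans; apply: near_eq_cvg; apply: nearW => n.
by rewrite /riemann_sum; apply: eq_bigr => j _; rewrite zt /wt mulrA.
Qed.

(** Before [t0] the difference is, up to sign, the Riemann error times [u], and tends to 0
    pointwise. Up to a time [b < t0] it is dominated by a multiple of the integrand at [(t0, 0)],
    square integrable by assumption. On the remaining strip the kernels of time [t0 - r] are
    singular, but [u] is bounded and the contribution is small with [t0 - b], uniformly in [n]. *)
Let integral_D_cvg w : (\int[stm]_(z in @spacetime R) (uk 0 t0 0 z w ^+ 2)%:E < +oo)%E ->
  forall dl : R, 0 < dl -> \forall n \near \oo, (\int[stm]_(z in @spacetime R) (D n z w ^+ 2)%:E <= dl%:E)%E.
Proof.
move=> fin dl dl0; have t0p := t00; have sp := s0; have [C C0 hC] := @hk_le R (t0 + s).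
pose K := C / Num.sqrt s; have K0 : 0 < K by rewrite divr_gt0// sqrtr_gt0.
have hK t y z : s <= t -> t <= t0 + s -> hk t y z <= K.
  move=> st tt; apply: le_trans (hC t y z _ tt) _; first exact: lt_le_trans st.
  by rewrite ler_pM2l// lef_pV2 ?posrE ?sqrtr_gt0 ?ler_wsqrtr//; exact: lt_le_trans st.
(* There are [n + 1] weights, each at most [mesh n * K], and the meshes add up to the length 2 of
   the torus. *)
have hW2 n : \sum_(j < n.+1) wt n j <= 2 * K.
  apply: (@le_trans _ _ (\sum_(j < n.+1) mesh n * K)).
    apply: ler_sum => j _; rewrite /wt ler_pM2l ?mesh_gt0// hK//; lra.
  have n0 : n.+1%:R != 0 :> R by rewrite pnatr_eq0.
  have e1 : mesh n * K * n.+1%:R = 2 * K by rewrite /mesh mulrAC divfK.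
  by rewrite sumr_const card_ord -[leLHS]mulr_natr e1.
have [M hM] := @u_bounded (t0 / 2) t0 w (divr_gt0 t00 (ltr0n R 2)).
pose L := 1 + `|M|; have L0 : 0 < L by rewrite /L; have := normr_ge0 M; lra.
have hL r y : t0 / 2 <= r <= t0 -> torus y -> u r y w ^+ 2 <= L ^+ 2.
  move=> hr Ty; rewrite -(real_normK (num_real (u r y w))) lerXn2r ?nnegrE// ?(ltW L0)//.
  by apply: le_trans (hM r y hr Ty) _; rewrite /L; have := ler_norm M; lra.
pose K3 := L ^+ 2 * (4 * K ^+ 2 * t0 + 4 * K ^+ 2 * C * 8 * (1 + t0)).
(* On the strip [b, t0] one factor of the kernel is bounded by C (t0 - r)^(-1/2) *)
pose q (b : R) := L ^+ 2 * (4 * K ^+ 2 * (t0 - b) + 8 * K ^+ 2 * C * (4 * Num.sqrt (t0 - b))).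
have [b [b1 b2 hb]] : exists b, [/\ t0 / 2 <= b, b < t0 & q b <= dl / 2].
  have cq : q b @[b --> t0] --> q t0.
    apply: cvgMr; apply: cvgD; first by apply: cvgMr; apply: cvgB; [exact: cvg_cst|exact: cvg_id].
    apply: cvgMr; apply: cvgMr; apply: (@continuous_comp _ _ _ (fun b => t0 - b) Num.sqrt); last exact: sqrt_continuous.
    by apply: cvgB; [exact: cvg_cst|exact: cvg_id].
  have q0 : q t0 = 0 by rewrite /q subrr sqrtr0 !mulr0 addr0 mulr0.
  have dl2 : 0 < dl / 2 by rewrite divr_gt0.
  move: cq; rewrite q0 => /cvgrPdist_le/(_ _ dl2)/nbhs_ballP[r /= r0 hr].
  pose b := Num.max (t0 / 2) (t0 - r / 2); exists b; split.
  - by rewrite le_max lexx.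
  - by rewrite gt_max; apply/andP; split; lra.
  - have := hr b; rewrite /ball/= sub0r normrN => h; apply: le_trans (ler_norm _) (h _).
    have b3 : t0 - r / 2 <= b by rewrite le_max lexx orbT.
    have b4 : b < t0 by rewrite gt_max; apply/andP; split; lra.
    by rewrite gtr0_norm; lra.
have b0 : 0 < b by apply: lt_le_trans b1; rewrite divr_gt0.
have mS1 : measurable (`]0, b] `*` @torus R) by apply: measurableX; exact: measurable_itv.
have mS2 : measurable (`]b, t0] `*` @torus R) by apply: measurableX; exact: measurable_itv.
have mDS n S : measurable_fun S (fun z => (D n z w ^+ 2)%:E).
  by apply/measurable_EFinP; apply: measurable_funTS; apply: measurable_funX; exact: mD.
have split n : (\int[stm]_(z in @spacetime R) (D n z w ^+ 2)%:E =
    \int[stm]_(z in `]0%R, b] `*` @torus R) (D n z w ^+ 2)%:E + \int[stm]_(z in `]b, t0] `*` @torus R) (D n z w ^+ 2)%:E)%E.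
  rewrite -ge0_integral_setU//; last 3 first.
  - exact: mDS.
  - by move=> z _; rewrite lee_fin sqr_ge0.
  - apply/disj_setPS => z [[/=]]; rewrite in_itv/= => /andP[_ zb] _ [/=]; rewrite in_itv/= => /andP[bz _] _.
    by move: bz; rewrite ltNge zb.
  rewrite [LHS]integral_mkcond [RHS]integral_mkcond; apply: eq_integral => z _; rewrite !patchE.
  case: ifPn => [/set_mem[/= z1 z2]|/negP n1]; case: ifPn => [/set_mem h|/negP n2] //.
  - case: (leP z.1 0) => z0; first by rewrite D0 ?expr0n//; left.
    case: (leP z.1 t0) => zt; last by rewrite D0 ?expr0n//; right.
    exfalso; apply: n2; apply/mem_set; case: (leP z.1 b) => zb; [left|right]; split => //=; by rewrite in_itv/= ?z0 ?zb ?zt.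
  - exfalso; apply: n1; apply/mem_set; case: h => -[/=]; rewrite in_itv/= => /andP[z1 _] z2; split => //=; rewrite in_itv/= andbT.
      exact: ltW.
    by apply: ltW; exact: lt_trans z1.
have near n : (\int[stm]_(z in `]b, t0] `*` @torus R) (D n z w ^+ 2)%:E <= (dl / 2)%:E)%E.
  rewrite ge0_integral_plane; [|exact: measurable_itv|exact: measurable_itv|exact: mDS|by move=> z _; rewrite lee_fin sqr_ge0].
  pose S r y := \sum_(j < n.+1) wt n j * (if r < t0 then hk (t0 - r) (node n j) y else 0).
  have k0 r y z : 0 <= (if r < t0 then hk (t0 - r) y z else 0).
    by case: ifP => // h; apply: ltW; rewrite hk_gt0// subr_gt0.
  have S0 r y : 0 <= S r y by apply: sumr_ge0 => j _; rewrite mulr_ge0.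
  have SB r y : b < r -> r <= t0 -> S r y <= 2 * K * (C * (Num.sqrt (t0 - r))^-1).
    move=> br rt; apply: (@le_trans _ _ (\sum_(j < n.+1) wt n j * (C * (Num.sqrt (t0 - r))^-1))).
      apply: ler_sum => j _; apply: ler_wpM2l => //; case: ifPn => h; last by rewrite mulr_ge0 ?(ltW C0)// invr_ge0 sqrtr_ge0.
      apply: hC; first by rewrite subr_gt0.
      by apply: (@le_trans _ _ t0); [rewrite gerBl; exact/ltW/(lt_trans b0 br)|rewrite lerDl ltW].
    by rewrite -mulr_suml ler_wpM2r// mulr_ge0 ?(ltW C0)// invr_ge0 sqrtr_ge0.
  have mk r : b < r -> r <= t0 -> forall j : 'I_n.+1, measurable_fun (@torus R) (fun y => (wt n j * (if r < t0 then hk (t0 - r) (node n j) y else 0))%:E).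
    move=> br rt j; apply/measurable_EFinP; apply: measurable_funM => //; case: (boolP (r < t0)) => h; last exact: measurable_cst.
    by apply: measurable_funTS; apply: measurable_hk; rewrite subr_gt0.
  have intS r : b < r -> r <= t0 -> (\int[mu]_(y in @torus R) (S r y)%:E <= (2 * K)%:E)%E.
    move=> br rt; rewrite /S; under eq_integral do rewrite -sumEFin.
    rewrite ge0_integral_sum//; last 2 first.
    - by move=> j; exact: mk.
    - by move=> j y _; rewrite lee_fin mulr_ge0.
    apply: (@le_trans _ _ (\sum_(j < n.+1) (wt n j)%:E)%E); last by rewrite sumEFin lee_fin.
    apply: lee_sum => j _; case: (boolP (r < t0)) => h; last first.
      by under eq_integral do rewrite mulr0; rewrite integral0 lee_fin.
    under eq_integral do rewrite EFinM.
    rewrite ge0_integralZl_EFin//.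
    - by rewrite integral_hk ?mule1// subr_gt0.
    - by move=> y _; rewrite lee_fin ltW// hk_gt0// subr_gt0.
    - by apply/measurable_EFinP; apply: measurable_funTS; apply: measurable_hk; rewrite subr_gt0.
  have inner r : b < r -> r <= t0 -> (\int[mu]_(y in @torus R) (D n (r, y) w ^+ 2)%:E <=
      (L ^+ 2 * (4 * K ^+ 2 + 8 * K ^+ 2 * C * (Num.sqrt (t0 - r))^-1))%:E)%E.
    move=> br rt; set c := (Num.sqrt (t0 - r))^-1; have c0 : 0 <= c by rewrite invr_ge0 sqrtr_ge0.
    pose A := L ^+ 2 * (2 * K ^+ 2); pose B := L ^+ 2 * (4 * K * C * c).
    have A0 : 0 <= A by apply: mulr_ge0; [exact: sqr_ge0|apply: mulr_ge0 => //; exact: sqr_ge0].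
    have B0 : 0 <= B by rewrite !mulr_ge0 ?(ltW L0) ?(ltW K0) ?(ltW C0).
    apply: (@le_trans _ _ (\int[mu]_(y in @torus R) (A%:E + B%:E * (S r y)%:E))%E).
      apply: ge0_integral_mono => y Ty; first by rewrite lee_fin sqr_ge0.
      rewrite -EFinM -EFinD lee_fin DE//=; last exact: lt_trans br.
      rewrite sqrrN exprMn /restart_kernel/= -/(S r y).
      have k1 : hk (t0 + s - r) x y <= K by apply: hK; [rewrite addrAC lerDr subr_ge0|rewrite gerBl; exact/ltW/(lt_trans b0 br)].
      have k2 : 0 <= hk (t0 + s - r) x y by apply/ltW/hk_gt0; rewrite addrAC ltr_wpDl ?subr_ge0.
      set h := hk _ _ _ in k1 k2 *; have s1 := S0 r y; have s2 := SB r y br rt; set Sr := S r y in s1 s2 *.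
      have hur : u r y w ^+ 2 <= L ^+ 2 by apply: hL => //; rewrite (le_trans b1 (ltW br)) rt.
      have hS2 : Sr ^+ 2 <= 2 * K * (C * c) * Sr by rewrite expr2 ler_wpM2r.
      have hh : h ^+ 2 <= K ^+ 2 by rewrite lerXn2r ?nnegrE// ltW.
      have e1 : (h - Sr) ^+ 2 <= 2 * K ^+ 2 + 4 * K * C * c * Sr.
        have : (h - Sr) ^+ 2 <= 2 * h ^+ 2 + 2 * Sr ^+ 2.
          by rewrite -subr_ge0 (_ : _ - _ = (h + Sr) ^+ 2) ?sqr_ge0//; ring.
        have e2 : 2 * (2 * K * (C * c) * Sr) = 4 * K * C * c * Sr by ring.
        by rewrite -e2; lra.
      rewrite mulrC; apply: (@le_trans _ _ (L ^+ 2 * (h - Sr) ^+ 2)); first by rewrite ler_wpM2r// sqr_ge0.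
      rewrite /A /B -[leRHS](_ : L ^+ 2 * (2 * K ^+ 2 + 4 * K * C * c * Sr) = _); last by ring.
      by rewrite ler_wpM2l// sqr_ge0.
    rewrite ge0_integralD//; last 2 first.
    - by move=> y _; rewrite mule_ge0// lee_fin.
    - apply: measurable_funeM; rewrite /S; under eq_fun do rewrite -sumEFin.
      by apply: emeasurable_sum => j; exact: mk.
    have mT2 : measurable (@torus R) by exact: measurable_itv.
    have eA : (\int[mu]_(_ in @torus R) A%:E = A%:E * 2%:E)%E.
      by apply: (eq_trans (integral_cst mu mT2 A%:E)); congr (_ * _)%E; exact: torus_measure.
    rewrite eA ge0_integralZl_EFin//; last 2 first.
    - by move=> y _; rewrite lee_fin.
    - by rewrite /S; under eq_fun do rewrite -sumEFin; apply: emeasurable_sum => j; exact: mk.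
    apply: (@le_trans _ _ (A%:E * 2%:E + B%:E * (2 * K)%:E)%E); first by apply: leeD => //; apply: lee_wpmul2l => //; exact: intS.
    by rewrite -!EFinM -EFinD lee_fin /A /B le_eqVlt; apply/orP; left; apply/eqP; ring.
  apply: (@le_trans _ _ (\int[mu]_(r in `]b, t0]) ((L ^+ 2 * (4 * K ^+ 2))%:E + (L ^+ 2 * (8 * K ^+ 2 * C))%:E * ((Num.sqrt (t0 - r))^-1)%:E))%E).
    apply: ge0_integral_mono => r; rewrite /= in_itv/= => /andP[br rt].
      by apply: integral_ge0 => y _; rewrite lee_fin sqr_ge0.
    by apply: le_trans (inner r br rt) _; rewrite -EFinM -EFinD mulrDr !mulrA.
  have a1 : 0 <= L ^+ 2 * (4 * K ^+ 2) by apply: mulr_ge0; [exact: sqr_ge0|apply: mulr_ge0 => //; exact: sqr_ge0].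
  have a2 : 0 <= L ^+ 2 * (8 * K ^+ 2 * C) by rewrite !mulr_ge0 ?(ltW L0) ?(ltW K0) ?(ltW C0).
  have ms : measurable_fun `]b, t0[ (fun r => ((Num.sqrt (t0 - r))^-1)%:E).
    apply/measurable_EFinP; apply: measurable_funV => [r|].
      by rewrite /= in_itv/= sqrtr_gt0 subr_gt0 => /andP[].
    apply: (measurableT_comp (continuous_measurable_fun (@sqrt_continuous R))).
    by apply: measurable_realfun.measurable_funB => //; exact: measurable_id.
  have ms' : measurable_fun `]b, t0[ (fun r => (L ^+ 2 * (4 * K ^+ 2))%:E + (L ^+ 2 * (8 * K ^+ 2 * C))%:E * ((Num.sqrt (t0 - r))^-1)%:E)%E.
    by apply: emeasurable_funD => //; exact: measurable_funeM.
  rewrite -(integral_itv_bndo_bndc ms').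
  rewrite ge0_integralD; [|exact: measurable_itv|by move=> r _; rewrite lee_fin|exact: measurable_cst|
    by move=> r _; rewrite mule_ge0// lee_fin// invr_ge0 sqrtr_ge0|exact: measurable_funeM].
  have mu_itv : (mu `]b, t0[ = (t0 - b)%:E) by rewrite lebesgue_measure_itv /= lte_fin b2.
  have tb : 0 <= t0 - b by lra.
  have le1 : (\int[mu]_(r in `]b, t0[) ((Num.sqrt (t0 - r))^-1)%:E <= (4 * Num.sqrt (t0 - b))%:E)%E.
    apply: le_trans (integral_kprof_le (ltW b0) (ltW b2) (lexx t0)).
    apply: ge0_integral_mono => r _; rewrite lee_fin ?invr_ge0 ?sqrtr_ge0// /kprof lerDl.
    by rewrite invr_ge0 sqrtr_ge0.
  have mI : measurable `]b, t0[ by exact: measurable_itv.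
  have eB : (\int[mu]_(_ in `]b, t0[) (L ^+ 2 * (4 * K ^+ 2))%:E = (L ^+ 2 * (4 * K ^+ 2))%:E * (t0 - b)%:E)%E.
    by apply: (eq_trans (integral_cst mu mI _)); congr (_ * _)%E; exact: mu_itv.
  rewrite eB ge0_integralZl_EFin//.
  apply: (@le_trans _ _ ((L ^+ 2 * (4 * K ^+ 2))%:E * (t0 - b)%:E + (L ^+ 2 * (8 * K ^+ 2 * C))%:E * (4 * Num.sqrt (t0 - b))%:E)%E).
    by apply: leeD => //; apply: lee_wpmul2l => //; rewrite lee_fin.
  rewrite -!EFinM -EFinD lee_fin; apply: le_trans hb; rewrite /q le_eqVlt; apply/orP; left; apply/eqP; ring.
have tb0 : 0 < t0 - b by rewrite subr_gt0.
(* Before [b] the kernel at [(t0, 0)] is bounded below, so a multiple of its integrand dominates any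
   bounded kernel times [u]. This replaces a bound on [u] near time 0. *)
have [c c0 hc] := hk_lower t0 tb0.
pose K2 := K + 2 * K * (C / Num.sqrt (t0 - b)).
have K20 : 0 <= K2 by rewrite addr_ge0 ?(ltW K0)// !mulr_ge0 ?(ltW K0) ?(ltW C0)// invr_ge0 sqrtr_ge0.
have far : (\int[stm]_(z in `]0%R, b] `*` @torus R) (D n z w ^+ 2)%:E)%E @[n --> \oo] --> (\int[stm]_(z in `]0%R, b] `*` @torus R) (0 : R)%:E)%E.
  have [||||] // := @cvg_integral_dominated R _ _ stm (`]0, b] `*` @torus R) (fun n z => D n z w ^+ 2) (fun=> 0)
    (fun z => (K2 / c) ^+ 2 * uk 0 t0 0 z w ^+ 2) mS1.
  - by move=> n; apply: measurable_funTS; apply: measurable_funX; exact: mD.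
  - apply: (@eq_integrable _ _ _ stm _ mS1 (fun z => ((K2 / c) ^+ 2)%:E * (uk 0 t0 0 z w ^+ 2)%:E)%E) => //.
    apply: integrableZl => //; apply/integrableP; split.
      by apply/measurable_EFinP; apply: measurable_funTS; apply: measurable_funX; exact: measurable_uk.
    apply: le_lt_trans fin; under eq_integral do rewrite gee0_abs ?lee_fin ?sqr_ge0//.
    apply: ge0_subset_integral => //.
    + exact: measurable_spacetime.
    + by apply/measurable_EFinP; apply: measurable_funTS; apply: measurable_funX; exact: measurable_uk.
    + by move=> z _; rewrite lee_fin sqr_ge0.
    + by move=> z [/=]; rewrite in_itv/= => /andP[z1 _] z2; split => //=; rewrite in_itv/= andbT ltW.
  - move=> n z [/=]; rewrite in_itv/= => /andP[z1 z2] z3; have zt : z.1 < t0 by exact: le_lt_trans b2.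
    rewrite ger0_norm ?sqr_ge0// DE ?(ltW zt)// sqrrN exprMn.
    have -> : uk 0 t0 0 z w = hk (t0 - z.1) 0 z.2 * u z.1 z.2 w.
      by move: z3; rewrite /uk /torus/= in_itv/= => ->; rewrite z1 zt.
    rewrite (_ : (K2 / c) ^+ 2 * (hk (t0 - z.1) 0 z.2 * u z.1 z.2 w) ^+ 2 =
      ((K2 / c) ^+ 2 * hk (t0 - z.1) 0 z.2 ^+ 2) * u z.1 z.2 w ^+ 2); last by ring.
    apply: ler_wpM2r; first exact: sqr_ge0.
    have h1 : c <= hk (t0 - z.1) 0 z.2 by apply: hc; [rewrite lerD2l lerN2|rewrite gerBl ltW].
    apply: (@le_trans _ _ (K2 ^+ 2)).
      rewrite -(real_normK (num_real (restart_kernel n z))) lerXn2r ?nnegrE//.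
      apply: le_trans (ler_normB _ _) _; apply: lerD.
        rewrite ger0_norm; first by apply: hK; [rewrite addrAC lerDr subr_ge0 ltW|rewrite gerBl ltW].
        by apply/ltW/hk_gt0; rewrite addrAC addr_gt0// subr_gt0.
      rewrite ger0_norm; last by apply: sumr_ge0 => j _; rewrite zt mulr_ge0// ltW// hk_gt0// subr_gt0.
      apply: (@le_trans _ _ (\sum_(j < n.+1) wt n j * (C / Num.sqrt (t0 - b)))).
        apply: ler_sum => j _; apply: ler_wpM2l => //; rewrite zt.
        have bz : t0 - b <= t0 - z.1 by rewrite lerD2l lerN2.
        have tz : 0 < t0 - z.1 by rewrite subr_gt0.
        have tz1 : t0 - z.1 <= t0 + s by apply: (@le_trans _ _ t0); [rewrite gerBl ltW|rewrite lerDl ltW].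
        apply: le_trans (hC _ _ _ tz tz1) _.
        by rewrite ler_pM2l// lef_pV2 ?posrE ?sqrtr_gt0// ler_wsqrtr.
      by rewrite -mulr_suml ler_wpM2r// divr_ge0 ?(ltW C0)// sqrtr_ge0.
    rewrite -exprMn lerXn2r ?nnegrE//.
      by rewrite mulr_ge0 ?divr_ge0 ?(ltW c0)//; exact: le_trans (ltW c0) h1.
    by rewrite -[leLHS](divfK (lt0r_neq0 c0)); apply: ler_wpM2l h1; rewrite divr_ge0// ltW.
  - move=> z [/=]; rewrite in_itv/= => /andP[z1 z2] z3; have zt : z.1 < t0 by exact: le_lt_trans b2.
    have h : restart_kernel n z * u z.1 z.2 w @[n --> \oo] --> (0 : R).
      by rewrite -(mul0r (u z.1 z.2 w)); apply: cvgMl; exact: kernel_cvg.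
    have -> : (fun n => D n z w ^+ 2) = (fun n => (restart_kernel n z * u z.1 z.2 w) ^+ 2).
      by apply: funext => n; rewrite DE ?(ltW zt)// sqrrN.
    by rewrite -[X in _ --> X](expr0n _ 2); apply: (@cvg_comp _ _ _ _ (fun a : R => a ^+ 2) _ _ _ h); exact: exprn_continuous.
rewrite integral0 in far; have dl2 : 0 < dl / 2 by rewrite divr_gt0.
have /fine_cvgP[ffin /cvgrPdist_le/(_ _ dl2) hfine] := far.
apply: filterS2 hfine ffin => n h1 h2; rewrite split.
rewrite [dl]splitr.
rewrite EFinD; apply: leeD => //.
rewrite -(fineK h2) lee_fin; apply: le_trans (ler_norm _) _; move: h1.
by rewrite sub0r normrN.
Qed.

(** A stochastic Fubini theorem in disguise. The mild equation at [(t0 + s, x)] minus the Riemann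
    sum of those at time [t0] has the stochastic integral [I_ n]; in the limit the terms in [u0]
    cancel by the semigroup property and the integrand becomes that of the restarted equation. This
    gives a Walsh integral from time 0, and [walsh_after] moves its start to [t0]. *)
Lemma walsh_restart : walsh t0 (uk t0 (t0 + s) x) (fun w => (u (t0 + s) x w - hS s (u t0 ^~ w) x) / Q).
Proof.
set J := (X in walsh _ _ X).
have ts0 : 0 < t0 + s by rewrite addr_gt0.
apply: walsh_after => //.
  by move=> z w zt; rewrite /uk ltNge zt.
apply: walsh_lim => [w|e e0]; first by apply: measurable_uk; exact: ltW.
have [I0 [wI0 eI0]] := walsh_of_mild x ts0.
have /choice[IS hIS] : forall z, exists I : {RV P >-> R}, walsh 0 (uk 0 t0 z) I /\
  {ae P, forall w, u t0 z w = hS t0 (u0 w) z + Q * I w} by move=> z; exact: walsh_of_mild.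
pose I_ n w := I0 w - \sum_(j < n.+1) wt n j * IS (node n j) w.
have wPhi n : walsh 0 (Phi n) (I_ n).
  by apply: (@walsh_sub_sum 0 n.+1 (wt n) _ _ (fun j => uk 0 t0 (node n j)) (fun j => IS (node n j))) => // j; exact: (hIS _).1.
pose e4 := e / 2; have e40 : 0 < e4 by rewrite divr_gt0.
(* The mild equation at [(t0, 0)] makes its integrand square integrable off a small event, as
   [integral_D_cvg] demands. *)
have near1 : \forall n \near \oo, exists N, [/\ measurable N, (P N <= (2 * (e4 / 2))%:E)%E &
    forall w, ~ N w -> (\int[stm]_(z in @spacetime R) (D n z w ^+ 2)%:E <= (e4 / 2)%:E)%E].
  have [IZ [[_ hIZ] _]] := walsh_of_mild 0 t00.
  have [es [N0 [_ mN0 pN0 hN0]]] := hIZ (e4 / 2) (divr_gt0 e40 (ltr0n R 2)).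
  apply: (near_small _ _ mN0 pN0); first by rewrite divr_gt0.
    by move=> n; apply: measurable_integral_sqr; exact: mD2.
  move=> w /hN0[h _]; apply: integral_D_cvg.
  have hB : (\int[stm]_(z in @spacetime R) (simple_process es z w ^+ 2)%:E <= (lin_var (at_point (eform es) w))%:E)%E.
    by rewrite simple_process_int.
  rewrite (_ : (\int[stm]_(z in _) _)%E = (\int[stm]_(z in @spacetime R)
      ((1 * (uk 0 t0 0 z w - simple_process es z w) + 1 * simple_process es z w) ^+ 2)%:E)%E); last first.
    by apply: eq_integral => z _; congr EFin; ring.
  apply: le_lt_trans (@integral_sqrD R (fun z => uk 0 t0 0 z w - simple_process es z w) (simple_process es ^~ w) 1 1 _ _ _ _ h hB) _.
  - by apply: measurable_realfun.measurable_funB; [exact: measurable_uk|exact: measurable_simple_process].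
  - exact: measurable_simple_process.
  - exact: ltry.
have [_ [N2 [mN2 pN2 hN2]]] : True /\ {ae P, forall w, I_ n w - J w @[n --> \oo] --> (0 : R)}.
  split => //.
  have ha : {ae P, forall w, forall n j, u t0 (node n j) w = hS t0 (u0 w) (node n j) + Q * IS (node n j) w}.
    by apply/ae_foralln => n; apply/ae_foralln => j; exact: (hIS _).2.
  apply: filterS2 ha eI0 => w hn h0.
  have Q0 : Q != 0 by rewrite gt_eqF.
  have cf := continuous_hS t00 (nnbounded_u0 w).
  have c1 := @cvg_riemann_hS s x (fun y => u t0 y w) s0 (@continuous_u t0 w t00).
  have c2 := @cvg_riemann_hS s x _ s0 cf.
  have eI n : I_ n w = (u (t0 + s) x w - hS (t0 + s) (u0 w) x -
      (riemann_sum (fun y => hk s x y * u t0 y w) n - riemann_sum (fun y => hk s x y * hS t0 (u0 w) y) n)) / Q.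
    have -> : riemann_sum (fun y => hk s x y * u t0 y w) n =
        riemann_sum (fun y => hk s x y * hS t0 (u0 w) y) n + Q * \sum_(j < n.+1) wt n j * IS (node n j) w.
      rewrite /riemann_sum mulr_sumr -big_split/=; apply: eq_bigr => j _.
      by rewrite hn /wt; ring.
    by rewrite h0 /I_; field.
  pose a n := u (t0 + s) x w - hS (t0 + s) (u0 w) x -
    (riemann_sum (fun y => hk s x y * u t0 y w) n - riemann_sum (fun y => hk s x y * hS t0 (u0 w) y) n).
  pose al := u (t0 + s) x w - hS (t0 + s) (u0 w) x - (hS s (fun y => u t0 y w) x - hS s (hS t0 (u0 w)) x).
  have c3 : a n @[n --> \oo] --> al by apply: cvgB; [exact: cvg_cst|exact: cvgB].
  have c4 : a n / Q @[n --> \oo] --> al / Q by apply: cvgMl.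
  have al0 : al / Q - J w = 0.
    by rewrite /al hS_comp//; [rewrite (addrC s) /J; field|exact: nnbounded_u0].
  have -> : (fun n => I_ n w - J w) = (fun n => a n / Q - J w) by apply: funext => n; rewrite eI.
  by rewrite -al0; exact: (cvgB c4 (cvg_cst (J w))).
have mJ : measurable_fun setT J.
  apply: measurable_funM => //; apply: measurable_realfun.measurable_funB.
    exact: (adapted_measurable hu0 (adapted_u x ts0)).
  exact: (adapted_measurable hu0 (adapted_hS x t00 s0)).
have near2 : \forall n \near \oo, exists N, [/\ measurable N, (P N <= (2 * (e4 / 2))%:E)%E &
    forall w, ~ N w -> (`|I_ n w - J w|%:E <= (e4 / 2)%:E)%E].
  apply: (@near_small (fun n w => `|I_ n w - J w|%:E) N2) => //; first by rewrite divr_gt0.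
  - move=> n; apply/measurable_EFinP; apply: measurableT_comp => //; apply: measurable_realfun.measurable_funB => //.
    apply: measurable_realfun.measurable_funB => //; apply: measurable_sum => j; exact: measurable_funM.
  - by rewrite pN2 lee_fin !divr_ge0// ltW.
  - move=> w wN dl dl0; have : I_ n w - J w @[n --> \oo] --> (0 : R) by apply: contrapT => h; apply: wN; exact: hN2.
    by move=> /cvgrPdist_le/(_ _ dl0); apply: filterS => n; rewrite sub0r normrN lee_fin.
have [n [[N [mN pN hN]] [N' [mN' pN' hN']]]] : exists n, (exists N, [/\ measurable N, (P N <= (2 * (e4 / 2))%:E)%E &
    forall w, ~ N w -> (\int[stm]_(z in @spacetime R) (D n z w ^+ 2)%:E <= (e4 / 2)%:E)%E]) /\
  (exists N, [/\ measurable N, (P N <= (2 * (e4 / 2))%:E)%E & forall w, ~ N w -> (`|I_ n w - J w|%:E <= (e4 / 2)%:E)%E]).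
  have [m _ hm] := filterI near1 near2; exists m; exact: (hm m (leqnn m)).
exists (Phi n), (I_ n), (N `|` N'); split => //.
- exact: measurableU.
- apply: le_trans (measureU2 P mN mN') _; apply: le_trans (leeD pN pN') _.
  by rewrite -EFinD lee_fin /e4; lra.
- move=> w /not_orP[/hN h1 /hN' h2]; split.
    by apply: le_trans h1 _; rewrite lee_fin /e4; lra.
  by move: h2; rewrite lee_fin => /le_trans; apply; rewrite /e4; lra.
Qed.

End restart.

End mild.

(** * A Harnack inequality by chaining *)

Section harnack.
Context {R : realType} {d : measure_display} {T : measurableType d} (P : probability T R).
Variables (W : set (R * R) -> {RV P >-> R}) (Q : R) (u0 : T -> R -> R) (u : R -> R -> T -> R).
Hypotheses (hW : white_noise W) (hQ : 0 < Q) (hu0 : initial_datum W u0) (hu : mild_solution Q W u0 u).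
Local Notation mu := (@lebesgue_measure R).
Local Notation stm := ((@lebesgue_measure R \x @lebesgue_measure R)%E).
Local Notation walsh := (walsh W u0).
Local Notation adapted := (adapted W u0).
Let mT : measurable (@torus R) := @measurable_torus R.

Lemma nnbounded_u t w : 0 < t -> (forall x, 0 <= u t x w) -> nnbounded (u t ^~ w).
Proof.
move=> t0 up; split.
  by apply: measurable_funTS; apply: continuous_measurable_fun; exact: (continuous_u hu t0).
have [M hM] := u_bounded hu t w t0; exists M => y Ty; rewrite up/=.
by apply: le_trans (ler_norm _) _; apply: hM; rewrite ?lexx.
Qed.

Lemma continuous_hS2 (f : R -> R) (z : R * R) : nnbounded f -> 0 < z.1 ->
  {for z, continuous (fun z : R * R => hS z.1 f z.2)}.
Proof.
move=> bf z0; have [mf [M fM]] := bf; have [C C0 hC] := hS_lip (2 * z.1).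
pose m : R := Num.min 1 (z.1 / 2); have m0 : 0 < m by rewrite lt_min ltr01 divr_gt0.
have m1 : m <= 1 by rewrite ge_min lexx.
have mz : m <= z.1 / 2 by rewrite ge_min lexx orbT.
pose L := C / m ^+ 2 * `|M|; have L0 : 0 <= L by rewrite mulr_ge0// divr_ge0 ?exprn_ge0// ltW.
have bd t x : 0 < t -> 0 <= hS t f x <= `|M|.
  move=> t0; rewrite hS_ge0//= hS_ub// => y /fM/andP[_ h]; exact: le_trans (ler_norm M).
apply/cvgrPdist_le => e e0; apply/(@nbhs_ballP R (R * R)%type).
pose r := Num.min (Num.min 2 m) (e / (L + 1)).
have r0 : 0 < r by rewrite lt_min; apply/andP; split; [rewrite lt_min; apply/andP|apply: divr_gt0 => //; lra].
have r2 : r <= 2 by rewrite !ge_min lexx.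
have rm : r <= m.
  have m2 : Num.min 2 m <= m by rewrite ge_min lexx orbT.
  by apply: le_trans m2; rewrite /r ge_min lexx.
have re : r * L <= e.
  apply: (@le_trans _ _ (e / (L + 1) * (L + 1))); last by rewrite divfK//; lra.
  by apply: ler_pM => //; [exact: ltW|rewrite ge_min lexx orbT|lra].
exists r => // -[t x] [/= b1 b2].
have [t1 t2] : z.1 / 2 <= t /\ t <= 2 * z.1.
  by move: (b1); rewrite /ball/= => /(lt_le_trans)/(_ rm); rewrite ltr_norml => /andP[*]; split; lra.
have t0 : 0 < t by lra.
have zz : z.1 / 2 <= z.1 by lra.
have d1 : `|z.1 - t| <= r by exact: ltW.
have d2 : `|z.2 - x| <= r by exact: ltW.
have h1 := hC z.1 t z.2 x f m r bf m0 m1 (le_trans mz zz) ltac:(lra) (le_trans mz t1) d1 d2 r2.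
rewrite distrC in d1; rewrite distrC in d2.
have h2 := hC t z.1 x z.2 f m r bf m0 m1 (le_trans mz t1) t2 (le_trans mz zz) d1 d2 r2.
have /andP[g0 g1] := bd z.1 z.2 z0; have /andP[g0' g1'] := bd t x t0.
have ee : C * r / m ^+ 2 * `|M| = r * L by rewrite /L; ring.
have c0 : 0 <= C * r / m ^+ 2 by rewrite divr_ge0 ?exprn_ge0 ?mulr_ge0// ltW.
have k1 : C * r / m ^+ 2 * hS z.1 f z.2 <= r * L by rewrite -ee ler_wpM2l.
have k2 : C * r / m ^+ 2 * hS t f x <= r * L by rewrite -ee ler_wpM2l.
by move: h1 h2; rewrite !mulrBl !mul1r ler_norml => h1 h2; apply/andP; split; lra.
Qed.

Lemma continuous_u2 (z : R * R) w : 0 < z.1 -> {for z, continuous (fun z : R * R => u z.1 z.2 w)}.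
Proof.
move=> z0; have [_ hc _ _] := hu.
have oD : open [set z : R * R | 0 < z.1].
  by apply: (open_comp (f := fst) (D := [set x : R | 0 < x])); [move=> y _; exact: cvg_fst|exact: open_gt].
by have := hc w; rewrite continuous_open_subspace// => /(_ z); rewrite inE => /(_ z0).
Qed.

Section restarted.
Variables (t0 kap : R).
Hypotheses (t00 : 0 < t0) (kap0 : 0 < kap).

Let f w := u t0 ^~ w.

(* On the event [kap <= u t0], this is [1 / (hS s (u t0) x)]; the truncation makes it bounded everywhere. *)
Definition inv_hS (s x : R) (w : T) : R := (Num.max kap (hS s (f w) x))^-1.

Let inv_bounded s x : boundedf (inv_hS s x).
Proof.
exists kap^-1 => w; have h : kap <= Num.max kap (hS s (f w) x) by rewrite le_max lexx.
by rewrite ger0_norm ?invr_ge0 ?lef_pV2 ?posrE ?(le_trans (ltW kap0) h)//; exact: lt_le_trans h.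
Qed.

Let inv_adapted s x : 0 < s -> adapted t0 (inv_hS s x).
Proof.
move=> s0; apply: measurable_funV.
  by move=> w _; apply: lt_le_trans kap0 _; rewrite le_max lexx.
apply: measurable_maxr; first exact: measurable_cst.
exact: (adapted_hS hu).
Qed.

(* [u / P_s (u t0) - 1], set to [0] at the initial time [s = 0] *)
Definition ratio (s x : R) (w : T) : R := if 0 < s then u (t0 + s) x w / hS s (f w) x - 1 else 0.

(** With the truncated reciprocal this is a Walsh integral on the whole sample space; it equals
    [ratio / Q] where [kap <= u t0]. *)
Let trunc_ratio s x w := if 0 < s then inv_hS s x w * ((u (t0 + s) x w - hS s (f w) x) / Q) else 0.

Let walsh_ratio s x : 0 <= s ->
  walsh t0 (fun z w => inv_hS s x w * uk u t0 (t0 + s) x z w) (trunc_ratio s x).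
Proof.
have b0 (c : R) : boundedf (fun _ : T => c) by exists `|c|.
have a0 c : adapted t0 (fun=> c) by exact: measurable_cst.
rewrite le_eqVlt => /predU1P[<-|s0].
  (* At [s = 0] the integrand is 0, obtained as a zero multiple of an arbitrary Walsh integral. *)
  have w1 := walsh_restart hW hQ hu0 hu x t00 ltr01.
  have := walsh_lin (ltW t00) (b0 0) (b0 0) (a0 0) (a0 0) w1 w1.
  rewrite (_ : (fun z w => 0 * _ + _) = (fun z w => inv_hS 0 x w * uk u t0 (t0 + 0) x z w)).
    by rewrite (_ : (fun w : T => 0 * _ + _) = trunc_ratio 0 x)//; apply: funext => w; rewrite /trunc_ratio ltxx !mul0r addr0.
  apply: funext => z; apply: funext => w; rewrite /uk !mul0r !addr0.
  by case: ifP => [/andP[/andP[h1 h2] _]|_]; [have := lt_trans h1 h2; rewrite ltxx|rewrite mulr0].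
have w1 := walsh_restart hW hQ hu0 hu x t00 s0.
have := walsh_lin (ltW t00) (inv_bounded s x) (b0 0) (inv_adapted x s0) (a0 0) w1 w1.
rewrite (_ : (fun z w => _ + 0 * _) = (fun z w => inv_hS s x w * uk u t0 (t0 + s) x z w)).
  rewrite (_ : (fun w : T => _ + 0 * _) = trunc_ratio s x)//.
  by apply: funext => w; rewrite /trunc_ratio s0 mul0r addr0.
by apply: funext => z; apply: funext => w; rewrite mul0r addr0.
Qed.

Definition doubled (S : R) (w : T) : Prop :=
  forall r y, 0 < r -> r < S -> `|u (t0 + r) y w| <= 2 * hS r (f w) y.

(** Half the difference of the two ratios, divided by [Q], is the Walsh integral of [u / (2 g)]
    times a difference of densities, with [g] the semigroup, and [|u / (2 g)| <= 1] while [doubled]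
    holds. The threshold [a / (2 Q)] in [walsh_tail] gives the constant [128 Q^2 = 32 (2 Q)^2]. *)
Lemma ratio_increment (C : R) : 
  (forall (f : R -> R) (c s s' x x' del eta : R),
  nnbounded f -> 0 < c -> (forall y, torus y -> c <= f y) ->
  0 <= s' -> s' <= s -> s <= 1 -> s - s' <= del -> `|x - x'| <= del -> del <= 2 ->
  0 < eta -> eta <= 1 ->
  (\int[mu]_(r in `]0%R, s[) \int[mu]_(y in @torus R)
     ((qk f s x r y - if r < s' then qk f s' x' r y else 0) ^+ 2)%:E <=
   (C * (Num.sqrt eta + del / eta ^+ 2 + Num.sqrt del))%:E)%E) -> 0 < C ->
  forall s s' x x' del eta a dlt : R, 0 <= s' -> s' <= s -> s <= 1 -> s - s' <= del -> `|x - x'| <= del ->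
  0 < del -> del <= 2 -> 0 < eta -> eta <= 1 -> 0 < a -> 0 < dlt ->
  exists N, [/\ measurable N,
    (P N <= (2 * expR (- (a ^+ 2 / (128 * Q ^+ 2 * (C * (Num.sqrt eta + del / eta ^+ 2 + Num.sqrt del))))) + dlt)%:E)%E &
    forall w, ~ N w -> (forall y, kap <= u t0 y w) -> doubled s w ->
      `|ratio s x w - ratio s' x' w| <= a].
Proof.
move=> hC C0 s s' x x' del eta a dlt s'0 ss s1 ds dx del0 del2 eta0 eta1 a0 dlt0.
have s0 : 0 <= s by exact: le_trans ss.
set b := C * _.
have b0 : 0 < b.
  by rewrite mulr_gt0// ltr_wpDr ?sqrtr_ge0// addr_gt0 ?sqrtr_gt0// divr_gt0// exprn_gt0.
have bc (c : R) : boundedf (fun _ : T => c) by exists `|c|.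
have ac c : adapted t0 (fun=> c) by exact: measurable_cst.
have wd := walsh_lin (ltW t00) (bc 2^-1) (bc (- 2^-1)) (ac 2^-1) (ac (- 2^-1)) (walsh_ratio x s0) (walsh_ratio x' s'0).
have a2 : 0 < a / (2 * Q) by rewrite divr_gt0// mulr_gt0.
have [N [mN pN hN]] := walsh_tail hW hu0 wd a2 b0 dlt0.
exists N; split => //.
  move: pN; rewrite (_ : (a / (2 * Q)) ^+ 2 / (32 * b) = a ^+ 2 / (128 * Q ^+ 2 * b))//.
  by have Q0 := lt0r_neq0 hQ; have b1 := lt0r_neq0 b0; field; rewrite Q0 b1.
move=> w nN ku hd; have up y : 0 <= u t0 y w by exact: le_trans (ltW kap0) (ku y).
have bf := nnbounded_u t00 up.
have gk r y : 0 < r -> kap <= hS r (f w) y by move=> r0; exact: (hS_lb y r0 bf (ltW kap0) (fun y _ => ku y)).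
have gp r y : 0 < r -> 0 < hS r (f w) y by move=> r0; exact: lt_le_trans (gk r y r0).
have inv r y : 0 < r -> inv_hS r y w = (hS r (f w) y)^-1.
  by move=> r0; rewrite /inv_hS; congr (_^-1); apply/max_idPr; exact: gk.
have tr r y : trunc_ratio r y w = ratio r y w / Q.
  rewrite /trunc_ratio /ratio; case: ifP => r0; last by rewrite mul0r.
  by have g0 := lt0r_neq0 (gp r y r0); have Q0 := lt0r_neq0 hQ; rewrite inv//; field; rewrite Q0 g0.
pose Psi (z : R * R) := 2^-1 * (inv_hS s x w * uk u t0 (t0 + s) x z w) + (- 2^-1) * (inv_hS s' x' w * uk u t0 (t0 + s') x' z w).
have mPsi : measurable_fun [set: R * R] Psi.
  by apply: measurable_realfun.measurable_funD; apply: measurable_funM => //; apply: measurable_funM => //; apply: (measurable_uk hu0 hu); exact: ltW.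
pose A (r : R) : \bar R := (\int[mu]_(y in @torus R) ((Psi (r, y)) ^+ 2)%:E)%E.
have A0 r : (0 <= A r)%E by apply: integral_ge0 => y _; rewrite lee_fin sqr_ge0.
have mA : measurable_fun [set: R] A.
  have mS : measurable ([set: R] `*` @torus R) by apply: measurableX.
  have mP2 : measurable_fun ([set: R] `*` @torus R) (fun z => (Psi z ^+ 2)%:E).
    by apply: measurable_funTS; apply/measurable_EFinP; apply: measurable_funX.
  have r0 z : (0 <= ((fun z : R * R => (Psi z ^+ 2)%:E) \_ ([set: R] `*` @torus R)) z)%E.
    by apply: erestrict_ge0 => *; rewrite lee_fin sqr_ge0.
  have := @measurable_fun_fubini_tonelli_F _ _ (measurableTypeR R) (measurableTypeR R) R mu _ ((measurable_restrictT _ mS).1 mP2) r0.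
  move=> h; apply: eq_measurable_fun h => r _; rewrite /fubini_F /A [RHS]integral_mkcond; apply: eq_integral => y _.
  by rewrite !patchE in_setX in_setT.
have uk0 b' y r z : ~~ (t0 < r < b') -> uk u t0 b' y (r, z) w = 0 by rewrite /uk /=; move=> /negbTE ->.
have Aout r : ~~ (t0 < r < t0 + s) -> A r = 0%E.
  move=> h; apply: integral0_eq => y _; rewrite /Psi !uk0// ?mulr0 ?addr0 ?expr0n//.
  by apply: contra h => /andP[-> h2] /=; apply: lt_le_trans h2 _; rewrite lerD2l.
have QV : (\int[stm]_(z in @spacetime R) (Psi z ^+ 2)%:E <= b%:E)%E.
  rewrite ge0_integral_plane; [|exact: measurable_itv|exact: mT| |by move=> z _; rewrite lee_fin sqr_ge0]; last first.
    by apply: measurable_funTS; apply/measurable_EFinP; apply: measurable_funX.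
  rewrite -/A (_ : (\int[mu]_(r in _) _)%E = (\int[mu]_(r in `]t0, (t0 + s)%R[) A r)%E); last first.
    rewrite [LHS]integral_mkcond [RHS]integral_mkcond; apply: eq_integral => r _; rewrite !patchE.
    rewrite -/(A r); case: ifPn => h1; case: ifPn => h2 //; first by rewrite (Aout r)//; move: h2; rewrite notin_setE/= in_itv/= => /negP.
    exfalso; move: h1 h2; rewrite inE notin_setE/= !in_itv/= andbT => h1 /andP[h2 _].
    by apply: h1; apply: ltW; exact: lt_trans h2.
  rewrite -(@ge0_integral_translate R t0); [|exact: measurable_itv|exact: measurable_funTS|by move=> *].
  apply: le_trans (hC (f w) kap s s' x x' del eta bf kap0 (fun y _ => ku y) s'0 ss s1 ds dx del2 eta0 eta1).
  rewrite (_ : [set y | _] = [set` `]0, s[]); last first.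
    by apply/seteqP; split => r /=; rewrite !in_itv/= [t0 + s]addrC ltrDr ltrD2r.
  apply: ge0_integral_mono => r; rewrite /= in_itv/= => /andP[r0 rs] //.
  apply: ge0_integral_mono => y Ty; first by rewrite lee_fin sqr_ge0.
  rewrite lee_fin /Psi /uk/=; have Ty' : -1 <= y < 1 by move: Ty; rewrite /torus/= in_itv.
  rewrite Ty' !andbT ltrDr r0/= [r + t0]addrC !ltrD2l rs.
  have s0' : 0 < s by exact: lt_trans rs.
  have hg := gp r y r0; have hu2 := hd r y r0 rs.
  set v := u (t0 + r) y w in hu2 *; set g := hS r (f w) y in hg hu2 *.
  have e1 z z' : t0 + z - (t0 + z') = z - z' by ring.
  have q2 : (v / (2 * g)) ^+ 2 <= 1.
    rewrite -(real_normK (num_real (v / (2 * g)))) expr_le1// normrM normfV (gtr0_norm (mulr_gt0 _ hg))//.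
    by rewrite ler_pdivrMr ?mul1r ?mulr_gt0.
  rewrite (_ : _ + _ = v / (2 * g) * (qk (f w) s x r y - (if r < s' then qk (f w) s' x' r y else 0))).
    by rewrite exprMn -[leRHS]mul1r ler_wpM2r// sqr_ge0.
  rewrite /qk inv// !e1 -/g; have g0 := lt0r_neq0 hg; have gs := lt0r_neq0 (gp s x s0').
  case: ifP => rs'; last by rewrite !mulr0 addr0 subr0; field; rewrite gs g0.
  have s'p : 0 < s' by exact: lt_trans rs'.
  by have gs' := lt0r_neq0 (gp s' x' s'p); rewrite inv//; field; rewrite gs gs' g0.
have := hN w nN QV; rewrite !tr mulNr -mulrBr -mulrBl mulrA normrM normfV (gtr0_norm hQ) ler_pdivrMr//.
rewrite normrM gtr0_norm ?invr_gt0// => h.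
have Q0 := lt0r_neq0 hQ.
move: h; rewrite (_ : a / (2 * Q) * Q = 2^-1 * a); last by field; rewrite Q0.
by rewrite ler_pM2l ?invr_gt0.
Qed.

End restarted.

Section bootstrap.
Variables (t0 kap : R) (w : T).
Hypotheses (t00 : 0 < t0) (kap0 : 0 < kap) (ku : forall y, kap <= u t0 y w).

Let f := u t0 ^~ w.

Let bf : nnbounded f.
Proof. by apply: nnbounded_u => // x; exact: le_trans (ltW kap0) (ku x). Qed.

Lemma hS_u_ge r y : 0 < r -> kap <= hS r f y.
Proof. by move=> r0; exact: (hS_lb y r0 bf (ltW kap0) (fun y _ => ku y)). Qed.

Let per_le (r x : R) : 0 < r -> exists2 x', torus x' & u (t0 + r) x w = u (t0 + r) x' w /\ hS r f x = hS r f x'.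
Proof.
move=> r0; have [hper _ _ _] := hu; have [x' Tx hx] := periodic_torus x; exists x' => //; split.
  by apply: (hx (u (t0 + r) ^~ w)); apply: hper; rewrite addr_gt0.
by apply: hx; exact: hSD2.
Qed.

(** Compactness makes the local estimate uniform in space. The point 1 closes the cell [[-1, 1[];
    all other points come back to it by periodicity. *)
Let extend (S : R) :
  (forall x, torus x \/ x = 1 -> \forall x' \near x & r \near S, 0 < r -> `|u (t0 + r) x' w| <= 2 * hS r f x') ->
  exists2 e : R, 0 < e & forall r x, `|r - S| < e -> 0 < r -> `|u (t0 + r) x w| <= 2 * hS r f x.
Proof.
move=> loc; have ck : compact (`[-1, 1] : set R) by exact: segment_compact.
have /compact_near_coveringP/(_ R (nbhs S) (fun r x => 0 < r -> `|u (t0 + r) x w| <= 2 * hS r f x) _) := ck.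
have loc' x : [set` `[-1, 1 : R]] x -> \forall x' \near x & r \near S, 0 < r -> `|u (t0 + r) x' w| <= 2 * hS r f x'.
  rewrite /= in_itv/= => /andP[x1 x2]; apply: loc; move: x2; rewrite le_eqVlt => /predU1P[->|x2]; [by right|left].
  by rewrite /torus/= in_itv/= x1.
move=> /(_ loc')/nbhs_ballP[e /= e0 he]; exists e => // r x re r0.
have [x' Tx [-> ->]] := per_le x r0.
apply: (he r) => //; first by rewrite /ball/= distrC.
by move: Tx; rewrite /torus/= !in_itv/= => /andP[-> /ltW].
Qed.

Let continuous_local (S x : R) : 0 < S -> {for (x, S), continuous (fun z : R * R => u (t0 + z.2) z.1 w)} /\
  {for (x, S), continuous (fun z : R * R => hS z.2 f z.1)}.
Proof.
move=> S0; split.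
  have tS : 0 < t0 + S by rewrite addr_gt0.
  apply: (@continuous_comp _ _ _ (fun z : R * R => (t0 + z.2, z.1)) (fun z : R * R => u z.1 z.2 w)); last exact: (@continuous_u2 (t0 + S, x) w tS).
  have c1 : t0 + z.2 @[z --> (x, S)] --> t0 + S by apply: cvgD; [exact: cvg_cst|exact: cvg_snd].
  exact: (@cvg_pair _ _ _ (nbhs (x, S)) (nbhs (t0 + S)) (nbhs x) _ _ _ (fun z : R * R => t0 + z.2) (fun z : R * R => z.1) c1 cvg_fst).
apply: (@continuous_comp _ _ _ (fun z : R * R => (z.2, z.1)) (fun z : R * R => hS z.1 f z.2)); last exact: (@continuous_hS2 f (S, x)).
exact: (@cvg_pair _ _ _ (nbhs (x, S)) (nbhs S) (nbhs x) _ _ _ (fun z : R * R => z.2) (fun z : R * R => z.1) cvg_snd cvg_fst).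
Qed.

(** For small [r], [u (t0 + r)] is close to [u t0] and [hS r] is not much below it; as [u t0] is at
    least [kap], the factor 2 leaves room for both errors. *)
Let initial : exists2 e : R, 0 < e & forall r x, `|r - 0| < e -> 0 < r -> `|u (t0 + r) x w| <= 2 * hS r f x.
Proof.
apply: extend => x _; have k8 : 0 < kap / 8 by rewrite divr_gt0.
have := @continuous_u2 (t0, x) w t00 => /cvgrPdist_le/(_ _ k8)/(@nbhs_ballP R (R * R)%type)[h /= h0 hh].
(* With [r <= (h / 8)^2 / 8] the exponent [(h / 2)^2 / (8 r)] is at least 16, so the loss in
   [hS_near] is at most [2 / 16 = 1 / 8]. *)
pose rho := Num.min h ((h / 8) ^+ 2 / 8); have rho0 : 0 < rho by rewrite lt_min h0 divr_gt0// exprn_gt0// divr_gt0.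
have rh : rho <= h by rewrite ge_min lexx.
have rh2 : rho <= (h / 8) ^+ 2 / 8 by rewrite ge_min lexx orbT.
have h20 : 0 < h / 2 by rewrite divr_gt0.
exists (ball x (h / 2), ball (0 : R) rho) => /=; first by split; exact: nbhsx_ballx.
move=> [x' r] [/= b1 b2] r0; have sr : `|r| < rho by move: b2; rewrite /ball/= sub0r normrN.
have rr : r < rho by apply: le_lt_trans sr; exact: ler_norm.
have fx := ku x; have b1' : `|x - x'| < h / 2 by [].
have u1 : `|f x - u (t0 + r) x' w| <= kap / 8.
  apply: (hh (t0 + r, x')); split; rewrite /ball/=.
    by rewrite opprD addNKr normrN; exact: lt_le_trans sr rh.
  by apply: lt_trans b1' _; rewrite ltr_pdivrMr// mulr_natr mulr2n ltrDl.
have u2 y : `|y - x'| < h / 2 -> f x - kap / 8 <= f y.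
  move=> yx; have : `|f x - f y| <= kap / 8.
    apply: (hh (t0, y)); split; rewrite /ball/=; first by rewrite subrr normr0.
    apply: le_lt_trans (ler_distD x' _ _) _; rewrite (distrC x' y); move: b1' yx; set A := `|x - x'|; set B := `|y - x'|.
    by move=> *; lra.
  by move=> /(le_trans (ler_norm _)); lra.
have c0 : 0 <= f x - kap / 8 by rewrite /f; have := ku x; lra.
have [hper _ _ _] := hu.
have g1 := hS_near r0 h20 bf (hper t0 w t00) c0 u2.
have e1 : Num.sqrt 2 * expR (- (h / 2) ^+ 2 / (8 * r)) <= 8^-1.
  have s2 : Num.sqrt 2 <= 2 :> R.
    by rewrite -[leRHS](@ger0_norm R 2)// -sqrtr_sqr ler_sqrt ?sqr_ge0//; lra.
  pose X := (h / 2) ^+ 2 / (8 * r); have X0 : 0 < X by rewrite divr_gt0 ?exprn_gt0// mulr_gt0.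
  have X16 : 16 <= X.
    rewrite ler_pdivlMr ?mulr_gt0//; have : r <= (h / 8) ^+ 2 / 8 by exact: le_trans (ltW rr) rh2.
    by rewrite !expr2; lra.
  rewrite mulNr -/X expRN; have eX : X <= expR X by have := expR_ge1Dx X; lra.
  apply: (@le_trans _ _ (2 * X^-1)).
    by apply: ler_pM; rewrite ?sqrtr_ge0 ?invr_ge0 ?expR_ge0// lef_pV2 ?posrE ?expR_gt0.
  by rewrite ler_pdivrMr//; lra.
have f0 : 0 <= f x by exact: le_trans (ltW kap0) fx.
have u3 : `|u (t0 + r) x' w| <= f x + kap / 8.
  move: u1; rewrite ler_norml => /andP[u1 u1'].
  by rewrite ger0_norm; [lra|rewrite /f in u1'; lra].
apply: le_trans u3 _; apply: le_trans (_ : 2 * ((f x - kap / 8) * (1 - 8^-1)) <= _).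
  by rewrite /f; lra.
rewrite ler_pM2l//; apply: le_trans g1; rewrite ler_wpM2l//; lra.
Qed.

(** The supremum of the [S] for which [doubled] holds is itself such an [S]. If it were below [S1],
    then [|ratio| <= 1/2] at this time would give [|u| <= 3/2 g], strictly less than [2 g], and the
    condition would extend further. *)
Lemma bootstrap (S1 : R) : 0 < S1 ->
  (forall S, 0 < S -> S <= S1 -> doubled t0 S w -> forall s x, 0 < s -> s <= S -> s < S1 -> `|ratio t0 s x w| <= 2^-1) ->
  forall s x, 0 < s -> s < S1 -> `|ratio t0 s x w| <= 2^-1.
Proof.
move=> S10 hyp; pose E := [set S | [/\ 0 < S, S <= S1 & doubled t0 S w]].
suff [_ _ dS] : E S1 by move=> s x s0 sS; apply: (hyp S1) => //; exact: ltW.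
have [e0 e00 he0] := initial.
have E0 : E !=set0.
  exists (Num.min e0 S1); split; first by rewrite lt_min e00.
    by rewrite ge_min lexx orbT.
  move=> r y r0; rewrite lt_min => /andP[re _]; apply: he0 => //.
  by rewrite subr0 gtr0_norm.
have hsE : has_sup E by split=> //; exists S1 => S [].
have s1 : sup E <= S1 by apply: ge_sup => // S [].
have s0 : 0 < sup E.
  by have [S ES] := E0; have [S0 _ _] := ES; apply: lt_le_trans S0 _; exact: sup_upper_bound.
have Es : E (sup E).
  split=> // r y r0 rs; have sr : 0 < sup E - r by rewrite subr_gt0.
  by have [S [_ _ dS]] := sup_adherent sr hsE; rewrite opprB addrC subrK => rS; exact: dS.
move: s1; rewrite le_eqVlt => /predU1P[<-//|s1]; exfalso.
have [_ _ dS] := Es.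
have [x _|e e00' he] := @extend (sup E).
  have [cu ch] := continuous_local x s0.
  have hR := hyp (sup E) s0 (ltW s1) dS (sup E) x s0 (lexx _) s1.
  have g0 := lt_le_trans kap0 (hS_u_ge x s0).
  have pos : 0 < 2 * hS (sup E) f x - `|u (t0 + sup E) x w|.
    move: hR; rewrite /ratio s0 -/f; set g := hS _ _ _ in g0 *; set v := u _ _ _ => hR.
    have vg : `|v / g| <= 3 / 2.
      rewrite -[v / g](subrK 1); apply: le_trans (ler_normD _ _) _; rewrite normr1; lra.
    by move: vg; rewrite normrM normfV (gtr0_norm g0) ler_pdivrMr//; lra.
  have cH : (fun z : R * R => 2 * hS z.2 f z.1 - `|u (t0 + z.2) z.1 w|) z @[z --> (x, sup E)] --> 2 * hS (sup E) f x - `|u (t0 + sup E) x w|.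
    by apply: cvgB; [apply: cvgMr; exact: ch|apply: cvg_norm; exact: cu].
  move: cH => /cvgrPdist_lt/(_ _ pos)/(@nbhs_ballP R (R * R)%type)[e /= e1 he].
  exists (ball x e, ball (sup E) e) => /=; first by split; exact: nbhsx_ballx.
  by move=> [x' r] [/= b1 b2] _; have := he (x', r) (conj b1 b2); rewrite /= => /(le_lt_trans (ler_norm _)); lra.
pose S' := Num.min S1 (sup E + e / 2).
have S'g : sup E < S' by rewrite lt_min s1 ltrDl divr_gt0.
have ES' : E S'.
  split; [exact: lt_trans S'g|by rewrite ge_min lexx|].
  move=> r y r0 rS'; case: (ltP r (sup E)) => rs; first exact: dS.
  apply: he => //; rewrite ger0_norm ?subr_ge0//.
  have : S' <= sup E + e / 2 by rewrite ge_min lexx orbT.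
  by move=> h; lra.
by have := sup_upper_bound hsE ES'; rewrite leNgt S'g.
Qed.

End bootstrap.

(** Halving the index of the truncation at level [n + 1] gives the truncation at level [n]. At level
    [N] the chain starts at time 0, where [Z] vanishes, because [s < 2^-N]; it visits only times up
    to [s], so that its increments can be controlled by a condition up to [s]. *)
Lemma dyadic_chain (Z : R -> R -> R) (a : nat -> R) (N : nat) (s x : R) :
  (forall y, Z 0 y = 0) -> 0 <= s -> s < 2^-1 ^+ N -> -1 <= x -> x <= 1 ->
  (forall n k l, (N <= n)%N -> (k <= 2 ^ n.+1)%N -> (l <= 2 ^ n.+2)%N -> k%:R / 2 ^+ n.+1 <= s ->
    `|Z (k%:R / 2 ^+ n.+1) (l%:R / 2 ^+ n.+1 - 1) - Z (k./2%:R / 2 ^+ n) (l./2%:R / 2 ^+ n - 1)| <= a n) ->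
  forall n, (N <= n)%N ->
  `|Z ((Num.truncn (s * 2 ^+ n))%:R / 2 ^+ n) ((Num.truncn ((x + 1) * 2 ^+ n))%:R / 2 ^+ n - 1)| <=
    \sum_(N <= i < n) a i.
Proof.
move=> Z0 s0 sN x0 x1 h n; have p2 m : 0 < 2 ^+ m :> R by rewrite exprn_gt0.
have half_trunc (y : R) m : 0 <= y -> (Num.truncn (y * 2 ^+ m.+1))./2 = Num.truncn (y * 2 ^+ m).
  move=> y0; apply/esym/truncn_def.
  have /truncn_itv/andP[h1 h2] : 0 <= y * 2 ^+ m.+1 by rewrite mulr_ge0// ltW.
  move: h1 h2; set k := Num.truncn _; rewrite exprS => h1 h2.
  have e : k%:R = (odd k)%:R + 2 * (k./2)%:R :> R by rewrite -{1}(odd_double_half k) natrD -muln2 natrM mulrC.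
  move: h1 h2; rewrite -!natr1 e mulrCA; case: (odd k) => /= h1 h2; apply/andP; split; lra.
elim: n => [|n ih] Nn.
  have N0 : N = 0%N by apply/eqP; rewrite -leqn0.
  rewrite N0 big_geq// expr0 mulr1 (_ : Num.truncn s = 0%N) ?mul0r ?Z0 ?normr0//.
  by apply: truncn_def; rewrite s0/=; move: sN; rewrite N0 expr0.
case: (leqP N n) => Nn'; last first.
  have -> : N = n.+1 by apply/eqP; rewrite eqn_leq Nn Nn'.
  rewrite big_geq// (_ : Num.truncn (s * 2 ^+ n.+1) = 0%N) ?mul0r ?Z0 ?normr0//.
  apply: truncn_def; rewrite mulr_ge0 ?(ltW (p2 _))//=.
  have Nn1 : N = n.+1 by apply/eqP; rewrite eqn_leq Nn Nn'.
  by move: sN; rewrite Nn1 exprVn -[X in _ < X]div1r ltr_pdivlMr.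
rewrite big_nat_recr//=.
have s1 : s <= 1 by apply: le_trans (ltW sN) _; rewrite exprn_ile1// invf_le1// ler1n.
have xx0 : 0 <= x + 1 by lra.
have := ih Nn'; rewrite -(half_trunc s n s0) -(half_trunc (x + 1) n xx0).
have /truncn_itv/andP[k1 k2] : 0 <= s * 2 ^+ n.+1 by rewrite mulr_ge0// ltW.
have /truncn_itv/andP[l1 l2] : 0 <= (x + 1) * 2 ^+ n.+1 by rewrite mulr_ge0// ltW.
set k := Num.truncn (s * _) in k1 k2 *; set l := Num.truncn ((x + 1) * _) in l1 l2 *.
have kb : (k <= 2 ^ n.+1)%N.
  rewrite -(ler_nat R) natrX; apply: le_trans k1 _.
  by rewrite -[leRHS]mul1r ler_wpM2r// ltW.
have lb : (l <= 2 ^ n.+2)%N.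
  rewrite -(ler_nat R) natrX; apply: le_trans l1 _; rewrite [leRHS]exprS; apply: ler_wpM2r; [exact/ltW/p2|lra].
have := h n k l Nn' kb lb; rewrite ler_pdivrMr// => /(_ k1) h1 h2.
rewrite -[X in `|X|](subrK (Z (k./2%:R / 2 ^+ n) (l./2%:R / 2 ^+ n - 1))) addrC.
by apply: le_trans (ler_normD _ _) _; exact: lerD.
Qed.

(** The inequality [expR y >= y] at [y = x / (m + 1)], raised to the power [m + 1]: it turns
    exponential tails into powers of any chosen degree. *)
Lemma expRN_le (m : nat) (x : R) : 0 < x -> expR (- x) <= (m.+1%:R / x) ^+ m.+1.
Proof.
move=> x0; have m0 : 0 < m.+1%:R :> R by rewrite ltr0n.
have e : expR x = expR (x / m.+1%:R) ^+ m.+1 by rewrite -expRM_natl mulrC divfK// gt_eqF.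
rewrite expRN e -exprVn lerXn2r ?nnegrE ?invr_ge0 ?expR_ge0 ?divr_ge0 ?(ltW m0) ?(ltW x0)//.
rewrite -[leRHS]invrK lef_pV2 ?posrE ?expR_gt0 ?invr_gt0 ?divr_gt0// invf_div.
set y := x / _; have := expR_ge1Dx y; lra.
Qed.

Lemma union_bound (N : nat -> set T) (p : R) (n : nat) :
  (forall k, measurable (N k)) -> (forall k, (P (N k) <= p%:E)%E) ->
  measurable (\bigcup_(k in `I_n) N k) /\ (P (\bigcup_(k in `I_n) N k) <= (n%:R * p)%:E)%E.
Proof.
move=> mN pN; rewrite bigcup_mkord; split; first exact: bigsetU_measurable.
apply: le_trans (Boole_inequality _ (fun i _ => mN i)) _.
apply: (@le_trans _ _ (\sum_(i < n) p%:E)%E); first by apply: lee_sum => i _; exact: pN.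
by rewrite sumEFin lee_fin sumr_const card_ord mulr_natl.
Qed.

(* The exponent 33 beats the [4 ^ n] pairs of level [n], because [4 = gam ^- 64] and [64 < 2 * 33]. *)
Lemma level_bound (gam : R) : 0 < gam -> gam < 1 -> gam ^+ 32 = 2^-1 ->
  exists2 K : R, 0 < K & forall t0 kap n, 0 < t0 -> 0 < kap -> exists N, [/\ measurable N,
    (P N <= (K * (gam ^+ 2) ^+ n)%:E)%E &
    forall w, ~ N w -> (forall y, kap <= u t0 y w) -> forall k l S, (k <= 2 ^ n.+1)%N -> (l <= 2 ^ n.+2)%N ->
      k%:R / 2 ^+ n.+1 <= S -> doubled t0 S w ->
      `|ratio t0 (k%:R / 2 ^+ n.+1) (l%:R / 2 ^+ n.+1 - 1) w - ratio t0 (k./2%:R / 2 ^+ n) (l./2%:R / 2 ^+ n - 1) w| <= gam ^+ n].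
Proof.
move=> g0 g1 g32; have [C C0 hC] := @qk_increment R.
pose c := 128 * Q ^+ 2 * (C * 3); have c0 : 0 < c by rewrite !mulr_gt0// exprn_gt0.
pose m := 32%N; pose K1 := 2 * (m.+1%:R * c) ^+ m.+1 + 1.
have K10 : 0 < K1 by rewrite addr_gt0// mulr_gt0// exprn_gt0// mulr_gt0// ltr0n.
exists (32 * K1) => [|t0 kap n t00 kap0]; first by rewrite mulr_gt0.
pose z := gam ^+ n; have z0 : 0 < z by rewrite exprn_gt0.
have z1 : z <= 1 by rewrite exprn_ile1// ltW.
pose del : R := 2^-1 ^+ n.+1; have del0 : 0 < del by rewrite exprn_gt0.
have delz : del <= z ^+ 32.
  rewrite /del /z exprAC g32 exprS; have : 0 < 2^-1 ^+ n :> R by rewrite exprn_gt0.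
  by set q := _ ^+ n; lra.
have zle a b : (a <= b)%N -> z ^+ b <= z ^+ a by move=> ab; apply: ler_wiXn2l; rewrite ?(ltW z0).
have del2 : del <= 2.
  apply: (@le_trans _ _ 1); last by rewrite ler1n.
  by apply: le_trans delz _; exact: (@zle 0 32)%N.
(* With [del <= z^32], this choice makes [sqrt eta], [del / eta^2] and [sqrt del] all at most [z^4].
   For increments of size [z] the exponent of the tail is then at least of order [z^-2], and the
   tail decays faster than any power of [z]. *)
pose eta := z ^+ 8; have eta0 : 0 < eta by rewrite exprn_gt0.
have eta1 : eta <= 1 by exact: (@zle 0 8)%N.
have sq a : Num.sqrt (z ^+ (a * 2)) = z ^+ a by rewrite exprM sqrtr_sqr ger0_norm// exprn_ge0// ltW.
pose B := C * (Num.sqrt eta + del / eta ^+ 2 + Num.sqrt del).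
have B0 : 0 < B by rewrite mulr_gt0// ltr_wpDr ?sqrtr_ge0// addr_gt0 ?sqrtr_gt0// divr_gt0// exprn_gt0.
have BB : B <= C * 3 * z ^+ 4.
  rewrite /B -mulrA ler_wpM2l ?(ltW C0)//.
  have b1 : Num.sqrt eta <= z ^+ 4 by rewrite (sq 4%N).
  have b2 : del / eta ^+ 2 <= z ^+ 4.
    rewrite ler_pdivrMr ?exprn_gt0// /eta -exprM -exprD; apply: le_trans delz _; exact: zle.
  have b3 : Num.sqrt del <= z ^+ 4.
    apply: (@le_trans _ _ (Num.sqrt (z ^+ (16 * 2)))); first by rewrite ler_sqrt ?exprn_ge0// ltW.
    by rewrite sq; exact: zle.
  by move: b1 b2 b3; set x1 := Num.sqrt _; set x2 := _ / _; set x3 := Num.sqrt _; set x4 := z ^+ 4; lra.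
pose dlt := z ^+ (2 * m.+1); have dlt0 : 0 < dlt by rewrite exprn_gt0.
pose p := K1 * z ^+ (2 * m.+1).
have tail : 2 * expR (- (z ^+ 2 / (128 * Q ^+ 2 * B))) + dlt <= p.
  have -> : p = 2 * ((m.+1%:R * c) ^+ m.+1 * z ^+ (2 * m.+1)) + dlt.
    by rewrite /p /K1 /dlt; set A := _ ^+ m.+1; set Z := z ^+ _; ring.
  rewrite lerD2r ler_pM2l//.
  have cB : 0 < 128 * Q ^+ 2 * B by apply: mulr_gt0 => //; apply: mulr_gt0 => //; exact: exprn_gt0.
  have X0 : 0 < z ^+ 2 / (128 * Q ^+ 2 * B) by rewrite divr_gt0// exprn_gt0.
  apply: le_trans (expRN_le m X0) _; rewrite exprM -exprMn; apply: lerXn2r.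
  - by rewrite nnegrE divr_ge0// ltW.
  - by rewrite nnegrE !mulr_ge0 ?(ltW c0) ?exprn_ge0// ltW.
  rewrite invf_div -[leRHS]mulrA; apply: ler_wpM2l; first exact: ler0n.
  rewrite ler_pdivrMr ?exprn_gt0//.
  apply: (@le_trans _ _ (128 * Q ^+ 2 * (C * 3 * z ^+ 4))); first by rewrite ler_wpM2l// mulr_ge0// exprn_ge0// ltW.
  by rewrite -[leRHS]mulrA -exprD /c !mulrA.
have p2 k : 0 < 2 ^+ k :> R by rewrite exprn_gt0.
have halfE (k : nat) : k%:R / 2 ^+ n.+1 - k./2%:R / 2 ^+ n = (odd k)%:R * del :> R.
  have -> : k%:R = (odd k)%:R + 2 * (k./2)%:R :> R by rewrite -{1}(odd_double_half k) natrD -muln2 natrM mulrC.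
  by rewrite /del exprVn exprS; have h := lt0r_neq0 (p2 n); field; rewrite h.
have pair (kl : nat * nat) : exists N, [/\ measurable N, (P N <= p%:E)%E & forall w, ~ N w -> (kl.1 <= 2 ^ n.+1)%N ->
    (forall y, kap <= u t0 y w) -> doubled t0 (kl.1%:R / 2 ^+ n.+1) w ->
    `|ratio t0 (kl.1%:R / 2 ^+ n.+1) (kl.2%:R / 2 ^+ n.+1 - 1) w - ratio t0 (kl.1./2%:R / 2 ^+ n) (kl.2./2%:R / 2 ^+ n - 1) w| <= z].
  (* Indices out of range get the empty event, so that the choice of events is a total function. *)
  case: kl => k l /=; case: (boolP (k <= 2 ^ n.+1)%N) => kn; last first.
    by exists set0; split=> //; rewrite measure0 lee_fin mulr_ge0 ?exprn_ge0 ?ltW.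
  have odd01 j : 0 <= (odd j)%:R * del <= del.
    by case: (odd j); rewrite ?mul1r ?mul0r ?lexx (ltW del0).
  have /andP[ok1 ok2] := odd01 k.
  have /andP[ol1 ol2] := odd01 l.
  have [|||||N [mN pN hN]] := @ratio_increment t0 kap t00 kap0 C hC C0 (k%:R / 2 ^+ n.+1) (k./2%:R / 2 ^+ n)
    (l%:R / 2 ^+ n.+1 - 1) (l./2%:R / 2 ^+ n - 1) del eta z dlt _ _ _ _ _ del0 del2 eta0 eta1 z0 dlt0.
  - by rewrite divr_ge0.
  - by rewrite -subr_ge0 halfE.
  - by rewrite ler_pdivrMr// mul1r -natrX ler_nat.
  - by rewrite halfE.
  - rewrite (_ : _ - _ = l%:R / 2 ^+ n.+1 - l./2%:R / 2 ^+ n); last by ring.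
    by rewrite halfE ger0_norm.
  by exists N; split => //; [apply: le_trans pN _; rewrite lee_fin|move=> w nN _; exact: hN].
have /choice[Nf hNf] := pair.
have inner k := @union_bound (fun l => Nf (k, l)) p (2 ^ n.+2).+1 (fun l => let: And3 a _ _ := hNf (k, l) in a) (fun l => let: And3 _ a _ := hNf (k, l) in a).
have [mU pU] := @union_bound _ _ (2 ^ n.+1).+1 (fun k => (inner k).1) (fun k => (inner k).2).
eexists; split; [exact: mU| |].
  apply: le_trans pU _; rewrite lee_fin.
  (* The numbers of indices [k] and [l] multiply to at most [32 * 4 ^ n], whence the constant
     [32 * K1]. *)
  have n1 : (2 ^ n.+1).+1%:R <= 4 * 2 ^+ n :> R.
    by rewrite -natr1 natrX exprS; have : 1 <= 2 ^+ n :> R by [rewrite exprn_ege1// ler1n]; set q := 2 ^+ n; lra.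
  have n2 : (2 ^ n.+2).+1%:R <= 8 * 2 ^+ n :> R.
    by rewrite -natr1 natrX !exprS; have : 1 <= 2 ^+ n :> R by [rewrite exprn_ege1// ler1n]; set q := 2 ^+ n; lra.
  have pp : 0 <= p by rewrite mulr_ge0 ?exprn_ge0 ?ltW.
  apply: (@le_trans _ _ (4 * 2 ^+ n * (8 * 2 ^+ n * p))).
    by apply: ler_pM => //; [exact: mulr_ge0|exact: ler_wpM2r].
  (* Of the exponent 66, two factors [z^32 = 2^-n] cancel the count [4 ^ n], and [z^2] remains. *)
  have zz : 2 ^+ n * z ^+ 32 = 1 by rewrite /z exprAC g32 -exprMn divff ?expr1n.
  have z66 : z ^+ (2 * m.+1) = z ^+ 32 * z ^+ 32 * z ^+ 2 by rewrite -!exprD.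
  rewrite /p z66 (_ : (gam ^+ 2) ^+ n = z ^+ 2); last by rewrite /z exprAC.
  move: zz; set q := 2 ^+ n; set y := z ^+ 32; set v := z ^+ 2 => zz.
  rewrite (_ : 4 * q * (8 * q * (K1 * (y * y * v))) = 32 * K1 * v * (q * y) ^+ 2); last by ring.
  by rewrite zz expr1n mulr1.
move=> w nN ku k l S kn ln kS dS.
have [_ _ h] := hNf (k, l); apply: h => //.
  by move=> h; apply: nN; exists k => //=; exists l.
by move=> r y r0 rk; apply: dS => //; exact: lt_le_trans kS.
Qed.

Section limit.
Variables (t0 kap : R) (w : T).
Hypotheses (t00 : 0 < t0) (kap0 : 0 < kap) (ku : forall y, kap <= u t0 y w).

Lemma ratio_near (s x e : R) : 0 < s -> 0 < e -> exists2 r, 0 < r & forall s' x', `|s - s'| < r -> `|x - x'| < r ->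
  `|ratio t0 s x w - ratio t0 s' x' w| <= e.
Proof.
move=> s0 e0; have g0 := lt_le_trans kap0 (hS_u_ge t00 kap0 ku x s0).
have bf : nnbounded (u t0 ^~ w) by apply: nnbounded_u => // y; exact: le_trans (ltW kap0) (ku y).
have c1 := @continuous_hS2 _ (s, x) bf s0.
have c2 : {for (s, x), continuous (fun z : R * R => u (t0 + z.1) z.2 w)}.
  have tS : 0 < t0 + s by rewrite addr_gt0.
  apply: (@continuous_comp _ _ _ (fun z : R * R => (t0 + z.1, z.2)) (fun z : R * R => u z.1 z.2 w)); last exact: (@continuous_u2 (t0 + s, x) w tS).
  have c1' : t0 + z.1 @[z --> (s, x)] --> t0 + s by apply: cvgD; [exact: cvg_cst|exact: cvg_fst].
  exact: (@cvg_pair _ _ _ (nbhs (s, x)) (nbhs (t0 + s)) (nbhs x) _ _ _ (fun z : R * R => t0 + z.1) (fun z : R * R => z.2) c1' cvg_snd).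
have c3 : (u (t0 + z.1) z.2 w / hS z.1 (u t0 ^~ w) z.2 - 1) @[z --> (s, x)] --> u (t0 + s) x w / hS s (u t0 ^~ w) x - 1.
  apply: cvgB; last exact: cvg_cst.
  by apply: cvgM; [exact: c2|apply: cvgV; [rewrite gt_eqF|exact: c1]].
move: c3 => /cvgrPdist_le/(_ _ e0)/(@nbhs_ballP R (R * R)%type)[r /= r0 hr].
exists (Num.min r s); first by rewrite lt_min r0.
move=> s' x'; rewrite !lt_min => /andP[h1 h2] /andP[h3 _].
have s'0 : 0 < s' by move: h2; rewrite ltr_norml => /andP[_]; lra.
by have := hr (s', x') (conj h1 h3); rewrite /ratio s0 s'0.
Qed.

Lemma ratio_periodic s x : exists2 x', torus x' & ratio t0 s x w = ratio t0 s x' w.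
Proof.
have [hper _ _ _] := hu; have [x' Tx hx] := periodic_torus x; exists x' => //.
apply: (hx (fun x => ratio t0 s x w)) => y; rewrite /ratio; case: ifP => // s0.
by rewrite hSD2 (hper _ w (addr_gt0 t00 s0)).
Qed.

(** The dyadic truncations of [(s, x)] tend to it and [ratio] is continuous at positive times, so
    the geometric bound of the chain passes to the limit. *)
Lemma ratio_limit (gam : R) (N : nat) (S s x : R) : 0 < gam -> gam < 1 -> 0 < s -> s < 2^-1 ^+ N -> s <= S ->
  (forall n k l, (N <= n)%N -> (k <= 2 ^ n.+1)%N -> (l <= 2 ^ n.+2)%N -> k%:R / 2 ^+ n.+1 <= S ->
    `|ratio t0 (k%:R / 2 ^+ n.+1) (l%:R / 2 ^+ n.+1 - 1) w - ratio t0 (k./2%:R / 2 ^+ n) (l./2%:R / 2 ^+ n - 1) w| <= gam ^+ n) ->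
  `|ratio t0 s x w| <= gam ^+ N / (1 - gam).
Proof.
move=> g0 g1 s0 sN sS h; have [x' Tx ->] := ratio_periodic s x.
move: Tx; rewrite /torus/= in_itv/= => /andP[x1 /ltW x2]; clear x.
apply/ler_addgt0Pr => e e0; have [r r0 hr] := ratio_near x' s0 e0.
have [n Nn nr] : exists2 n, (N <= n)%N & 2^-1 ^+ n < r.
  have hc : `|2^-1 : R| < 1 by rewrite ger0_norm ?invf_lt1 ?ltr1n.
  have /cvgrPdist_lt/(_ _ r0)[m _ hm] := cvg_expr hc.
  exists (maxn m N); first exact: leq_maxr.
  by have := hm (maxn m N) (leq_maxl _ _); rewrite sub0r normrN ger0_norm// exprn_ge0.
have ch := @dyadic_chain (fun s x => ratio t0 s x w) (fun n => gam ^+ n) N s x' _ (ltW s0) sN x1 x2 _ n Nn.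
have p2 : 0 < 2 ^+ n :> R by rewrite exprn_gt0.
have close (y : R) : 0 <= y -> `|y - (Num.truncn (y * 2 ^+ n))%:R / 2 ^+ n| < r.
  move=> y0; apply: le_lt_trans nr.
  have /truncn_itv/andP[] : 0 <= y * 2 ^+ n by rewrite mulr_ge0// ltW.
  rewrite -natr1; set k := (Num.truncn _)%:R => h1 h2.
  rewrite exprVn -[leRHS]div1r -[X in `|X - _|](mulfK (lt0r_neq0 p2)) -mulrBl normrM normfV (gtr0_norm p2).
  by rewrite ler_pM2r ?invr_gt0// ger0_norm; lra.
have b1 : \sum_(N <= i < n) gam ^+ i <= gam ^+ N / (1 - gam).
  rewrite -(subnKC Nn) geometric_partial_tail; apply: geometric_le_lim => //; first by rewrite exprn_ge0// ltW.
  by rewrite gtr0_norm.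
rewrite -[X in `|X|](subrK (ratio t0 ((Num.truncn (s * 2 ^+ n))%:R / 2 ^+ n) ((Num.truncn ((x' + 1) * 2 ^+ n))%:R / 2 ^+ n - 1) w)) addrC.
apply: le_trans (ler_normD _ _) _; apply: lerD.
  apply: le_trans b1; apply: ch => [y|m k l Nm km lm ks]; first by rewrite /ratio ltxx.
  by apply: h => //; exact: le_trans ks sS.
apply: hr; first by apply: close; exact: ltW.
have x0 : 0 <= x' + 1 by lra.
by have := close _ x0; rewrite (_ : x' + 1 - _ = x' - ((Num.truncn ((x' + 1) * 2 ^+ n))%:R / 2 ^+ n - 1))//; ring.
Qed.

End limit.

(** The starting level [n0] makes two geometric tails small at once: the length of the chain, below
    [1/2], and the probability of the bad events, below [eps]. It depends on [eps] but not on [t0]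
    or [kap]. *)
Lemma harnack (eps : R) : 0 < eps -> exists S1 : R, [/\ 0 < S1, S1 <= 1 & forall t0 kap, 0 < t0 -> 0 < kap ->
  exists N, [/\ measurable N, (P N <= eps%:E)%E & forall w, ~ N w -> (forall y, kap <= u t0 y w) ->
    forall s x, 0 < s -> s < S1 -> `|ratio t0 s x w| <= 2^-1]].
Proof.
(* The number [2^(-1/32)], so that the fractional powers of dyadic lengths in use are integer powers
   of [gam]. *)
move=> eps0; pose gam : R := expR (32%:R^-1 * ln 2^-1).
have g0 : 0 < gam by exact: expR_gt0.
have g32 : gam ^+ 32 = 2^-1 by rewrite -expRM_natl mulrA divff ?mul1r ?lnK ?posrE ?invr_gt0// pnatr_eq0.
have g1 : gam < 1.
  rewrite ltNge; apply/negP => h; have : 1 <= gam ^+ 32 by rewrite exprn_ege1.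
  by rewrite g32; lra.
have [K K0 hK] := level_bound g0 g1 g32.
pose g2 := gam ^+ 2; have g20 : 0 < g2 by rewrite exprn_gt0.
have g21 : g2 < 1 by rewrite exprn_ilt1// ltW.
have [n0 [a1 a2]] : exists n0 : nat, gam ^+ n0 / (1 - gam) <= 2^-1 /\ K * g2 ^+ n0 / (1 - g2) <= eps.
  have h1 : gam ^+ n / (1 - gam) @[n --> \oo] --> (0 : R).
    by rewrite -(mul0r (1 - gam)^-1); apply: cvgMl; apply: cvg_expr; rewrite gtr0_norm.
  have h2 : K * g2 ^+ n / (1 - g2) @[n --> \oo] --> (0 : R).
    by rewrite -(mul0r (1 - g2)^-1) -(mulr0 K); apply: cvgMl; apply: cvgMr; apply: cvg_expr; rewrite gtr0_norm.
  have half0 : 0 < 2^-1 :> R by rewrite invr_gt0.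
  move: h1 h2 => /cvgrPdist_le/(_ _ half0) h1 /cvgrPdist_le/(_ _ eps0) h2.
  have [n _ hn] := filterI h1 h2; exists n; have [] := hn n (leqnn n).
  by rewrite /= !sub0r !normrN => b1 b2; split; apply: le_trans (ler_norm _) _.
exists (2^-1 ^+ n0); split; [by rewrite exprn_gt0|by rewrite exprn_ile1// invf_le1 ?ler1n|].
move=> t0 kap t00 kap0; have /choice[Nf hNf] := fun n => hK t0 kap n t00 kap0.
have mN n : measurable (Nf n) by have [] := hNf n.
exists (\bigcup_n Nf (n0 + n)%N); split.
- exact: bigcup_measurable.
- apply: le_trans (generalized_Boole_inequality _ _ _) _ => //; first exact: bigcup_measurable.
  apply: lime_le; first by apply: is_cvg_nneseries.
  apply: nearW => k; apply: (@le_trans _ _ (\sum_(0 <= i < k) (K * g2 ^+ n0 * g2 ^+ i)%:E)%E).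
    by apply: lee_sum => i _; rewrite -mulrA -exprD; have [] := hNf (n0 + i)%N.
  rewrite sumEFin lee_fin; apply: le_trans a2; apply: (@geometric_le_lim R k (K * g2 ^+ n0) g2) => //.
    by rewrite mulr_ge0 ?exprn_ge0 ?ltW.
  by rewrite gtr0_norm.
- move=> w nN ku; apply: (@bootstrap t0 kap) => //.
  move=> S S0 SS dS s x s0 sS sS1; apply: le_trans a1; apply: (@ratio_limit t0 kap w t00 kap0 ku gam n0 S) => //.
  move=> n k l Nn kn ln kS; have [_ _ h] := hNf n; apply: (h w _ ku k l S kn ln kS dS).
  by move=> h'; apply: nN; exists (n - n0)%N => //; rewrite subnKC.
Qed.

(** With [g] the semigroup at time [s], [|ratio| <= 1/2] places [u] between [g / 2] and [3 g / 2],
    and [hS_osc] compares [g] at two points; the factor 3 is the quotient of the two bounds. *)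
Lemma oscillation (eps : R) : 0 < eps -> exists s C : R, [/\ 0 < s, 0 < C & forall t0 kap, 0 < t0 -> 0 < kap ->
  exists N, [/\ measurable N, (P N <= eps%:E)%E & forall w, ~ N w -> (forall y, kap <= u t0 y w) ->
    (forall x, 0 < u (t0 + s) x w) /\ forall x x', u (t0 + s) x w <= C * u (t0 + s) x' w]].
Proof.
move=> eps0; have [S1 [S10 S11 h]] := harnack eps0; have [C C0 hC] := @hS_osc R.
pose s := S1 / 2; have s0 : 0 < s by rewrite divr_gt0.
have sS : s < S1 by rewrite /s; lra.
have s1 : s <= 1 by rewrite /s; lra.
exists s, (3 * (C * expR s^-1)); split=> //; first by rewrite !mulr_gt0// expR_gt0.
move=> t0 kap t00 kap0; have [N [mN pN hN]] := h t0 kap t00 kap0.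
exists N; split => // w nN ku; have bd x : hS s (u t0 ^~ w) x / 2 <= u (t0 + s) x w <= 3 / 2 * hS s (u t0 ^~ w) x.
  have := hN w nN ku s x s0 sS; have g0 := lt_le_trans kap0 (hS_u_ge t00 kap0 ku x s0).
  rewrite /ratio s0; set g := hS _ _ _ in g0 *; set v := u _ _ _; rewrite ler_norml => /andP[h1 h2].
  have e : v = v / g * g by rewrite divfK// gt_eqF.
  have k1 : 2^-1 <= v / g by lra.
  have k2 : v / g <= 3 / 2 by lra.
  by apply/andP; split; rewrite e; [rewrite mulrC ler_wpM2r// ltW|rewrite ler_wpM2r// ltW].
have bf : nnbounded (u t0 ^~ w) by apply: nnbounded_u => // y; exact: le_trans (ltW kap0) (ku y).
split=> [x|x x'].
  have /andP[h1 _] := bd x; apply: lt_le_trans h1; rewrite divr_gt0//.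
  exact: lt_le_trans kap0 (hS_u_ge t00 kap0 ku x s0).
have /andP[_ h1] := bd x; have /andP[h2 _] := bd x'.
apply: le_trans h1 _; have := hC s x x' (u t0 ^~ w) bf s0 s1.
set B := C * expR _; set g := hS _ _ x; set g' := hS _ _ x' in h2 *; set v := u _ _ _ in h2 * => h3.
have B0 : 0 <= B by rewrite mulr_ge0 ?expR_ge0 ?ltW.
have : B * (g' / 2) <= B * v by rewrite ler_wpM2l.
lra.
Qed.

End harnack.

(** * Convergence in law *)

Section convergence_in_law.
Context {R : realType}.

(** Unfolds the topology that uniform convergence induces on the subtype into balls of the uniform
    norm. *)
Lemma CT_nbhs (h : @CT R) (V : set (@CT R)) : nbhs h V ->
  exists2 r : R, 0 < r & forall h' : @CT R, (forall x, `|(\val h : R -> R) x - (\val h' : R -> R) x| < r) -> V h'.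
Proof.
rewrite nbhsE => -[B [oB Bh] BV]; move: oB Bh BV; case=> A oA <- Ah BV.
have /uniform_nbhs[E [eE hE]] := open_nbhs_nbhs (conj oA Ah).
move: eE; rewrite -entourage_ballE => -[r /= r0 rE]; exists r => // h' hh.
have H (x : R) : [set: R] x -> E (set_val h x, set_val h' x) by move=> _; apply: rE; rewrite /ball/= set_valE; exact: hh.
exact: (BV _ (hE (set_val h') H)).
Qed.

Lemma val_toCT (f : R -> R) : continuous f -> periodic2 f -> \val (toCT f) = f.
Proof. by move=> cf pf; rewrite /toCT insubdK//; apply/mem_set. Qed.

Lemma val_toCT_cst (y : R) : \val (toCT (fun=> y)) = (fun=> y).
Proof. by apply: val_toCT => // x; exact: cvg_cst. Qed.

Section functional.
Variables (F : @CT R -> R) (cF : continuous F).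

Let near_cst (y e : R) : 0 < e -> exists2 r : R, 0 < r & forall h : @CT R, (forall x, `|y - (\val h : R -> R) x| < r) ->
  `|F (toCT (fun=> y)) - F h| <= e.
Proof.
move=> e0; have := cF (x := toCT (fun=> y)) => /cvgrPdist_le/(_ _ e0)/CT_nbhs[r r0 hr].
by exists r => // h hh; apply: hr => x; rewrite val_toCT_cst.
Qed.

Lemma continuous_F_cst : continuous (fun y : R => F (toCT (fun=> y))).
Proof.
move=> y; apply/cvgrPdist_le => e e0; have [r r0 hr] := near_cst y e0.
by apply/nbhs_ballP; exists r => //= z hz; apply: hr => x; rewrite val_toCT_cst.
Qed.

(** [F] need not be uniformly continuous, but the constants of modulus at most [A] form a compact
    set, near which one radius serves for all. *)
Lemma F_near_constants (A e : R) : 0 < e -> exists2 r : R, 0 < r & forall y, `|y| <= A ->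
  forall h : @CT R, (forall x, `|(\val h : R -> R) x - y| <= r) -> `|F h - F (toCT (fun=> y))| <= e.
Proof.
move=> e0; have e2 : 0 < e / 2 by rewrite divr_gt0.
have ck : compact [set` `[- A, A]] by exact: segment_compact.
have /compact_near_coveringP/(_ R (nbhs (0 : R)) (fun r y => forall h : @CT R, (forall x, `|(\val h : R -> R) x - y| <= `|r|) ->
  `|F h - F (toCT (fun=> y))| <= e) _) := ck.
have loc y : [set` `[- A, A]] y -> \forall y' \near y & r \near (0 : R),
    forall h : @CT R, (forall x, `|(\val h : R -> R) x - y'| <= `|r|) -> `|F h - F (toCT (fun=> y'))| <= e.
  move=> _; have [r r0 hr] := near_cst y e2; have r2 : 0 < r / 2 by rewrite divr_gt0.
  exists (ball y (r / 2), ball (0 : R) (r / 2)) => /=; first by split; exact: nbhsx_ballx.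
  move=> [y' s] [/= b1 b2] h hh; have sr : `|s| < r / 2 by move: b2; rewrite /ball/= sub0r normrN.
  have b1' : `|y - y'| < r / 2 by [].
  have d1 : `|F (toCT (fun=> y)) - F h| <= e / 2.
    apply: hr => x; apply: le_lt_trans (ler_distD y' _ _) _.
    have hx : `|y' - (\val h : R -> R) x| <= `|s| by rewrite distrC; exact: hh.
    by apply: le_lt_trans (lerD (ltW b1') hx) _; lra.
  have d2 : `|F (toCT (fun=> y)) - F (toCT (fun=> y'))| <= e / 2.
    apply: hr => x; rewrite val_toCT_cst; apply: lt_trans b1' _; lra.
  apply: le_trans (ler_distD (F (toCT (fun=> y))) _ _) _; move: d1 d2; rewrite (distrC (F h)).
  by set a := `|_ - F h|; set b := `|_ - F (toCT (fun=> y'))|; lra.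
move=> /(_ loc)/nbhs_ballP[r /= r0 hr]; have r2 : 0 < r / 2 by rewrite divr_gt0.
exists (r / 2) => // y yA h hh; apply: (hr (r / 2)).
- by rewrite /ball/= sub0r normrN gtr0_norm//; lra.
- by rewrite /= in_itv/= -ler_norml.
- by move=> x; rewrite (gtr0_norm r2).
Qed.

End functional.

Section comparison.
Context {d : measure_display} {T : measurableType d} (P : probability T R).

Let integral_cstP (c : R) : (\int[P]_w c%:E)%E = c%:E.
Proof.
apply: (eq_trans (integral_cst P measurableT c%:E)).
by apply: (eq_trans (congr1 (fun a => c%:E * a)%E (probability_setT P))); exact: mule1.
Qed.

Let bounded_fin (f : T -> R) (M : R) : (forall w, 0 <= f w <= M) -> (\int[P]_w (f w)%:E)%E \is a fin_num.
Proof.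
move=> fM; rewrite ge0_fin_numE; last by apply: integral_ge0 => w _; rewrite lee_fin; have /andP[] := fM w.
apply: (@le_lt_trans _ _ (\int[P]_w M%:E)%E).
  by apply: ge0_integral_mono => w _; rewrite lee_fin; have /andP[] := fM w.
by rewrite integral_cstP ltry.
Qed.

Let slack (k : T -> R) (M e : R) (N : set T) : measurable_fun setT k -> (forall w, 0 <= k w) -> 0 <= M -> 0 <= e ->
  measurable N -> (P N <= e%:E)%E ->
  (\int[P]_w (k w + (e + M * \1_N w))%:E <= \int[P]_w (k w)%:E + ((1 + M) * e)%:E)%E.
Proof.
move=> mk k0 M0 e0 mN pN.
have i0 w : 0 <= \1_N w :> R by rewrite indicE; case: (_ \in _).
have m1 : measurable_fun setT (fun w => (M * \1_N w)%:E).
  by apply/measurable_EFinP; apply: measurable_funM => //; exact: measurable_indic.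
have p1 w : (0 <= (M * \1_N w)%:E)%E by rewrite lee_fin mulr_ge0.
rewrite (_ : (\int[P]_w _)%E = (\int[P]_w ((k w)%:E + (e%:E + (M * \1_N w)%:E)))%E); last first.
  by apply: eq_integral => w _; rewrite -!EFinD.
rewrite ge0_integralD//; last 4 first.
- by move=> w _; rewrite lee_fin.
- by apply/measurable_EFinP.
- by move=> w _; rewrite adde_ge0.
- by apply: emeasurable_funD => //; exact: measurable_cst.
rewrite leeD2l// ge0_integralD//.
rewrite integral_cstP.
under eq_integral do rewrite EFinM.
rewrite ge0_integralZl_EFin//; last by apply/measurable_EFinP; exact: measurable_indic.
rewrite integral_indic// setIT mulrDl mul1r EFinD leeD2l// EFinM.
by apply: lee_wpmul2l => //; rewrite lee_fin.
Qed.

Let ge0_close (f g : T -> R) (M e : R) (N : set T) : (forall w, 0 <= f w <= M) -> (forall w, 0 <= g w <= M) ->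
  measurable_fun setT g -> measurable N -> (P N <= e%:E)%E -> 0 <= e -> (forall w, ~ N w -> `|f w - g w| <= e) ->
  `|fine (\int[P]_w (f w)%:E)%E - fine (\int[P]_w (g w)%:E)%E| <= (1 + M) * e.
Proof.
move=> fM gM mg mN pN e0 fg; have M0 : 0 <= M.
  by have [w _] : exists w : T, True; [exists point|have /andP[h1 h2] := gM w; exact: le_trans h1 h2].
have ff := bounded_fin fM; have gf := bounded_fin gM.
have i0 w : 0 <= \1_N w :> R by rewrite indicE; case: (_ \in _).
have up : (\int[P]_w (f w)%:E <= \int[P]_w (g w)%:E + ((1 + M) * e)%:E)%E.
  apply: le_trans (slack mg _ M0 e0 mN pN); last by move=> w; have /andP[] := gM w.
  apply: ge0_integral_mono => w _; rewrite lee_fin; first by have /andP[] := fM w.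
  have /andP[f0 f1] := fM w; have /andP[g0 g1] := gM w.
  rewrite indicE; case: (boolP (w \in N)) => [|/negP] wN; rewrite ?mulr1 ?mulr0 ?addr0; first by lra.
  by have := fg w (fun h => wN (mem_set h)) => /(le_trans (ler_norm _)); lra.
(* A measurable minorant of [f]: for the lower bound, the error terms have to be added to a
   measurable function. *)
pose l w := Num.max 0 (g w - (e + M * \1_N w)).
have ml : measurable_fun setT l.
  apply: measurable_maxr => //; apply: measurable_realfun.measurable_funB => //.
  by apply: measurable_realfun.measurable_funD => //; apply: measurable_funM => //; exact: measurable_indic.
have l0 w : 0 <= l w by rewrite le_max lexx.
have lf : (\int[P]_w (l w)%:E <= \int[P]_w (f w)%:E)%E.
  apply: ge0_integral_mono => w _; rewrite lee_fin//.
  have /andP[f0 f1] := fM w; have /andP[g0 g1] := gM w; rewrite ge_max f0/=.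
  rewrite indicE; case: (boolP (w \in N)) => [|/negP] wN; rewrite ?mulr1 ?mulr0 ?addr0; first by lra.
  by have := fg w (fun h => wN (mem_set h)); rewrite distrC => /(le_trans (ler_norm _)); lra.
have low : (\int[P]_w (g w)%:E <= \int[P]_w (l w)%:E + ((1 + M) * e)%:E)%E.
  apply: le_trans (slack ml l0 M0 e0 mN pN).
  apply: ge0_integral_mono => w _; rewrite lee_fin; first by have /andP[] := gM w.
  by have : g w - (e + M * \1_N w) <= l w by [rewrite le_max lexx orbT]; lra.
have low' : (\int[P]_w (g w)%:E <= \int[P]_w (f w)%:E + ((1 + M) * e)%:E)%E.
  by apply: le_trans low _; rewrite leeD2r.
move: up low'; rewrite -(fineK ff) -(fineK gf) -!EFinD !lee_fin ler_norml /= => h1 h2; apply/andP; split; lra.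
Qed.

(* [f] need not be measurable: only the monotonicity of the integral of nonnegative functions is used for it. *)
Lemma expectation_close (f g : T -> R) (M e : R) (N : set T) : (forall w, `|f w| <= M) -> (forall w, `|g w| <= M) ->
  measurable_fun setT g -> measurable N -> (P N <= e%:E)%E -> 0 <= e -> (forall w, ~ N w -> `|f w - g w| <= e) ->
  [/\ 'E_P[f]%E \is a fin_num, 'E_P[g]%E \is a fin_num & `|fine 'E_P[f]%E - fine 'E_P[g]%E| <= 2 * ((1 + M) * e)].
Proof.
move=> fM gM mg mN pN e0 fg.
pose pp (h : T -> R) w := Num.max (h w) 0; pose np (h : T -> R) w := Num.max (- h w) 0.
have E (h : T -> R) : 'E_P[h]%E = (\int[P]_w (pp h w)%:E - \int[P]_w (np h w)%:E)%E.
  rewrite unlock integralE; congr (_ - _)%E; apply: eq_integral => w _; rewrite ?funeposE ?funenegE -?EFinN -EFin_max//.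
have pb (h : T -> R) : (forall w, `|h w| <= M) -> (forall w, 0 <= pp h w <= M) /\ (forall w, 0 <= np h w <= M).
  move=> hM; have M0 (w : T) : 0 <= M by exact: le_trans (normr_ge0 (h w)) (hM w).
  by split=> w; have := hM w; rewrite ler_norml => /andP[h1 h2]; rewrite le_max lexx orbT ge_max (M0 w) andbT/=; clear M0; lra.
have [fp fn] := pb f fM; have [gp gn] := pb g gM.
have max_lip (a b : R) : `|Num.max a 0 - Num.max b 0| <= `|a - b|.
  case: (leP a 0) => h1; case: (leP b 0) => h2; rewrite ?subrr ?normr0 ?subr0 ?sub0r ?normrN//.
    by rewrite (gtr0_norm h2) distrC; apply: le_trans (ler_norm _); lra.
  by rewrite (gtr0_norm h1); apply: le_trans (ler_norm _); lra.
have mgp : measurable_fun setT (pp g) by exact: measurable_maxr.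
have mgn : measurable_fun setT (np g).
  rewrite (_ : np g = fun w => Num.max (0 - g w) 0); last by apply: funext => w; rewrite /np sub0r.
  by apply: measurable_maxr => //; exact: measurable_realfun.measurable_funB.
have c1 := ge0_close fp gp mgp mN pN e0 (fun w nN => le_trans (max_lip _ _) (fg w nN)).
have c2 : `|fine (\int[P]_w (np f w)%:E)%E - fine (\int[P]_w (np g w)%:E)%E| <= (1 + M) * e.
  apply: (ge0_close fn gn mgn mN pN e0) => w nN; apply: le_trans (max_lip _ _) _.
  by rewrite -opprD normrN; exact: fg.
have ffp := bounded_fin fp; have ffn := bounded_fin fn; have fgp := bounded_fin gp; have fgn := bounded_fin gn.
rewrite !E; split; [by rewrite fin_numB ffp|by rewrite fin_numB fgp|].
have tri (x y x' y' K : R) : `|x - x'| <= K -> `|y - y'| <= K -> `|x - y - (x' - y')| <= 2 * K.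
  by rewrite !ler_norml => /andP[? ?] /andP[? ?]; apply/andP; split; lra.
by rewrite (fineB ffp ffn) (fineB fgp fgn); apply: tri; [exact: c1|exact: c2].
Qed.

End comparison.

End convergence_in_law.

(** * From the oscillation bound to convergence in law of the whole profile *)

Section corollary.
Context {R : realType} {d : measure_display} {T : measurableType d} (P : probability T R).
Variables (W : set (R * R) -> {RV P >-> R}) (Q : R) (u0 : T -> R -> R) (u : R -> R -> T -> R) (lambda : R).
Hypotheses (hW : white_noise W) (hQ : 0 < Q) (hu0 : initial_datum W u0) (hu : mild_solution Q W u0 u).
Hypotheses (hlambda : 0 < lambda) (hdecay : decay_rate P u lambda).

Let mu_t t x : 0 < t -> measurable_fun setT (u t x).
Proof. by move=> t0; exact: (adapted_measurable hu0 (adapted_u hu x t0)). Qed.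

(** Supplies the deterministic [kap] that [oscillation] demands. Almost surely [t^-1 log u] is
    eventually within [lambda / 2] of [- lambda], hence above [- 3/2 lambda]; any rate above
    [lambda] would serve. *)
Lemma u_ge_near (t : nat -> R) (e : R) : t n @[n --> \oo] --> +oo -> 0 < e ->
  \forall n \near \oo, exists N, [/\ measurable N, (P N <= e%:E)%E &
    forall w, ~ N w -> forall x, expR (- (3 / 2 * lambda * t n)) <= u (t n) x w].
Proof.
move=> tt e0; pose kap n := expR (- (3 / 2 * lambda * t n)).
(* A union over rational points is measurable; continuity of [u] in space recovers every [x]. *)
pose M n := if 0 < t n then \bigcup_(q : rat) [set w | u (t n) (ratr q) w < kap n] else set0.
have mM n : measurable (M n).
  rewrite /M; case: ifP => // t0; apply: bigcupT_measurable_rat => q.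
  rewrite (_ : [set w | _] = u (t n) (ratr q) @^-1` [set` `]-oo, kap n[]); last by apply/seteqP; split => w /=; rewrite in_itv.
  by rewrite -[X in measurable X]setTI; exact: (mu_t (ratr q) t0).
have [N0 [mN0 pN0 hN0]] := hdecay.
(* Being less than 1, [e1] forces an indicator bounded by it to vanish. *)
pose e1 : R := Num.min (e / 2) (1 / 2); have e10 : 0 < e1 by rewrite lt_min !divr_gt0.
have e1e : 2 * e1 <= e by rewrite -ler_pdivlMl// mulrC ge_min lexx.
have e11 : e1 < 1 by apply: (@le_lt_trans _ _ (1 / 2)); [rewrite ge_min lexx orbT|lra].
have t_near A : \forall n \near \oo, A <= t n by exact: (cvgryPge t).1.
have mX n : measurable_fun setT (fun w => (\1_(M n) w : R)%:E) by apply/measurable_EFinP; exact: measurable_indic.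
have pN0e : (P N0 <= e1%:E)%E by rewrite pN0 lee_fin ltW.
have hX w : ~ N0 w -> forall dl : R, 0 < dl -> \forall n \near \oo, ((\1_(M n) w : R)%:E <= dl%:E)%E.
  move=> wN dl dl0; have cs : ereal_sup [set `|(t n)^-1 * ln (u (t n) x w) + lambda|%:E | x in [set: R]] @[n --> \oo] --> (0 : \bar R).
    have h := contrapT (fun h => wN (hN0 w h)).
    exact: (cvg_comp _ _ tt h).
  have l2 : 0 < lambda / 2 by rewrite divr_gt0.
  move: cs => /fine_cvgP[ffin /cvgrPdist_le/(_ _ l2) fle].
  apply: filterS3 ffin fle (t_near 1) => n h1 h2 t1; have t0 : 0 < t n by exact: lt_le_trans t1.
  rewrite lee_fin indicE memNset ?(ltW dl0)// /M t0 => -[q _] /=; rewrite ltNge => /negP; apply.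
  have sup_le : (`|(t n)^-1 * ln (u (t n) (ratr q) w) + lambda|%:E <= (lambda / 2)%:E)%E.
    apply: (@le_trans _ _ (ereal_sup [set `|(t n)^-1 * ln (u (t n) x w) + lambda|%:E | x in [set: R]])).
      by apply: ereal_sup_ubound; exists (ratr q).
    by rewrite -(fineK h1) lee_fin; apply: le_trans (ler_norm _) _; move: h2; rewrite /= sub0r normrN.
  move: sup_le; rewrite lee_fin; set v := u _ _ _; rewrite ler_norml => /andP[a1 a2].
  have b1 : - (3 / 2 * lambda) <= (t n)^-1 * ln v by lra.
  have b2 : (t n)^-1 * ln v <= - (lambda / 2) by lra.
  (* [ln] takes the value 0 on nonpositive numbers, so a negative [ln v] forces [v] to be
     positive. *)
  have v0 : 0 < v.
    rewrite ltNge; apply/negP => v0; move: b2; rewrite ln0// mulr0; lra.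
  rewrite -[leRHS](lnK v0) ler_expR; move: b1; rewrite ler_pdivlMl//; lra.
apply: filterS2 (t_near 1) (near_small e10 mX mN0 pN0e hX) => n t1 [N [mN pN hN]]; have t0 : 0 < t n by exact: lt_le_trans t1.
exists N; split => //; first by apply: le_trans pN _; rewrite lee_fin.
move=> w wN x; have := hN w wN; rewrite lee_fin indicE; case: (boolP (w \in M n)) => [_|/negP nM _].
  by rewrite leNgt e11.
rewrite leNgt; apply/negP => ux; apply: nM; apply/mem_set; rewrite /M t0.
have := @continuous_u _ _ _ _ _ _ _ _ hu (t n) w t0 x => /cvgrPdist_lt; set v := u (t n) x w in ux *.
have kv : 0 < kap n - v by rewrite subr_gt0.
move=> /(_ _ kv)/nbhs_ballP[r /= r0 hr]; have [q] := @rat_in_itvoo R x (x + r) ltac:(lra).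
rewrite in_itv/= => /andP[q1 q2]; exists q => //=.
have : `|v - u (t n) (ratr q) w| < kap n - v.
  by apply: hr; rewrite /ball/= distrC gtr0_norm; lra.
by rewrite ltr_norml => /andP[h _]; lra.
Qed.

Variables (d' : measure_display) (T' : measurableType d') (P' : probability T' R) (eta : {RV P' >-> R}).

Let Y t w : R := (ln (u t 0 w) + lambda * t) / Num.sqrt t.

Hypothesis hclt : cvg_in_law P P' Y eta.

Let mY t : 0 < t -> measurable_fun setT (Y t).
Proof.
move=> t0; apply: measurable_funM => //; apply: measurable_realfun.measurable_funD => //.
by apply: measurableT_comp; [exact: measurable_ln|exact: mu_t].
Qed.

Let cutoff (A y : R) : R := Num.min 1 (Num.max 0 (`|y| - A)).

Let cutoff_bound A y : 0 <= cutoff A y <= 1.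
Proof. by rewrite /cutoff le_min ler01 le_max lexx ge_min lexx. Qed.

Let continuous_cutoff A : continuous (cutoff A).
Proof.
move=> y; have c1 : {for y, continuous (fun y : R => `|y| - A)} by apply: cvgB; [exact: norm_continuous|exact: cvg_cst].
have cc (c : R) : {for y, continuous (cst c : R -> R)} by exact: cvg_cst.
have c2 : {for y, continuous (cst 0 \max (fun y : R => `|y| - A))} := continuous_max (cc 0) c1.
exact: (continuous_min (cc 1) c2).
Qed.

(** The continuous cutoff at level [A] lies between the indicators of [|y| >= A + 1] and of
    [|y| > A], so convergence in law bounds the tails of [Y] by those of [eta]. *)
Lemma tight_near (t : nat -> R) (e : R) : t n @[n --> \oo] --> +oo -> 0 < e ->
  exists A : R, \forall n \near \oo, exists N, [/\ measurable N, (P N <= e%:E)%E & forall w, ~ N w -> `|Y (t n) w| <= A].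
Proof.
move=> tt e0; have e2 : 0 < e / 2 by rewrite divr_gt0.
have i1 : P'.-integrable setT (EFin \o (fun=> 1 : R)) by exact: finite_measure_integrable_cst.
have mc A : measurable_fun setT (fun w => cutoff A (eta w)).
  by apply: measurableT_comp => //; exact: (continuous_measurable_fun (@continuous_cutoff A)).
have c1 (n : nat) w : `|cutoff n%:R (eta w)| <= 1.
  by have /andP[h1 h2] := cutoff_bound n%:R (eta w); rewrite ger0_norm.
have c0 w : cutoff n%:R (eta w) @[n --> \oo] --> (0 : R).
  apply: cvg_near_cst; have := @nbhs_infty_ger R `|eta w|; apply: filterS => n hn.
  by rewrite /cutoff (_ : Num.max 0 _ = 0) ?min_r//; apply/max_idPl; rewrite subr_le0.
have [_] := @cvg_Rintegral_dominated R d' T' P' (fun n w => cutoff n%:R (eta w)) (fun=> 0) (fun=> 1) (fun n => mc n%:R) i1 c1 c0.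
rewrite [X in _ --> X](_ : _ = 0); last by rewrite /Rintegral integral0.
move=> /cvgrPdist_le/(_ _ e2)[n _ /(_ n (leqnn n))] /=; rewrite sub0r normrN => hA.
have b1 : exists M : R, forall s, `|cutoff n%:R s| <= M.
  by exists 1 => s; have /andP[h1 h2] := cutoff_bound n%:R s; rewrite ger0_norm.
have hc := cvg_comp _ _ tt (hclt (@continuous_cutoff n%:R) b1).
have fin' : ('E_P'[cutoff n%:R \o eta])%E = (\int[P']_w cutoff n%:R (eta w))%:E.
  rewrite unlock /Rintegral fineK// ge0_fin_numE; last by apply: integral_ge0 => w _; rewrite lee_fin; have /andP[] := cutoff_bound n%:R (eta w).
  apply: (@le_lt_trans _ _ (\int[P']_w (1 : R)%:E)%E).
    by apply: ge0_integral_mono => w _; rewrite lee_fin; have /andP[] := cutoff_bound n%:R (eta w).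
  by have /integrableP[_] := i1; under eq_integral do rewrite /= normr1.
move: hc; rewrite fin' => /fine_cvgP[ffin /cvgrPdist_le/(_ _ e2) fle].
have t_near A : \forall n \near \oo, A <= t n by exact: (cvgryPge t).1.
exists (n%:R + 1); apply: filterS3 ffin fle (t_near 1) => k h1 h2 t1; have t0 : 0 < t k by exact: lt_le_trans t1.
pose N := Y (t k) @^-1` [set y | n%:R + 1 < `|y|].
have mN : measurable N.
  rewrite (_ : N = (fun w => `|Y (t k) w|) @^-1` [set` `]n%:R + 1, +oo[]); last first.
    by apply/seteqP; split => w /=; rewrite in_itv/= andbT.
  have mYn : measurable_fun setT (fun w => `|Y (t k) w|) by apply: measurableT_comp => //; exact: mY.
  by rewrite -[X in measurable X]setTI; exact: mYn.
exists N; split => //; last by move=> w /negP; rewrite -leNgt.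
have -> : P N = (\int[P]_w (\1_N w)%:E)%E by rewrite integral_indic// setIT.
apply: (@le_trans _ _ ('E_P[cutoff n%:R \o Y (t k)])%E).
  rewrite unlock; apply: ge0_integral_mono => w _; rewrite lee_fin indicE; first by case: (_ \in _).
  have /andP[g0 g1] := cutoff_bound n%:R (Y (t k) w).
  case: (boolP (w \in N)) => // /set_mem; rewrite /N /= => h.
  by rewrite /cutoff le_min lexx/= le_max; apply/orP; right; lra.
move: h1 h2 hA => /= h1 h2 hA; rewrite -(fineK h1) lee_fin.
have h3 : fine ('E_P[cutoff n%:R \o Y (t k)])%E - \int[P']_w cutoff n%:R (eta w) <= e / 2.
  by apply: le_trans (ler_norm _) _; rewrite distrC.
by have := le_trans (ler_norm _) hA; lra.
Qed.

(** The restriction [G] of [F] to constants reduces the limit to the one-point hypothesis. Off three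
    small events, from the lower bound at time [t - s], the tightness of [Y] and the oscillation,
    the profile is within [ln C / sqrt t] of the constant [Y t], whose modulus is at most [A], and
    [F_near_constants] applies. *)
Lemma rescaled_log_cvg : cvg_in_law P P' (rescaled_log u lambda) (fun w => toCT (fun=> eta w)).
Proof.
move=> F cF [M0 FM0]; pose M := `|M0|; have M0' : 0 <= M by exact: normr_ge0.
have FM s : `|F s| <= M by exact: le_trans (FM0 s) (ler_norm _).
pose G y := F (toCT (fun=> y)); have cG : continuous G by exact: continuous_F_cst.
have hG := hclt cG (ex_intro _ M (fun y => FM _)).
have -> : F \o (fun w => toCT (fun=> eta w)) = G \o eta by [].
have mg t : 0 < t -> measurable_fun setT (G \o Y t).
  by move=> t0; apply: measurableT_comp; [exact: (continuous_measurable_fun cG)|exact: mY].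
have key (t : nat -> R) (e : R) : t n @[n --> \oo] --> +oo -> 0 < e -> \forall n \near \oo,
    [/\ 'E_P[F \o rescaled_log u lambda (t n)]%E \is a fin_num, 'E_P[G \o Y (t n)]%E \is a fin_num &
      `|fine 'E_P[F \o rescaled_log u lambda (t n)]%E - fine 'E_P[G \o Y (t n)]%E| <= e].
  move=> tt e0; pose e1 := e / (2 * (1 + M)); have M1 : 0 < 1 + M by lra.
  have e10 : 0 < e1 by rewrite divr_gt0// mulr_gt0.
  have e1e : 2 * ((1 + M) * e1) = e.
    by have h := lt0r_neq0 M1; rewrite /e1; field; rewrite h.
  have e3 : 0 < e1 / 3 by rewrite divr_gt0.
  have [s [C [s0 C0 osc]]] := oscillation hW hQ hu0 hu e3.
  have t_near A : \forall n \near \oo, A <= t n by exact: (cvgryPge t).1.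
  have ts : t n - s @[n --> \oo] --> +oo.
    by apply/cvgryPge => A; apply: filterS (t_near (A + s)) => n; lra.
  have [A tight] := tight_near tt e3.
  have [rho rho0 hrho] := F_near_constants cF A e10.
  (* From [t >= (ln C / rho)^2] on, [ln C / sqrt t <= rho]; [t >= s + 1] keeps the restart time
     positive. *)
  apply: filterS3 (u_ge_near ts e3) tight (filterI (t_near (s + 1)) (t_near ((ln C / rho) ^+ 2))) => n.
  move=> [N1 [mN1 pN1 hN1]] [N2 [mN2 pN2 hN2]] [t1 t2].
  have t0 : 0 < t n by lra.
  have ts0 : 0 < t n - s by lra.
  have [N3 [mN3 pN3 hN3]] := osc (t n - s) _ ts0 (expR_gt0 (- (3 / 2 * lambda * (t n - s)))).
  rewrite subrK in hN3.
  rewrite -e1e; apply: (@expectation_close R d T P _ _ M e1 (N1 `|` N2 `|` N3)) => //.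
  - by move=> w; exact: FM.
  - by move=> w; exact: FM.
  - exact: mg.
  - by apply: measurableU => //; exact: measurableU.
  - apply: le_trans (measureU2 P (measurableU _ _ mN1 mN2) mN3) _.
    apply: (@le_trans _ _ ((e1 / 3)%:E + (e1 / 3)%:E + (e1 / 3)%:E)%E).
      by apply: leeD => //; apply: le_trans (measureU2 P mN1 mN2) _; exact: leeD.
    by rewrite -!EFinD lee_fin; lra.
  - exact: ltW.
  move=> w /not_orP[/not_orP[nN1 nN2] nN3].
  have [up uC] := hN3 w nN3 (hN1 w nN1).
  have st0 : 0 < Num.sqrt (t n) by rewrite sqrtr_gt0.
  have lnC : ln C / Num.sqrt (t n) <= rho.
    rewrite ler_pdivrMr// mulrC -ler_pdivrMr//; apply: le_trans (ler_norm _) _.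
    by rewrite -sqrtr_sqr ler_sqrt// ltW.
  pose f x := (ln (u (t n) x w) + lambda * t n) / Num.sqrt (t n).
  have cf : continuous f.
    move=> x; apply: cvgMl; apply: cvgD; last exact: cvg_cst.
    by apply: (@continuous_comp _ _ _ (fun x => u (t n) x w) (@ln R)); [exact: (@continuous_u _ _ _ _ _ _ _ _ hu (t n) w t0)|exact: continuous_ln].
  have pf : periodic2 f by have [hper _ _ _] := hu; move=> x; rewrite /f (hper _ w t0).
  have Xf : rescaled_log u lambda (t n) w = toCT f by rewrite /rescaled_log asboolT.
  rewrite /= Xf; apply: hrho; first exact: hN2.
  have lnle x x' : ln (u (t n) x w) - ln (u (t n) x' w) <= ln C.
    by rewrite lerBlDr -lnM ?posrE// ler_ln ?posrE ?mulr_gt0.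
  move=> x; rewrite val_toCT// /Y /f -mulrBl opprD addrACA subrr addr0 normrM normfV (gtr0_norm st0).
  apply: le_trans lnC; rewrite ler_pM2r ?invr_gt0// ler_norml; apply/andP; split; last exact: lnle.
  by have := lnle 0 x; lra.
have Lfin : ('E_P'[G \o eta])%E \is a fin_num.
  have mGe : measurable_fun setT (G \o eta) by apply: measurableT_comp => //; exact: (continuous_measurable_fun cG).
  have p0 : (P' set0 <= (0 : R)%:E)%E by rewrite measure0.
  have h0 w : ~ set0 w -> `|(G \o eta) w - (G \o eta) w| <= (0 : R) by move=> _; rewrite subrr normr0.
  by have [] := expectation_close (fun w => FM _) (fun w => FM _) mGe measurable0 p0 (lexx 0) h0.
pose L := fine ('E_P'[G \o eta])%E; rewrite -(fineK Lfin) -/L; rewrite -(fineK Lfin) -/L in hG.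
apply/fine_cvgP; move: hG => /fine_cvgP[_ hG].
(* Dominated convergence works along sequences; a property that holds eventually along each sequence
   tending to infinity holds near [+oo]. *)
have seq_near (A : R -> Prop) : (forall t : nat -> R, t n @[n --> \oo] --> +oo -> \forall n \near \oo, A (t n)) -> \forall t \near +oo, A t.
  move=> hA; apply: contrapT => nA.
  have ex (n : nat) : exists t : R, n%:R < t /\ ~ A t.
    apply: contrapT => h; apply: nA; exists n%:R; split; first exact: num_real.
    by move=> t nt; apply: contrapT => At; apply: h; exists t.
  have /choice[t ht] := ex.
  have tt : t n @[n --> \oo] --> +oo.
    apply/cvgryPge => B; have := @nbhs_infty_ger R B; apply: filterS => n /= h.
    by apply: le_trans h _; have [h' _] := ht n; exact: ltW.
  by have [n _ /(_ n (leqnn n))] := hA t tt; have [_] := ht n.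
split.
  by apply: seq_near => t tt; apply: filterS (key t 1 tt ltr01) => n [].
apply/cvgrPdist_le => e e0; have e2 : 0 < e / 2 by rewrite divr_gt0.
apply: seq_near => t tt; have /cvgrPdist_le/(_ _ e2) h := cvg_comp _ _ tt hG.
apply: filterS2 h (key t (e / 2) tt e2) => n /= h1 [_ _ h2].
apply: le_trans (ler_distD (fine ('E_P[G \o Y (t n)])%E) _ _) _; rewrite (distrC (fine ('E_P[G \o Y (t n)])%E)).
by apply: le_trans (lerD h1 h2) _; lra.
Qed.

End corollary.

Theorem corollary1p5 (R : realType)
    (d : measure_display) (T : measurableType d) (P : probability T R)
    (W : set (R * R) -> {RV P >-> R}) (hW : white_noise W)
    (Q : R) (hQ : 0 < Q)
    (u0 : T -> R -> R) (hu0 : initial_datum W u0)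
    (u : R -> R -> T -> R) (hu : mild_solution Q W u0 u)
    (lambda : R) (hlambda : 0 < lambda) (hdecay : decay_rate P u lambda)
    (d' : measure_display) (T' : measurableType d') (P' : probability T' R)
    (eta : {RV P' >-> R}) (sigma : R) (hsigma : 0 < sigma)
    (heta : forall B : set R, measurable B ->
       distribution P' eta B = normal_prob 0 sigma B)
    (hclt : cvg_in_law P P'
       (fun t w => (ln (u t 0 w) + lambda * t) / Num.sqrt t : R) eta) :
  cvg_in_law P P'
    (rescaled_log u lambda) (fun w => toCT (fun=> eta w)).
Proof. exact: (rescaled_log_cvg hW hQ hu0 hu hlambda hdecay hclt). Qed.
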